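(* Let $K$ be a Markov kernel on $X$ that is both geometrically ergodic and $V$-uniformly ergodic, with invariant distribution $\mu$, and let $f:X\to\mathbb R$ be measurable with $\sup_xf(x)^2/V(x)<\infty$. Then: (1) For every weighted ensemble method with $N$ particles driven by $K$ (with any choice of bins, bin allocations and resampling satisfying the definition), whose initial distribution satisfies $\mu_0\{V<\infty\}=1$, $$\liminf_{T\to\infty}T\,\mathrm{Var}\Big[\frac1T\sum_{t=0}^{T-1}\sum_{i=1}^Nw_t^if(\xi_t^i)\Big]\ge\frac{\mu(v_f)^2}{N}.$$ (2) For every $\epsilon>0$ there exists $N_\epsilon$ such that for every $N\ge N_\epsilon$ there is a weighted ensemble method with $N$ particles driven by $K$ (with a suitable initial distribution $\mu_0$ satisfying $\mu_0(V)<\infty$, suitable bins and allocations, and binned multinomial resampling) satisfying $$\limsup_{T\to\infty}T\,\mathrm{Var}\Big[\frac1T\sum_{t=0}^{T-1}\sum_{i=1}^Nw_t^if(\xi_t^i)\Big]\le(1+\epsilon)\frac{\mu(v_f)^2}{N}.$$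
   Context: Splitting method: Let $K$ be a Markov transition kernel on a measurable state space $X$ and $\mu_0$ a probability distribution on $X$. A splitting method produces, for $t=0,1,2,\dots$, particles $\xi_t^1,\dots,\xi_t^{N_t}\in X$ with weights $w_t^1,\dots,w_t^{N_t}\ge 0$, together with a filtration $\mathcal F_0\subseteq\hat{\mathcal F}_0\subseteq\mathcal F_1\subseteq\hat{\mathcal F}_1\subseteq\cdots$, as follows. Initially $\xi_0^1,\dots,\xi_0^{N_0}$ are i.i.d. with law $\mu_0$ and $w_0^i=1/N_0$. At each time $t\ge 0$: (Splitting step) for each $i$ a number $C_t^i>0$ is chosen, where $(\xi_t^i,w_t^i,C_t^i)_{1\le i\le N_t}$ is $\mathcal F_t$-measurable; random nonnegative integers $N_t^i$ are drawn with $\mathbb E[N_t^i\mid\mathcal F_t]=C_t^i$; each $\xi_t^i$ is replaced by $N_t^i$ copies, each with weight $w_t^i/C_t^i$; the resulting children are listed as $(\hat\xi_t^j,\hat w_t^j)_{1\le j\le N_{t+1}}$ with $N_{t+1}=\sum_i N_t^i$, and they are $\hat{\mathcal F}_t$-measurable. (Evolution step) conditional on $\hat{\mathcal F}_t$, the particles $\xi_{t+1}^1,\dots,\xi_{t+1}^{N_{t+1}}$ are independent with $\xi_{t+1}^j\sim K(\hat\xi_t^j,\cdot)$, and $w_{t+1}^j=\hat w_t^j$. Weighted ensemble (WE) method: a splitting method in which at each time $t$ the splitting step is: the indices $1,\dots,N_t$ are partitioned ($\mathcal F_t$-measurably) into bins $u$, with $w_t(u)=\sum_{i\in u}w_t^i$;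 integers $N_t(u)\ge1$ are chosen ($\mathcal F_t$-measurably); for $i\in u$, $C_t^i=N_t(u)w_t^i/w_t(u)$; the $N_t^i$ satisfy $\mathbb E[N_t^i\mid\mathcal F_t]=C_t^i$ and $\sum_{i\in u}N_t^i=N_t(u)$ almost surely; and every child of a parent in bin $u$ receives weight $w_t(u)/N_t(u)$. A WE method with $N$ particles has $N_0=N$ and $\sum_uN_t(u)=N$ for all $t$. Binned multinomial resampling: conditional on $\mathcal F_t$, independently across bins, for the particles $\xi_t^{i_1},\dots,\xi_t^{i_m}$ of bin $u$, $(N_t^{i_1},\dots,N_t^{i_m})\sim\mathrm{Multinomial}\big(N_t(u);\,w_t^{i_1}/w_t(u),\dots,w_t^{i_m}/w_t(u)\big)$. Ergodicity notions (for a $\psi$-irreducible aperiodic $K$ with invariant probability $\mu=\mu K$; $\|\nu\|=\sup_{\|g\|_\infty\le1}|\nu(g)|$): $K$ is geometrically ergodic if for some fixed $r>1$, $\sum_{t\ge0}r^t\|K^t(x,\cdot)-\mu\|<\infty$ for all $x\in X$. For measurable $V:X\to[1,\infty]$ with $\mu(V)<\infty$, $K$ is $V$-uniformly ergodic if there exist $R>0$, $\rho<1$ with $\sup_{|g|\le V}|K^tg(x)-\mu(g)|\le R\rho^tV(x)$ for all $x\in X$, $t\ge0$. Functions $h_f,v_f$: $h_f(x)=\sum_{t=0}^\infty\big(K^tf(x)-\mu(f)\big)$ and $v_f(x)=\sqrt{K(h_f^2)(x)-(Kh_f(x))^2}$ (defined on $\{V<\infty\}$); $\mu(v_f)=\int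 v_f\,d\mu$. *)

(* Defs.v *)
From HB Require Import structures.
From mathcomp Require Import all_boot all_order all_algebra.
From mathcomp Require Import all_classical all_reals all_analysis.
From mathcomp Require Import measurable_realfun.
Set Implicit Arguments.
Unset Strict Implicit.
Unset Printing Implicit Defensive.
Import Order.TTheory GRing.Theory Num.Theory.
Import numFieldNormedType.Exports.
Local Open Scope classical_set_scope.
Local Open Scope ring_scope.

Section Ergodic.
Context {R : realType} {d : measure_display} {X : measurableType d}.
Variable K : R.-pker X ~> X.

Definition Kpos (t : nat) (h : X -> \bar R) : X -> \bar R :=
  iter t (fun h x => (\int[K x]_y h y)%E) h.

Definition Kt (t : nat) (g : X -> R) (x : X) : R :=
  fine (Kpos t (fun y => (Num.max (g y) 0)%:E) x)
  - fine (Kpos t (fun y => (Num.max (- g y) 0)%:E) x).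

Definition integ (nu : {measure set X -> \bar R}) (g : X -> R) : R :=
  fine (\int[nu]_y (g y)%:E)%E.

Definition invariant (mu : probability X R) : Prop :=
  forall A, measurable A -> mu A = (\int[mu]_x K x A)%E.

Definition tv_dist (mu : probability X R) (t : nat) (x : X) : \bar R :=
  ereal_sup [set (`|Kt t g x - integ mu g|)%:E | g in
     [set g : X -> R | measurable_fun setT g /\ forall y, `|g y| <= 1]].

Definition geometrically_ergodic (mu : probability X R) : Prop :=
  invariant mu /\
  exists r : R, 1 < r /\
    forall x, (\sum_(t <oo) ((r ^+ t)%:E * tv_dist mu t x) < +oo)%E.

Definition V_uniformly_ergodic (mu : probability X R) (V : X -> \bar R) : Prop :=
  [/\ invariant mu,
      measurable_fun setT V,
      (forall x, 1 <= V x)%E,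
      (\int[mu]_x V x < +oo)%E &
      exists Rc rho : R, [/\ 0 < Rc, rho < 1 &
        forall (g : X -> R), measurable_fun setT g ->
          (forall y, ((`|g y|)%:E <= V y)%E) ->
          forall x t, (V x < +oo)%E ->
            [/\ (Kpos t (fun y => (Num.max (g y) 0)%:E) x < +oo)%E,
                (Kpos t (fun y => (Num.max (- g y) 0)%:E) x < +oo)%E &
                `|Kt t g x - integ mu g| <= Rc * rho ^+ t * fine (V x)]]].

Definition h_fun (mu : probability X R) (f : X -> R) (x : X) : R :=
  limn (fun n => \sum_(0 <= t < n) (Kt t f x - integ mu f)).

Definition v_fun (mu : probability X R) (f : X -> R) (x : X) : R :=
  Num.sqrt (Kt 1 (fun y => h_fun mu f y ^+ 2) x - (Kt 1 (h_fun mu f) x) ^+ 2).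

Definition mu_vf (mu : probability X R) (f : X -> R) : R :=
  fine (\int[mu]_x (v_fun mu f x)%:E)%E.

End Ergodic.

Section SubSigma.
Context {d' : measure_display} {Omega : measurableType d'}.

Definition sub_sigma (G : set (set Omega)) : Prop :=
  sigma_algebra setT G /\ (forall A, G A -> measurable A).

Definition Gmeas {dT} {T : measurableType dT} (G : set (set Omega))
  (h : Omega -> T) : Prop := forall B, measurable B -> G (h @^-1` B).

Definition Gmeas_discr {T : Type} (G : set (set Omega)) (h : Omega -> T) : Prop :=
  forall y, G (h @^-1` [set y]).

End SubSigma.

Record WEdata (R : realType) (N : nat) (d : measure_display) (X : measurableType d)
   (d' : measure_display) (Omega : measurableType d') := WEData {
  WF  : nat -> set (set Omega);
  WFh : nat -> set (set Omega);
  Wxi : nat -> Omega -> 'I_N -> X;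
  Ww  : nat -> Omega -> 'I_N -> R;
  (* bins: bin label (among at most N labels) of particle i at time t *)
  Wbin : nat -> Omega -> 'I_N -> 'I_N;
  Wall : nat -> Omega -> 'I_N -> nat;
  Wnum : nat -> Omega -> 'I_N -> nat;
  (* children \hat xi_t^j, \hat w_t^j, and the parent of child j *)
  Wxih : nat -> Omega -> 'I_N -> X;
  Wwh  : nat -> Omega -> 'I_N -> R;
  Wpar : nat -> Omega -> 'I_N -> 'I_N }.

Section WE.
Context {R : realType} {d : measure_display} {X : measurableType d}.
Variable K : R.-pker X ~> X.
Variable N : nat.
Context {d' : measure_display} {Omega : measurableType d'}.
Variable P : probability Omega R.
Variable mu0 : probability X R.
Variable m : WEdata R N X Omega.

Local Notation F := (WF m).
Local Notation Fh := (WFh m).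
Local Notation xi := (Wxi m).
Local Notation w := (Ww m).
Local Notation bin := (Wbin m).
Local Notation Nall := (Wall m).
Local Notation Nnum := (Wnum m).

Definition bin_nonempty t om (u : 'I_N) : bool := [exists i, bin t om i == u].

Definition bin_weight t om (u : 'I_N) : R :=
  \sum_(i | bin t om i == u) w t om i.

Definition Cfac t om (i : 'I_N) : R :=
  (Nall t om (bin t om i))%:R * w t om i / bin_weight t om (bin t om i).

Definition is_WE_method : Prop :=
  (0 < N)%N /\
  (forall t, sub_sigma (F t) /\ sub_sigma (Fh t)) /\
  (forall t, F t `<=` Fh t /\ Fh t `<=` F t.+1) /\
  (forall B : 'I_N -> set X, (forall i, measurable (B i)) ->
     P [set om | forall i, B i (xi 0 om i)] = (\prod_i fine (mu0 (B i)))%:E) /\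
  (forall om i, w 0 om i = N%:R^-1) /\
  (forall t,
     (forall i, Gmeas (F t) (fun om => xi t om i) /\
                Gmeas (F t) (fun om => w t om i) /\
                Gmeas (F t) (fun om => Cfac t om i) /\
                Gmeas_discr (F t) (fun om => bin t om i)) /\
     (forall u, Gmeas_discr (F t) (fun om => Nall t om u)) /\
     (forall om u, bin_nonempty t om u -> (1 <= Nall t om u)%N) /\
     (forall om, (\sum_(u | bin_nonempty t om u) Nall t om u)%N = N) /\
     (forall om i, 0 < Cfac t om i) /\
     (* E[N_t^i | F_t] = C_t^i *)
     (forall i A, F t A ->
        (\int[P]_(om in A) ((Nnum t om i)%:R)%:E = \int[P]_(om in A) (Cfac t om i)%:E)%E) /\
     {ae P, forall om, forall u,
        (\sum_(i | bin t om i == u) Nnum t om i)%N = Nall t om u} /\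
     {ae P, forall om,
        (forall i, #|[set j | Wpar m t om j == i]| = Nnum t om i) /\
        (forall j, Wxih m t om j = xi t om (Wpar m t om j) /\
           Wwh m t om j = bin_weight t om (bin t om (Wpar m t om j))
                         / (Nall t om (bin t om (Wpar m t om j)))%:R)} /\
     (forall j, Gmeas (Fh t) (fun om => Wxih m t om j) /\
                Gmeas (Fh t) (fun om => Wwh m t om j))) /\
  (* evolution step: conditional on \hat F_t the xi_{t+1}^j are independent
     with laws K(\hat xi_t^j, .), and w_{t+1}^j = \hat w_t^j *)
  (forall t A (B : 'I_N -> set X), Fh t A -> (forall j, measurable (B j)) ->
     P (A `&` [set om | forall j, B j (xi t.+1 om j)]) =
     (\int[P]_(om in A) (\prod_j fine (K (Wxih m t om j) (B j)))%:E)%E) /\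
  (forall t om j, w t.+1 om j = Wwh m t om j).

Definition bin_multinomial t om (u : 'I_N) (n : 'I_N -> nat) : R :=
  if (\sum_(i | bin t om i == u) n i)%N == Nall t om u then
    (Nall t om u)`!%:R / (\prod_(i | bin t om i == u) (n i)`!%:R) *
    \prod_(i | bin t om i == u) (w t om i / bin_weight t om u) ^+ n i
  else 0.

(* binned multinomial resampling: conditional on F_t, independently across
   bins, (N_t^i)_{i in u} ~ Multinomial(N_t(u); w_t^i / w_t(u)) *)
Definition binned_multinomial : Prop :=
  forall t A (n : 'I_N -> nat), F t A ->
    P (A `&` [set om | forall i, Nnum t om i = n i]) =
    (\int[P]_(om in A)
        (\prod_(u | bin_nonempty t om u) bin_multinomial t om u n)%:E)%E.

Definition WE_estimator (f : X -> R) (T : nat) (om : Omega) : R :=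
  T%:R^-1 * \sum_(0 <= t < T) \sum_i w t om i * f (xi t om i).

End WE.

Definition evar {R : realType} {d' : measure_display} {Omega : measurableType d'}
  (P : probability Omega R) (Y : Omega -> R) : \bar R :=
  if (\int[P]_om ((Y om) ^+ 2)%:E < +oo)%E then
    (fine (\int[P]_om ((Y om) ^+ 2)%:E) - (fine (\int[P]_om (Y om)%:E)) ^+ 2)%:E
  else +oo%E.

(* Main.v *)
(* With h the solution of the Poisson equation h - K h = f - mu(f), the sum over t < T of
   the weighted averages W_t(f - mu f) is, up to a boundary term bounded in L2, a
   sum of orthogonal increments D_t = W_(t+1)(h) - W_t(K h).  Each D_t splits into a
   mutation and a selection part; by Cauchy-Schwarz the mutation part alone contributes
   at least W_t(v)^2 / N in conditional variance, which gives the lower bound.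

   For the upper bound the particles start from mu and live on the space of
   trajectories built with the Ionescu-Tulcea theorem.  Bins are the cells of a fine
   grid of values of (v, K h), completed by one tail bin, and the children are
   allocated to a bin u in proportion to its weight times the value of v on u.  Then
   the conditional variance of D_t is about W_t(v)^2 / N, and W_t(v) concentrates
   around mu(v) because its own martingale increments are O(1/N).  If mu(v) = 0, one
   bin per particle makes every increment vanish. *)
Require Import Defs.
From HB Require Import structures.
From mathcomp Require Import all_boot all_order all_algebra.
From mathcomp Require Import all_classical all_reals all_analysis.
From mathcomp Require Import measurable_realfun.
From mathcomp Require Import zify ring lra.
Set Implicit Arguments.
Unset Strict Implicit.
Unset Printing Implicit Defensive.
Import Order.TTheory GRing.Theory Num.Theory.
Import numFieldNormedType.Exports.
Local Open Scope classical_set_scope.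
Local Open Scope ring_scope.
Import HBNNSimple.

(** * Measure-theoretic preliminaries *)

(** Since [f] is controlled only through f^2 <= C V, every estimate is an L2 estimate, and V-uniform
    ergodicity is traded for a square-root form: functions with phi^2 <= c V converge geometrically,
    with a bound linear in c. Conditional expectations are never constructed: each conditional law
    is an equality of integrals against nonnegative test functions, and signed functions are
    recovered from positive and negative parts. In the lower bound mu0(V) may be infinite, so the
    weights are cut off outside the event that all initial particles lie in {V <= n}, and n tends to
    infinity at the end. In the upper bound, sharing in proportion to v itself would fail where v is
    small compared with the spread of K h in a cell. On the grid v is therefore replaced by a
    function q, bounded above and away from 0, whose square dominates, off the tail, v^2 plus the
    squared spread of K h. Mutation and selection are then controlled together by W_t(q)^2 / N, and
    the two bounds on q alone give child weights O(1/N), from which the concentration of W_t(q)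
    follows without circularity. *)

Section nonneg_induction.
Context {d : measure_display} {T : measurableType d} {R : realType}.
Local Open Scope ereal_scope.

Lemma nonneg_measurable_ind (Q : (T -> \bar R) -> Prop) :
  (forall A, measurable A -> Q (fun x => (\1_A x)%:E)) ->
  (forall f g, measurable_fun setT f -> measurable_fun setT g ->
     (forall x, 0 <= f x) -> (forall x, 0 <= g x) ->
     Q f -> Q g -> Q (f \+ g)) ->
  (forall (k : R) f, (0 <= k)%R -> measurable_fun setT f ->
     (forall x, 0 <= f x) -> Q f -> Q (fun x => k%:E * f x)) ->
  (forall u : nat -> T -> \bar R, (forall n, measurable_fun setT (u n)) ->
     (forall n x, 0 <= u n x) -> (forall x, nondecreasing_seq (u ^~ x)) ->
     (forall n, Q (u n)) -> Q (fun x => limn (u ^~ x))) ->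
  forall g, measurable_fun setT g -> (forall x, 0 <= g x) -> Q g.
Proof.
move=> Qi Qd Qz Ql g mg g0.
have Qs (h : {nnsfun T >-> R}) : Q (fun x => (h x)%:E).
  have -> : (fun x => (h x)%:E) = (fun x =>
      \sum_(r <- finmap.enum_fset (fset_set (range h))) (r * \1_(h @^-1` [set r]) x)%:E).
    apply/funext => x; rewrite (fimfunE h x) fsbig_finite//=.
    by rewrite sumEFin.
  have : forall r, r \in finmap.enum_fset (fset_set (range h)) -> (0 <= r)%R.
    by move=> r; rewrite in_fset_set// inE => -[y _ <-].
  have : forall s : seq R, (forall r, r \in s -> (0 <= r)%R) ->
      [/\ measurable_fun setT (fun x => \sum_(r <- s) (r * \1_(h @^-1` [set r]) x)%:E),
      (forall x, 0 <= \sum_(r <- s) (r * \1_(h @^-1` [set r]) x)%:E) &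
      Q (fun x => \sum_(r <- s) (r * \1_(h @^-1` [set r]) x)%:E)].
    elim=> [_|r s ih rs].
      have E0 : (fun x : T => \sum_(r <- [::]) (r * \1_(h @^-1` [set r]) x)%:E) =
          (fun x => (\1_set0 x)%:E).
        by apply/funext => x; rewrite big_nil indicE in_set0.
      rewrite E0; split; last exact: Qi.
        exact/measurable_EFinP/measurable_indic.
      by move=> x; rewrite big_nil.
    have [m1 p1 Q1] := ih (fun t ts => rs t (mem_behead (s := r :: s) ts)).
    have r0 : (0 <= r)%R by apply: rs; rewrite inE eqxx.
    have mi : measurable_fun setT (fun x : T => (\1_(h @^-1` [set r]) x)%:E : \bar R).
      exact/measurable_EFinP/measurable_indic.
    have E1 : (fun x : T => \sum_(r <- r :: s) (r * \1_(h @^-1` [set r]) x)%:E) =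
          (fun x => r%:E * (\1_(h @^-1` [set r]) x)%:E) \+
          (fun x => \sum_(r <- s) (r * \1_(h @^-1` [set r]) x)%:E).
        by apply/funext => x; rewrite big_cons EFinM.
    have mr : measurable_fun setT (fun x : T => r%:E * (\1_(h @^-1` [set r]) x)%:E : \bar R).
      exact: measurable_funeM.
    have pr x : 0 <= r%:E * (\1_(h @^-1` [set r]) x)%:E.
      by rewrite mule_ge0// lee_fin.
    rewrite E1; split.
    - exact: emeasurable_funD.
    - by move=> x; rewrite big_cons EFinM adde_ge0.
    - apply: Qd => //; apply: Qz => //.
      by apply: Qi; exact: measurable_sfunP.
  by move=> ind pos; have [_ _] := ind _ pos.
pose k_ := nnsfun_approx measurableT mg.
have -> : g = (fun x => limn (fun n => (k_ n x)%:E)).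
  by apply/funext => x; apply/esym/cvg_lim => //=; exact: cvg_nnsfun_approx.
apply: (Ql (fun n x => (k_ n x)%:E)) => //.
- by move=> n; exact/measurable_EFinP.
- by move=> n x; rewrite lee_fin.
- by move=> x a b ab; rewrite lee_fin; exact/lefP/nd_nnsfun_approx.
Qed.

End nonneg_induction.

(** The only delicate case is [c = +oo]: a zero limit forces every term to be zero, and a positive
    limit keeps the product clear of the form infinity times 0. *)
Lemma nondecreasing_cvgeZl {R : realType} (c : \bar R) (u : nat -> \bar R) :
  (0 <= c)%E -> (forall n, 0 <= u n)%E -> nondecreasing_seq u ->
  (c * u n @[n --> \oo] --> c * limn u)%E.
Proof.
move=> c0 u0 ndu; have cu := ereal_nondecreasing_is_cvgn ndu.
case: c c0 => [r|_|]// r0; first exact: cvgeZl.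
have l0 : (0 <= limn u)%E by apply: lime_ge => //; exact: nearW.
have [l00|ln0] := eqVneq (limn u) 0%E.
  have u00 n : u n = 0%E.
    apply/eqP; rewrite eq_le u0 andbT -l00.
    rewrite (cvg_lim _ (ereal_nondecreasing_cvgn ndu))//.
    by apply: ereal_sup_ubound; exists n.
  rewrite l00 mule0; under eq_fun do rewrite u00 mule0.
  exact: cvg_cst.
apply: cvgeM => //; last exact: cvg_cst.
by rewrite mule_defE/= eqxx (negbTE ln0).
Qed.

(** * Identities between integrals, from indicators to nonnegative functions *)

Section kernel_extension.
Context {d d' : measure_display} {Om : measurableType d} {T : measurableType d'}
  {R : realType}.
Variable P : {measure set Om -> \bar R}.
Local Open Scope ereal_scope.

(** Both sides are additive, homogeneous and continuous along increasing sequences in [g], so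
    agreement on indicators propagates. This is the device by which a conditional law given on sets
    becomes a statement about functions; the weights [A1] and [A2] carry the rest of the
    integrand. *)
Lemma eq_integral_kernel (A1 A2 : Om -> \bar R)
    (k1 k2 : Om -> {measure set T -> \bar R}) :
  measurable_fun setT A1 -> measurable_fun setT A2 ->
  (forall w, 0 <= A1 w) -> (forall w, 0 <= A2 w) ->
  (forall U, measurable U -> measurable_fun setT (k1 ^~ U)) ->
  (forall U, measurable U -> measurable_fun setT (k2 ^~ U)) ->
  (forall U, measurable U ->
     \int[P]_w (A1 w * k1 w U) = \int[P]_w (A2 w * k2 w U)) ->
  forall g, measurable_fun setT g -> (forall x, 0 <= g x) ->
     \int[P]_w (A1 w * \int[k1 w]_x g x) = \int[P]_w (A2 w * \int[k2 w]_x g x).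
Proof.
move=> mA1 mA2 A10 A20 mk1 mk2 kE g mg g0.
have mI (k : Om -> {measure set T -> \bar R}) (mk : forall U, measurable U -> measurable_fun setT (k ^~ U)) f :
    measurable_fun setT f -> (forall x, 0 <= f x) ->
    measurable_fun [set: Om] (fun w => \int[k w]_x f x : \bar R).
  by move=> mf f0; exact: (@measurable_fun_integral_kernel _ _ _ _ _ k mk f f0 mf).
have I0 (k : Om -> {measure set T -> \bar R}) f w : (forall x, 0 <= f x) ->
   0 <= \int[k w]_x f x :> \bar R by move=> f0; exact: integral_ge0.
move: g mg g0; apply: nonneg_measurable_ind.
- move=> A mA; under eq_integral do rewrite integral_indic// setIT.
  by under [in RHS]eq_integral do rewrite integral_indic// setIT; exact: kE.
- move=> f g mf mg f0 g0 Qf Qg.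
  under eq_integral do rewrite ge0_integralD// ge0_muleDr ?I0//.
  under [in RHS]eq_integral do rewrite ge0_integralD// ge0_muleDr ?I0//.
  rewrite ge0_integralD//; [|by move=> w _; rewrite mule_ge0 ?I0|
     by apply: emeasurable_funM => //; exact: mI|
     by move=> w _; rewrite mule_ge0 ?I0|
     by apply: emeasurable_funM => //; exact: mI].
  rewrite ge0_integralD//; [|by move=> w _; rewrite mule_ge0 ?I0|
     by apply: emeasurable_funM => //; exact: mI|
     by move=> w _; rewrite mule_ge0 ?I0|
     by apply: emeasurable_funM => //; exact: mI].
  by rewrite Qf Qg.
- move=> k f k0 mf f0 Qf.
  under eq_integral do rewrite ge0_integralZl_EFin// muleCA.
  under [in RHS]eq_integral do rewrite ge0_integralZl_EFin// muleCA.
  rewrite ge0_integralZl_EFin//; [|by move=> w _; rewrite mule_ge0 ?I0|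
     by apply: emeasurable_funM => //; exact: mI].
  rewrite ge0_integralZl_EFin//; [|by move=> w _; rewrite mule_ge0 ?I0|
     by apply: emeasurable_funM => //; exact: mI].
  by rewrite Qf.
- move=> u mu u0 ndu Qu.
  have lim_int (k : Om -> {measure set T -> \bar R}) w :
      \int[k w]_x limn (u ^~ x) = limn (fun n => \int[k w]_x u n x).
    by apply: monotone_convergence => // x _; exact: ndu.
  have nd_int (k : Om -> {measure set T -> \bar R}) w :
      nondecreasing_seq (fun n => \int[k w]_x u n x).
    by move=> a b ab; apply: ge0_le_integral => // x _; exact: ndu.
  have L A (k : Om -> {measure set T -> \bar R}) (mA : measurable_fun setT A) (A0 : forall w, 0 <= A w)
      (mk : forall U, measurable U -> measurable_fun setT (k ^~ U)) :
    \int[P]_w (A w * \int[k w]_x limn (u ^~ x)) =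
    limn (fun n => \int[P]_w (A w * \int[k w]_x u n x)).
    rewrite -monotone_convergence//.
    - apply: eq_integral => w _; rewrite lim_int.
      apply/esym/cvg_lim => //; apply: nondecreasing_cvgeZl => //.
      by move=> n; exact: I0.
    - by move=> n; apply: emeasurable_funM => //; exact: mI.
    - by move=> n w _; rewrite mule_ge0 ?I0.
    - by move=> w _ a b ab; rewrite lee_wpmul2l//; exact: nd_int.
  rewrite (L A1 k1 mA1 A10 mk1) (L A2 k2 mA2 A20 mk2).
  by congr (limn _); apply/funext => n; exact: Qu.
Qed.

End kernel_extension.

Section sub_sigma_theory.
Context {d : measure_display} {Om : measurableType d} {R : realType}.
Implicit Types G : set (set Om).

Lemma sub_sigmaE G : sub_sigma G -> <<s G >> = G.
Proof. by move=> [sG _]; exact: sigma_algebra_id. Qed.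

Lemma GmeasP dT (T : measurableType dT) G (h : Om -> T) : sub_sigma G ->
  Gmeas G h <-> measurable_fun [set: g_sigma_algebraType G] h.
Proof.
move=> sG; split=> [mh _ B mB|mh B mB].
  by rewrite setTI /measurable/= sub_sigmaE//; exact: mh.
have := mh measurableT B mB.
by rewrite setTI /measurable/= sub_sigmaE.
Qed.

Lemma Gmeas_measurable dT (T : measurableType dT) G (h : Om -> T) : sub_sigma G ->
  Gmeas G h -> measurable_fun setT h.
Proof. by move=> sG mh _ B mB; rewrite setTI; apply: sG.2; exact: mh. Qed.

Lemma Gmeas_sub dT (T : measurableType dT) G G' (h : Om -> T) : G `<=` G' ->
  Gmeas G h -> Gmeas G' h.
Proof. by move=> GG' mh B mB; apply: GG'; exact: mh. Qed.

Lemma Gmeas_comp d1 d2 (T1 : measurableType d1) (T2 : measurableType d2) G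
    (h : Om -> T1) (k : T1 -> T2) :
  measurable_fun setT k -> Gmeas G h -> Gmeas G (k \o h).
Proof.
by move=> mk mh B mB; rewrite comp_preimage; apply: mh; rewrite -[X in measurable X]setTI; exact: mk.
Qed.

(** A substitute for conditional expectation: [U1] and [U2] have the same projection on [G],
    expressed without constructing it. In the proof [H] is integrated against the Dirac kernel from
    the ambient space to the space equipped with [G], for which the hypothesis is the identity on
    indicators. *)
Lemma eq_integral_sub_sigma (P : {measure set Om -> \bar R}) G
    (U1 U2 H : Om -> \bar R) : sub_sigma G ->
  measurable_fun setT U1 -> measurable_fun setT U2 ->
  (forall w, 0 <= U1 w)%E -> (forall w, 0 <= U2 w)%E ->
  (forall A, G A -> \int[P]_(w in A) U1 w = \int[P]_(w in A) U2 w)%E ->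
  Gmeas G H -> (forall w, 0 <= H w)%E ->
  (\int[P]_w (H w * U1 w) = \int[P]_w (H w * U2 w))%E.
Proof.
move=> sG mU1 mU2 U10 U20 UE mH H0.
pose T := g_sigma_algebraType G.
pose k (w : Om) : {measure set T -> \bar R} := \d_(w : T).
have mT (U : set T) : measurable U -> G U.
  by rewrite /measurable/= sub_sigmaE.
have mk U : measurable U -> measurable_fun setT (k ^~ U).
  move=> mU; rewrite /k/= /dirac/=; apply/measurable_EFinP.
  by apply: (@measurable_indic _ Om R setT U); exact/sG.2/mT.
have mHT : measurable_fun [set: T] H by apply/GmeasP.
have := @eq_integral_kernel _ _ Om T R P U1 U2 k k mU1 mU2 U10 U20 mk mk.
have kE (U : Om -> \bar R) A : measurable A -> measurable_fun setT U ->
    (forall w, 0 <= U w)%E ->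
    (\int[P]_w (U w * k w A) = \int[P]_(w in A) U w)%E.
  move=> mA mU U0; rewrite [RHS]integral_mkcond; congr (integral _ _ _); apply/funext => w.
  by rewrite /k/= /dirac/= patchE indicE; case: ifP; rewrite ?mule1 ?mule0.
have H1 (U : set T) : measurable U ->
     (\int[P]_w (U1 w * k w U) = \int[P]_w (U2 w * k w U))%E.
  by move=> mU; rewrite !kE//; exact/UE/mT.
move=> /(_ H1 H mHT H0) HH.
transitivity (\int[P]_w (U1 w * \int[k w]_x H x))%E.
  by apply: eq_integral => w _; rewrite /k integral_dirac// diracT mul1e muleC.
rewrite HH; apply: eq_integral => w _.
by rewrite /k integral_dirac// diracT mul1e muleC.
Qed.

End sub_sigma_theory.

(** * Square integrable random variables *)

Section square_integrable.
Context {d : measure_display} {Om : measurableType d} {R : realType}.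
Variable P : probability Om R.
Implicit Types X Y H U : Om -> R.

Definition ex Y : R := \int[P]_w Y w.
Definition itg Y := P.-integrable setT (EFin \o Y).
Definition L2 Y := measurable_fun setT Y /\ itg (fun w => Y w ^+ 2).

Lemma itg_meas Y : itg Y -> measurable_fun setT Y.
Proof. by move=> /measurable_int/measurable_EFinP. Qed.

Lemma exE Y : itg Y -> (ex Y)%:E = (\int[P]_w (Y w)%:E)%E.
Proof. by move=> iY; rewrite /ex/Rintegral fineK//; exact: integrable_fin_num. Qed.

Lemma le_itg X Y : measurable_fun setT Y -> (forall w, `|Y w| <= X w) ->
  itg X -> itg Y.
Proof.
move=> mY YX; apply: le_integrable => //; first exact/measurable_EFinP.
move=> w _ /=; rewrite lee_fin; apply: (le_trans (YX w)); exact: ler_norm.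
Qed.

Lemma itgD X Y : itg X -> itg Y -> itg (fun w => X w + Y w).
Proof. by move=> iX iY; have := integrableD measurableT iX iY. Qed.

Lemma itgB X Y : itg X -> itg Y -> itg (fun w => X w - Y w).
Proof. by move=> iX iY; have := integrableB measurableT iX iY. Qed.

Lemma itgZ k X : itg X -> itg (fun w => k * X w).
Proof. by move=> iX; have := integrableZl measurableT k iX. Qed.

Lemma itg_cst (k : R) : itg (fun=> k).
Proof. exact: finite_measure_integrable_cst. Qed.

Lemma itg_sum I (s : seq I) (X : I -> Om -> R) : (forall i, itg (X i)) ->
  itg (fun w => \sum_(i <- s) X i w).
Proof.
move=> iX; elim: s => [|i s ih].
  by under eq_fun do rewrite big_nil; exact: itg_cst.
by under eq_fun do rewrite big_cons; exact: itgD.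
Qed.

Lemma exD X Y : itg X -> itg Y -> ex (fun w => X w + Y w) = ex X + ex Y.
Proof. by move=> iX iY; rewrite /ex RintegralD. Qed.

Lemma exB X Y : itg X -> itg Y -> ex (fun w => X w - Y w) = ex X - ex Y.
Proof. by move=> iX iY; rewrite /ex RintegralB. Qed.

Lemma exZ k X : itg X -> ex (fun w => k * X w) = k * ex X.
Proof. by move=> iX; rewrite /ex RintegralZl. Qed.

Lemma ex_cst k : ex (fun=> k) = k.
Proof. by rewrite /ex Rintegral_cst// [X in fine X]probability_setT/= mulr1. Qed.

Lemma ex_sum I (s : seq I) (X : I -> Om -> R) : (forall i, itg (X i)) ->
  ex (fun w => \sum_(i <- s) X i w) = \sum_(i <- s) ex (X i).
Proof.
move=> iX; elim: s => [|i s ih].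
  by under [in LHS]eq_fun do rewrite big_nil; rewrite big_nil ex_cst.
under [in LHS]eq_fun do rewrite big_cons.
by rewrite big_cons exD ?ih//; exact: itg_sum.
Qed.

Lemma eq_ex X Y : (forall w, X w = Y w) -> ex X = ex Y.
Proof. by move=> XY; congr ex; exact/funext. Qed.

Lemma ex_ae X Y : measurable_fun setT X -> measurable_fun setT Y ->
  {ae P, forall w, X w = Y w} -> ex X = ex Y.
Proof.
move=> mX mY XY; congr fine; apply: ae_eq_integral => //.
- exact/measurable_EFinP.
- exact/measurable_EFinP.
- by apply: filterS XY => w /= ->.
Qed.

Lemma itg_ae X Y : measurable_fun setT Y ->
  {ae P, forall w, X w = Y w} -> itg X -> itg Y.
Proof.
move=> mY XY iX; apply/integrableP; split; first exact/measurable_EFinP.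
have [mX] := integrableP _ _ _ iX.
rewrite (@ae_eq_integral _ _ _ P setT (abse \o (EFin \o Y)))//.
- exact: measurableT_comp.
- by apply: measurableT_comp => //; exact/measurable_EFinP.
- by apply: filterS XY => w /= ->.
Qed.

Lemma ex_ge0 X : (forall w, 0 <= X w) -> 0 <= ex X.
Proof. by move=> X0; apply: Rintegral_ge0. Qed.

Lemma le_ex X Y : itg X -> itg Y -> (forall w, X w <= Y w) -> ex X <= ex Y.
Proof. by move=> iX iY XY; apply: le_Rintegral. Qed.

Lemma le_ex_ae X Y : itg X -> itg Y -> {ae P, forall w, X w <= Y w} ->
  ex X <= ex Y.
Proof.
move=> iX iY XY.
have iM : itg (fun w => Num.max (X w) (Y w)).
  apply: (@le_itg (fun w => `|X w| + `|Y w|)).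
  - by apply: measurable_maxr; exact: itg_meas.
  - move=> w; rewrite /Num.max; case: ifP => _; by rewrite ?lerDr ?lerDl.
  - by apply: itgD; exact: integrable_norm.
rewrite (@ex_ae Y (fun w => Num.max (X w) (Y w))).
- by apply: le_ex => // w; rewrite le_max lexx.
- exact: itg_meas.
- exact: itg_meas.
- by apply: filterS XY => w /= /max_r ->.
Qed.

Lemma L2_meas Y : L2 Y -> measurable_fun setT Y. Proof. by case. Qed.

Lemma L2_sqr Y : L2 Y -> itg (fun w => Y w ^+ 2). Proof. by case. Qed.

Lemma le_L2 X Y : measurable_fun setT Y -> (forall w, `|Y w| <= `|X w|) ->
  L2 X -> L2 Y.
Proof.
move=> mY YX [mX iX]; split=> //; apply: (le_itg _ _ iX).
- exact: measurable_funX.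
- move=> w; rewrite normrX -[X in _ <= X](real_normK (num_real (X w))).
  by apply: lerXn2r => //; rewrite nnegrE.
Qed.

Lemma L2_itgM X Y : L2 X -> L2 Y -> itg (fun w => X w * Y w).
Proof.
move=> [mX iX] [mY iY]; apply: (@le_itg (fun w => X w ^+ 2 + Y w ^+ 2)).
- exact: measurable_funM.
- move=> w; rewrite normrM -(real_normK (num_real (X w))) -(real_normK (num_real (Y w))).
  set a := `|X w|; set b := `|Y w|; have := sqr_ge0 (a - b);
    have : 0 <= a * b by apply: mulr_ge0; exact: normr_ge0.
  by nra.
- exact: itgD.
Qed.

Lemma L2_cst k : L2 (fun=> k).
Proof. by split; [exact: measurable_cst|exact: itg_cst]. Qed.

Lemma L2_itg X : L2 X -> itg X.
Proof.
move=> X2; have := L2_itgM X2 (L2_cst 1).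
by under eq_fun do rewrite mulr1.
Qed.

Lemma L2D X Y : L2 X -> L2 Y -> L2 (fun w => X w + Y w).
Proof.
move=> LX LY; have iXY := L2_itgM LX LY; case: LX LY => mX iX [mY iY].
split; first exact: measurable_funD.
under eq_fun do rewrite sqrrD -mulr_natl.
by apply: itgD => //; apply: itgD => //; exact: itgZ.
Qed.

Lemma L2Z k X : L2 X -> L2 (fun w => k * X w).
Proof.
move=> [mX iX]; split; first exact: measurable_funM.
by under eq_fun do rewrite exprMn; exact: itgZ.
Qed.

Lemma L2B X Y : L2 X -> L2 Y -> L2 (fun w => X w - Y w).
Proof.
move=> LX LY; under eq_fun do rewrite -mulN1r.
by apply: L2D => //; exact: L2Z.
Qed.

Lemma L2_sum I (s : seq I) (X : I -> Om -> R) : (forall i, L2 (X i)) ->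
  L2 (fun w => \sum_(i <- s) X i w).
Proof.
move=> iX; elim: s => [|i s ih].
  by under eq_fun do rewrite big_nil; exact: L2_cst.
by under eq_fun do rewrite big_cons; exact: L2D.
Qed.

Lemma ex_sqrD X Y : L2 X -> L2 Y ->
  ex (fun w => (X w + Y w) ^+ 2) =
  ex (fun w => X w ^+ 2) + 2 * ex (fun w => X w * Y w) + ex (fun w => Y w ^+ 2).
Proof.
move=> LX LY; have iXY := L2_itgM LX LY; case: LX LY => mX iX [mY iY].
rewrite (@eq_ex _ (fun w => X w ^+ 2 + 2 * (X w * Y w) + Y w ^+ 2)); last first.
  by move=> w; ring.
by rewrite !exD ?exZ//; do ?[apply: itgD => //|apply: itgZ].
Qed.

Lemma ex_sqr_ge X : L2 X -> (ex X) ^+ 2 <= ex (fun w => X w ^+ 2).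
Proof.
move=> LX; have iX := L2_itg LX.
have := ex_sqrD LX (L2_cst (- ex X)).
rewrite ex_cst; under [X in _ + 2 * X]eq_ex do rewrite mulrC.
rewrite exZ// => E.
have := @ex_ge0 (fun w => (X w - ex X) ^+ 2) (fun w => sqr_ge0 _).
by rewrite E; nra.
Qed.

(** Young's inequality: the difference of the two sides is the mean of k^-1 (k X - Y)^2. A small [k]
    isolates the main term of a sum at the price of a factor close to 1. *)
Lemma ex_sqrD_le k X Y : 0 < k -> L2 X -> L2 Y ->
  ex (fun w => (X w + Y w) ^+ 2) <=
  (1 + k) * ex (fun w => X w ^+ 2) + (1 + k^-1) * ex (fun w => Y w ^+ 2).
Proof.
move=> k0 LX LY; have iX := L2_sqr LX; have iY := L2_sqr LY.
rewrite -!exZ// -exD ?itgZ//; apply: le_ex.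
- exact: L2_sqr (L2D LX LY).
- by apply: itgD; exact: itgZ.
- move=> w; rewrite -subr_ge0.
  rewrite (_ : _ - _ = k^-1 * (k * X w - Y w) ^+ 2).
    by rewrite mulr_ge0 ?sqr_ge0// invr_ge0 ltW.
  by field; rewrite gt_eqF.
Qed.

(** The companion lower estimate, from the square of k X + Y. *)
Lemma ex_sqrD_ge k X Y : 0 < k -> L2 X -> L2 Y ->
  (1 - k) * ex (fun w => X w ^+ 2) - (k^-1 - 1) * ex (fun w => Y w ^+ 2) <=
  ex (fun w => (X w + Y w) ^+ 2).
Proof.
move=> k0 LX LY; have iX := L2_sqr LX; have iY := L2_sqr LY.
rewrite -!exZ// -exB ?itgZ//; apply: le_ex.
- by apply: itgB; exact: itgZ.
- exact: L2_sqr (L2D LX LY).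
- move=> w; rewrite -subr_ge0.
  rewrite (_ : _ - _ = k^-1 * (k * X w + Y w) ^+ 2).
    by rewrite mulr_ge0 ?sqr_ge0// invr_ge0 ltW.
  by field; rewrite gt_eqF.
Qed.

(** Meant for positive and negative parts: four identities between nonnegative variables combine, by
    bilinearity, into one for signed variables. *)
Lemma orthogonality H1 H2 U1 U2 V1 V2 :
  L2 H1 -> L2 H2 -> L2 U1 -> L2 U2 -> L2 V1 -> L2 V2 ->
  ex (fun w => H1 w * U1 w) = ex (fun w => H1 w * V1 w) ->
  ex (fun w => H1 w * U2 w) = ex (fun w => H1 w * V2 w) ->
  ex (fun w => H2 w * U1 w) = ex (fun w => H2 w * V1 w) ->
  ex (fun w => H2 w * U2 w) = ex (fun w => H2 w * V2 w) ->
  ex (fun w => (H1 w - H2 w) * ((U1 w - U2 w) - (V1 w - V2 w))) = 0.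
Proof.
move=> LH1 LH2 LU1 LU2 LV1 LV2 e11 e12 e21 e22.
rewrite (@eq_ex _ (fun w => ((H1 w * U1 w - H1 w * V1 w) - (H1 w * U2 w - H1 w * V2 w))
  - ((H2 w * U1 w - H2 w * V1 w) - (H2 w * U2 w - H2 w * V2 w)))); last first.
  by move=> w; ring.
by rewrite !exB ?e11 ?e12 ?e21 ?e22 ?subrr//; do ?[apply: itgB|apply: L2_itgM].
Qed.

End square_integrable.

(** * Iterates of a Markov kernel *)

Section kernel_powers.
Context {R : realType} {d : measure_display} {X : measurableType d}.
Variable K : R.-pker X ~> X.
Implicit Types (h : X -> \bar R) (t : nat).
Local Open Scope ereal_scope.

Lemma Kpos_nice t h : measurable_fun setT h -> (forall x, 0 <= h x) ->
  measurable_fun setT (Kpos K t h) /\ (forall x, 0 <= Kpos K t h x).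
Proof.
move=> mh h0; elim: t => [//|t [mt t0]]; split.
- exact: (@measurable_fun_integral_kernel _ _ _ _ R K (measurable_kernel K) _ t0 mt).
- by move=> x; apply: integral_ge0 => y _; exact: t0.
Qed.

Lemma measurable_Kpos t h : measurable_fun setT h -> (forall x, 0 <= h x) ->
  measurable_fun setT (Kpos K t h).
Proof. by move=> mh h0; have [] := Kpos_nice t mh h0. Qed.

Lemma Kpos_ge0 t h x : measurable_fun setT h -> (forall x, 0 <= h x) ->
  0 <= Kpos K t h x.
Proof. by move=> mh h0; have [] := Kpos_nice t mh h0. Qed.

Lemma KposD s t h : Kpos K (s + t) h = Kpos K s (Kpos K t h).
Proof. by rewrite /Kpos iterD. Qed.

Section push_kernel.
Variable nu : probability X R.

Definition push_kernel (A : set X) : \bar R := \int[nu]_y K y A.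

Let push0 : push_kernel set0 = 0.
Proof. by rewrite /push_kernel integral0_eq// => y _; rewrite measure0. Qed.

Let push_ge0 A : 0 <= push_kernel A.
Proof. by apply: integral_ge0. Qed.

Let push_sigma_additive : semi_sigma_additive push_kernel.
Proof.
move=> U mU tU mUU; rewrite [X in _ --> X](_ : _ =
    \int[nu]_y (\sum_(n <oo) K y (U n))); last first.
  apply: eq_integral => y _.
  by apply/esym/cvg_lim => //; exact/measure_semi_sigma_additive.
apply/cvg_closeP; split.
  by apply: is_cvg_nneseries => n _ _; exact: integral_ge0.
rewrite closeE// integral_nneseries// => n.
by have := measurable_kernel K (U n) (mU n).
Qed.

HB.instance Definition _ := isMeasure.Build _ _ _ push_kernel
  push0 push_ge0 push_sigma_additive.

Let push_setT : push_kernel setT = 1.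
Proof.
rewrite /push_kernel (eq_integral (cst 1)); last by move=> y _; exact: prob_kernel.
by rewrite integral_cst// mul1e; exact: probability_setT.
Qed.

HB.instance Definition _ := Measure_isProbability.Build _ _ _ push_kernel push_setT.

Lemma integral_push_kernel h : measurable_fun setT h -> (forall x, 0 <= h x) ->
  \int[push_kernel]_x h x = \int[nu]_y Kpos K 1 h y.
Proof.
move=> mh h0.
have := @eq_integral_kernel _ _ X X R nu (cst 1) (cst 1) (fun=> push_kernel) K
  (measurable_cst _) (measurable_cst _) (fun=> lee01) (fun=> lee01)
  (fun U mU => measurable_cst _) (fun U mU => measurable_kernel K U mU) _ h mh h0.
have E (k : \bar R) : \int[nu]_w (1 * k) = k.
  by rewrite integral_cst ?mul1e// [X in _ * X]probability_setT mule1.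
rewrite E => -> ; first by apply: eq_integral => y _; rewrite mul1e.
move=> U mU; rewrite E.
by apply: eq_integral => y _; rewrite mul1e.
Qed.

End push_kernel.

(** [Kpos] iterates integrals of functions; realising it as integration against a probability gives
    access to Jensen's inequality and the L2 theory under K^t(x, .). The law for t+1 is the law for
    t pushed through [K]. *)
Lemma Kn_exists t x : exists nu : probability X R, forall h,
  measurable_fun setT h -> (forall x, 0 <= h x) ->
  Kpos K t h x = \int[nu]_y h y.
Proof.
elim: t => [|t [nu ih]].
  by exists (\d_x) => h mh h0; rewrite integral_dirac// diracT mul1e.
exists (push_kernel nu) => h mh h0.
rewrite integral_push_kernel// -ih; last 2 first.
- exact: measurable_Kpos.
- by move=> y; exact: Kpos_ge0.
by rewrite -KposD addn1.
Qed.

Definition Kn t x : probability X R := sval (cid (Kn_exists t x)).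

Lemma KnE t x h : measurable_fun setT h -> (forall x, 0 <= h x) ->
  Kpos K t h x = \int[Kn t x]_y h y.
Proof. exact: (svalP (cid (Kn_exists t x))). Qed.

Lemma integral_invariant (mu : probability X R) h : Defs.invariant K mu ->
  measurable_fun setT h -> (forall x, 0 <= h x) ->
  forall t, \int[mu]_x Kpos K t h x = \int[mu]_x h x.
Proof.
move=> inv mh h0; elim=> [//|t ih]; rewrite -ih.
have mt := measurable_Kpos t mh h0.
have t0 x := Kpos_ge0 t x mh h0.
rewrite -[LHS](integral_push_kernel mu mt t0).
by apply: eq_measure_integral => A mA _; rewrite [RHS]inv.
Qed.

End kernel_powers.

Section Kt_theory.
Context {R : realType} {d : measure_display} {X : measurableType d}.
Variable K : R.-pker X ~> X.
Implicit Types (g : X -> R) (t : nat).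

Lemma measurable_max0 g : measurable_fun setT g ->
  measurable_fun setT (fun y => (Num.max (g y) 0)%:E).
Proof. by move=> mg; apply/measurable_EFinP/measurable_maxr. Qed.

Lemma measurable_maxN0 g : measurable_fun setT g ->
  measurable_fun setT (fun y => (Num.max (- g y) 0)%:E).
Proof.
by move=> mg; apply/measurable_EFinP/measurable_maxr => //; exact: measurableT_comp.
Qed.

Lemma pos_ge0 (r : R) : (0 <= (Num.max r 0)%:E)%E.
Proof. by rewrite lee_fin le_max lexx orbT. Qed.

Lemma measurable_Kt t g : measurable_fun setT g -> measurable_fun setT (Kt K t g).
Proof.
move=> mg; apply: measurable_funB.
- apply: measurableT_comp => //; apply: measurable_Kpos => [|y]; last exact: pos_ge0.
  exact: measurable_max0.
- apply: measurableT_comp => //; apply: measurable_Kpos => [|y]; last exact: pos_ge0.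
  exact: measurable_maxN0.
Qed.

Lemma ex_pos_neg (P : probability X R) g : itg P g ->
  ex P g = fine (\int[P]_y (Num.max (g y) 0)%:E) -
           fine (\int[P]_y (Num.max (- g y) 0)%:E).
Proof.
move=> ig; have mg := itg_meas ig.
have i1 : itg P (fun y => Num.max (g y) 0).
  apply: (@le_itg _ _ _ P (fun y => `|g y|)); last exact: integrable_norm.
  - exact: measurable_maxr.
  - by move=> y; rewrite ger0_norm ?le_max ?lexx ?orbT// ge_max ler_norm normr_ge0.
have i2 : itg P (fun y => Num.max (- g y) 0).
  apply: (@le_itg _ _ _ P (fun y => `|g y|)); last exact: integrable_norm.
  - by apply: measurable_maxr => //; exact: measurableT_comp.
  - move=> y; rewrite ger0_norm ?le_max ?lexx ?orbT// ge_max normr_ge0 andbT.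
    by rewrite -normrN ler_norm.
rewrite -[fine _]/(ex P _) -[X in _ - X]/(ex P _) -exB//.
apply: eq_ex => y; rewrite /Num.max oppr_lt0.
by case: ltgtP => [| |->]; rewrite ?subr0 ?sub0r ?opprK.
Qed.

Lemma Kt_ex t g x : itg (Kn K t x) g -> Kt K t g x = ex (Kn K t x) g.
Proof.
move=> ig; have mg := itg_meas ig.
rewrite ex_pos_neg// /Kt !KnE//; [exact: measurable_maxN0| |exact: measurable_max0|];
  by move=> y; exact: pos_ge0.
Qed.

Lemma Kt0 g x : Kt K 0 g x = g x.
Proof.
rewrite /Kt/= /Num.max oppr_lt0.
by case: ltgtP => [| |->]; rewrite ?subr0 ?sub0r ?opprK.
Qed.

End Kt_theory.

(** A finite integral makes [u] finite almost everywhere, so passing to real values changes it on a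
    null set only. *)
Lemma ex_fine d (T : measurableType d) (R : realType) (P : probability T R)
    (u : T -> \bar R) : measurable_fun setT u -> (forall x, 0 <= u x)%E ->
  (\int[P]_x u x < +oo)%E ->
  itg P (fine \o u) /\ ex P (fine \o u) = fine (\int[P]_x u x)%E.
Proof.
move=> mu u0 iu.
have Iu : P.-integrable setT u.
  apply/integrableP; split => //.
  by under eq_integral do rewrite gee0_abs//.
have ae : ae_eq P setT u (EFin \o (fine \o u)).
  apply: filterS (integrable_ae measurableT Iu) => x /(_ I) ufin _ /=.
  by rewrite fineK.
have mf : measurable_fun setT (EFin \o (fine \o u)).
  by apply/measurable_EFinP; exact: measurableT_comp.
have E : (\int[P]_x u x = \int[P]_x (EFin \o (fine \o u)) x)%E.
  exact: ae_eq_integral.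
split; last by rewrite E.
apply/integrableP; split => //.
under eq_integral => x _ do rewrite gee0_abs ?lee_fin ?fine_ge0//.
by rewrite -E.
Qed.

(** * Square roots of V and the Poisson equation *)

Section sqrtV_ergodicity.
Context {R : realType} {d : measure_display} {X : measurableType d}.
Variables (K : R.-pker X ~> X) (mu : probability X R) (V : X -> \bar R).

(** The condition |phi| <= sqrt(c V), written with squares: [f] satisfies one such condition, and
    second moments of these functions are controlled by moments of [V]. *)
Definition V_class (c : R) (phi : X -> R) :=
  measurable_fun setT phi /\ forall x, ((phi x ^+ 2)%:E <= c%:E * V x)%E.

(** The consequences of V-uniform ergodicity on which the rest depends. In [sv_erg] the bound is on
    the square and linear in the class constant [c], so that the deviations K^t phi - mu(phi) form a
    class again. *)
Record sqrtV_ergodic (CV D r : R) : Prop := SqrtVErgodic {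
  sv_inv : Defs.invariant K mu;
  sv_meas : measurable_fun setT V;
  sv_ge1 : forall x, (1 <= V x)%E;
  sv_int : (\int[mu]_x V x < +oo)%E;
  sv_C : 1 <= CV;
  sv_D : 0 < D;
  sv_r0 : 0 < r;
  sv_r1 : r < 1;
  sv_K : forall t x, (Kpos K t V x <= CV%:E * V x)%E;
  sv_erg : forall c phi x t, 0 < c -> V_class c phi -> (V x < +oo)%E ->
    (Kt K t phi x - ex mu phi) ^+ 2 <= c * D * r ^+ t * fine (V x) }.

Hypothesis HV : V_uniformly_ergodic K mu V.

Let mV : measurable_fun setT V. Proof. by case: HV. Qed.
Let V1 x : (1 <= V x)%E. Proof. by case: HV. Qed.
Let V0 x : (0 <= V x)%E. Proof. by apply: le_trans (V1 x). Qed.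
Let iV : (\int[mu]_x V x < +oo)%E. Proof. by case: HV. Qed.
Let inv : Defs.invariant K mu. Proof. by case: HV. Qed.

Let Vfin x : (V x < +oo)%E -> V x = (fine (V x))%:E.
Proof. by move=> Vx; rewrite fineK// ge0_fin_numE. Qed.

Let fineV1 x : (V x < +oo)%E -> 1 <= fine (V x).
Proof. by move=> Vx; rewrite -lee_fin -Vfin. Qed.

Lemma V_finite_point : exists x, (V x < +oo)%E.
Proof.
apply: contrapT => nV.
have Vy x : V x = +oo%E.
  by apply/eqP; rewrite -leye_eq leNgt; apply/negP => Vx; apply: nV; exists x.
have := iV; rewrite (eq_integral (cst +oo%E)); last by move=> x _; rewrite Vy.
by rewrite integral_cst// [X in (_ * X)%E]probability_setT mule1 ltxx.
Qed.

(** Ergodicity speaks of real-valued functions, while [V] may be infinite: it is applied to simple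
    functions increasing to [V], whose K^t-integrals are at most mu(V) + Rc V(x). As 1 <= V, the
    constant mu(V) is absorbed into a multiple of V(x). *)
Lemma Kpos_V_bound : exists2 CV : R, 1 <= CV &
  forall t x, (Kpos K t V x <= CV%:E * V x)%E.
Proof.
have [_ _ _ _ [Rc [rho [Rc0 rho1 bd]]]] := HV.
have [x0 Vx0] := V_finite_point.
(* The bound for the zero function, at time 1 and at a point where [V] is finite, forces the rate to
   be nonnegative. *)
have rho0 : 0 <= rho.
  have := bd (fun=> 0) (measurable_cst _) (fun y => _) x0 1%N Vx0.
  move=> /(_ ltac:(by rewrite normr0; exact: V0)) [_ _].
  move=> /(le_trans (normr_ge0 _)); rewrite expr1 -mulrA pmulr_rge0// pmulr_lge0//.
  exact: lt_le_trans (fineV1 Vx0).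
have rhot t : rho ^+ t <= 1 by rewrite exprn_ile1// ltW.
have iV0 : 0 <= fine (\int[mu]_x V x)%E by rewrite fine_ge0// integral_ge0.
exists (1 + fine (\int[mu]_x V x)%E + Rc); first by rewrite -addrA lerDl addr_ge0// ltW.
move=> t x; have [Vx|] := ltP (V x) +oo%E; last first.
  rewrite leye_eq => /eqP ->; rewrite gt0_muley ?leey// lte_fin.
  by rewrite -addrA ltr_pwDl// addr_ge0// ltW.
pose k_ := nnsfun_approx measurableT mV.
have kV n y : ((k_ n y)%:E <= V y)%E.
  by rewrite /k_ nnsfun_approxE; apply: le_approx => //.
have kpos n : (fun y => (Num.max (k_ n y) 0)%:E) = (fun y => (k_ n y)%:E) :> (X -> \bar R).
  by apply/funext => y; congr EFin; apply/max_idPl.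
have mk n : measurable_fun setT (k_ n) by [].
have bk n : (\int[Kn K t x]_y (k_ n y)%:E <=
    (fine (\int[mu]_x V x)%E + Rc * fine (V x))%:E)%E.
  have akV y : ((`|k_ n y|)%:E <= V y)%E by rewrite ger0_norm.
  have [fp fn le] := bd (k_ n) (mk n) akV x t Vx.
  have ik : itg (Kn K t x) (k_ n).
    apply/integrableP; split; first exact/measurable_EFinP.
    under eq_integral => y _ do rewrite /= ger0_norm//.
    rewrite -KnE; [by rewrite -kpos|exact/measurable_EFinP|by move=> y; rewrite lee_fin].
  rewrite -exE// lee_fin -Kt_ex//.
  have le2 : integ mu (k_ n) <= fine (\int[mu]_x V x)%E.
    rewrite /integ fine_le//.
    - rewrite ge0_fin_numE; last by apply: integral_ge0 => y _; rewrite lee_fin.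
      apply: le_lt_trans iV; apply: ge0_le_integral => //.
      by move=> y _; rewrite lee_fin.
      exact/measurable_EFinP.
    - by rewrite ge0_fin_numE// integral_ge0.
    - apply: ge0_le_integral => //; first by move=> y _; rewrite lee_fin.
      exact/measurable_EFinP.
  have : Rc * rho ^+ t * fine (V x) <= Rc * fine (V x).
    rewrite ler_wpM2r//; first by rewrite (le_trans _ (fineV1 Vx)).
    by rewrite ler_piMr// ltW.
  move: le; rewrite ler_norml => /andP[_ le]; lra.
rewrite KnE// (eq_integral (fun y => limn (fun n => (k_ n y)%:E))); last first.
  by move=> y _; apply/esym/cvg_lim => //=; apply: cvg_nnsfun_approx => //.
rewrite monotone_convergence//; last 3 first.
- by move=> n; exact/measurable_EFinP.
- by move=> n y _; rewrite lee_fin.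
- by move=> y _ a b ab; rewrite lee_fin; exact/lefP/nd_nnsfun_approx.
apply: lime_le.
  apply: ereal_nondecreasing_is_cvgn => a b ab; apply: ge0_le_integral => //.
  - by move=> y _; rewrite lee_fin.
  - exact/measurable_EFinP.
  - exact/measurable_EFinP.
  - by move=> y _; rewrite lee_fin; exact/lefP/nd_nnsfun_approx.
apply: nearW => n; apply: (le_trans (bk n)).
rewrite Vfin// -EFinM lee_fin; have := fineV1 Vx; nra.
Qed.

Lemma V_class_itg CV c phi t x : 0 <= CV ->
  (forall t x, (Kpos K t V x <= CV%:E * V x)%E) -> (V x < +oo)%E ->
  V_class c phi -> L2 (Kn K t x) phi.
Proof.
move=> CV0 KV Vx [mphi phiV]; split => //.
apply/integrableP; split; first by apply/measurable_EFinP; exact: measurable_funX.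
apply: (@le_lt_trans _ _ (\int[Kn K t x]_y (`|c|%:E * V y))%E).
  apply: ge0_le_integral => //.
  - by apply: measurableT_comp => //; apply/measurable_EFinP; exact: measurable_funX.
  - exact: measurable_funeM.
  - move=> y _; rewrite /= ger0_norm ?sqr_ge0//; apply: (le_trans (phiV y)).
    by rewrite lee_wpmul2r// lee_fin ler_norm.
rewrite ge0_integralZl_EFin// -KnE// lte_mul_pinfty// ?lee_fin//.
by apply: le_lt_trans (KV t x) _; rewrite Vfin// -EFinM ltry.
Qed.

Lemma V_class_L2 c phi : V_class c phi -> L2 mu phi.
Proof.
move=> [mphi phiV]; split => //.
apply/integrableP; split; first by apply/measurable_EFinP; exact: measurable_funX.
apply: (@le_lt_trans _ _ (\int[mu]_y (`|c|%:E * V y))%E).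
  apply: ge0_le_integral => //.
  - by apply: measurableT_comp => //; apply/measurable_EFinP; exact: measurable_funX.
  - exact: measurable_funeM.
  - move=> y _; rewrite /= ger0_norm ?sqr_ge0//; apply: (le_trans (phiV y)).
    by rewrite lee_wpmul2r// lee_fin ler_norm.
by rewrite ge0_integralZl_EFin// lte_mul_pinfty// ?lee_fin//.
Qed.

Lemma ex_bound (P : probability X R) (Y : X -> R) (M : R) :
  measurable_fun setT Y -> (forall y, `|Y y| <= M) -> `|ex P Y| <= M.
Proof.
move=> mY YM; have iY : itg P Y.
  by apply: (le_itg mY YM); exact: itg_cst.
rewrite ler_norml -{2}(ex_cst P M) -(ex_cst P (- M)).
by apply/andP; split; apply: le_ex => //; try exact: itg_cst;
  move=> y; have := YM y; rewrite ler_norml => /andP[].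
Qed.

(* The function is split at the level V = a with a := r^t V(x): the part on
   {V <= a} is bounded by sqrt a, and the part on {V > a} is at most V / sqrt a,
   to which V-uniform ergodicity applies. *)
Lemma V_uniform_sqrtV : exists CV D r, sqrtV_ergodic CV D r.
Proof.
have [CV CV1 KV] := Kpos_V_bound.
have CV0 : 0 <= CV by apply: le_trans CV1.
have [_ _ _ _ [Rc [rho [Rc0 rho1 bd]]]] := HV.
have [x0 Vx0] := V_finite_point.
have rho0 : 0 <= rho.
  have := bd (fun=> 0) (measurable_cst _) (fun y => _) x0 1%N Vx0.
  move=> /(_ ltac:(by rewrite normr0; exact: V0)) [_ _].
  move=> /(le_trans (normr_ge0 _)); rewrite expr1 -mulrA pmulr_rge0// pmulr_lge0//.
  exact: lt_le_trans (fineV1 Vx0).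
(* The maximum with 1/2 keeps the rate positive, as the level [a] below must be. *)
pose r := Num.max rho 2^-1.
have r0 : 0 < r by rewrite lt_max; apply/orP; right; rewrite invr_gt0.
have r1 : r < 1 by rewrite gt_max rho1/=; lra.
have rhor t : rho ^+ t <= r ^+ t by apply: lerXn2r; rewrite ?nnegrE//; [exact: ltW|rewrite /r le_max lexx].
(* In 2 + Rc, the 2 pays for the bounded part, estimated under both measures, and Rc for the
   unbounded one. *)
exists CV, ((2 + Rc) ^+ 2), r; split => //; first by rewrite exprn_gt0// ltr_wpDl.
move=> c phi x t c0 cphi Vx; have [mphi phiV] := cphi.
have v1 := fineV1 Vx; set v := fine (V x) in v1 *.
have v0 : 0 < v by apply: lt_le_trans v1.
pose a := r ^+ t * v.
have a0 : 0 < a by rewrite mulr_gt0// exprn_gt0.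
pose s := Num.sqrt a; pose q := Num.sqrt c.
have s0 : 0 < s by rewrite sqrtr_gt0.
have q0 : 0 < q by rewrite sqrtr_gt0.
have ss : s ^+ 2 = a by rewrite sqr_sqrtr// ltW.
have qq : q ^+ 2 = c by rewrite sqr_sqrtr// ltW.
pose S := [set y | (V y <= a%:E)%E].
have mS : measurable S.
  by rewrite -[S]setTI; apply: measurable_lee => //; exact: measurable_cst.
pose p1 y := phi y * \1_S y.
pose p2 y := phi y * \1_(~` S) y.
have m1 : measurable_fun setT p1 by apply: measurable_funM.
have m2 : measurable_fun setT p2.
  by apply: measurable_funM => //; apply: measurable_indic; exact: measurableC.
have b1 y : `|p1 y| <= q * s.
  rewrite /p1 indicE; case: (boolP (y \in S)) => [yS|_]/=; last by rewrite mulr0 normr0 mulr_ge0// ltW.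
  rewrite mulr1 -ler_sqr ?nnegrE// ?mulr_ge0 ?sqrtr_ge0// real_normK ?num_real//.
  rewrite exprMn ss qq -lee_fin; apply: (le_trans (phiV y)).
  by rewrite EFinM; apply: lee_wpmul2l; [rewrite lee_fin ltW|move: yS; rewrite inE].
pose g y := (s / q) * p2 y.
have mg : measurable_fun setT g by exact: measurable_funM.
have gV y : ((`|g y|)%:E <= V y)%E.
  rewrite /g /p2 indicE; case: (boolP (y \in ~` S)) => [|_]/=; last by rewrite !mulr0 normr0.
  rewrite inE /S/= => /negP; rewrite -ltNge => aV.
  have [Vy|] := ltP (V y) +oo%E; last by rewrite leye_eq => /eqP ->; rewrite leey.
  move: aV (phiV y) (fineV1 Vy); rewrite (Vfin Vy)/= -EFinM !lee_fin lte_fin.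
  set w := fine (V y) => aw pw w1; rewrite -ler_sqr ?nnegrE//; last by apply: le_trans w1.
  rewrite real_normK ?num_real// mulr1 exprMn exprMn exprVn ss qq.
  rewrite mulrAC ler_pdivrMr//.
  have := ltW aw; have := ltW a0; have := ltW c0; nra.
have iV' t' : itg (Kn K t' x) (fine \o V).
  have [] := @ex_fine _ X R (Kn K t' x) V mV V0; last by [].
  by rewrite -KnE//; apply: le_lt_trans (KV t' x) _; rewrite Vfin// -EFinM ltry.
have L := V_class_itg t CV0 KV Vx cphi.
have Lm := V_class_L2 cphi.
have L1 (P : probability X R) : L2 P phi -> L2 P p1.
  move=> LP; apply: le_L2 LP => // y; rewrite /p1 normrM ler_piMr//.
  by rewrite indicE; case: (_ \in _); rewrite ?normr1 ?normr0.
have L2' (P : probability X R) : L2 P phi -> L2 P p2.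
  move=> LP; apply: le_L2 LP => // y; rewrite /p2 normrM ler_piMr//.
  by rewrite indicE; case: (_ \in _); rewrite ?normr1 ?normr0.
have split (P : probability X R) : L2 P phi -> ex P phi = ex P p1 + ex P p2.
  move=> LP; rewrite -exD; [|exact/L2_itg/L1|exact/L2_itg/L2'].
  apply: eq_ex => y; rewrite /p1 /p2 -mulrDr !indicE in_setC.
  by case: (_ \in _); rewrite ?addr0 ?add0r mulr1.
have ig (P : probability X R) : L2 P phi -> ex P g = s / q * ex P p2.
  by move=> LP; rewrite exZ//; exact/L2_itg/L2'.
have [_ _] := bd g mg gV x t Vx.
rewrite Kt_ex; last by apply: itgZ; exact/L2_itg/L2'.
rewrite -[integ mu g]/(ex mu g) !ig// -mulrBr normrM ger0_norm; last first.
  by rewrite divr_ge0// ltW.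
rewrite Kt_ex; last exact: L2_itg.
rewrite !split// => bnd.
have e2 : `|ex (Kn K t x) p2 - ex mu p2| <= Rc * (q * s).
  rewrite -(ler_pM2l (_ : 0 < s / q)) ?divr_gt0//; apply: (le_trans bnd).
  rewrite (_ : _ * (_ * _) = Rc * (s ^+ 2)); last by field; rewrite gt_eqF.
  rewrite ss /a mulrA; apply: ler_wpM2r; first exact: ltW.
  by apply: ler_wpM2l; [exact: ltW|exact: rhor].
have e1 : `|ex (Kn K t x) p1 - ex mu p1| <= 2 * (q * s).
  apply: (le_trans (ler_normB _ _)).
  by rewrite mulr_natl mulr2n lerD//; exact: ex_bound.
have : `|(ex (Kn K t x) p1 + ex (Kn K t x) p2) - (ex mu p1 + ex mu p2)| <= (2 + Rc) * (q * s).
  rewrite mulrDl opprD addrACA; exact: le_trans (ler_normD _ _) (lerD e1 e2).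
rewrite -ler_sqr ?nnegrE//; last by rewrite !mulr_ge0 ?sqrtr_ge0// addr_ge0// ltW.
rewrite real_normK ?num_real// => /le_trans; apply.
by rewrite !exprMn ss qq /a -/v le_eqVlt; apply/orP; left; apply/eqP; ring.
Qed.

End sqrtV_ergodicity.

(** [limn] takes the default value [point] where the sequence diverges, so the function is glued
    along the measurable set where the upper and lower limits agree and are finite. *)
Lemma measurable_limn d (T : measurableType d) (R : realType) (S : nat -> T -> R) :
  (forall n, measurable_fun setT (S n)) ->
  measurable_fun setT (fun x => limn (fun n => S n x)).
Proof.
move=> mS; pose u n x := (S n x)%:E.
have mu n : measurable_fun setT (u n) by exact/measurable_EFinP.
pose s x := limn_esup (u ^~ x); pose i x := (- limn_esup (fun n => (- S n x)%:E))%E.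
have ms : measurable_fun setT s by exact: measurable_fun_limn_esup.
have mi : measurable_fun setT i.
  apply: measurableT_comp => //; apply: measurable_fun_limn_esup => n.
  by apply/measurable_EFinP; exact: measurableT_comp.
have iE x : i x = limn_einf (u ^~ x) by [].
pose b x := (s x == i x) && (s x == (fine (s x))%:E).
have mb : measurable_fun setT b.
  apply: measurable_and; apply: measurable_fun_eqe => //.
  by apply/measurable_EFinP; exact: measurableT_comp.
have -> : (fun x => limn (fun n => S n x)) = (fun x => if b x then fine (s x) else point).
  apply/funext => x; case: ifPn => [/andP[/eqP si /eqP sf]|nb].
    apply/cvg_lim => //.
    have E : u^~ x n @[n --> \oo] --> s x.
      apply: (@squeeze_cvge _ _ _ _ (einfs (u^~x)) _ (esups (u^~x))).
      - apply: nearW => n; apply/andP; split.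
        + by apply: ereal_inf_lbound; exists n => /=.
        + by apply: ereal_sup_ubound; exists n => /=.
      - by rewrite si iE limn_einf_lim; exact: is_cvg_einfs.
      - by rewrite /s limn_esup_lim; exact: is_cvg_esups.
    by rewrite sf in E; exact: (fine_cvg E).
  apply: xgetPN => l Sl; move/negP: nb; apply.
  have ul : u^~ x n @[n --> \oo] --> l%:E by apply: cvg_EFin => //; exact: nearW.
  have sl : s x = l%:E by rewrite /s limn_esup_lim; apply/cvg_lim => //; exact: cvg_esups.
  have il : i x = l%:E by rewrite iE limn_einf_lim; apply/cvg_lim => //; exact: cvg_einfs.
  by rewrite /b sl il !eqxx.
apply: measurable_fun_ifT => //; exact: measurableT_comp.
Qed.

Section V_class_theory.
Context {R : realType} {d : measure_display} {X : measurableType d}.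
Variables (K : R.-pker X ~> X) (mu : probability X R) (V : X -> \bar R).
Variables (CV D r : R).
Hypothesis Hs : sqrtV_ergodic K mu V CV D r.
Local Notation cls := (V_class V).
Implicit Types (c a b : R) (phi psi : X -> R) (x y : X) (t : nat).

Let mV : measurable_fun setT V. Proof. exact: sv_meas Hs. Qed.
Let V1 x : (1 <= V x)%E. Proof. exact: sv_ge1 Hs x. Qed.
Let V0 x : (0 <= V x)%E. Proof. by apply: le_trans (V1 x). Qed.
Let CV1 := sv_C Hs.
Let CV0 : 0 <= CV. Proof. by apply: le_trans CV1. Qed.
Let D0 := sv_D Hs.
Let r0 := sv_r0 Hs.
Let r1 := sv_r1 Hs.

Lemma V_fineK x : (V x < +oo)%E -> V x = (fine (V x))%:E.
Proof. by move=> Vx; rewrite fineK// ge0_fin_numE. Qed.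

Lemma fine_V_ge1 x : (V x < +oo)%E -> 1 <= fine (V x).
Proof. by move=> Vx; rewrite -lee_fin -V_fineK. Qed.

Lemma V_classP c phi : 0 < c -> measurable_fun setT phi ->
  (forall x, (V x < +oo)%E -> phi x ^+ 2 <= c * fine (V x)) -> cls c phi.
Proof.
move=> c0 mphi h; split => // x.
have [Vx|] := ltP (V x) +oo%E; first by rewrite (V_fineK Vx) -EFinM lee_fin h.
by rewrite leye_eq => /eqP ->; rewrite gt0_muley ?leey// lte_fin.
Qed.

Lemma V_class_le c phi x : cls c phi -> (V x < +oo)%E -> phi x ^+ 2 <= c * fine (V x).
Proof. by move=> [_ h] Vx; have := h x; rewrite (V_fineK Vx) -EFinM lee_fin. Qed.

Lemma V_class_L2K c phi t x : (V x < +oo)%E -> cls c phi -> L2 (Kn K t x) phi.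
Proof.
move=> Vx cphi; have [mphi phiV] := cphi; split => //.
apply/integrableP; split; first by apply/measurable_EFinP; exact: measurable_funX.
apply: (@le_lt_trans _ _ (\int[Kn K t x]_y (`|c|%:E * V y))%E).
  apply: ge0_le_integral => //.
  - by apply: measurableT_comp => //; apply/measurable_EFinP; exact: measurable_funX.
  - exact: measurable_funeM.
  - move=> y _; rewrite /= ger0_norm ?sqr_ge0//; apply: (le_trans (phiV y)).
    by rewrite lee_wpmul2r// lee_fin ler_norm.
rewrite ge0_integralZl_EFin// -KnE// lte_mul_pinfty// ?lee_fin//.
by apply: le_lt_trans (sv_K Hs t x) _; rewrite V_fineK// -EFinM ltry.
Qed.

Lemma V_class_L2mu c phi : cls c phi -> L2 mu phi.
Proof.
move=> [mphi phiV]; split => //.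
apply/integrableP; split; first by apply/measurable_EFinP; exact: measurable_funX.
apply: (@le_lt_trans _ _ (\int[mu]_y (`|c|%:E * V y))%E).
  apply: ge0_le_integral => //.
  - by apply: measurableT_comp => //; apply/measurable_EFinP; exact: measurable_funX.
  - exact: measurable_funeM.
  - move=> y _; rewrite /= ger0_norm ?sqr_ge0//; apply: (le_trans (phiV y)).
    by rewrite lee_wpmul2r// lee_fin ler_norm.
by rewrite ge0_integralZl_EFin// lte_mul_pinfty// ?lee_fin//; exact: (sv_int Hs).
Qed.

Lemma Kt_exV c phi t x : (V x < +oo)%E -> cls c phi ->
  Kt K t phi x = ex (Kn K t x) phi.
Proof. by move=> Vx cphi; apply: Kt_ex; exact/L2_itg/(V_class_L2K _ Vx cphi). Qed.

Lemma itg_fineV t x : (V x < +oo)%E ->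
  itg (Kn K t x) (fine \o V) /\ ex (Kn K t x) (fine \o V) <= CV * fine (V x).
Proof.
move=> Vx.
have bd : (\int[Kn K t x]_y V y <= CV%:E * V x)%E by rewrite -KnE//; exact: sv_K Hs t x.
have bdoo : (\int[Kn K t x]_y V y < +oo)%E.
  by apply: le_lt_trans bd _; rewrite V_fineK// -EFinM ltry.
have [i e] := ex_fine mV V0 bdoo; split => //.
rewrite e -lee_fin fineK; first by rewrite EFinM -V_fineK.
by rewrite ge0_fin_numE// integral_ge0.
Qed.

Lemma V_ae t x : (V x < +oo)%E -> {ae Kn K t x, forall y, (V y < +oo)%E}.
Proof.
move=> Vx; have : (Kn K t x).-integrable setT V.
  apply/integrableP; split=> //.
  under eq_integral do rewrite gee0_abs//.
  rewrite -KnE//; apply: le_lt_trans (sv_K Hs t x) _; by rewrite V_fineK// -EFinM ltry.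
move=> /(integrable_ae measurableT); apply: filterS => y /(_ I).
by rewrite ge0_fin_numE.
Qed.

Lemma ex_sqr_V c phi t x : 0 <= c -> (V x < +oo)%E -> cls c phi ->
  ex (Kn K t x) (fun y => phi y ^+ 2) <= c * CV * fine (V x).
Proof.
move=> c0 Vx cphi; have [i e] := itg_fineV t Vx.
rewrite -mulrA; apply: (@le_trans _ _ (c * ex (Kn K t x) (fine \o V))).
  rewrite -exZ//; apply: le_ex_ae.
  - exact/L2_sqr/(V_class_L2K _ Vx cphi).
  - exact: itgZ.
  - by apply: filterS (V_ae t Vx) => y Vy; exact: V_class_le.
exact: ler_wpM2l.
Qed.

Lemma V_class_Kt c phi t : 0 < c -> cls c phi -> cls (c * CV) (Kt K t phi).
Proof.
move=> c0 cphi; have [mphi _] := cphi; apply: V_classP.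
- by rewrite mulr_gt0// (lt_le_trans _ CV1).
- exact: measurable_Kt.
- move=> x Vx; rewrite (Kt_exV t Vx cphi).
  apply: le_trans (ex_sqr_ge (V_class_L2K t Vx cphi)) _.
  by apply: ex_sqr_V => //; exact: ltW.
Qed.

(** The geometric decay is recorded in the class constant: any L2 bound proved for classes then
    yields a factor r^t. *)
Lemma V_class_dev c phi t : 0 < c -> cls c phi ->
  cls (c * D * r ^+ t) (fun x => Kt K t phi x - ex mu phi).
Proof.
move=> c0 cphi; have [mphi _] := cphi; apply: V_classP.
- by rewrite !mulr_gt0// exprn_gt0.
- apply: measurable_funB => //; exact: measurable_Kt.
- by move=> x Vx; exact: (sv_erg Hs).
Qed.

(** [Kt] subtracts the real values of two extended integrals, so the semigroup property is proved on
    positive and negative parts separately, both having finite iterates where [V] is finite. *)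
Lemma KtS c phi t x : 0 < c -> cls c phi -> (V x < +oo)%E ->
  Kt K 1 (Kt K t phi) x = Kt K t.+1 phi x.
Proof.
move=> c0 cphi Vx; have [mphi _] := cphi.
have mp := measurable_max0 mphi; have mn := measurable_maxN0 mphi.
set p := fun y => _ in mp; set n := fun y => _ in mn.
have p0 y : (0 <= p y)%E by exact: pos_ge0.
have n0 y : (0 <= n y)%E by exact: pos_ge0.
have fin q : measurable_fun setT q -> (forall y, 0 <= q y)%E ->
   (forall y, q y <= (`|phi y|)%:E)%E -> (Kpos K t.+1 q x < +oo)%E.
  move=> mq q0 qphi; rewrite KnE//.
  apply: (@le_lt_trans _ _ (\int[Kn K t.+1 x]_y (`|phi y|)%:E)%E).
    apply: ge0_le_integral => //.
    by apply/measurable_EFinP; exact: measurableT_comp.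
  have /integrableP[_] := L2_itg (V_class_L2K t.+1 Vx cphi).
  by [].
have fp : (Kpos K t.+1 p x < +oo)%E.
  by apply: fin => // y; rewrite lee_fin ge_max ler_norm normr_ge0.
have fn : (Kpos K t.+1 n x < +oo)%E.
  by apply: fin => // y; rewrite lee_fin ge_max -normrN ler_norm normr_ge0.
have mKp := measurable_Kpos K t mp p0; have mKn := measurable_Kpos K t mn n0.
have Kp0 y : (0 <= Kpos K t p y)%E by exact: Kpos_ge0.
have Kn0 y : (0 <= Kpos K t n y)%E by exact: Kpos_ge0.
have E q : Kpos K t.+1 q x = Kpos K 1 (Kpos K t q) x by rewrite -KposD.
have [ip ep] : itg (Kn K 1 x) (fine \o Kpos K t p) /\
    ex (Kn K 1 x) (fine \o Kpos K t p) = fine (Kpos K t.+1 p x).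
  rewrite E KnE//; apply: ex_fine => //; by rewrite -KnE// -E.
have [iN eN] : itg (Kn K 1 x) (fine \o Kpos K t n) /\
    ex (Kn K 1 x) (fine \o Kpos K t n) = fine (Kpos K t.+1 n x).
  rewrite E KnE//; apply: ex_fine => //; by rewrite -KnE// -E.
rewrite [RHS]/Kt -[fun y => _]/p -[X in _ - fine (Kpos K _ X x)]/n -ep -eN -exB//.
rewrite Kt_ex//; exact: itgB.
Qed.

Lemma V_class_bounded M phi : 0 < M -> measurable_fun setT phi ->
  (forall x, `|phi x| <= M) -> cls (M ^+ 2) phi.
Proof.
move=> M0 mphi bphi; apply: V_classP => //; first by rewrite exprn_gt0.
move=> x Vx; apply: (@le_trans _ _ (M ^+ 2)).
  by rewrite -[leLHS]real_normK ?num_real// ler_sqr ?nnegrE// ltW.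
by rewrite ler_peMr ?sqr_ge0// fine_V_ge1.
Qed.

End V_class_theory.

Lemma cvg_le_eps (R : realType) (a b q : R) : 0 <= b -> 0 <= q < 1 ->
  (forall n, a <= b * q ^+ n) -> a <= 0.
Proof.
move=> b0 /andP[q0 q1] h.
have c : (fun n => b * q ^+ n) @ \oo --> (0 : R).
  by apply: (cvg_geometric b); rewrite ger0_norm.
rewrite -(cvg_lim _ c)//; apply: limr_ge; first by apply/cvg_ex; exists 0.
exact: nearW.
Qed.

Section poisson_equation.
Context {R : realType} {d : measure_display} {X : measurableType d}.
Variables (K : R.-pker X ~> X) (mu : probability X R) (V : X -> \bar R).
Variables (CV D r : R).
Hypothesis Hs : sqrtV_ergodic K mu V CV D r.
Local Notation cls := (V_class V).
Variables (c : R) (f : X -> R).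
Hypothesis c0 : 0 < c.
Hypothesis cf : cls c f.

Let D0 := sv_D Hs.
Let r0 := sv_r0 Hs.
Let r1 := sv_r1 Hs.
Let CV0 : 0 < CV. Proof. by apply: lt_le_trans (sv_C Hs). Qed.
Let mf : measurable_fun setT f. Proof. by case: cf. Qed.

Let S n x := \sum_(0 <= t < n) (Kt K t f x - integ mu f).
Let q := Num.sqrt r.
Let q0 : 0 < q. Proof. by rewrite sqrtr_gt0. Qed.
Let qq : q ^+ 2 = r. Proof. by rewrite sqr_sqrtr// ltW. Qed.
Let q1 : q < 1.
Proof. by rewrite -(ltr_pXn2r (n := 2))// ?nnegrE ?ltW// qq expr1n. Qed.
Let B x := Num.sqrt (c * D * fine (V x)).

(** With q = sqrt r, the terms of the series defining [h_fun] are at most sqrt(c D V) q^t; this is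
    the square of the sum of that geometric series, with V factored out. *)
Definition h_const := c * D / (1 - q) ^+ 2.
Local Notation G := h_const.

Let G0 : 0 < G.
Proof. by apply: divr_gt0; [exact: mulr_gt0|rewrite exprn_gt0// subr_gt0]. Qed.

Let dev_le t x : (V x < +oo)%E -> `|Kt K t f x - integ mu f| <= B x * q ^+ t.
Proof.
move=> Vx; have v1 := fine_V_ge1 Hs Vx.
rewrite -ler_sqr ?nnegrE//; last by rewrite mulr_ge0 ?sqrtr_ge0// exprn_ge0// ltW.
rewrite real_normK ?num_real// exprMn -exprM mulnC exprM qq.
rewrite sqr_sqrtr; last by rewrite !mulr_ge0// ?ltW// (lt_le_trans _ v1).
rewrite mulrAC; exact: (sv_erg Hs).
Qed.

Let S_cvg x : (V x < +oo)%E -> cvgn (S ^~ x).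
Proof.
move=> Vx; apply: normed_cvg.
apply: (@series_le_cvg R _ (geometric (B x) q)).
- by move=> n /=.
- by move=> n; apply: geometric_ge0; [exact: sqrtr_ge0|exact: ltW].
- by move=> n /=; exact: dev_le.
- by apply: is_cvg_geometric_series; rewrite ger0_norm// ltW.
Qed.

Lemma measurable_h_fun : measurable_fun setT (h_fun K mu f).
Proof.
apply: measurable_limn => n; apply: measurable_sum => t.
by apply: measurable_funB => //; exact: measurable_Kt.
Qed.

Let S_tail x n m : (V x < +oo)%E -> (n <= m)%N ->
  `|S m x - S n x| <= B x / (1 - q) * q ^+ n.
Proof.
move=> Vx nm; rewrite /S (big_cat_nat (leq0n n) nm)//= addrAC subrr add0r.
apply: (le_trans (ler_norm_sum _ _ _)).
apply: (@le_trans _ _ (\sum_(n <= t < m) B x * q ^+ t)).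
  by apply: ler_sum => t _; exact: dev_le.
rewrite -mulr_sumr -mulrA ler_wpM2l ?sqrtr_ge0//.
rewrite -[m](subnKC nm) geometric_partial_tail geometric_seriesE ?lt_eqF//=.
rewrite mulrC; apply: ler_wpM2l; first by rewrite invr_ge0 subr_ge0 ltW.
by rewrite ler_piMr ?exprn_ge0 ?gerBl ?exprn_ge0// ltW.
Qed.

Let h_tail x n : (V x < +oo)%E ->
  `|h_fun K mu f x - S n x| <= B x / (1 - q) * q ^+ n.
Proof.
move=> Vx.
have cv : (fun m => `|S m x - S n x|) @ \oo --> `|h_fun K mu f x - S n x|.
  by apply: cvg_norm; apply: cvgB; [exact: S_cvg|exact: cvg_cst].
rewrite -(cvg_lim _ cv)//; apply: limr_le; first by apply/cvg_ex; eexists; exact: cv.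
by exists n => // m /= nm; exact: S_tail.
Qed.

(** The remainder after n terms gains the factor r^n in its class constant; this quantitative form
    is what makes the exchange of [K] and the series possible. *)
Let h_tail_cls n : cls (G * r ^+ n) (fun x => h_fun K mu f x - S n x).
Proof.
apply: (V_classP Hs).
- by rewrite mulr_gt0// exprn_gt0.
- apply: measurable_funB; first exact: measurable_h_fun.
  by apply: measurable_sum => t; apply: measurable_funB => //; exact: measurable_Kt.
- move=> x Vx; have v1 := fine_V_ge1 Hs Vx; rewrite -[leLHS]real_normK ?num_real//.
  have := h_tail n Vx.
  rewrite -ler_sqr ?nnegrE//; last first.
    by rewrite !mulr_ge0 ?sqrtr_ge0 ?exprn_ge0 ?invr_ge0 ?subr_ge0// ltW.
  move=> /le_trans; apply.
  rewrite exprMn -[in leLHS]exprM mulnC exprM qq exprMn sqr_sqrtr; last first.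
    by rewrite !mulr_ge0// ?ltW// (lt_le_trans _ v1).
  by rewrite exprVn /G -/q le_eqVlt; apply/orP; left; apply/eqP; ring.
Qed.

Lemma V_class_h_fun : cls G (h_fun K mu f).
Proof.
have := h_tail_cls 0; rewrite expr0 mulr1.
by under eq_fun do rewrite /S big_geq// subr0.
Qed.

(** Applying K to a partial sum shifts it by one term and drops the initial one. The exchange with
    the limit rests on the tail classes: for each n the squared defect is at most a constant times
    r^n, hence zero. *)
Lemma poisson_eq x : (V x < +oo)%E ->
  Kt K 1 (h_fun K mu f) x = h_fun K mu f x - (f x - ex mu f).
Proof.
move=> Vx; have v1 := fine_V_ge1 Hs Vx; set h := h_fun K mu f.
have Lh : L2 (Kn K 1 x) h := V_class_L2K Hs 1 Vx V_class_h_fun.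
have LKt t : L2 (Kn K 1 x) (Kt K t f).
  by apply: (V_class_L2K Hs 1 Vx); exact: (V_class_Kt Hs t c0 cf).
have LS n : L2 (Kn K 1 x) (S n).
  rewrite /S; apply: L2_sum => t; apply: L2B => //; exact: L2_cst.
have exS n : ex (Kn K 1 x) (S n) = S n.+1 x - (f x - ex mu f).
  rewrite /S ex_sum; last by move=> t; apply: itgB; [exact: L2_itg|exact: itg_cst].
  rewrite big_nat_recl// Kt0 addrC addKr; apply: eq_bigr => t _.
  rewrite exB; [|exact: L2_itg|exact: itg_cst].
  rewrite ex_cst -(KtS Hs t c0 cf Vx) Kt_ex//; exact: L2_itg.
rewrite (Kt_exV Hs 1 Vx V_class_h_fun); apply/eqP; rewrite -subr_eq0 -sqrf_eq0.
rewrite eq_le sqr_ge0 andbT.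
apply: (@cvg_le_eps _ _ (2 * (G * CV * fine (V x) + G * fine (V x))) r).
- have v0 : 0 <= fine (V x) by apply: le_trans v1.
  apply: mulr_ge0 => //; apply: addr_ge0.
    exact: mulr_ge0 (mulr_ge0 (ltW G0) (ltW CV0)) v0.
  exact: mulr_ge0 (ltW G0) v0.
- by rewrite ltW.
move=> n.
have e1 : (ex (Kn K 1 x) h - ex (Kn K 1 x) (S n)) ^+ 2 <= G * r ^+ n * CV * fine (V x).
  rewrite -exB; [|exact: L2_itg|exact: L2_itg].
  apply: (le_trans (ex_sqr_ge (L2B Lh (LS n)))).
  apply: (ex_sqr_V Hs) => //; first by rewrite mulr_ge0 ?exprn_ge0// ltW.
have e2 : (h x - S n.+1 x) ^+ 2 <= G * r ^+ n.+1 * fine (V x).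
  exact: (V_class_le Hs (h_tail_cls n.+1) Vx).
have e3 : G * r ^+ n.+1 * fine (V x) <= G * r ^+ n * fine (V x).
  apply: ler_wpM2r; first by apply: le_trans v1.
  by apply: ler_wpM2l; [exact: ltW|rewrite exprS ler_piMl ?exprn_ge0// ltW].
rewrite exS in e1.
set a := ex _ h in e1 *; set b := h x in e2 *.
have := sqr_ge0 ((a - (S n.+1 x - (f x - ex mu f))) + (b - S n.+1 x)); nra.
Qed.

(** Jensen makes the radicand in [v_fun] nonnegative, so the square root loses nothing where [V] is
    finite. *)
Lemma v_fun_sqr x : (V x < +oo)%E ->
  v_fun K mu f x ^+ 2 = ex (Kn K 1 x) (fun y => h_fun K mu f y ^+ 2)
      - (Kt K 1 (h_fun K mu f) x) ^+ 2.
Proof.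
move=> Vx; have Lh : L2 (Kn K 1 x) (h_fun K mu f) := V_class_L2K Hs 1 Vx V_class_h_fun.
rewrite /v_fun Kt_ex; last exact: L2_sqr.
rewrite sqr_sqrtr// subr_ge0 (Kt_exV Hs 1 Vx V_class_h_fun); exact: ex_sqr_ge.
Qed.

Lemma v_fun_ge0 x : 0 <= v_fun K mu f x. Proof. exact: sqrtr_ge0. Qed.

Lemma V_class_v_fun : cls (G * CV) (v_fun K mu f).
Proof.
have mh := measurable_h_fun.
apply: (V_classP Hs); first by rewrite mulr_gt0.
- apply: (measurableT_comp (continuous_measurable_fun (@sqrt_continuous R))).
  apply: measurable_funB.
  + by apply: measurable_Kt; exact: measurable_funX.
  + by apply: measurable_funX; exact: measurable_Kt.
- move=> x Vx; rewrite v_fun_sqr//.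
  apply: (@le_trans _ _ (ex (Kn K 1 x) (fun y => h_fun K mu f y ^+ 2))).
    by rewrite gerBl sqr_ge0.
  by apply: (ex_sqr_V Hs) => //; [exact: ltW|exact: V_class_h_fun].
Qed.

End poisson_equation.

(** * Weighted particle systems *)

Section Gmeas_closure.
Context {d : measure_display} {Om : measurableType d} {R : realType}.
Variable G : set (set Om).
Hypothesis sG : sub_sigma G.
Implicit Types (X Y : Om -> R) (U Z : Om -> \bar R).

Lemma Gmeas_cst dT (T : measurableType dT) (y : T) : Gmeas G (fun=> y).
Proof. by apply/GmeasP => //; exact: measurable_cst. Qed.

Lemma GmeasD X Y : Gmeas G X -> Gmeas G Y -> Gmeas G (fun w => X w + Y w).
Proof. by do 2 move=> /GmeasP-/(_ sG) ?; apply/GmeasP => //; exact: measurable_funD. Qed.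

Lemma GmeasB X Y : Gmeas G X -> Gmeas G Y -> Gmeas G (fun w => X w - Y w).
Proof. by do 2 move=> /GmeasP-/(_ sG) ?; apply/GmeasP => //; exact: measurable_funB. Qed.

Lemma GmeasM X Y : Gmeas G X -> Gmeas G Y -> Gmeas G (fun w => X w * Y w).
Proof. by do 2 move=> /GmeasP-/(_ sG) ?; apply/GmeasP => //; exact: measurable_funM. Qed.

Lemma Gmeas_sum I (s : seq I) (X : I -> Om -> R) : (forall i, Gmeas G (X i)) ->
  Gmeas G (fun w => \sum_(i <- s) X i w).
Proof.
move=> mX; apply/GmeasP => //; apply: measurable_sum => i.
exact/GmeasP.
Qed.

Lemma Gmeas_max0 X : Gmeas G X -> Gmeas G (fun w => Num.max (X w) 0).
Proof.
move=> /GmeasP-/(_ sG) mX; apply/GmeasP => //.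
by apply: measurable_maxr.
Qed.

Lemma Gmeas_maxN0 X : Gmeas G X -> Gmeas G (fun w => Num.max (- X w) 0).
Proof.
move=> /GmeasP-/(_ sG) mX; apply/GmeasP => //.
by apply: measurable_maxr => //; exact: measurableT_comp.
Qed.

Lemma Gmeas_EFin X : Gmeas G X -> Gmeas G (fun w => (X w)%:E).
Proof. by move=> /GmeasP-/(_ sG) mX; apply/GmeasP => //; exact/measurable_EFinP. Qed.

Lemma GmeasMe U Z : Gmeas G U -> Gmeas G Z -> Gmeas G (fun w => U w * Z w)%E.
Proof. by do 2 move=> /GmeasP-/(_ sG) ?; apply/GmeasP => //; exact: emeasurable_funM. Qed.

Lemma Gmeas_indic A : G A -> Gmeas G (\1_A : Om -> R).
Proof.
move=> GA; apply/GmeasP => //.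
apply: (@measurable_indic _ (g_sigma_algebraType G) R).
by rewrite /measurable/= sub_sigmaE.
Qed.

End Gmeas_closure.

Section particle_system.
Context {R : realType} {d : measure_display} {X : measurableType d}.
Variables (K : R.-pker X ~> X) (V : X -> \bar R) (N : nat).
Context {d' : measure_display} {Om : measurableType d'}.
Variable P : probability Om R.
Variables (F Fh : nat -> set (set Om)) (xi xih : nat -> Om -> 'I_N -> X).
Variable (c : nat -> Om -> 'I_N -> R).

(** What the estimates need from a weighted ensemble. Conditional laws are tested against
    nonnegative functions; single particles and pairs suffice, because only second moments of sums
    are computed. The total weight is merely bounded by 1, which admits systems cut off outside an
    event. *)
Record particle_system : Prop := ParticleSystem {
  ps_F : forall t, sub_sigma (F t);
  ps_Fh : forall t, sub_sigma (Fh t);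
  ps_FFh : forall t, F t `<=` Fh t;
  ps_FhF : forall t, Fh t `<=` F t.+1;
  ps_xi : forall t i, Gmeas (F t) (fun w => xi t w i);
  ps_c : forall t i, Gmeas (F t) (fun w => c t w i);
  ps_xih : forall t j, Gmeas (Fh t) (fun w => xih t w j);
  ps_ch : forall t j, Gmeas (Fh t) (fun w => c t.+1 w j);
  ps_c0 : forall t w i, 0 <= c t w i;
  ps_c1 : forall t w i, c t w i <= 1;
  ps_sum : forall t, {ae P, forall w, \sum_i c t w i <= 1};
  ps_sel : forall t (H : Om -> \bar R) (g : X -> \bar R),
    Gmeas (F t) H -> (forall w, 0 <= H w)%E ->
    measurable_fun setT g -> (forall x, 0 <= g x)%E ->
    (\int[P]_w (H w * \sum_j (c t.+1 w j)%:E * g (xih t w j)) =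
     \int[P]_w (H w * \sum_i (c t w i)%:E * g (xi t w i)))%E;
  ps_mut1 : forall t j (H : Om -> \bar R) (g : X -> \bar R),
    Gmeas (Fh t) H -> (forall w, 0 <= H w)%E ->
    measurable_fun setT g -> (forall x, 0 <= g x)%E ->
    (\int[P]_w (H w * g (xi t.+1 w j)) =
     \int[P]_w (H w * Kpos K 1 g (xih t w j)))%E;
  ps_mut2 : forall t i j (H : Om -> \bar R) (g g' : X -> \bar R), i != j ->
    Gmeas (Fh t) H -> (forall w, 0 <= H w)%E ->
    measurable_fun setT g -> (forall x, 0 <= g x)%E ->
    measurable_fun setT g' -> (forall x, 0 <= g' x)%E ->
    (\int[P]_w (H w * (g (xi t.+1 w i) * g' (xi t.+1 w j))) =
     \int[P]_w (H w * (Kpos K 1 g (xih t w i) * Kpos K 1 g' (xih t w j))))%E;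
  ps_V : (\int[P]_w (\sum_i (c 0 w i)%:E * V (xi 0 w i)) < +oo)%E }.

Hypothesis PS : particle_system.
Variables (mu : probability X R) (CV D r : R).
Hypothesis Hs : sqrtV_ergodic K mu V CV D r.
Local Notation cls := (V_class V).
Implicit Types (phi psi : X -> R) (g : X -> \bar R) (a b : R).

Let mV : measurable_fun setT V. Proof. exact: sv_meas Hs. Qed.
Let V1 x : (1 <= V x)%E. Proof. exact: sv_ge1 Hs x. Qed.
Let V0 x : (0 <= V x)%E. Proof. by apply: le_trans (V1 x). Qed.
Let CV1 := sv_C Hs.
Let CV0 : 0 <= CV. Proof. by apply: le_trans CV1. Qed.

Let mxi t i : measurable_fun setT (fun w => xi t w i).
Proof. exact: Gmeas_measurable (ps_F PS t) (ps_xi PS t i). Qed.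
Let mxih t i : measurable_fun setT (fun w => xih t w i).
Proof. exact: Gmeas_measurable (ps_Fh PS t) (ps_xih PS t i). Qed.
Let mc t i : measurable_fun setT (fun w => c t w i).
Proof. exact: Gmeas_measurable (ps_F PS t) (ps_c PS t i). Qed.

(** The averages exist in two versions: [We] and [Weh] are for extended nonnegative functions and
    need no integrability, [wsum] and [wsumh] are real and used on V-classes. The suffix h refers to
    the children before they move. *)
Definition We t g w : \bar R := (\sum_i (c t w i)%:E * g (xi t w i))%E.
Definition Weh t g w : \bar R := (\sum_i (c t.+1 w i)%:E * g (xih t w i))%E.
Definition wsum t phi w : R := \sum_i c t w i * phi (xi t w i).
Definition wsumh t phi w : R := \sum_i c t.+1 w i * phi (xih t w i).

Let term_ge0 t w i g x : (forall x, 0 <= g x)%E -> (0 <= (c t w i)%:E * g x)%E.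
Proof. by move=> g0; rewrite mule_ge0// lee_fin ps_c0. Qed.

Lemma measurable_term t i g : measurable_fun setT g ->
  measurable_fun setT (fun w => (c t w i)%:E * g (xi t w i))%E.
Proof.
move=> mg; apply: emeasurable_funM; first exact/measurable_EFinP.
exact: measurableT_comp.
Qed.

Lemma measurable_termh t i g : measurable_fun setT g ->
  measurable_fun setT (fun w => (c t.+1 w i)%:E * g (xih t w i))%E.
Proof.
move=> mg; apply: emeasurable_funM; first exact/measurable_EFinP.
exact: measurableT_comp.
Qed.

Lemma measurable_We t g : measurable_fun setT g -> measurable_fun setT (We t g).
Proof. by move=> mg; apply: emeasurable_sum => i; exact: measurable_term. Qed.

Lemma We_ge0 t g w : (forall x, 0 <= g x)%E -> (0 <= We t g w)%E.
Proof. by move=> g0; apply: sume_ge0 => i _; exact: term_ge0. Qed.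

Let Kpos1 g : measurable_fun setT g -> (forall x, 0 <= g x)%E ->
  measurable_fun setT (Kpos K 1 g) /\ (forall x, 0 <= Kpos K 1 g x)%E.
Proof. by move=> mg g0; apply: Kpos_nice. Qed.

Lemma We_step_hat t (H : Om -> \bar R) g : Gmeas (Fh t) H -> (forall w, 0 <= H w)%E ->
  measurable_fun setT g -> (forall x, 0 <= g x)%E ->
  (\int[P]_w (H w * We t.+1 g w) = \int[P]_w (H w * Weh t (Kpos K 1 g) w))%E.
Proof.
move=> mH H0 mg g0; have mHT := Gmeas_measurable (ps_Fh PS t) mH.
have [mK K0] := Kpos1 mg g0.
rewrite (eq_integral (fun w => \sum_i (H w * ((c t.+1 w i)%:E * g (xi t.+1 w i))))%E);
  last by move=> w _; rewrite ge0_sume_distrr// => i _; exact: term_ge0.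
rewrite [RHS](eq_integral (fun w =>
    \sum_i (H w * ((c t.+1 w i)%:E * Kpos K 1 g (xih t w i))))%E);
  last by move=> w _; rewrite ge0_sume_distrr// => i _; exact: term_ge0.
rewrite ge0_integral_sum//; last 2 first.
- by move=> j; apply: emeasurable_funM => //; exact: measurable_term.
- by move=> j w _; rewrite mule_ge0// term_ge0.
rewrite ge0_integral_sum//; last 2 first.
- by move=> j; apply: emeasurable_funM => //; exact: measurable_termh.
- by move=> j w _; rewrite mule_ge0// term_ge0.
apply: eq_bigr => j _.
under eq_integral do rewrite muleA.
under [in RHS]eq_integral do rewrite muleA.
apply: (ps_mut1 PS) => //.
- apply: GmeasMe => //; [exact: ps_Fh|apply: Gmeas_EFin; [exact: ps_Fh|exact: ps_ch]].
- by move=> w; rewrite mule_ge0// lee_fin ps_c0.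
Qed.

Lemma We_step t (H : Om -> \bar R) g : Gmeas (F t) H -> (forall w, 0 <= H w)%E ->
  measurable_fun setT g -> (forall x, 0 <= g x)%E ->
  (\int[P]_w (H w * We t.+1 g w) = \int[P]_w (H w * We t (Kpos K 1 g) w))%E.
Proof.
move=> mH H0 mg g0; have [mK K0] := Kpos1 mg g0.
rewrite (We_step_hat (Gmeas_sub (ps_FFh PS (t := t)) mH) H0 mg g0).
exact: (ps_sel PS mH H0 mK K0).
Qed.

Lemma F_mono s t : (s <= t)%N -> F s `<=` F t.
Proof.
elim: t => [|t ih]; first by rewrite leqn0 => /eqP ->.
rewrite leq_eqVlt => /predU1P[->//|]; rewrite ltnS => /ih st A /st.
by move=> /(ps_FFh PS)/(ps_FhF PS).
Qed.

Lemma We_0 t (H : Om -> \bar R) g : Gmeas (F 0) H -> (forall w, 0 <= H w)%E ->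
  measurable_fun setT g -> (forall x, 0 <= g x)%E ->
  (\int[P]_w (H w * We t g w) = \int[P]_w (H w * We 0 (Kpos K t g) w))%E.
Proof.
move=> mH H0; elim: t g => [//|t ih] g mg g0.
have [mK K0] := Kpos1 mg g0.
rewrite (We_step (Gmeas_sub (F_mono (leq0n t)) mH) H0 mg g0).
by rewrite (ih _ mK K0) -KposD addn1.
Qed.

Lemma int_We_0 t g : measurable_fun setT g -> (forall x, 0 <= g x)%E ->
  (\int[P]_w We t g w = \int[P]_w We 0 (Kpos K t g) w)%E.
Proof.
move=> mg g0; transitivity (\int[P]_w (cst 1%E w * We t g w))%E.
  by apply: eq_integral => w _; rewrite mul1e.
rewrite We_0//; last by apply: Gmeas_cst; exact: ps_F.
by apply: eq_integral => w _; rewrite mul1e.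
Qed.

Lemma int_Weh t g : measurable_fun setT g -> (forall x, 0 <= g x)%E ->
  (\int[P]_w Weh t g w = \int[P]_w We t g w)%E.
Proof.
move=> mg g0; transitivity (\int[P]_w (cst 1%E w * Weh t g w))%E.
  by apply: eq_integral => w _; rewrite mul1e.
rewrite (ps_sel PS)//; last by apply: Gmeas_cst; exact: ps_F.
by apply: eq_integral => w _; rewrite mul1e.
Qed.

(** Since K^t V <= CV V, the product [CV * MV] bounds the expectation of W_t(V) for every t, and
    thereby all second moments uniformly in time. *)
Definition MV : R := fine (\int[P]_w We 0 V w).

Lemma MVE : MV%:E = (\int[P]_w We 0 V w)%E.
Proof.
rewrite /MV fineK// ge0_fin_numE; first exact: ps_V.
by apply: integral_ge0 => w _; exact: We_ge0.
Qed.

Lemma MV_ge0 : 0 <= MV.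
Proof. by rewrite fine_ge0// integral_ge0// => w _; exact: We_ge0. Qed.

Lemma int_We_V t : (\int[P]_w We t V w <= (CV * MV)%:E)%E.
Proof.
rewrite int_We_0// EFinM MVE -ge0_integralZl_EFin//; last 2 first.
- by move=> w _; exact: We_ge0.
- exact: measurable_We.
apply: ge0_le_integral => //.
- by move=> w _; apply: We_ge0 => x; exact: Kpos_ge0.
- by apply: measurable_We; exact: measurable_Kpos.
- by apply: measurable_funeM; exact: measurable_We.
- move=> w _; rewrite /We ge0_sume_distrr; last by move=> i _; exact: term_ge0.
  apply: lee_sum => i _; rewrite muleCA.
  by apply: lee_wpmul2l; [rewrite lee_fin ps_c0|exact: (sv_K Hs)].
Qed.

Lemma int_Weh_V t : (\int[P]_w Weh t V w <= (CV * MV)%:E)%E.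
Proof. by rewrite int_Weh//; exact: int_We_V. Qed.


(** Class bounds and the Poisson equation are available only where [V] is finite. A term of nonzero
    weight at a point with infinite [V] would make the sum infinite, so such terms occur with
    probability zero; particles of weight zero escape this control. *)
Let ae_term_fin (T : Om -> 'I_N -> X) t : 
  (forall i, measurable_fun setT (fun w => T w i)) ->
  (\int[P]_w (\sum_i (c t w i)%:E * V (T w i)) < +oo)%E ->
  {ae P, forall w, forall i, c t w i != 0 -> (V (T w i) < +oo)%E}.
Proof.
move=> mT fin.
have t0 w i : (0 <= (c t w i)%:E * V (T w i))%E by rewrite mule_ge0// lee_fin ps_c0.
have : P.-integrable setT (fun w => \sum_i (c t w i)%:E * V (T w i))%E.
  apply/integrableP; split.
    apply: emeasurable_sum => i; apply: emeasurable_funM; first exact/measurable_EFinP.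
    exact: measurableT_comp.
  rewrite (eq_integral (fun w => \sum_i (c t w i)%:E * V (T w i))%E)//.
  by move=> w _; rewrite gee0_abs// sume_ge0.
move=> /(integrable_ae measurableT); apply: filterS => w /(_ I) fw i ci.
rewrite ltNge; apply/negP => /=; rewrite leye_eq => /eqP Vy.
move: fw; rewrite (bigD1 i)//= Vy gt0_muley ?lte_fin ?lt_def ?ci ?ps_c0//.
by rewrite addye// gt_eqF// (lt_le_trans (ltNyr 0))// sume_ge0.
Qed.

Lemma ae_V t : {ae P, forall w, forall i, c t w i != 0 -> (V (xi t w i) < +oo)%E}.
Proof. by apply: ae_term_fin => //; apply: le_lt_trans (int_We_V t) (ltry _). Qed.

Lemma ae_Vh t : {ae P, forall w, forall i, c t.+1 w i != 0 -> (V (xih t w i) < +oo)%E}.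
Proof. by apply: ae_term_fin => //; apply: le_lt_trans (int_Weh_V t) (ltry _). Qed.

Let csq_bound (T : Om -> 'I_N -> X) t a phi :
  (forall i, measurable_fun setT (fun w => T w i)) ->
  (\int[P]_w (\sum_i (c t w i)%:E * V (T w i)) <= (CV * MV)%:E)%E ->
  0 <= a -> cls a phi ->
  (forall i, itg P (fun w => c t w i * phi (T w i) ^+ 2)) /\
  ex P (fun w => \sum_i c t w i * phi (T w i) ^+ 2) <= a * (CV * MV).
Proof.
move=> mT bd a0 [mphi cphi].
have ct0 t' w i : 0 <= c t' w i := ps_c0 PS t' w i.
have t0 w i : (0 <= (c t w i)%:E * V (T w i))%E by rewrite mule_ge0// lee_fin.
pose S w := (\sum_i (c t w i)%:E * V (T w i))%E.
have S0 w : (0 <= S w)%E by exact: sume_ge0.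
have mt i : measurable_fun setT (fun w => (c t w i)%:E * V (T w i))%E.
  apply: emeasurable_funM; first exact/measurable_EFinP; exact: measurableT_comp.
have mS : measurable_fun setT S by exact: emeasurable_sum.
have ms i : measurable_fun setT (fun w => c t w i * phi (T w i) ^+ 2).
  apply: measurable_funM => //; apply: measurable_funX; exact: measurableT_comp.
have le1 w i : ((c t w i * phi (T w i) ^+ 2)%:E <= a%:E * ((c t w i)%:E * V (T w i)))%E.
  by rewrite muleCA EFinM lee_wpmul2l// lee_fin.
have i0 i : itg P (fun w => c t w i * phi (T w i) ^+ 2).
  apply/integrableP; split; first exact/measurable_EFinP.
  apply: (@le_lt_trans _ _ (\int[P]_w (a%:E * S w))%E).
    apply: ge0_le_integral => //.
    - apply: measurableT_comp => //; exact/measurable_EFinP.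
    - exact: measurable_funeM.
    - move=> w _; rewrite /= ger0_norm; last by apply: mulr_ge0; rewrite ?sqr_ge0.
      apply: (le_trans (le1 w i)); apply: lee_wpmul2l; first by rewrite lee_fin.
      by rewrite /S (bigD1 i)//= leeDl// sume_ge0.
  rewrite ge0_integralZl_EFin//.
  rewrite lte_mul_pinfty// ?lee_fin//; exact: le_lt_trans bd (ltry _).
split => //; rewrite -lee_fin exE; last exact: itg_sum.
apply: (@le_trans _ _ (\int[P]_w (a%:E * S w))%E).
  apply: ge0_le_integral => //.
  - by move=> w _; rewrite lee_fin sumr_ge0// => i _; rewrite mulr_ge0 ?sqr_ge0.
  - by apply/measurable_EFinP; exact: measurable_sum.
  - exact: measurable_funeM.
  - move=> w _; rewrite -sumEFin ge0_sume_distrr//; apply: lee_sum => i _; exact: le1.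
rewrite ge0_integralZl_EFin//.
by rewrite [leRHS]EFinM; apply: lee_wpmul2l; rewrite ?lee_fin.
Qed.

Lemma itg_csq t i a phi : 0 <= a -> cls a phi ->
  itg P (fun w => c t w i * phi (xi t w i) ^+ 2).
Proof. by move=> a0 cphi; have [] := csq_bound (mxi t) (int_We_V t) a0 cphi. Qed.

Lemma itg_csqh t i a phi : 0 <= a -> cls a phi ->
  itg P (fun w => c t.+1 w i * phi (xih t w i) ^+ 2).
Proof. by move=> a0 cphi; have [] := csq_bound (mxih t) (int_Weh_V t) a0 cphi. Qed.

Lemma ex_csq t a phi : 0 <= a -> cls a phi ->
  ex P (fun w => \sum_i c t w i * phi (xi t w i) ^+ 2) <= a * (CV * MV).
Proof. by move=> a0 cphi; have [] := csq_bound (mxi t) (int_We_V t) a0 cphi. Qed.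

(** As 0 <= c <= 1, the square of c phi is at most c phi^2. *)
Lemma L2_term t i a phi : 0 <= a -> cls a phi ->
  L2 P (fun w => c t w i * phi (xi t w i)).
Proof.
move=> a0 cphi; have [mphi _] := cphi.
have m1 : measurable_fun setT (fun w => c t w i * phi (xi t w i)).
  by apply: measurable_funM => //; exact: measurableT_comp.
split => //; apply: (le_itg _ _ (itg_csq t i a0 cphi)).
- exact: measurable_funX.
- move=> w; rewrite ger0_norm ?sqr_ge0// exprMn expr2 -mulrA ler_wpM2l ?ps_c0//.
  by rewrite ler_piMl ?sqr_ge0 ?ps_c1.
Qed.

Lemma L2_termh t i a phi : 0 <= a -> cls a phi ->
  L2 P (fun w => c t.+1 w i * phi (xih t w i)).
Proof.
move=> a0 cphi; have [mphi _] := cphi.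
have m1 : measurable_fun setT (fun w => c t.+1 w i * phi (xih t w i)).
  by apply: measurable_funM => //; exact: measurableT_comp.
split => //; apply: (le_itg _ _ (itg_csqh t i a0 cphi)).
- exact: measurable_funX.
- move=> w; rewrite ger0_norm ?sqr_ge0// exprMn expr2 -mulrA ler_wpM2l ?ps_c0//.
  by rewrite ler_piMl ?sqr_ge0 ?ps_c1.
Qed.

Lemma L2_W t a phi : 0 <= a -> cls a phi -> L2 P (wsum t phi).
Proof. by move=> a0 cphi; apply: L2_sum => i; exact: L2_term a0 cphi. Qed.

Lemma L2_Wh t a phi : 0 <= a -> cls a phi -> L2 P (wsumh t phi).
Proof. by move=> a0 cphi; apply: L2_sum => i; exact: L2_termh a0 cphi. Qed.

Lemma Gmeas_W t phi : measurable_fun setT phi -> Gmeas (F t) (wsum t phi).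
Proof.
move=> mphi; apply: Gmeas_sum => [|i]; first exact: ps_F.
apply: GmeasM; [exact: ps_F|exact: ps_c|].
exact: (Gmeas_comp mphi (ps_xi PS t i)).
Qed.

Lemma Gmeas_Wh t phi : measurable_fun setT phi -> Gmeas (Fh t) (wsumh t phi).
Proof.
move=> mphi; apply: Gmeas_sum => [|i]; first exact: ps_Fh.
apply: GmeasM; [exact: ps_Fh|exact: ps_ch|].
exact: (Gmeas_comp mphi (ps_xih PS t i)).
Qed.

(** Cauchy-Schwarz for weights of total mass at most 1, read off from the nonnegative weighted sum
    of the squared deviations of phi from [wsum]. *)
Lemma sqr_W_le t phi : {ae P, forall w,
  wsum t phi w ^+ 2 <= \sum_i c t w i * phi (xi t w i) ^+ 2}.
Proof.
apply: filterS (ps_sum PS t) => w s1.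
have : 0 <= \sum_i c t w i * (phi (xi t w i) - wsum t phi w) ^+ 2.
  by apply: sumr_ge0 => i _; rewrite mulr_ge0 ?sqr_ge0 ?ps_c0.
rewrite (eq_bigr (fun i => c t w i * phi (xi t w i) ^+ 2
   - 2 * wsum t phi w * (c t w i * phi (xi t w i)) + wsum t phi w ^+ 2 * c t w i)); last first.
  by move=> i _; ring.
rewrite !big_split/= sumrN -!mulr_sumr -/(wsum t phi w).
set Q := \sum_i c t w i * phi _ ^+ 2; set S := \sum_i c t w i in s1 *.
have := sqr_ge0 (wsum t phi w); nra.
Qed.

Lemma ex_W_sqr t a phi : 0 <= a -> cls a phi ->
  ex P (fun w => wsum t phi w ^+ 2) <= a * (CV * MV).
Proof.
move=> a0 cphi; apply: le_trans (ex_csq t a0 cphi).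
apply: le_ex_ae; last exact: sqr_W_le.
- exact/L2_sqr/(L2_W t a0 cphi).
- by apply: itg_sum => i; exact: itg_csq a0 cphi.
Qed.

Lemma W_congr t phi psi : (forall x, (V x < +oo)%E -> phi x = psi x) ->
  {ae P, forall w, wsum t phi w = wsum t psi w}.
Proof.
move=> h; apply: filterS (ae_V t) => w Vw; apply: eq_bigr => i _.
have [->|ci] := eqVneq (c t w i) 0; first by rewrite !mul0r.
by rewrite h//; exact: Vw.
Qed.

End particle_system.

Lemma ex_sqr_sum_orth d (Om : measurableType d) (R : realType) (P : probability Om R)
    (N : nat) (Y : 'I_N -> Om -> R) : (forall i, L2 P (Y i)) ->
  (forall i j, i != j -> ex P (fun w => Y i w * Y j w) = 0) ->
  ex P (fun w => (\sum_i Y i w) ^+ 2) = \sum_i ex P (fun w => Y i w ^+ 2).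
Proof.
move=> LY oY.
under [in LHS]eq_ex do rewrite expr2 big_distrlr/=.
rewrite ex_sum; last by move=> i; apply: itg_sum => j; exact: L2_itgM.
apply: eq_bigr => i _; rewrite ex_sum; last by move=> j; exact: L2_itgM.
rewrite (bigD1 i)//= big1 ?addr0//.
by move=> j ji; apply: oY; rewrite eq_sym.
Qed.

Lemma posnegB (R : realType) (x : R) : x = Num.max x 0 - Num.max (- x) 0.
Proof.
by rewrite /Num.max oppr_lt0; case: ltgtP => [| |->]; rewrite ?subr0 ?sub0r ?opprK.
Qed.

(** * Orthogonality of the mutation and selection terms *)

Section orthogonality.
Context {R : realType} {d : measure_display} {X : measurableType d}.
Variables (K : R.-pker X ~> X) (V : X -> \bar R) (N : nat).
Context {d' : measure_display} {Om : measurableType d'}.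
Variable P : probability Om R.
Variables (F Fh : nat -> set (set Om)) (xi xih : nat -> Om -> 'I_N -> X).
Variable (c : nat -> Om -> 'I_N -> R).
Hypothesis PS : particle_system K V P F Fh xi xih c.
Variables (mu : probability X R) (CV D r : R).
Hypothesis Hs : sqrtV_ergodic K mu V CV D r.
Local Notation cls := (V_class V).
Local Notation W := (wsum xi c).
Local Notation Wh := (wsumh xih c).
Implicit Types (phi psi p : X -> R) (g : X -> \bar R) (a b : R) (H : Om -> R) (t : nat)
  (i j : 'I_N) (w : Om).

Let mV : measurable_fun setT V. Proof. exact: sv_meas Hs. Qed.
Let mxi t i : measurable_fun setT (fun w => xi t w i).
Proof. exact: Gmeas_measurable (ps_F PS t) (ps_xi PS t i). Qed.
Let mxih t i : measurable_fun setT (fun w => xih t w i).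
Proof. exact: Gmeas_measurable (ps_Fh PS t) (ps_xih PS t i). Qed.
Let mc t i : measurable_fun setT (fun w => c t w i).
Proof. exact: Gmeas_measurable (ps_F PS t) (ps_c PS t i). Qed.
Let c0 t w i : 0 <= c t w i. Proof. exact: ps_c0 PS t w i. Qed.

Lemma V_class_max0 a phi : cls a phi -> cls a (fun x => Num.max (phi x) 0).
Proof.
move=> [mphi h]; split; first exact: measurable_maxr.
move=> x; apply: le_trans (h x); rewrite lee_fin /Num.max; case: ifP => //.
by rewrite expr0n/= sqr_ge0.
Qed.

Lemma V_class_maxN0 a phi : cls a phi -> cls a (fun x => Num.max (- phi x) 0).
Proof.
move=> [mphi h]; split.
  by apply: measurable_maxr => //; exact: measurableT_comp.
move=> x; apply: le_trans (h x); rewrite lee_fin /Num.max; case: ifP => //.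
  by rewrite expr0n/= sqr_ge0.
by rewrite sqrrN.
Qed.

Lemma Kpos1_Kt p x : measurable_fun setT p -> (forall y, 0 <= p y) ->
  itg (Kn K 1 x) p -> Kpos K 1 (fun y => (p y)%:E) x = (Kt K 1 p x)%:E.
Proof.
move=> mp p0 ip; rewrite Kt_ex// exE// KnE//; exact/measurable_EFinP.
Qed.

Lemma Kt1_posneg a phi x : (V x < +oo)%E -> cls a phi -> Kt K 1 phi x =
  Kt K 1 (fun y => Num.max (phi y) 0) x - Kt K 1 (fun y => Num.max (- phi y) 0) x.
Proof.
move=> Vx cphi.
rewrite (Kt_exV Hs 1 Vx cphi) (Kt_exV Hs 1 Vx (V_class_max0 cphi)).
rewrite (Kt_exV Hs 1 Vx (V_class_maxN0 cphi)) -exB.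
- by apply: eq_ex => y; exact: posnegB.
- exact/L2_itg/(V_class_L2K Hs 1 Vx (V_class_max0 cphi)).
- exact/L2_itg/(V_class_L2K Hs 1 Vx (V_class_maxN0 cphi)).
Qed.

(** One mutation, tested against a weight [H] that need not be [Fh t]-measurable: it may involve the
    new position of another particle, as required for pairs. *)
Definition mut_test t j H := forall g, measurable_fun setT g ->
  (forall x, 0 <= g x)%E ->
  (\int[P]_w ((H w)%:E * g (xi t.+1 w j)) =
   \int[P]_w ((H w)%:E * Kpos K 1 g (xih t w j)))%E.

(** Integrability on the right comes from the equality of the extended integrals. The passage from
    [Kpos] to [Kt] uses finiteness of [V], which is asked for only where the weight is nonzero. *)
Lemma mut_nonneg t j H p : measurable_fun setT H -> (forall w, 0 <= H w) ->
  measurable_fun setT p -> (forall x, 0 <= p x) ->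
  (forall x, (V x < +oo)%E -> itg (Kn K 1 x) p) ->
  mut_test t j H -> {ae P, forall w, H w != 0 -> (V (xih t w j) < +oo)%E} ->
  itg P (fun w => H w * p (xi t.+1 w j)) ->
  itg P (fun w => H w * Kt K 1 p (xih t w j)) /\
  ex P (fun w => H w * p (xi t.+1 w j)) = ex P (fun w => H w * Kt K 1 p (xih t w j)).
Proof.
move=> mH H0 mp p0 ip good Vae iHp.
have mpe : measurable_fun setT (fun y => (p y)%:E) by exact/measurable_EFinP.
have pe0 y : (0 <= (p y)%:E)%E by rewrite lee_fin.
pose u w := ((H w)%:E * Kpos K 1 (fun y => (p y)%:E) (xih t w j))%E.
have E : (\int[P]_w u w = (ex P (fun w => H w * p (xi t.+1 w j)))%:E)%E.
  rewrite exE//; rewrite -good//.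
have mu0 : measurable_fun setT u.
  apply: emeasurable_funM; first exact/measurable_EFinP.
  apply: measurableT_comp => //; exact: (measurable_Kpos K 1 mpe pe0).
have u0 w : (0 <= u w)%E by rewrite mule_ge0 ?lee_fin// Kpos_ge0.
have [i1 e1] := ex_fine (P := P) mu0 u0 ltac:(by rewrite E ltry).
have ae : {ae P, forall w, (fine \o u) w = H w * Kt K 1 p (xih t w j)}.
  apply: filterS Vae => w Vw; change (fine (u w) = H w * Kt K 1 p (xih t w j)).
  rewrite /u.
  have [->|Hw] := eqVneq (H w) 0; first by rewrite mul0e mul0r.
  by rewrite Kpos1_Kt//; apply: ip; exact: Vw.
have mK : measurable_fun setT (fun w => H w * Kt K 1 p (xih t w j)).
  apply: measurable_funM => //; apply: measurableT_comp => //; exact: measurable_Kt.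
split; first exact: itg_ae mK ae i1.
rewrite -(ex_ae (itg_meas i1) mK ae).
by rewrite e1 E.
Qed.

Lemma mut_test_Fh t j H : Gmeas (Fh t) H -> (forall w, 0 <= H w) -> mut_test t j H.
Proof.
move=> mH H0 g mg g0; apply: (ps_mut1 PS j (Gmeas_EFin (ps_Fh PS t) mH) _ mg g0).
by move=> w; rewrite lee_fin.
Qed.

Lemma cls_Kt1 a phi : 0 < a -> cls a phi -> cls (a * CV) (Kt K 1 phi).
Proof. exact: (V_class_Kt Hs). Qed.

Let aCV a : 0 < a -> 0 <= a * CV.
Proof. by move=> a0; apply: ltW; rewrite mulr_gt0// (lt_le_trans _ (sv_C Hs)). Qed.

(** Both factors are split into nonnegative parts, the weight as H1 - H2 and phi as its positive
    minus its negative part; the four tested identities are recombined by [orthogonality]. *)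
Lemma mut_orth t j H1 H2 a phi : 0 < a -> cls a phi -> L2 P H1 -> L2 P H2 ->
  (forall w, 0 <= H1 w) -> (forall w, 0 <= H2 w) ->
  mut_test t j (fun w => H1 w * c t.+1 w j) -> mut_test t j (fun w => H2 w * c t.+1 w j) ->
  ex P (fun w => (H1 w - H2 w) * (c t.+1 w j * phi (xi t.+1 w j)
                                 - c t.+1 w j * Kt K 1 phi (xih t w j))) = 0.
Proof.
move=> a0 cphi L1 L2' H10 H20 g1 g2.
pose pp x := Num.max (phi x) 0; pose pn x := Num.max (- phi x) 0.
have cp : cls a pp := V_class_max0 cphi.
have cn : cls a pn := V_class_maxN0 cphi.
have key H p : L2 P H -> (forall w, 0 <= H w) -> cls a p -> (forall x, 0 <= p x) ->
    mut_test t j (fun w => H w * c t.+1 w j) ->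
    ex P (fun w => H w * (c t.+1 w j * p (xi t.+1 w j))) =
    ex P (fun w => H w * (c t.+1 w j * Kt K 1 p (xih t w j))).
  move=> LH H0 ca p0 good; have [mp _] := ca.
  have [||||||||_ e] := @mut_nonneg t j (fun w => H w * c t.+1 w j) p => //.
  - by apply: measurable_funM => //; exact: (L2_meas LH).
  - by move=> w; apply: mulr_ge0.
  - by move=> x Vx; exact/L2_itg/(V_class_L2K Hs 1 Vx ca).
  - apply: filterS (ae_Vh PS Hs t) => w Vw; rewrite mulf_eq0 negb_or => /andP[_].
    exact: Vw.
  - under eq_fun do rewrite -mulrA.
    by apply: L2_itgM => //; exact: (L2_term PS Hs t.+1 j (ltW a0) ca).
  under eq_ex do rewrite mulrA.
  by under [in RHS]eq_ex do rewrite mulrA.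
have ppos x : 0 <= pp x by rewrite le_max lexx orbT.
have pnos x : 0 <= pn x by rewrite le_max lexx orbT.
have L_ p : cls a p -> L2 P (fun w => c t.+1 w j * p (xi t.+1 w j)).
  by move=> ca; exact: (L2_term PS Hs t.+1 j (ltW a0) ca).
have LK p : cls a p -> L2 P (fun w => c t.+1 w j * Kt K 1 p (xih t w j)).
  move=> ca; exact: (L2_termh PS Hs t j (aCV a0) (cls_Kt1 a0 ca)).
rewrite -(orthogonality L1 L2' (L_ _ cp) (L_ _ cn) (LK _ cp) (LK _ cn)
  (key _ _ L1 H10 cp ppos g1) (key _ _ L1 H10 cn pnos g1)
  (key _ _ L2' H20 cp ppos g2) (key _ _ L2' H20 cn pnos g2)).
have mH : measurable_fun setT (fun w => H1 w - H2 w).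
  by apply: measurable_funB; [exact: L2_meas L1|exact: L2_meas L2'].
apply: ex_ae.
- apply: measurable_funM => //; apply: measurable_funB; apply: L2_meas; [exact: L_|exact: LK].
- apply: measurable_funM => //; apply: measurable_funB; apply: measurable_funB;
    apply: L2_meas; [exact: L_|exact: L_|exact: LK|exact: LK].
- apply: filterS (ae_Vh PS Hs t) => w Vw.
  congr (_ * (_ - _)); first by rewrite -mulrBr -posnegB.
  have [->|cj] := eqVneq (c t.+1 w j) 0; first by rewrite !mul0r subr0.
  by rewrite (Kt1_posneg (Vw _ cj) cphi) mulrBr.
Qed.

Lemma orth_mut_Fh t j H a phi : 0 < a -> cls a phi -> L2 P H -> Gmeas (Fh t) H ->
  ex P (fun w => H w * (c t.+1 w j * phi (xi t.+1 w j)
                       - c t.+1 w j * Kt K 1 phi (xih t w j))) = 0.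
Proof.
move=> a0 cphi LH mH.
have mH' := L2_meas LH.
have good H' : Gmeas (Fh t) H' -> (forall w, 0 <= H' w) ->
    mut_test t j (fun w => H' w * c t.+1 w j).
  move=> mG G0; apply: mut_test_Fh; last by move=> w; apply: mulr_ge0.
  exact: (GmeasM (ps_Fh PS t) mG (ps_ch PS t j)).
have Lp : L2 P (fun w => Num.max (H w) 0).
  apply: le_L2 LH; first exact: measurable_maxr.
  move=> w; rewrite ger0_norm ?le_max ?lexx ?orbT// ge_max normr_ge0 andbT.
  exact: ler_norm.
have Ln : L2 P (fun w => Num.max (- H w) 0).
  apply: le_L2 LH; first by apply: measurable_maxr => //; exact: measurableT_comp.
  move=> w; rewrite ger0_norm ?le_max ?lexx ?orbT// ge_max normr_ge0 andbT.
  by rewrite -normrN; exact: ler_norm.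
have p0 w : 0 <= Num.max (H w) 0 by rewrite le_max lexx orbT.
have n0 w : 0 <= Num.max (- H w) 0 by rewrite le_max lexx orbT.
have sFh := ps_Fh PS t.
have := mut_orth a0 cphi Lp Ln p0 n0 (good _ (Gmeas_max0 sFh mH) p0) (good _ (Gmeas_maxN0 sFh mH) n0).
by under eq_ex => w do rewrite -posnegB.
Qed.

Let sFh t := ps_Fh PS t.
Let sF t := ps_F PS t.

(** The joint identity for [i] and [j] averages both new positions at once; the identity for [i]
    alone, read backwards, restores that of [i]. The shape of the weight is that of the two
    nonnegative halves into which c phi(xi) - c K phi(xih) is split in [orth_mut_pair]. *)
Lemma mut_test_pair t i j p (q : X -> R) : i != j ->
  measurable_fun setT p -> (forall x, 0 <= p x) ->
  measurable_fun setT q -> (forall x, 0 <= q x) ->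
  mut_test t j (fun w => (c t.+1 w i * p (xi t.+1 w i) + c t.+1 w i * q (xih t w i))
                          * c t.+1 w j).
Proof.
move=> ij mp p0 mq q0 g mg g0.
have mKg : measurable_fun setT (Kpos K 1 g) := measurable_Kpos K 1 mg g0.
have Kg0 x : (0 <= Kpos K 1 g x)%E by exact: Kpos_ge0.
have mpe : measurable_fun setT (fun y => (p y)%:E) by exact/measurable_EFinP.
have pe0 y : (0 <= (p y)%:E)%E by rewrite lee_fin.
have Gcc : Gmeas (Fh t) (fun w => (c t.+1 w i * c t.+1 w j)%:E).
  exact: (Gmeas_EFin (sFh t) (GmeasM (sFh t) (ps_ch PS t i) (ps_ch PS t j))).
have cc0 w : (0 <= (c t.+1 w i * c t.+1 w j)%:E)%E by rewrite lee_fin mulr_ge0.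
have Gccq : Gmeas (Fh t) (fun w => (c t.+1 w i * c t.+1 w j * q (xih t w i))%:E).
  apply: (Gmeas_EFin (sFh t)).
  apply: (GmeasM (sFh t) (GmeasM (sFh t) (ps_ch PS t i) (ps_ch PS t j))).
  exact: (Gmeas_comp mq (ps_xih PS t i)).
have ccq0 w : (0 <= (c t.+1 w i * c t.+1 w j * q (xih t w i))%:E)%E.
  by rewrite lee_fin !mulr_ge0.
have Kgh : Gmeas (Fh t) (fun w => Kpos K 1 g (xih t w j)).
  exact: (Gmeas_comp mKg (ps_xih PS t j)).
have expand (G : Om -> \bar R) : measurable_fun setT G -> (forall w, 0 <= G w)%E ->
   (\int[P]_w (((c t.+1 w i * p (xi t.+1 w i) + c t.+1 w i * q (xih t w i))
                          * c t.+1 w j)%:E * G w) =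
    \int[P]_w ((c t.+1 w i * c t.+1 w j)%:E * ((p (xi t.+1 w i))%:E * G w)) +
    \int[P]_w ((c t.+1 w i * c t.+1 w j * q (xih t w i))%:E * G w))%E.
  move=> mG G0; rewrite -ge0_integralD//; last 4 first.
  - by move=> w _; rewrite mule_ge0// mule_ge0// lee_fin.
  - apply: emeasurable_funM; first by apply/measurable_EFinP; exact: measurable_funM.
    by apply: emeasurable_funM => //; apply/measurable_EFinP; exact: measurableT_comp.
  - by move=> w _; rewrite mule_ge0.
  - apply: emeasurable_funM => //; exact: (Gmeas_measurable (sFh t) Gccq).
  apply: eq_integral => w _.
  rewrite muleA -EFinM -ge0_muleDl ?lee_fin; [|by rewrite !mulr_ge0|by rewrite !mulr_ge0].
  by rewrite -EFinD; congr ((_ : R)%:E * _)%E; ring.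
rewrite (expand _ (measurableT_comp mg (mxi t.+1 j)) (fun w => g0 _)).
rewrite (expand _ (measurableT_comp mKg (mxih t j)) (fun w => Kg0 _)).
congr (_ + _)%E; last exact: (ps_mut1 PS j Gccq ccq0 mg g0).
rewrite (ps_mut2 PS ij Gcc cc0 mpe pe0 mg g0).
transitivity (\int[P]_w (((c t.+1 w i * c t.+1 w j)%:E * Kpos K 1 g (xih t w j)) *
   Kpos K 1 (fun y => (p y)%:E) (xih t w i)))%E.
  by apply: eq_integral => w _; rewrite -muleA; congr (_ * _)%E; rewrite muleC.
rewrite -(ps_mut1 PS i (GmeasMe (sFh t) Gcc Kgh) _ mpe pe0); last first.
  by move=> w; rewrite mule_ge0.
by apply: eq_integral => w _; rewrite -muleA; congr (_ * _)%E; rewrite muleC.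
Qed.

Lemma orth_mut_pair t i j a phi : 0 < a -> cls a phi -> i != j ->
  ex P (fun w => (c t.+1 w i * phi (xi t.+1 w i) - c t.+1 w i * Kt K 1 phi (xih t w i)) *
                 (c t.+1 w j * phi (xi t.+1 w j) - c t.+1 w j * Kt K 1 phi (xih t w j))) = 0.
Proof.
move=> a0 cphi ij; have cK := cls_Kt1 a0 cphi.
have aK := aCV a0.
have [mp p0] : measurable_fun setT (fun x => Num.max (phi x) 0) /\
    forall x, 0 <= Num.max (phi x) 0.
  by split; [have [] := V_class_max0 cphi|move=> x; rewrite le_max lexx orbT].
have [mn n0] : measurable_fun setT (fun x => Num.max (- phi x) 0) /\
    forall x, 0 <= Num.max (- phi x) 0.
  by split; [have [] := V_class_maxN0 cphi|move=> x; rewrite le_max lexx orbT].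
have [mKp Kp0] : measurable_fun setT (fun x => Num.max (Kt K 1 phi x) 0) /\
    forall x, 0 <= Num.max (Kt K 1 phi x) 0.
  by split; [have [] := V_class_max0 cK|move=> x; rewrite le_max lexx orbT].
have [mKn Kn0] : measurable_fun setT (fun x => Num.max (- Kt K 1 phi x) 0) /\
    forall x, 0 <= Num.max (- Kt K 1 phi x) 0.
  by split; [have [] := V_class_maxN0 cK|move=> x; rewrite le_max lexx orbT].
pose H1 w := c t.+1 w i * Num.max (phi (xi t.+1 w i)) 0 +
             c t.+1 w i * Num.max (- Kt K 1 phi (xih t w i)) 0.
pose H2 w := c t.+1 w i * Num.max (- phi (xi t.+1 w i)) 0 +
             c t.+1 w i * Num.max (Kt K 1 phi (xih t w i)) 0.
have L1 : L2 P H1.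
  apply: L2D; first exact: (L2_term PS Hs t.+1 i (ltW a0) (V_class_max0 cphi)).
  exact: (L2_termh PS Hs t i aK (V_class_maxN0 cK)).
have L2' : L2 P H2.
  apply: L2D; first exact: (L2_term PS Hs t.+1 i (ltW a0) (V_class_maxN0 cphi)).
  exact: (L2_termh PS Hs t i aK (V_class_max0 cK)).
have H10 w : 0 <= H1 w by rewrite addr_ge0// mulr_ge0.
have H20 w : 0 <= H2 w by rewrite addr_ge0// mulr_ge0.
rewrite -(mut_orth a0 cphi L1 L2' H10 H20 (mut_test_pair t ij mp p0 mKn Kn0)
  (mut_test_pair t ij mn n0 mKp Kp0)).
apply: eq_ex => w; congr (_ * _); rewrite /H1 /H2.
rewrite [X in _ * X - _]posnegB [X in _ - _ * X]posnegB; ring.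
Qed.

Definition var1 phi x := Kt K 1 (fun y => phi y ^+ 2) x - (Kt K 1 phi x) ^+ 2.

(** Pythagoras: c K phi at the child is orthogonal to the mutation term, so the second moment of
    that term is the difference of the second moments of c phi and c K phi. *)
Lemma mut_var t j a phi : 0 < a -> cls a phi ->
  itg P (fun w => c t.+1 w j ^+ 2 * var1 phi (xih t w j)) /\
  ex P (fun w => (c t.+1 w j * phi (xi t.+1 w j) - c t.+1 w j * Kt K 1 phi (xih t w j)) ^+ 2)
  = ex P (fun w => c t.+1 w j ^+ 2 * var1 phi (xih t w j)).
Proof.
move=> a0 cphi; have cK := cls_Kt1 a0 cphi; have aK := aCV a0.
have [mphi _] := cphi.
have LA := L2_term PS Hs t.+1 j (ltW a0) cphi.
have LB := L2_termh PS Hs t j aK cK.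
have GB : Gmeas (Fh t) (fun w => c t.+1 w j * Kt K 1 phi (xih t w j)).
  have [mK _] := cK.
  exact: (GmeasM (sFh t) (ps_ch PS t j) (Gmeas_comp mK (ps_xih PS t j))).
have o := orth_mut_Fh j a0 cphi LB GB.
have iAB := L2_itgM LB LA.
have iBB := L2_sqr LB.
have iAA := L2_sqr LA.
set A := fun w => c t.+1 w j * phi (xi t.+1 w j) in LA iAB iAA o *.
set B := fun w => c t.+1 w j * Kt K 1 phi (xih t w j) in LB iAB iBB o *.
have o' : ex P (fun w => B w * A w) = ex P (fun w => B w ^+ 2).
  apply/eqP; rewrite -subr_eq0 -exB//.
  by rewrite -[X in _ == X]o; apply/eqP/eq_ex => w; rewrite mulrBr expr2.
have mc2 : measurable_fun setT (fun w => c t.+1 w j ^+ 2) by exact: measurable_funX.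
have i2 : itg P (fun w => c t.+1 w j ^+ 2 * phi (xi t.+1 w j) ^+ 2).
  by under eq_fun do rewrite -exprMn.
have [||||||||i3 e3] := @mut_nonneg t j (fun w => c t.+1 w j ^+ 2) (fun y => phi y ^+ 2) => //.
- by move=> w; rewrite sqr_ge0.
- exact: measurable_funX.
- by move=> x; rewrite sqr_ge0.
- by move=> x Vx; exact: (L2_sqr (V_class_L2K Hs 1 Vx cphi)).
- apply: mut_test_Fh; last by move=> w; rewrite sqr_ge0.
  exact: (GmeasM (sFh t) (ps_ch PS t j) (ps_ch PS t j)).
- apply: filterS (ae_Vh PS Hs t) => w Vw; rewrite sqrf_eq0; exact: Vw.
have E w : c t.+1 w j ^+ 2 * var1 phi (xih t w j) =
    c t.+1 w j ^+ 2 * Kt K 1 (fun y => phi y ^+ 2) (xih t w j) - B w ^+ 2.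
  by rewrite /var1 /B mulrBr exprMn.
split; first by under eq_fun do rewrite E; exact: itgB.
rewrite [RHS](eq_ex _ E) exB// -e3.
rewrite (@eq_ex _ _ _ P _ (fun w => A w ^+ 2 - 2 * (B w * A w) + B w ^+ 2)); last first.
  by move=> w; rewrite /A /B; ring.
rewrite exD//; last by apply: itgB => //; exact: itgZ.
rewrite exB//; last exact: itgZ.
rewrite exZ// o'; under [in RHS]eq_ex do rewrite -exprMn.
by rewrite /A; ring.
Qed.

Lemma orth_sel t H a phi : 0 < a -> cls a phi -> L2 P H -> Gmeas (F t) H ->
  ex P (fun w => H w * (Wh t phi w - W t phi w)) = 0.
Proof.
move=> a0 cphi LH mH; have mH' := L2_meas LH.
pose pp x := Num.max (phi x) 0; pose pn x := Num.max (- phi x) 0.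
have cp : cls a pp := V_class_max0 cphi.
have cn : cls a pn := V_class_maxN0 cphi.
have Lp : L2 P (fun w => Num.max (H w) 0).
  apply: le_L2 LH; first exact: measurable_maxr.
  move=> w; rewrite ger0_norm ?le_max ?lexx ?orbT// ge_max normr_ge0 andbT.
  exact: ler_norm.
have Ln : L2 P (fun w => Num.max (- H w) 0).
  apply: le_L2 LH; first by apply: measurable_maxr => //; exact: measurableT_comp.
  move=> w; rewrite ger0_norm ?le_max ?lexx ?orbT// ge_max normr_ge0 andbT.
  by rewrite -normrN; exact: ler_norm.
have key H' p : Gmeas (F t) H' -> L2 P H' -> (forall w, 0 <= H' w) -> cls a p ->
    (forall x, 0 <= p x) ->
    ex P (fun w => H' w * Wh t p w) = ex P (fun w => H' w * W t p w).
  move=> mG LG G0 ca p0; have [mp _] := ca.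
  apply/eqP; rewrite -(inj_eq (@EFin_inj _)) !exE; last 2 first.
  - by apply: L2_itgM => //; exact: (L2_W PS Hs t (ltW a0) ca).
  - by apply: L2_itgM => //; exact: (L2_Wh PS Hs t (ltW a0) ca).
  have E1 w : (H' w * Wh t p w)%:E =
      ((H' w)%:E * \sum_j (c t.+1 w j)%:E * (p (xih t w j))%:E)%E.
    by rewrite EFinM /wsumh -sumEFin.
  have E2 w : (H' w * W t p w)%:E =
      ((H' w)%:E * \sum_j (c t w j)%:E * (p (xi t w j))%:E)%E.
    by rewrite EFinM /wsum -sumEFin.
  under eq_integral do rewrite E1; under [in eqbRHS]eq_integral do rewrite E2.
  apply/eqP.
  apply: (@ps_sel _ _ _ _ _ _ _ _ _ _ _ _ _ _ PS t (fun w => (H' w)%:E) (fun x => (p x)%:E)).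
  - exact: (Gmeas_EFin (sF t) mG).
  - by move=> w; rewrite lee_fin.
  - exact/measurable_EFinP.
  - by move=> x; rewrite lee_fin.
have ppos x : 0 <= pp x by rewrite le_max lexx orbT.
have pnos x : 0 <= pn x by rewrite le_max lexx orbT.
have Hp0 w : 0 <= Num.max (H w) 0 by rewrite le_max lexx orbT.
have Hn0 w : 0 <= Num.max (- H w) 0 by rewrite le_max lexx orbT.
have Gp := Gmeas_max0 (sF t) mH; have Gn := Gmeas_maxN0 (sF t) mH.
have LW p : cls a p -> L2 P (W t p) by move=> ca; exact: (L2_W PS Hs t (ltW a0) ca).
have LWh p : cls a p -> L2 P (Wh t p) by move=> ca; exact: (L2_Wh PS Hs t (ltW a0) ca).
rewrite -(orthogonality Lp Ln (LWh _ cp) (LWh _ cn) (LW _ cp) (LW _ cn)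
  (key _ _ Gp Lp Hp0 cp ppos) (key _ _ Gp Lp Hp0 cn pnos)
  (key _ _ Gn Ln Hn0 cp ppos) (key _ _ Gn Ln Hn0 cn pnos)).
apply: eq_ex => w; rewrite -posnegB; congr (_ * (_ - _)).
- rewrite /wsumh -sumrB; apply: eq_bigr => i _; by rewrite -mulrBr -posnegB.
- rewrite /wsum -sumrB; apply: eq_bigr => i _; by rewrite -mulrBr -posnegB.
Qed.

End orthogonality.

(** * Martingale increments and telescoping *)

Section martingale.
Context {R : realType} {d : measure_display} {X : measurableType d}.
Variables (K : R.-pker X ~> X) (V : X -> \bar R) (N : nat).
Context {d' : measure_display} {Om : measurableType d'}.
Variable P : probability Om R.
Variables (F Fh : nat -> set (set Om)) (xi xih : nat -> Om -> 'I_N -> X).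
Variable (c : nat -> Om -> 'I_N -> R).
Hypothesis PS : particle_system K V P F Fh xi xih c.
Variables (mu : probability X R) (CV D r : R).
Hypothesis Hs : sqrtV_ergodic K mu V CV D r.
Local Notation cls := (V_class V).
Local Notation W := (wsum xi c).
Local Notation Wh := (wsumh xih c).
Implicit Types (phi psi p : X -> R) (a b : R) (H : Om -> R) (t : nat)
  (i j : 'I_N) (w : Om).

Let aCV a : 0 < a -> 0 < a * CV.
Proof. by move=> a0; rewrite mulr_gt0// (lt_le_trans _ (sv_C Hs)). Qed.

Definition Dmut t phi w := W t.+1 phi w - Wh t (Kt K 1 phi) w.
Definition Dsel t phi w := Wh t (Kt K 1 phi) w - W t (Kt K 1 phi) w.
Definition Dinc t phi w := W t.+1 phi w - W t (Kt K 1 phi) w.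

Let DmutE t phi w : Dmut t phi w = \sum_j (c t.+1 w j * phi (xi t.+1 w j)
                       - c t.+1 w j * Kt K 1 phi (xih t w j)).
Proof. by rewrite sumrB. Qed.

Let L2_mterm t j a phi : 0 < a -> cls a phi -> L2 P (fun w =>
  c t.+1 w j * phi (xi t.+1 w j) - c t.+1 w j * Kt K 1 phi (xih t w j)).
Proof.
move=> a0 cphi; apply: L2B; first exact: (L2_term PS Hs t.+1 j (ltW a0) cphi).
exact: (L2_termh PS Hs t j (ltW (aCV a0)) (cls_Kt1 Hs a0 cphi)).
Qed.

Lemma L2_Dmut t a phi : 0 < a -> cls a phi -> L2 P (Dmut t phi).
Proof.
move=> a0 cphi; rewrite (funext (DmutE t phi)).
by apply: L2_sum => j; exact: L2_mterm a0 cphi.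
Qed.

Lemma L2_Dsel t a phi : 0 < a -> cls a phi -> L2 P (Dsel t phi).
Proof.
move=> a0 cphi; have cK := cls_Kt1 Hs a0 cphi; have aK := ltW (aCV a0).
apply: L2B; [exact: (L2_Wh PS Hs t aK cK)|exact: (L2_W PS Hs t aK cK)].
Qed.

Lemma L2_Dinc t a phi : 0 < a -> cls a phi -> L2 P (Dinc t phi).
Proof.
move=> a0 cphi; have cK := cls_Kt1 Hs a0 cphi; have aK := ltW (aCV a0).
apply: L2B; [exact: (L2_W PS Hs t.+1 (ltW a0) cphi)|exact: (L2_W PS Hs t aK cK)].
Qed.

Lemma orth_Dmut t a phi H : 0 < a -> cls a phi -> L2 P H -> Gmeas (Fh t) H ->
  ex P (fun w => H w * Dmut t phi w) = 0.
Proof.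
move=> a0 cphi LH mH; under eq_ex do rewrite DmutE mulr_sumr.
rewrite ex_sum; last by move=> j; apply: L2_itgM => //; exact: L2_mterm a0 cphi.
by rewrite big1// => j _; exact: (orth_mut_Fh PS Hs j a0 cphi LH mH).
Qed.

Lemma ex_Dmut_sqr t a phi : 0 < a -> cls a phi ->
  ex P (fun w => Dmut t phi w ^+ 2) =
  \sum_j ex P (fun w => c t.+1 w j ^+ 2 * var1 K phi (xih t w j)).
Proof.
move=> a0 cphi; under eq_ex do rewrite DmutE.
rewrite ex_sqr_sum_orth.
- by apply: eq_bigr => j _; have [_] := mut_var PS Hs t j a0 cphi.
- by move=> j; exact: L2_mterm a0 cphi.
- by move=> i j ij; exact: (orth_mut_pair PS Hs t a0 cphi ij).
Qed.

Lemma Gmeas_Dsel t phi : measurable_fun setT phi -> Gmeas (Fh t) (Dsel t phi).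
Proof.
move=> mphi; have mK := measurable_Kt K 1 mphi.
apply: (GmeasB (ps_Fh PS t)); first exact: (Gmeas_Wh PS t mK).
exact: (Gmeas_sub (ps_FFh PS (t := t)) (Gmeas_W PS t mK)).
Qed.

Lemma Gmeas_Dinc t phi : measurable_fun setT phi -> Gmeas (F t.+1) (Dinc t phi).
Proof.
move=> mphi; have mK := measurable_Kt K 1 mphi.
apply: (GmeasB (ps_F PS t.+1)); first exact: (Gmeas_W PS t.+1 mphi).
exact: (Gmeas_sub (F_mono PS (leqnSn t)) (Gmeas_W PS t mK)).
Qed.

Let DincE t phi w : Dinc t phi w = Dmut t phi w + Dsel t phi w.
Proof. by rewrite /Dinc /Dmut /Dsel addrA subrK. Qed.

Lemma orth_Dinc t a phi H : 0 < a -> cls a phi -> L2 P H -> Gmeas (F t) H ->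
  ex P (fun w => H w * Dinc t phi w) = 0.
Proof.
move=> a0 cphi LH mH; have cK := cls_Kt1 Hs a0 cphi.
have mH' := Gmeas_sub (ps_FFh PS (t := t)) mH.
under eq_ex do rewrite DincE mulrDr.
rewrite exD.
- by rewrite (orth_Dmut a0 cphi LH mH') (orth_sel PS Hs (aCV a0) cK LH mH) addr0.
- by apply: L2_itgM => //; exact: L2_Dmut a0 cphi.
- by apply: L2_itgM => //; exact: L2_Dsel a0 cphi.
Qed.

Lemma ex_Dinc_sqr t a phi : 0 < a -> cls a phi ->
  ex P (fun w => Dinc t phi w ^+ 2) =
  ex P (fun w => Dmut t phi w ^+ 2) + ex P (fun w => Dsel t phi w ^+ 2).
Proof.
move=> a0 cphi; have [mphi _] := cphi.
under eq_ex do rewrite DincE.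
have LS := L2_Dsel t a0 cphi.
rewrite (ex_sqrD (L2_Dmut t a0 cphi) LS).
rewrite (@eq_ex _ _ _ P (fun w => Dmut t phi w * Dsel t phi w)
   (fun w => Dsel t phi w * Dmut t phi w)); last by move=> w; rewrite mulrC.
by rewrite (orth_Dmut a0 cphi LS (Gmeas_Dsel t mphi)) mulr0 addr0.
Qed.

(** The functions may vary with time: they are constant for the Poisson martingale, and equal to
    K^(T-s-1) phi in the backward expansion of W_T(phi). *)
Lemma ex_sum_Dinc (Y : Om -> R) (a : nat -> R) (phi : nat -> X -> R) T :
  L2 P Y -> Gmeas (F 0) Y -> (forall s, 0 < a s) -> (forall s, cls (a s) (phi s)) ->
  [/\ L2 P (fun w => Y w + \sum_(0 <= s < T) Dinc s (phi s) w),
      Gmeas (F T) (fun w => Y w + \sum_(0 <= s < T) Dinc s (phi s) w) &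
  ex P (fun w => (Y w + \sum_(0 <= s < T) Dinc s (phi s) w) ^+ 2) =
  ex P (fun w => Y w ^+ 2) + \sum_(0 <= s < T) ex P (fun w => Dinc s (phi s) w ^+ 2)].
Proof.
move=> LY mY a0 cphi; elim: T => [|T [LT mT eT]].
  by under eq_fun do rewrite big_geq// addr0;
     under eq_ex do rewrite big_geq// addr0; rewrite big_geq// addr0.
have E w : Y w + \sum_(0 <= s < T.+1) Dinc s (phi s) w =
    (Y w + \sum_(0 <= s < T) Dinc s (phi s) w) + Dinc T (phi T) w.
  by rewrite big_nat_recr//= addrA.
have LD := L2_Dinc T (a0 T) (cphi T).
have [mphi _] := cphi T.
under eq_fun do rewrite E; under eq_ex do rewrite E; split.
- exact: L2D.
- apply: (GmeasD (ps_F PS T.+1)); last exact: Gmeas_Dinc.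
  exact: (Gmeas_sub (F_mono PS (leqnSn T)) mT).
- rewrite (ex_sqrD LT LD) (orth_Dinc (a0 T) (cphi T) LT mT) mulr0 addr0 eT.
  by rewrite big_nat_recr//= addrA.
Qed.

Lemma ex_W s t a phi : 0 < a -> cls a phi -> ex P (W (s + t) phi) = ex P (W s (Kt K t phi)).
Proof.
move=> a0 cphi; have [mphi _] := cphi; elim: t s => [|t ih] s.
  by rewrite addn0; congr (ex _ (wsum _ _ _ _)); apply/funext => x; rewrite Kt0.
have cK := V_class_Kt Hs t a0 cphi.
have := @orth_Dinc s _ (Kt K t phi) (fun=> 1) (aCV a0) cK (L2_cst P 1)
   (Gmeas_cst (ps_F PS s) (1 : R)).
under eq_ex do rewrite mul1r.
rewrite exB; last 2 first.
- exact: L2_itg (L2_W PS Hs s.+1 (ltW (aCV a0)) cK).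
- exact: L2_itg (L2_W PS Hs s (ltW (aCV (aCV a0))) (cls_Kt1 Hs (aCV a0) cK)).
rewrite -ih addSnnS => /eqP; rewrite subr_eq0 => /eqP ->.
apply: ex_ae.
- exact: L2_meas (L2_W PS Hs s (ltW (aCV (aCV a0))) (cls_Kt1 Hs (aCV a0) cK)).
- exact: L2_meas (L2_W PS Hs s (ltW (aCV a0)) (V_class_Kt Hs t.+1 a0 cphi)).
- by apply: (W_congr PS Hs) => x Vx; exact: (KtS Hs t a0 cphi Vx).
Qed.

Lemma W_lin t phi psi (k l : R) w :
  W t (fun x => k * phi x + l * psi x) w = k * W t phi w + l * W t psi w.
Proof.
rewrite /wsum !mulr_sumr -big_split/=; apply: eq_bigr => i _; ring.
Qed.

Lemma telescope_poisson a phi (f0 : X -> R) T : 0 < a -> cls a phi ->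
  (forall x, (V x < +oo)%E -> Kt K 1 phi x = phi x - f0 x) ->
  {ae P, forall w, \sum_(0 <= t < T) W t f0 w =
     (W 0 phi w + \sum_(0 <= t < T) Dinc t phi w) - W T phi w}.
Proof.
move=> a0 cphi poi; elim: T => [|T ih].
  by apply: nearW => w; rewrite !big_geq// addr0 subrr.
have := W_congr PS Hs T poi.
apply: filterS2 ih => w ih e.
rewrite !big_nat_recr//= ih /Dinc e.
have -> : W T (fun x => phi x - f0 x) w = W T phi w - W T f0 w.
  have := W_lin T phi f0 1 (-1) w; rewrite mul1r mulN1r => <-.
  by congr (wsum _ _ _ _ _); apply/funext => x; rewrite mul1r mulN1r.
ring.
Qed.

(** A discrete Duhamel formula. When mu(phi) = 0 the functions K^(T-s-1) phi are small for T - s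
    large, so only the latest increments count; this is the source of the concentration of weighted
    averages. *)
Lemma telescope_power a phi T : 0 < a -> cls a phi ->
  {ae P, forall w, W T phi w =
     W 0 (Kt K T phi) w + \sum_(0 <= s < T) Dinc s (Kt K (T - s.+1) phi) w}.
Proof.
move=> a0 cphi.
suff : forall n, (n <= T)%N -> {ae P, forall w, W n (Kt K (T - n) phi) w =
     W 0 (Kt K T phi) w + \sum_(0 <= s < n) Dinc s (Kt K (T - s.+1) phi) w}.
  move=> /(_ T (leqnn T)); rewrite subnn; apply: filterS => w <-.
  by congr (wsum _ _ _ _ _); apply/funext => x; rewrite Kt0.
elim=> [_|n ih nT]; first by apply: nearW => w; rewrite subn0 big_geq// addr0.
have key x : (V x < +oo)%E -> Kt K 1 (Kt K (T - n.+1) phi) x = Kt K (T - n) phi x.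
  by move=> Vx; rewrite -(subnSK nT); exact: (KtS Hs (T - n.+1) a0 cphi Vx).
have := W_congr PS Hs n key.
apply: filterS2 (ih (ltnW nT)) => w ih' e.
rewrite big_nat_recr//= addrA -ih' /Dinc.
by rewrite e addrC subrK.
Qed.

End martingale.

(** * Weighted ensembles as particle systems *)

Section lower_integral.
Context {d : measure_display} {T : measurableType d} {R : realType}.
Variable P : {measure set T -> \bar R}.
Local Open Scope ereal_scope.

(** The integral of a nonnegative function is a supremum over the simple functions below it, a lower
    integral, hence monotone without measurability. *)
Lemma ge0_le_integral_nonmeas (A : set T) (f g : T -> \bar R) :
  (forall x, 0 <= f x) -> (forall x, f x <= g x) ->
  \int[P]_(x in A) f x <= \int[P]_(x in A) g x.
Proof.
move=> f0 fg; have g0 x : 0 <= g x by exact: le_trans (fg x).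
rewrite !ge0_integralE//; apply: ereal_sup_le => _ [h hf <-]; exists h => //= x.
apply: le_trans (hf x) _; rewrite !patchE; case: ifP => // _.
Qed.

(** Simple functions below [f] with integrals approaching the supremum are merged into their
    pointwise supremum, which stays below [f]. *)
Lemma measurable_minorant (f : T -> \bar R) : (forall x, 0 <= f x) ->
  \int[P]_x f x < +oo ->
  exists M : T -> \bar R, [/\ measurable_fun setT M, forall x, 0 <= M x,
    forall x, M x <= f x & \int[P]_x M x = \int[P]_x f x].
Proof.
move=> f0 ifin; set I := \int[P]_x f x.
have Ifin : I \is a fin_num by rewrite ge0_fin_numE// integral_ge0.
have IE : I = ereal_sup [set sintegral P h | h in
    [set h : {nnsfun T >-> R} | forall x, (h x)%:E <= f x]].
  by rewrite /I ge0_integralTE.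
have adh n : {h : {nnsfun T >-> R} | (forall x, (h x)%:E <= f x) /\
    I - (n.+1%:R^-1)%:E < sintegral P h}.
  apply: cid; rewrite IE in Ifin *.
  have n0 : (0 < n.+1%:R^-1 :> R)%R by rewrite invr_gt0.
  by have [_ [h hf <-] lt] := ub_ereal_sup_adherent n0 Ifin; exists h.
pose h n := sval (adh n).
have hf n x : (h n x)%:E <= f x by have [] := svalP (adh n).
have hI n : I - (n.+1%:R^-1)%:E < sintegral P (h n) by have [] := svalP (adh n).
pose M x := esups (fun n => (h n x)%:E) 0%N.
have mM : measurable_fun setT M.
  by apply: measurable_fun_esups => n; exact/measurable_EFinP.
have hM n x : (h n x)%:E <= M x by apply: ereal_sup_ubound; exists n.
have M0 x : 0 <= M x by apply: le_trans (hM 0%N x); rewrite lee_fin.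
have Mf x : M x <= f x by apply: ge_ereal_sup => _ [n _ <-].
exists M; split => //; apply/eqP; rewrite eq_le; apply/andP; split.
  exact: ge0_le_integral_nonmeas.
apply/lee_addgt0Pr => e e0.
have [n ne] : exists n, (n.+1%:R^-1 <= e)%R.
  exists (Num.truncn e^-1); rewrite invf_ple ?posrE//.
  by apply: ltW; exact: truncnS_gt.
have : I - (n.+1%:R^-1)%:E <= \int[P]_x M x.
  apply: le_trans (ltW (hI n)) _; rewrite -integralT_nnsfun.
  apply: ge0_le_integral => //; [by move=> x _; rewrite lee_fin|exact/measurable_EFinP].
rewrite leeBlDr// => /le_trans; apply.
by rewrite leeD2l// lee_fin.
Qed.

End lower_integral.

Lemma Gmeas_nat_comp d (Om : measurableType d) (R : realType) (G : set (set Om))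
    (h : Om -> nat) (k : nat -> R) :
  sub_sigma G -> Gmeas_discr G h -> Gmeas G (fun w => k (h w)).
Proof.
move=> [[G0 _ GU] _] mh B mB.
rewrite (_ : _ @^-1` B = \bigcup_n (if `[< B (k n) >] then h @^-1` [set n] else set0)).
  by apply: GU => n; case: ifP => _; [exact: mh|exact: G0].
apply/seteqP; split=> [w /= Bw|w [n _]]; first by exists (h w) => //; case: asboolP.
by case: asboolP => // Bn /= ->.
Qed.

Lemma sum_fibers (R : nmodType) N (par : 'I_N -> 'I_N) (num : 'I_N -> nat) (G : 'I_N -> R) :
  (forall i, #|[set j | par j == i]| = num i) ->
  \sum_j G (par j) = \sum_i G i *+ num i.
Proof.
move=> h; rewrite (partition_big par predT)//=; apply: eq_bigr => i _.
rewrite (eq_bigr (fun=> G i)); last by move=> j /eqP ->.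
by rewrite -h -sumr_const; apply: eq_bigl => j; apply/idP/idP; rewrite inE.
Qed.

Section WE_particle_system.
Context {R : realType} {d : measure_display} {X : measurableType d}.
Variables (K : R.-pker X ~> X) (V : X -> \bar R) (N : nat).
Context {d' : measure_display} {Om : measurableType d'}.
Variables (P : probability Om R) (mu0 : probability X R) (m : WEdata R N X Om).
Hypothesis HW : is_WE_method K P mu0 m.

Local Notation F := (WF m).
Local Notation Fh := (WFh m).
Local Notation xi := (Wxi m).
Local Notation w_ := (Ww m).
Local Notation bin := (Wbin m).
Local Notation Nall := (Wall m).
Local Notation num := (Wnum m).
Local Notation par := (Wpar m).
Local Notation bw := (bin_weight m).
Local Notation Cf := (Cfac m).
Implicit Types (t : nat) (i j u : 'I_N) (w : Om).

Lemma WE_F t : sub_sigma (F t). Proof. by case: HW => _ [/(_ t)[]]. Qed.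
Lemma WE_Fh t : sub_sigma (Fh t). Proof. by case: HW => _ [/(_ t)[]]. Qed.
Lemma WE_FFh t : F t `<=` Fh t. Proof. by case: HW => _ [_ [/(_ t)[]]]. Qed.
Lemma WE_FhF t : Fh t `<=` F t.+1. Proof. by case: HW => _ [_ [/(_ t)[]]]. Qed.
Lemma WE_w0 w i : w_ 0 w i = N%:R^-1.
Proof. by case: HW => _ [_ [_ [_ [-> _]]]]. Qed.
Lemma WE_N : (0 < N)%N. Proof. by case: HW. Qed.
Lemma WE_wS t w j : w_ t.+1 w j = Wwh m t w j.
Proof. by case: HW => _ [_ [_ [_ [_ [_ [_ ->]]]]]]. Qed.

Let step t := let: conj _ (conj _ (conj _ (conj _ (conj _ (conj s _))))) := HW in s t.

Lemma WE_xi t i : Gmeas (F t) (fun w => xi t w i).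
Proof. by have [/(_ i)[]] := step t. Qed.
Lemma WE_w t i : Gmeas (F t) (fun w => w_ t w i).
Proof. by have [/(_ i)[_ []]] := step t. Qed.
Lemma WE_Cf t i : Gmeas (F t) (fun w => Cf t w i).
Proof. by have [/(_ i)[_ [_ []]]] := step t. Qed.
Lemma WE_bin t i : Gmeas_discr (F t) (fun w => bin t w i).
Proof. by have [/(_ i)[_ [_ []]]] := step t. Qed.
Lemma WE_Nall t u : Gmeas_discr (F t) (fun w => Nall t w u).
Proof. by have [_ []] := step t. Qed.
Lemma WE_Nall1 t w u : bin_nonempty m t w u -> (1 <= Nall t w u)%N.
Proof. by have [_ [_ [h _]]] := step t; exact: h. Qed.
Lemma WE_Nsum t w : (\sum_(u | bin_nonempty m t w u) Nall t w u)%N = N.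
Proof. by have [_ [_ [_ [h _]]]] := step t; exact: h. Qed.
Lemma WE_Cf0 t w i : 0 < Cf t w i.
Proof. by have [_ [_ [_ [_ [h _]]]]] := step t; exact: h. Qed.
Lemma WE_mean t i A : F t A ->
  (\int[P]_(w in A) ((num t w i)%:R)%:E = \int[P]_(w in A) (Cf t w i)%:E)%E.
Proof. by have [_ [_ [_ [_ [_ [h _]]]]]] := step t; exact: h. Qed.
Lemma WE_binsum t : {ae P, forall w, forall u,
  (\sum_(i | bin t w i == u) num t w i)%N = Nall t w u}.
Proof. by have [_ [_ [_ [_ [_ [_ []]]]]]] := step t. Qed.
Lemma WE_children t : {ae P, forall w,
  (forall i, #|[set j | par t w j == i]| = num t w i) /\
  (forall j, Wxih m t w j = xi t w (par t w j) /\
     Wwh m t w j = bw t w (bin t w (par t w j)) / (Nall t w (bin t w (par t w j)))%:R)}.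
Proof. by have [_ [_ [_ [_ [_ [_ [_ []]]]]]]] := step t. Qed.
Lemma WE_xih t j : Gmeas (Fh t) (fun w => Wxih m t w j).
Proof. by have [_ [_ [_ [_ [_ [_ [_ [_ h]]]]]]]] := step t; have [] := h j. Qed.
Lemma WE_wh t j : Gmeas (Fh t) (fun w => Wwh m t w j).
Proof. by have [_ [_ [_ [_ [_ [_ [_ [_ h]]]]]]]] := step t; have [] := h j. Qed.
Lemma WE_evolution t A (B : 'I_N -> set X) : Fh t A -> (forall j, measurable (B j)) ->
  P (A `&` [set w | forall j, B j (xi t.+1 w j)]) =
  (\int[P]_(w in A) (\prod_j fine (K (Wxih m t w j) (B j)))%:E)%E.
Proof. by case: HW => _ [_ [_ [_ [_ [_ [h _]]]]]]; exact: h. Qed.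

Lemma bin_nonempty_self t w i : bin_nonempty m t w (bin t w i).
Proof. by apply/existsP; exists i. Qed.

Lemma bw_neq0 t w i : bw t w (bin t w i) != 0.
Proof.
apply/eqP => b0; have := WE_Cf0 t w i.
by rewrite /Cfac b0 invr0 mulr0 ltxx.
Qed.

Lemma sum_nonempty t w (G : 'I_N -> R) :
  \sum_i G i = \sum_(u | bin_nonempty m t w u) \sum_(i | bin t w i == u) G i.
Proof.
rewrite (partition_big (bin t w) (bin_nonempty m t w)) => [|i _]//.
exact: bin_nonempty_self.
Qed.

Lemma sum_Cf t w : \sum_i Cf t w i = N%:R.
Proof.
rewrite (sum_nonempty t w) -[in RHS](WE_Nsum t w) natr_sum; apply: eq_bigr => u.
move=> /existsP[i /eqP iu].
rewrite (eq_bigr (fun k => (Nall t w u)%:R / bw t w u * w_ t w k)); last first.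
  by move=> k /eqP ku; rewrite /Cfac ku mulrAC.
by rewrite -mulr_sumr -/(bin_weight _ _ _ _) mulrVK// unitfE -iu bw_neq0.
Qed.

Lemma sum_num t : {ae P, forall w, (\sum_i num t w i)%N = N}.
Proof.
apply: filterS (WE_binsum t) => w h.
rewrite (partition_big (bin t w) (bin_nonempty m t w)) => [|i _]/=;
  last exact: bin_nonempty_self.
by rewrite -[RHS](WE_Nsum t w); apply: eq_bigr => u _; rewrite h.
Qed.

Lemma Gmeas_bin_eq t i u : Gmeas (F t) (fun w => (bin t w i == u)%:R : R).
Proof.
have := Gmeas_indic (R := R) (WE_F t) (WE_bin t i u).
rewrite (_ : \1_ _ = (fun w => (bin t w i == u)%:R))//; apply/funext => w.
rewrite indicE; congr ((nat_of_bool _)%:R).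
by apply/idP/eqP; rewrite inE.
Qed.

Lemma Gmeas_bw t u : Gmeas (F t) (fun w => bw t w u).
Proof.
rewrite (_ : (fun w => _) = (fun w => \sum_i (bin t w i == u)%:R * w_ t w i)); last first.
  apply/funext => w; rewrite /bin_weight big_mkcond; apply: eq_bigr => i _.
  by case: eqP; rewrite ?mul1r ?mul0r.
apply: (Gmeas_sum (WE_F t)) => i.
exact: (GmeasM (WE_F t) (Gmeas_bin_eq t i u) (WE_w t i)).
Qed.

Definition child_weight t w i : R := bw t w (bin t w i) / (Nall t w (bin t w i))%:R.

Lemma Gmeas_child_weight t i : Gmeas (F t) (fun w => child_weight t w i).
Proof.
rewrite (_ : (fun w => _) = (fun w =>
   \sum_u (bin t w i == u)%:R * (bw t w u * (Nall t w u)%:R^-1))); last first.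
  apply/funext => w; rewrite (bigD1 (bin t w i))//= eqxx mul1r big1 ?addr0//.
  by move=> u ui; rewrite eq_sym (negbTE ui) mul0r.
apply: (Gmeas_sum (WE_F t)) => u.
apply: (GmeasM (WE_F t) (Gmeas_bin_eq t i u)).
apply: (GmeasM (WE_F t) (Gmeas_bw t u)).
exact: (Gmeas_nat_comp (fun n => n%:R^-1 : R) (WE_F t) (WE_Nall t u)).
Qed.

(* The offspring numbers are not assumed measurable: they are replaced by
   measurable minorants with the same integral, which agree with them almost
   surely because both families sum to N. *)
Lemma num_minorant t : exists M : 'I_N -> Om -> \bar R,
  [/\ forall i, measurable_fun setT (M i), forall i w, (0 <= M i w)%E,
      {ae P, forall w, forall i, M i w = ((num t w i)%:R)%:E} &
      forall i A, F t A -> (\int[P]_(w in A) M i w = \int[P]_(w in A) (Cf t w i)%:E)%E].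
Proof.
have mCf i : measurable_fun setT (fun w => (Cf t w i)%:E).
  by apply/measurable_EFinP; exact: Gmeas_measurable (WE_F t) (WE_Cf t i).
have Cf0 i w : (0 <= (Cf t w i)%:E)%E by rewrite lee_fin ltW// WE_Cf0.
have FT : F t setT.
  by have [[G0 GC _] _] := WE_F t; have := GC _ G0; rewrite setD0.
have sumCf : (\sum_i \int[P]_w (Cf t w i)%:E = N%:R%:E)%E.
  rewrite -ge0_integral_sum//.
  rewrite (eq_integral (cst N%:R%:E)); last by move=> w _; rewrite sumEFin sum_Cf.
  by rewrite integral_cst// [X in (_ * X)%E]probability_setT mule1.
have intCf i : (\int[P]_w (Cf t w i)%:E < +oo)%E.
  apply: (@le_lt_trans _ _ N%:R%:E); last exact: ltry.
  by rewrite -sumCf (bigD1 i)//= leeDl// sume_ge0// => j _; exact: integral_ge0.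
have num0 i w : (0 <= ((num t w i)%:R : R)%:E)%E by rewrite lee_fin.
have ex_ i : exists M : Om -> \bar R, [/\ measurable_fun setT M, forall w, (0 <= M w)%E,
    forall w, (M w <= ((num t w i)%:R)%:E)%E &
    (\int[P]_w M w = \int[P]_w ((num t w i)%:R)%:E)%E].
  by apply: measurable_minorant => //; rewrite WE_mean.
pose M i := sval (cid (ex_ i)).
have [mM M0 Mle MI] : [/\ forall i, measurable_fun setT (M i), forall i w, (0 <= M i w)%E,
    forall i w, (M i w <= ((num t w i)%:R)%:E)%E &
    forall i, (\int[P]_w M i w = \int[P]_w (Cf t w i)%:E)%E].
  split=> i; have [? ? ? e] := svalP (cid (ex_ i)) => //.
  by rewrite /M e WE_mean.
exists M; split=> //.
- have sumM : (\int[P]_w (\sum_i M i w) = N%:R%:E)%E.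
    by rewrite ge0_integral_sum//; under eq_bigr do rewrite MI; exact: sumCf.
  have mS : measurable_fun setT (fun w => (\sum_i M i w)%E) by exact: emeasurable_sum.
  have S0 w : (0 <= \sum_i M i w)%E by exact: sume_ge0.
  have SleN : {ae P, forall w, (\sum_i M i w <= N%:R%:E)%E}.
    apply: filterS (sum_num t) => w sN.
    by rewrite -[in leRHS]sN natr_sum -sumEFin; apply: lee_sum => i _; exact: Mle.
  have Mfin i w : M i w \is a fin_num.
    by rewrite ge0_fin_numE//; apply: le_lt_trans (Mle i w) (ltry _).
  have Sfin w : (\sum_i M i w)%E \is a fin_num by apply/sum_fin_numP => i _ _; exact: Mfin.
  pose s w := fine (\sum_i M i w)%E.
  have [i_s es] : itg P s /\ ex P s = N%:R.
    have [] := @ex_fine _ _ _ P (fun w => \sum_i M i w)%E mS S0.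
      by rewrite sumM ltry.
    by rewrite sumM.
  have i2 : itg P (fun w => N%:R - s w) by apply: itgB => //; exact: itg_cst.
  (* N - s is almost surely nonnegative with mean 0, hence almost surely zero. The gaps between
     offspring numbers and minorants are nonnegative and sum to it, so each of them vanishes. *)
  have z : ex P (fun w => `|N%:R - s w|) = 0.
    rewrite (@ex_ae _ _ _ P _ (fun w => N%:R - s w)).
    - by rewrite (exB (itg_cst P _) i_s) ex_cst [X in _ - X]es subrr.
    - by apply: measurableT_comp => //; exact: (itg_meas i2).
    - exact: (itg_meas i2).
    - apply: filterS SleN => w; rewrite -[X in (X <= _)%E]fineK// lee_fin => h.
      by rewrite ger0_norm// subr_ge0.
  have aeS : {ae P, forall w, s w = N%:R}.
    have [+ _] := ae_eq_integral_abs P measurableT (measurable_int _ i2).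
    have z0 : (\int[P]_w `|((N%:R - s w)%R)%:E| = 0)%E.
      by rewrite -[RHS]/(0%R%:E) -z exE//; exact: (integrable_norm i2).
    move=> /(_ z0); apply: filterS => w /(_ I) [] /eqP.
    by rewrite subr_eq0 => /eqP ->.
  apply: filterS2 (sum_num t) aeS => w sN Ss i.
  apply/eqP; rewrite eq_le Mle/= -[X in (_ <= X)%E]fineK// lee_fin.
  have h : forall j, fine (M j w) <= (num t w j)%:R.
    by move=> j; rewrite -lee_fin fineK.
  have : \sum_j ((num t w j)%:R - fine (M j w)) = 0.
    have -> : \sum_j ((num t w j)%:R - fine (M j w)) = N%:R - s w.
      rewrite sumrB -natr_sum sN /s; congr (_ - _).
      rewrite [in RHS](eq_bigr (fun j => (fine (M j w))%:E)) ?sumEFin//.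
      by move=> j _; rewrite fineK.
    by rewrite Ss subrr.
  move=> /eqP; rewrite psumr_eq0; last by move=> j _; rewrite subr_ge0.
  by move=> /allP/(_ i (mem_index_enum _))/=; rewrite subr_eq0 => /eqP ->.
- move=> i A FA.
  have mA : measurable A by exact: (WE_F t).2.
  have FC : F t (~` A).
    by have [[_ GC _] _] := WE_F t; have := GC _ FA; rewrite setTD.
  (* Inequality on [A] and on its complement, together with equal totals, forces equality on
     both. *)
  have le B : F t B -> (\int[P]_(w in B) M i w <= \int[P]_(w in B) (Cf t w i)%:E)%E.
    by move=> FB; rewrite -WE_mean//; apply: ge0_le_integral_nonmeas.
  have split' (f : Om -> \bar R) : measurable_fun setT f -> (forall w, (0 <= f w)%E) ->
     (\int[P]_w f w = \int[P]_(w in A) f w + \int[P]_(w in ~` A) f w)%E.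
    move=> mf f0; rewrite -ge0_integral_setU//; first by rewrite setUv.
    + exact: measurableC.
    + by rewrite setUv.
    + by rewrite disj_set2E setICr.
  have := MI i; rewrite (split' _ (mM i) (M0 i)) (split' _ (mCf i) (Cf0 i)).
  have fA B : F t B -> (\int[P]_(w in B) (Cf t w i)%:E)%E \is a fin_num.
    move=> FB; rewrite ge0_fin_numE; last exact: integral_ge0.
    apply: le_lt_trans (intCf i); apply: ge0_subset_integral => //.
    exact: (WE_F t).2.
  have fM B : F t B -> (\int[P]_(w in B) M i w)%E \is a fin_num.
    move=> FB; rewrite ge0_fin_numE; last exact: integral_ge0.
    by apply: le_lt_trans (le _ FB) _; rewrite -ge0_fin_numE ?fA// integral_ge0.
  have := le _ FA; have := le _ FC.
  rewrite -(fineK (fA _ FA)) -(fineK (fA _ FC)) -(fineK (fM _ FA)) -(fineK (fM _ FC)).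
  rewrite -!EFinD !lee_fin => h1 h2 [] e; congr EFin; lra.
Qed.

(** The children enter through their parents only, so the sum over children is a sum over parents
    with multiplicity [num]. The measurable minorants of these counts have the same integrals as
    [Cf] on events of [F t], which allows the substitution. *)
Lemma integral_children t (Y : Om -> \bar R) (G : 'I_N -> Om -> \bar R) :
  measurable_fun setT Y -> (forall w, 0 <= Y w)%E ->
  (forall i, Gmeas (F t) (G i)) -> (forall i w, 0 <= G i w)%E ->
  {ae P, forall w, Y w = (\sum_j G (par t w j) w)%E} ->
  (\int[P]_w Y w = \int[P]_w (\sum_i (Cf t w i)%:E * G i w))%E.
Proof.
move=> mY Y0 mG G0 YG.
have [M [mM M0 Mnum MI]] := num_minorant t.
have mGT i : measurable_fun setT (G i) := Gmeas_measurable (WE_F t) (mG i).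
have mCf i : measurable_fun setT (fun w => (Cf t w i)%:E).
  by apply/measurable_EFinP; exact: Gmeas_measurable (WE_F t) (WE_Cf t i).
have Cf0 i w : (0 <= (Cf t w i)%:E)%E by rewrite lee_fin ltW// WE_Cf0.
transitivity (\int[P]_w (\sum_i G i w * M i w))%E.
  apply: ge0_ae_eq_integral => //.
  - by apply: emeasurable_sum => i; exact: emeasurable_funM.
  - by move=> w _; apply: sume_ge0 => i _; rewrite mule_ge0.
  - apply: filterS3 YG Mnum (WE_children t) => w -> eM [nE _] _.
    rewrite (sum_fibers (fun i => G i w) nE); apply: eq_bigr => i _.
    by rewrite eM muleC; exact/esym/mule_natl.
rewrite ge0_integral_sum//; last 2 first.
- by move=> i; exact: emeasurable_funM.
- by move=> i w _; rewrite mule_ge0.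
rewrite ge0_integral_sum//; last 2 first.
- by move=> i; exact: emeasurable_funM.
- by move=> i w _; rewrite mule_ge0.
apply: eq_bigr => i _; under [in RHS]eq_integral do rewrite muleC.
exact: (eq_integral_sub_sigma (WE_F t) (mM i) (mCf i) (M0 i) (Cf0 i) (MI i) (mG i) (G0 i)).
Qed.

(** Each bin shares its weight evenly among exactly N_t(u) children, so the total is preserved. The
    result is almost sure because children and bin counts are prescribed up to null sets. *)
Lemma WE_weights t : {ae P, forall w, (forall i, 0 < w_ t w i) /\ \sum_i w_ t w i = 1}.
Proof.
elim: t => [|t ih].
  apply: nearW => w; split.
    by move=> i; rewrite WE_w0 invr_gt0 ltr0n WE_N.
  under eq_bigr do rewrite WE_w0.
  by rewrite sumr_const card_ord -[LHS]mulr_natr mulVf// pnatr_eq0 -lt0n WE_N.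
apply: filterS3 ih (WE_children t) (WE_binsum t) => w [w0 w1] [nE ch] bs.
have E j : w_ t.+1 w j = child_weight t w (par t w j).
  by rewrite WE_wS; have [_ ->] := ch j.
have N0 i : 0 < (Nall t w (bin t w i))%:R :> R.
  by rewrite ltr0n; exact: WE_Nall1 (bin_nonempty_self t w i).
split.
  move=> j; rewrite E divr_gt0// /bin_weight (bigD1 (par t w j))//=.
  by apply: ltr_wpDr; [apply: sumr_ge0 => i _; exact: ltW|exact: w0].
under eq_bigr do rewrite E.
rewrite (sum_fibers _ nE) -[RHS]w1 !(sum_nonempty t w); apply: eq_bigr => u.
move=> /existsP[k /eqP ku].
rewrite (eq_bigr (fun i => bw t w u / (Nall t w u)%:R * (num t w i)%:R)); last first.
  by move=> i /eqP iu; rewrite -[LHS]mulr_natr /child_weight iu.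
rewrite -mulr_sumr -natr_sum bs mulfVK//.
by have := N0 k; rewrite ku => /lt0r_neq0.
Qed.

Lemma WE_child_weight t : {ae P, forall w, forall i, 0 < child_weight t w i <= 1}.
Proof.
apply: filterS (WE_weights t) => w [w0 w1] i.
have N1 : (1 <= Nall t w (bin t w i))%N by exact: WE_Nall1 (bin_nonempty_self t w i).
have N0 : 0 < (Nall t w (bin t w i))%:R :> R by rewrite ltr0n.
have b0 : 0 < bw t w (bin t w i).
  rewrite /bin_weight (bigD1 i)//=.
  by apply: ltr_wpDr; [apply: sumr_ge0 => k _; exact: ltW|exact: w0].
rewrite divr_gt0//= ler_pdivrMr// mul1r.
apply: (@le_trans _ _ 1); last by rewrite ler1n.
rewrite -w1 /bin_weight [leRHS](bigID (fun k => bin t w k == bin t w i))/=.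
by rewrite lerDl; apply: sumr_ge0 => k _; exact: ltW.
Qed.

End WE_particle_system.

Lemma integral_indic_setT d (T : measurableType d) (R : realType)
    (P : {measure set T -> \bar R}) (A : set T) : measurable A ->
  (\int[P]_x (\1_A x)%:E = P A)%E.
Proof. by move=> mA; rewrite integral_indic// setIT. Qed.

(** * Restriction of a weighted ensemble to an initial event *)

Section WE_restricted_system.
Context {R : realType} {d : measure_display} {X : measurableType d}.
Variables (K : R.-pker X ~> X) (V : X -> \bar R) (N : nat).
Context {d' : measure_display} {Om : measurableType d'}.
Variables (P : probability Om R) (mu0 : probability X R) (m : WEdata R N X Om).
Hypothesis HW : is_WE_method K P mu0 m.
Variable A : set Om.
Hypothesis FA : WF m 0 A.

Local Notation F := (WF m).
Local Notation Fh := (WFh m).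
Local Notation xi := (Wxi m).
Local Notation xih := (Wxih m).
Local Notation w_ := (Ww m).
Local Notation cw := (child_weight m).
Local Notation Cf := (Cfac m).
Implicit Types (t : nat) (i j u : 'I_N) (w : Om).

Definition clamp (x : R) := Num.min (Num.max x 0) 1.

Lemma clamp_ge0 x : 0 <= clamp x.
Proof. by rewrite le_min ler01 andbT le_max lexx orbT. Qed.

Lemma clamp_le1 x : clamp x <= 1.
Proof. by rewrite ge_min lexx orbT. Qed.

Lemma clamp_id x : 0 <= x <= 1 -> clamp x = x.
Proof. by move=> /andP[x0 x1]; rewrite /clamp max_l// min_l. Qed.

Lemma measurable_clamp : measurable_fun setT clamp.
Proof. by apply: measurable_minr => //; exact: measurable_maxr. Qed.

(* Weights cut off outside an event of the initial sigma-algebra; [clamp] changes them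
   on a null set only and makes them bounded everywhere. *)
Definition cweight t w i : R := \1_A w * clamp (w_ t w i).

Let sF t := WE_F HW t.
Let sFh t := WE_Fh HW t.

Lemma WE_F_mono t : F 0 `<=` F t.
Proof. by elim: t => [//|t ih] B /ih /(WE_FFh HW)/(WE_FhF HW). Qed.

Let G1A t : Gmeas (F t) (\1_A : Om -> R).
Proof. exact: (Gmeas_indic (sF t) (WE_F_mono t FA)). Qed.
Let G1Ah t : Gmeas (Fh t) (\1_A : Om -> R).
Proof. exact: (Gmeas_sub (WE_FFh HW (t := t)) (G1A t)). Qed.

Lemma WE_w_le1 t : {ae P, forall w, (forall i, 0 < w_ t w i <= 1) /\ \sum_i w_ t w i = 1}.
Proof.
apply: filterS (WE_weights HW t) => w [w0 w1]; split => // i; rewrite w0/= -w1.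
by rewrite (bigD1 i)//= lerDl; apply: sumr_ge0 => k _; exact: ltW.
Qed.

Let I0 w : 0 <= (\1_A w : R). Proof. by []. Qed.

Let cw0 t w i : 0 <= cweight t w i.
Proof. by rewrite /cweight mulr_ge0// clamp_ge0. Qed.

Let Gc t i : Gmeas (F t) (fun w => cweight t w i).
Proof.
exact: (GmeasM (sF t) (G1A t) (Gmeas_comp measurable_clamp (WE_w HW t i))).
Qed.

Let Gch t i : Gmeas (Fh t) (fun w => cweight t.+1 w i).
Proof.
apply: (GmeasM (sFh t) (G1Ah t)).
rewrite (_ : (fun w => _) = clamp \o (fun w => Wwh m t w i)).
  exact: (Gmeas_comp measurable_clamp (WE_wh HW t i)).
by apply/funext => w; rewrite /= (WE_wS HW).
Qed.

(** A parent has C_i children on average, each of weight w(u)/N(u), and the product of these two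
    numbers is w_i. *)
Let sel t (H : Om -> \bar R) (g : X -> \bar R) :
    Gmeas (F t) H -> (forall w, 0 <= H w)%E ->
    measurable_fun setT g -> (forall x, 0 <= g x)%E ->
    (\int[P]_w (H w * \sum_j (cweight t.+1 w j)%:E * g (xih t w j)) =
     \int[P]_w (H w * \sum_i (cweight t w i)%:E * g (xi t w i)))%E.
Proof.
move=> mH H0 mg g0.
have mHT := Gmeas_measurable (sF t) mH.
have c0 t' w i x : (0 <= (cweight t' w i)%:E * g x)%E by rewrite mule_ge0// lee_fin.
have mxi i : measurable_fun setT (fun w => g (xi t w i)).
  exact: (measurableT_comp mg (Gmeas_measurable (sF t) (WE_xi HW t i))).
have mxih i : measurable_fun setT (fun w => g (xih t w i)).
  exact: (measurableT_comp mg (Gmeas_measurable (sFh t) (WE_xih HW t i))).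
have mc t' i : measurable_fun setT (fun w => (cweight t' w i)%:E).
  by apply/measurable_EFinP; exact: (Gmeas_measurable (sF t') (Gc t' i)).
pose a i w : R := \1_A w * clamp (cw t w i).
have a0 i w : 0 <= a i w by rewrite mulr_ge0// clamp_ge0.
have Ga i : Gmeas (F t) (fun w => (a i w)%:E).
  apply: (Gmeas_EFin (sF t)).
  exact: (GmeasM (sF t) (G1A t) (Gmeas_comp measurable_clamp (Gmeas_child_weight HW t i))).
pose G i w := (H w * ((a i w)%:E * g (xi t w i)))%E.
have GG i : Gmeas (F t) (G i).
  apply: (GmeasMe (sF t) mH); apply: (GmeasMe (sF t) (Ga i)).
  exact: (Gmeas_comp mg (WE_xi HW t i)).
have G0 i w : (0 <= G i w)%E by rewrite mule_ge0// mule_ge0// lee_fin.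
rewrite (integral_children HW (t := t) (G := G)) //; first last.
- apply: filterS (WE_children HW t) => w [_ ch].
  rewrite ge0_sume_distrr; last by move=> j _; exact: c0.
  apply: eq_bigr => j _; have [exi ew] := ch j.
  by rewrite /G /a /cweight exi (WE_wS HW) ew.
- by move=> w; rewrite mule_ge0// sume_ge0.
- apply: emeasurable_funM => //; apply: emeasurable_sum => j.
  by apply: emeasurable_funM; [exact: mc|exact: mxih].
apply: ge0_ae_eq_integral => //.
- apply: emeasurable_sum => i; apply: emeasurable_funM.
    by apply/measurable_EFinP; exact: (Gmeas_measurable (sF t) (WE_Cf HW t i)).
  exact: (Gmeas_measurable (sF t) (GG i)).
- apply: emeasurable_funM => //; apply: emeasurable_sum => j.
  by apply: emeasurable_funM; [exact: mc|exact: mxi].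
- move=> w _; apply: sume_ge0 => i _; rewrite mule_ge0// lee_fin ltW//.
  exact: (WE_Cf0 HW).
- by move=> w _; rewrite mule_ge0// sume_ge0.
apply: filterS2 (WE_w_le1 t) (WE_child_weight HW t) => w [w1 _] cwb _.
rewrite ge0_sume_distrr; last by move=> j _; exact: c0.
apply: eq_bigr => i _; rewrite /G muleCA; congr (_ * _)%E.
rewrite muleA -EFinM; congr (_%:E * _)%E.
have /andP[w0 wl] := w1 i; have /andP[cw00 cwl] := cwb i.
have e1 : clamp (cw t w i) = cw t w i by rewrite clamp_id// ltW.
have e2 : clamp (w_ t w i) = w_ t w i by rewrite clamp_id// ltW.
rewrite /a /cweight e1 e2 mulrCA; congr (_ * _).
have b0 := bw_neq0 HW t w i.
have N1 : (1 <= Wall m t w (Wbin m t w i))%N.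
  exact: (WE_Nall1 HW (bin_nonempty_self m t w i)).
by rewrite /Cfac /child_weight; field; rewrite b0 pnatr_eq0 -lt0n N1.
Qed.

Let mut_ind t (B : 'I_N -> set X) H : Gmeas (Fh t) H -> (forall w, 0 <= H w)%E ->
  (forall j, measurable (B j)) ->
  (\int[P]_w (H w * (\1_[set w | forall j, B j (xi t.+1 w j)] w)%:E) =
   \int[P]_w (H w * (\prod_j fine (K (xih t w j) (B j)))%:E))%E.
Proof.
move=> mH H0 mB.
have mBs : measurable [set w | forall j, B j (xi t.+1 w j)].
  rewrite (_ : [set _ | _] = \bigcap_(j in [set: 'I_N]) ((fun w => xi t.+1 w j) @^-1` B j)).
    apply: fin_bigcap_measurable; first exact: finite_finset.
    move=> j _; rewrite -[X in measurable X]setTI.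
    exact: (Gmeas_measurable (sF t.+1) (WE_xi HW t.+1 j) measurableT (mB j)).
  by apply/seteqP; split => [w /= h j _|w /= h j]; [exact: h|exact: (h j I)].
apply: (eq_integral_sub_sigma (sFh t)) => //.
- exact/measurable_EFinP/measurable_indic.
- apply/measurable_EFinP; apply: measurable_prod => j _.
  apply: (measurableT_comp (f := fine)) => //.
  apply: (measurableT_comp (measurable_kernel K (B j) (mB j))).
  exact: (Gmeas_measurable (sFh t) (WE_xih HW t j)).
- by move=> w; rewrite lee_fin prodr_ge0// => j _; rewrite fine_ge0.
move=> C FC; rewrite -(WE_evolution HW FC mB) integral_mkcond.
have mC : measurable C by exact: (sFh t).2.
rewrite -[RHS](integral_indic_setT P (measurableI _ _ mC mBs)).
apply: eq_integral => w _; rewrite patchE indicI/=.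
by case: ifPn => wC; rewrite !indicE ?wC ?mul1r// (negbTE wC) mul0r.
Qed.

Let fineK1 x B : measurable B -> (fine (K x B))%:E = K x B.
Proof.
move=> mB; rewrite fineK// ge0_fin_numE//.
apply: (@le_lt_trans _ _ (K x setT)); last by rewrite prob_kernel ltry.
by apply: le_measure; rewrite ?inE.
Qed.

Let mxi t i : measurable_fun setT (fun w => xi t w i).
Proof. exact: (Gmeas_measurable (sF t) (WE_xi HW t i)). Qed.
Let mxih t i : measurable_fun setT (fun w => xih t w i).
Proof. exact: (Gmeas_measurable (sFh t) (WE_xih HW t i)). Qed.

Let mdirac t j U : measurable U ->
  measurable_fun setT (fun w => (\d_(xi t w j) : {measure set X -> \bar R}) U).
Proof.
move=> mU; rewrite /dirac/=; apply/measurable_EFinP.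
by apply: (measurableT_comp _ (mxi t j)); exact: measurable_indic.
Qed.

Let mKxih t j U : measurable U -> measurable_fun setT (fun w => K (xih t w j) U).
Proof. by move=> mU; exact: (measurableT_comp (measurable_kernel K U mU) (mxih t j)). Qed.

Let int_dirac t j w (g : X -> \bar R) : measurable_fun setT g ->
  (\int[\d_(xi t w j)]_x g x = g (xi t w j))%E.
Proof. by move=> mg; rewrite integral_dirac// diracT mul1e. Qed.

(* Replacing an indicator by an arbitrary nonnegative function in one of the
   particles; the weights A1, A2 may involve another particle. *)
Let mut_lift t j (A1 A2 : Om -> \bar R) (g : X -> \bar R) :
  measurable_fun setT A1 -> measurable_fun setT A2 ->
  (forall w, 0 <= A1 w)%E -> (forall w, 0 <= A2 w)%E ->
  (forall B, measurable B -> \int[P]_w (A1 w * (\1_B (xi t.+1 w j))%:E) =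
     \int[P]_w (A2 w * K (xih t w j) B))%E ->
  measurable_fun setT g -> (forall x, 0 <= g x)%E ->
  (\int[P]_w (A1 w * g (xi t.+1 w j)) = \int[P]_w (A2 w * Kpos K 1 g (xih t w j)))%E.
Proof.
move=> mA1 mA2 A10 A20 h mg g0.
have := @eq_integral_kernel _ _ Om X R P A1 A2 (fun w => \d_(xi t.+1 w j))
  (fun w => K (xih t w j)) mA1 mA2 A10 A20 (@mdirac t.+1 j) (@mKxih t j) h g mg g0.
by under eq_integral do rewrite int_dirac//.
Qed.

Let prod1 t j (B : set X) w : measurable B ->
  (\prod_k fine (K (xih t w k) (if k == j then B else setT)))%:E = K (xih t w j) B.
Proof.
move=> mB; rewrite (bigD1 j)//= eqxx big1 ?mulr1 ?fineK1// => k kj.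
by rewrite (negbTE kj) prob_kernel.
Qed.

Let prod2 t i j (B B' : set X) w : i != j -> measurable B -> measurable B' ->
  (\prod_k fine (K (xih t w k) (if k == i then B else if k == j then B' else setT)))%:E =
  (K (xih t w i) B * K (xih t w j) B')%E.
Proof.
move=> ij mB mB'; have ji : j == i = false by rewrite eq_sym (negbTE ij).
rewrite (bigD1 i)//= eqxx (bigD1 j)/=; last by rewrite ji.
rewrite ji eqxx big1 ?mulr1; last first.
  by move=> k /andP[ki kj]; rewrite (negbTE ki) (negbTE kj) prob_kernel.
by rewrite EFinM !fineK1.
Qed.

Let mut1 t j (H : Om -> \bar R) (g : X -> \bar R) :
    Gmeas (Fh t) H -> (forall w, 0 <= H w)%E ->
    measurable_fun setT g -> (forall x, 0 <= g x)%E ->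
    (\int[P]_w (H w * g (xi t.+1 w j)) =
     \int[P]_w (H w * Kpos K 1 g (xih t w j)))%E.
Proof.
move=> mH H0 mg g0; have mHT := Gmeas_measurable (sFh t) mH.
apply: mut_lift => // B mB.
have := mut_ind (B := fun k => if k == j then B else setT) mH H0.
move=> /(_ ltac:(by move=> k; case: ifP)) E.
under [RHS]eq_integral => w _ do rewrite -prod1//.
rewrite -E; apply: eq_integral => w _; congr (_ * (_)%:E)%E.
rewrite !indicE; congr (_%:R); congr nat_of_bool; apply/idP/idP; rewrite !inE.
  by move=> Bj k; case: eqP => // ->.
by move=> /(_ j); rewrite eqxx.
Qed.

(** The particles other than [i] and [j] are left free by taking the whole space in the product law;
    [mut_lift] is used twice, once for each of the two functions. *)
Let mut2 t i j (H : Om -> \bar R) (g g' : X -> \bar R) : i != j ->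
    Gmeas (Fh t) H -> (forall w, 0 <= H w)%E ->
    measurable_fun setT g -> (forall x, 0 <= g x)%E ->
    measurable_fun setT g' -> (forall x, 0 <= g' x)%E ->
    (\int[P]_w (H w * (g (xi t.+1 w i) * g' (xi t.+1 w j))) =
     \int[P]_w (H w * (Kpos K 1 g (xih t w i) * Kpos K 1 g' (xih t w j))))%E.
Proof.
move=> ij mH H0 mg g0 mg' g'0; have mHT := Gmeas_measurable (sFh t) mH.
have mKg' := measurable_Kpos K 1 mg' g'0.
have Kg'0 x : (0 <= Kpos K 1 g' x)%E by exact: Kpos_ge0.
under eq_integral do rewrite [X in (_ * X)%E]muleC muleA.
under [in RHS]eq_integral do rewrite [X in (_ * X)%E]muleC muleA.
apply: mut_lift => //.
- by apply: emeasurable_funM => //; exact: (measurableT_comp mg' (mxi t.+1 j)).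
- by apply: emeasurable_funM => //; exact: (measurableT_comp mKg' (mxih t j)).
- by move=> w; rewrite mule_ge0.
- by move=> w; rewrite mule_ge0.
move=> B mB.
under eq_integral do rewrite muleAC.
under [in RHS]eq_integral do rewrite muleAC.
apply: mut_lift => //.
- apply: emeasurable_funM => //; apply/measurable_EFinP.
  by apply: (measurableT_comp _ (mxi t.+1 i)); exact: measurable_indic.
- by apply: emeasurable_funM => //; exact: mKxih.
- by move=> w; rewrite mule_ge0.
- by move=> w; rewrite mule_ge0.
move=> B' mB'.
have := mut_ind (B := fun k => if k == i then B else if k == j then B' else setT) mH H0.
move=> /(_ ltac:(by move=> k; case: ifP => // _; case: ifP)) E.
under [RHS]eq_integral => w _ do rewrite -muleA -(prod2 _ _ ij)//.
rewrite -E; apply: eq_integral => w _; rewrite -muleA -EFinM; congr (_ * (_)%:E)%E.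
rewrite !indicE -natrM mulnb; congr (_%:R); congr nat_of_bool.
apply/andP/idP; rewrite !inE.
  by move=> [Bi Bj] k; case: eqP => [->//|_]; case: eqP => // ->.
by move=> h; split; [have := h i|have := h j]; rewrite eqxx// eq_sym (negbTE ij).
Qed.

Lemma WE_system : (\int[P]_w (\sum_i (cweight 0 w i)%:E * V (xi 0 w i)) < +oo)%E ->
  particle_system K V P F Fh xi xih cweight.
Proof.
move=> hV; split=> //.
- exact: (WE_FFh HW).
- exact: (WE_FhF HW).
- exact: (WE_xi HW).
- exact: (WE_xih HW).
- by move=> t w i; rewrite /cweight mulr_ile1// ?clamp_ge0 ?clamp_le1// indicE; case: (_ \in _).
- move=> t; apply: filterS (WE_w_le1 t) => w [w0 <-].
  apply: ler_sum => i _; have /andP[w00 w01] := w0 i.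
  rewrite /cweight clamp_id ?(ltW w00)// ler_piMl// ?(ltW w00)//. 
Qed.

Lemma cweight_ae t : {ae P, forall w, (forall i, cweight t w i = \1_A w * w_ t w i) /\
   \sum_i cweight t w i = \1_A w}.
Proof.
apply: filterS (WE_w_le1 t) => w [w0 w1].
have E i : cweight t w i = \1_A w * w_ t w i.
  by have /andP[w00 w01] := w0 i; rewrite /cweight clamp_id ?(ltW w00).
by split => //; under eq_bigr do rewrite E; rewrite -mulr_sumr w1 mulr1.
Qed.

End WE_restricted_system.

(** * The lower bound *)

Section limits.
Context {R : realType}.

Lemma limn_einf_ge (u : nat -> \bar R) (b C : R) :
  (forall T, (0 < T)%N -> ((b - C / T%:R)%:E <= u T)%E) -> (b%:E <= limn_einf u)%E.
Proof.
move=> h; apply/lee_subgt0Pr => e e0.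
pose n := (Num.truncn (`|C| / e)).+1.
have n0 : 0 < n%:R :> R by rewrite ltr0n.
have Cn T : (n <= T)%N -> C / T%:R <= e.
  move=> nT; have T0 : 0 < T%:R :> R by apply: lt_le_trans n0 _; rewrite ler_nat.
  rewrite ler_pdivrMr//; apply: le_trans (ler_norm _) _.
  rewrite -ler_pdivrMl// mulrC; apply: (@le_trans _ _ n%:R); last by rewrite ler_nat.
  by apply: ltW; exact: truncnS_gt.
have le1 : limn (einfs u) = ereal_sup (range (einfs u)).
  by apply/cvg_lim => //; exact: cvg_einfs_sup.
rewrite limn_einf_lim le1.
apply: (@le_trans _ _ (einfs u n)); last by apply: ereal_sup_ubound; exists n.
apply: le_ereal_inf_tmp => _ [T /= nT <-].
apply: le_trans (h T _); last by apply: leq_trans nT.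
by rewrite -EFinB lee_fin lerB// Cn.
Qed.

Lemma limn_esup_le (u : nat -> \bar R) (b C : R) :
  (forall T, (0 < T)%N -> (u T <= (b + C / T%:R)%:E)%E) -> (limn_esup u <= b%:E)%E.
Proof.
move=> h; rewrite -leeN2 -limn_einfN -EFinN; apply: (@limn_einf_ge _ _ C) => T T0.
by rewrite /= leeNr -EFinN opprB opprK addrC; exact: h.
Qed.

Lemma sum_geometric_le (r : R) T : 0 <= r < 1 ->
  \sum_(0 <= t < T) r ^+ t <= (1 - r)^-1.
Proof.
move=> /andP[r0 r1].
have -> : \sum_(0 <= t < T) r ^+ t = series (geometric 1 r) T.
  by apply: eq_bigr => t _; rewrite /= mul1r.
rewrite geometric_seriesE ?lt_eqF//= mul1r ler_piMl ?invr_ge0 ?subr_ge0 ?(ltW r1)//.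
by rewrite gerBl exprn_ge0.
Qed.

End limits.

Lemma evar_ex d (Om : measurableType d) (R : realType) (P : probability Om R) (Y : Om -> R) :
  L2 P Y -> evar P Y = (ex P (fun w => (Y w - ex P Y) ^+ 2))%:E.
Proof.
move=> LY; rewrite /evar ifT; last exact: integrable_lty (L2_sqr LY).
congr EFin; rewrite -[fine _]/(ex P _) -[X in _ - X ^+ 2]/(ex P _).
have := ex_sqrD LY (L2_cst P (- ex P Y)).
under [X in _ = _ + 2 * X + _]eq_ex do rewrite mulrC.
rewrite exZ; last exact: L2_itg.
by rewrite ex_cst => ->; ring.
Qed.

(** When the second moment is infinite, [evar] is [+oo] by convention and a lower bound is
    trivial. *)
Lemma evar_L2 d (Om : measurableType d) (R : realType) (P : probability Om R) (Y : Om -> R) :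
  measurable_fun setT Y -> L2 P Y \/ evar P Y = +oo%E.
Proof.
move=> mY; rewrite /evar; case: ifPn => h; [left|by right].
split=> //; apply/integrableP; split.
  by apply/measurable_EFinP; exact: measurable_funX.
by under eq_integral => w _ do rewrite /= ger0_norm ?sqr_ge0//.
Qed.

Section lower_bound.
Context {R : realType} {d : measure_display} {X : measurableType d}.
Variables (K : R.-pker X ~> X) (V : X -> \bar R) (N : nat).
Context {d' : measure_display} {Om : measurableType d'}.
Variables (P : probability Om R) (mu0 : probability X R) (m : WEdata R N X Om).
Hypothesis HW : is_WE_method K P mu0 m.
Variables (mu : probability X R) (CV D r : R).
Hypothesis Hs : sqrtV_ergodic K mu V CV D r.
Local Notation cls := (V_class V).
Variables (c : R) (f : X -> R).
Hypothesis c0 : 0 < c.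
Hypothesis cf : cls c f.
Implicit Types (t : nat) (i j : 'I_N) (w : Om).

Local Notation xi := (Wxi m).
Local Notation xih := (Wxih m).
Local Notation h := (h_fun K mu f).
Local Notation v := (v_fun K mu f).
Local Notation G := (h_const D r c).

Let CV0 : 0 < CV. Proof. by apply: lt_le_trans (sv_C Hs). Qed.
Let mf : measurable_fun setT f. Proof. by case: cf. Qed.

Lemma h_const_gt0 : 0 < G.
Proof.
have r0 := sv_r0 Hs; have r1 := sv_r1 Hs.
apply: divr_gt0; first by rewrite mulr_gt0// (sv_D Hs).
rewrite exprn_gt0// subr_gt0 -(ltr_pXn2r (n := 2))// ?nnegrE ?sqrtr_ge0//.
by rewrite sqr_sqrtr ?(ltW r0)// ?expr1n.
Qed.
Let G0 := h_const_gt0.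

Lemma var1_h x : (V x < +oo)%E -> var1 K h x = v x ^+ 2.
Proof.
move=> Vx; rewrite (v_fun_sqr Hs c0 cf Vx) /var1 Kt_ex//.
exact: L2_sqr (V_class_L2K Hs 1 Vx (V_class_h_fun Hs c0 cf)).
Qed.

Lemma measurable_WE_sum T : measurable_fun setT
  (fun w => \sum_(0 <= t < T) \sum_i Ww m t w i * f (xi t w i)).
Proof.
apply: measurable_sum => t; apply: measurable_sum => i; apply: measurable_funM.
  exact: (Gmeas_measurable (WE_F HW t) (WE_w HW t i)).
exact: (measurableT_comp mf (Gmeas_measurable (WE_F HW t) (WE_xi HW t i))).
Qed.

Variable A : set Om.
Hypothesis FA : WF m 0 A.
Local Notation cwt := (cweight m A).
Hypothesis hV : (\int[P]_w (\sum_i (cwt 0 w i)%:E * V (xi 0 w i)) < +oo)%E.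
Let PS := WE_system HW FA hV.
Local Notation W := (wsum xi cwt).
Local Notation Wh := (wsumh xih cwt).
Let ch : cls G h := V_class_h_fun Hs c0 cf.
Let cv : cls (G * CV) v := V_class_v_fun Hs c0 cf.

Let mA : measurable A. Proof. exact: (WE_F HW 0).2. Qed.

Let c1 : cls 1 (fun=> 1).
Proof.
have := @V_class_bounded _ _ _ K mu V CV D r Hs 1 (fun=> 1) ltr01 (measurable_cst _).
by rewrite expr1n; apply => x; rewrite normr1.
Qed.

Lemma L2_indic : L2 P (\1_A : Om -> R).
Proof.
apply: (@le_L2 _ _ _ P (fun=> 1)); [exact: measurable_indic| |exact: L2_cst].
by move=> w; rewrite indicE; case: (_ \in _); rewrite ?normr0 ?normr1.
Qed.

(** In the cut-off system W_t(1) is almost surely the indicator of [A], so centring [f] costs mu(f)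
    per time step, on [A] only. *)
Lemma W_sum T : {ae P, forall w,
  \1_A w * (\sum_(0 <= t < T) \sum_i Ww m t w i * f (xi t w i)) =
  (T%:R * ex mu f * \1_A w + W 0 h w + \sum_(0 <= t < T) Dinc K xi cwt t h w) - W T h w}.
Proof.
have tel := telescope_poisson PS Hs T G0 ch (fun x Vx => poisson_eq Hs c0 cf Vx).
have ae1 : {ae P, forall w, \sum_(0 <= t < T) W t (fun x => f x - ex mu f) w =
    \1_A w * (\sum_(0 <= t < T) \sum_i Ww m t w i * f (xi t w i)) - T%:R * ex mu f * \1_A w}.
  elim: T {tel} => [|T ih].
    by apply: nearW => w; rewrite !big_geq// mulr0 !mul0r subrr.
  apply: filterS2 ih (cweight_ae HW A T) => w ih [e1 e2].
  rewrite !big_nat_recr//= ih {ih}.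
  have -> : W T (fun x => f x - ex mu f) w =
      \1_A w * (\sum_i Ww m T w i * f (xi T w i)) - ex mu f * \1_A w.
    rewrite -[X in _ - _ * X]e2 2!mulr_sumr -sumrB; apply: eq_bigr => i _.
    by rewrite e1; ring.
  by rewrite -natr1; ring.
apply: filterS2 tel ae1 => w e1 e2.
have := e1; rewrite e2 => /eqP; rewrite subr_eq => /eqP ->; ring.
Qed.

Lemma ex_W0_cst : ex P (W 0 (fun=> 1)) = ex P (\1_A).
Proof.
apply: ex_ae.
- apply: measurable_sum => i; apply: measurable_funM => //.
  exact: (Gmeas_measurable (ps_F PS 0) (ps_c PS 0 i)).
- exact: measurable_indic.
- apply: filterS (cweight_ae HW A 0) => w [_ <-].
  by apply: eq_bigr => i _; rewrite mulr1.
Qed.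

(** The selection part is dropped. After Cauchy-Schwarz over the N particles, Jensen bounds the
    second moment of Wh_t(v) below by the square of its mean, which unbiasedness carries back to
    time 0 as the mean of W_0(K^t v). *)
Lemma ex_Dinc_lower t :
  (ex P (\1_A) * ex mu v + ex P (W 0 (fun x => Kt K t v x - ex mu v))) ^+ 2 / N%:R
  <= ex P (fun w => Dinc K xi cwt t h w ^+ 2).
Proof.
have GCV : 0 < G * CV by rewrite mulr_gt0.
have N0 : 0 < N%:R :> R by rewrite ltr0n (WE_N HW).
rewrite (ex_Dinc_sqr PS Hs t G0 ch) (ex_Dmut_sqr PS Hs t G0 ch).
apply: ler_wpDr; first by apply: ex_ge0 => w; exact: sqr_ge0.
have ivar j : itg P (fun w => cwt t.+1 w j ^+ 2 * var1 K h (xih t w j)).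
  by have [] := mut_var PS Hs t j G0 ch.
rewrite -ex_sum//.
have LWh : L2 P (Wh t v) := L2_Wh PS Hs t (ltW GCV) cv.
apply: (@le_trans _ _ (ex P (fun w => N%:R^-1 * Wh t v w ^+ 2))); last first.
  apply: le_ex_ae.
  - by apply: itgZ; exact: L2_sqr.
  - exact: itg_sum.
  - apply: filterS (ae_Vh PS Hs t) => w Vw.
    rewrite (eq_bigr (fun j => (cwt t.+1 w j * v (xih t w j)) ^+ 2)); last first.
      move=> j _; have [->|cj] := eqVneq (cwt t.+1 w j) 0; first by rewrite !mul0r expr0n mul0r.
      by rewrite var1_h ?exprMn//; exact: Vw.
    rewrite ler_pdivrMl// /wsumh.
    set y := fun j => cwt t.+1 w j * v (xih t w j).
    (* Cauchy-Schwarz, as nonnegativity of the sum of the squares of N y_j - S. *)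
    have : 0 <= \sum_j (N%:R * y j - \sum_k y k) ^+ 2 by apply: sumr_ge0 => j _; exact: sqr_ge0.
    rewrite (eq_bigr (fun j => N%:R ^+ 2 * y j ^+ 2 - 2 * N%:R * (\sum_k y k) * y j
       + (\sum_k y k) ^+ 2)); last by move=> j _; ring.
    rewrite !big_split/= sumrN -!mulr_sumr sumr_const card_ord -mulr_natr.
    set S := \sum_k y k; set Q := \sum_j y j ^+ 2 => hh.
    rewrite -(ler_pM2l N0); nra.
rewrite exZ; last exact: L2_sqr.
rewrite mulrC; apply: ler_wpM2l; first by rewrite invr_ge0 ltW.
apply: le_trans (ex_sqr_ge LWh); rewrite le_eqVlt; apply/orP; left; apply/eqP; congr (_ ^+ 2).
have Lv : L2 P (W t v) := L2_W PS Hs t (ltW GCV) cv.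
have := orth_sel PS Hs GCV cv (L2_cst P 1) (Gmeas_cst (ps_F PS t) (1 : R)).
under eq_ex do rewrite mul1r.
rewrite exB; [|exact: L2_itg|exact: L2_itg].
move=> /eqP; rewrite subr_eq0 => /eqP ->.
have := ex_W PS Hs 0 t GCV cv; rewrite add0n => ->.
rewrite mulrC -ex_W0_cst -exZ; last first.
  apply: itg_sum => i; apply: L2_itg.
  exact: (L2_term PS Hs 0 i ler01 c1).
rewrite -exD; last 2 first.
- apply: itgZ; apply: itg_sum => i; apply: L2_itg.
  exact: (L2_term PS Hs 0 i ler01 c1).
- apply: L2_itg; apply: (L2_W PS Hs 0 _ (V_class_dev Hs t GCV cv)).
  by rewrite mulr_ge0 ?exprn_ge0 ?(ltW (sv_r0 Hs))// mulr_ge0 ?(ltW GCV) ?(ltW (sv_D Hs)).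
apply: eq_ex => w; rewrite /wsum mulr_sumr -big_split/=; apply: eq_bigr => i _; ring.
Qed.

Local Notation MVA := (MV V P xi cwt).

Lemma ex_W0_dev t : ex P (W 0 (fun x => Kt K t v x - ex mu v)) ^+ 2 <=
  G * CV * D * (CV * MVA) * r ^+ t.
Proof.
have GCV : 0 < G * CV by rewrite mulr_gt0.
have cd := V_class_dev Hs t GCV cv.
have p0 : 0 <= G * CV * D * r ^+ t.
  by rewrite mulr_ge0 ?exprn_ge0 ?(ltW (sv_r0 Hs))// mulr_ge0 ?(ltW GCV) ?(ltW (sv_D Hs)).
apply: le_trans (ex_sqr_ge (L2_W PS Hs 0 p0 cd)) _.
apply: le_trans (ex_W_sqr PS Hs 0 p0 cd) _.
by rewrite le_eqVlt; apply/orP; left; apply/eqP; ring.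
Qed.

(** The mean of the estimator is not known, but the gap between it and mu(f) only produces a
    constant multiple of the indicator of [A]. This is F_0-measurable, so it joins W_0(h) in the
    initial term, whose square is discarded. One factor 1 - k pays for the boundary term W_T(h), the
    other for the distance of the mean of W_t(v) from its limit. *)
Lemma evar_lower (k : R) : 0 < k -> k < 1 -> exists C : R, forall T, (0 < T)%N ->
  (((1 - k) ^+ 2 * (ex P (\1_A) * ex mu v) ^+ 2 / N%:R - C / T%:R)%:E <=
     (T%:R)%:E * evar P (WE_estimator m f T))%E.
Proof.
move=> k0 k1; have N0 : 0 < N%:R :> R by rewrite ltr0n (WE_N HW).
have r0 := sv_r0 Hs; have r1 := sv_r1 Hs.
have k10 : 0 <= 1 - k by rewrite subr_ge0 ltW.
set pm := ex P (\1_A) * ex mu v.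
pose B := G * CV * D * (CV * MVA).
have MV0 : 0 <= MVA := MV_ge0 PS Hs.
have B0 : 0 <= B.
  exact: mulr_ge0 (mulr_ge0 (mulr_ge0 (ltW G0) (ltW CV0)) (ltW (sv_D Hs)))
    (mulr_ge0 (ltW CV0) MV0).
exists ((1 - k) * (k^-1 * B * (1 - r)^-1 / N%:R) + k^-1 * (G * (CV * MVA))) => T T0.
have TR0 : 0 < T%:R :> R by rewrite ltr0n.
pose S w := \sum_(0 <= t < T) \sum_i Ww m t w i * f (xi t w i).
have mS : measurable_fun setT S := measurable_WE_sum T.
have estE : WE_estimator m f T = (fun w => T%:R^-1 * S w) by [].
have mest : measurable_fun setT (WE_estimator m f T).
  by rewrite estE; exact: measurable_funM.
have [LE|->] := evar_L2 P mest; last by rewrite gt0_muley ?leey// lte_fin.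
rewrite (evar_ex LE) -EFinM lee_fin.
have LS : L2 P S.
  have -> : S = (fun w => T%:R * WE_estimator m f T w).
    by apply/funext => w; rewrite estE mulVKf// gt_eqF.
  exact: L2Z.
pose sb := ex P S.
have estb : ex P (WE_estimator m f T) = T%:R^-1 * sb.
  by rewrite estE exZ//; exact: L2_itg.
have -> : T%:R * ex P (fun w => (WE_estimator m f T w - ex P (WE_estimator m f T)) ^+ 2) =
   T%:R^-1 * ex P (fun w => (S w - sb) ^+ 2).
  rewrite estb (@eq_ex _ _ _ P _ (fun w => (T%:R^-1) ^+ 2 * (S w - sb) ^+ 2)); last first.
    by move=> w; rewrite estE -mulrBr exprMn.
  rewrite exZ; last exact: L2_sqr (L2B LS (L2_cst P sb)).
  by rewrite expr2 -mulrA mulVKf// gt_eqF.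
have L2S := L2B LS (L2_cst P sb).
pose Z w := \1_A w * (S w - sb).
have mZ : measurable_fun setT Z.
  by apply: measurable_funM; [exact: measurable_indic|exact: L2_meas L2S].
have LZ : L2 P Z.
  apply: le_L2 L2S => // w; rewrite normrM ler_piMl// indicE.
  by case: (_ \in _); rewrite ?normr0 ?normr1.
pose Y w := (T%:R * ex mu f - sb) * \1_A w + W 0 h w.
have LY : L2 P Y.
  by apply: L2D; [apply: L2Z; exact: L2_indic|exact: (L2_W PS Hs 0 (ltW G0) ch)].
have GY : Gmeas (WF m 0) Y.
  have sF := ps_F PS 0; have [mh _] := ch.
  apply: (GmeasD sF); last exact: (Gmeas_W PS 0 mh).
  by apply: (GmeasM sF); [exact: Gmeas_cst|exact: (Gmeas_indic sF FA)].
have [LYD _ eYD] := @ex_sum_Dinc _ _ _ _ _ _ _ _ _ _ _ _ _ _ PS _ _ _ _ Hs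
  Y (fun=> G) (fun=> h) T LY GY (fun=> G0) (fun=> ch).
set YD := fun w => Y w + _ in LYD eYD.
have LWT : L2 P (W T h) := L2_W PS Hs T (ltW G0) ch.
have LWT' : L2 P (fun w => - 1 * W T h w) by exact: L2Z.
have ZE : ex P (fun w => Z w ^+ 2) = ex P (fun w => (YD w + - 1 * W T h w) ^+ 2).
  apply: ex_ae.
  - exact: measurable_funX.
  - by apply: measurable_funX; exact: L2_meas (L2D LYD LWT').
  - apply: filterS (W_sum T) => w e; congr (_ ^+ 2).
    rewrite /Z mulrBr e /YD /Y; ring.
have h1 : ex P (fun w => Z w ^+ 2) <= ex P (fun w => (S w - sb) ^+ 2).
  apply: le_ex; [exact: L2_sqr|exact: L2_sqr L2S|move=> w].
  rewrite /Z exprMn; apply: ler_piMl; first exact: sqr_ge0.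
  by rewrite indicE; case: (_ \in _); rewrite ?expr1n ?expr0n.
have h2 := ex_sqrD_ge k0 LYD LWT'; rewrite -ZE in h2.
have h3 : ex P (fun w => (- 1 * W T h w) ^+ 2) <= G * (CV * MVA).
  under eq_ex do rewrite mulN1r sqrrN.
  exact: (ex_W_sqr PS Hs T (ltW G0) ch).
have h30 : 0 <= ex P (fun w => (- 1 * W T h w) ^+ 2).
  by apply: ex_ge0 => w; exact: sqr_ge0.
have h4 : T%:R * ((1 - k) * pm ^+ 2 / N%:R) - k^-1 * B * (1 - r)^-1 / N%:R <=
   ex P (fun w => YD w ^+ 2).
  rewrite eYD; apply: ler_wpDl; first by apply: ex_ge0 => w; exact: sqr_ge0.
  apply: (@le_trans _ _ (\sum_(0 <= t < T) ((1 - k) * pm ^+ 2 / N%:R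
      - k^-1 * B / N%:R * r ^+ t))); last first.
    apply: ler_sum => t _; apply: le_trans (ex_Dinc_lower t).
    rewrite -/pm; set dl := ex P (W 0 _); have := ex_W0_dev t; rewrite -/dl -/B => hd.
    rewrite (_ : _ - _ = ((1 - k) * pm ^+ 2 - k^-1 * (B * r ^+ t)) / N%:R); last by ring.
    apply: ler_wpM2r; first by rewrite invr_ge0 ltW.
    have : k^-1 * dl ^+ 2 <= k^-1 * (B * r ^+ t) by apply: ler_wpM2l => //; rewrite invr_ge0 ltW.
    have : 0 <= k^-1 * (k * pm + dl) ^+ 2 by rewrite mulr_ge0 ?sqr_ge0// invr_ge0 ltW.
    rewrite (_ : k^-1 * (k * pm + dl) ^+ 2 = k * pm ^+ 2 + 2 * pm * dl + k^-1 * dl ^+ 2).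
      nra.
    by field; rewrite gt_eqF.
  rewrite sumrB sumr_const_nat subn0 -[X in _ <= X - _]mulr_natl -mulr_sumr lerB//.
  rewrite [leRHS]mulrAC; apply: ler_wpM2l.
    by rewrite mulr_ge0 ?invr_ge0 ?(ltW N0)// mulr_ge0 ?invr_ge0 ?(ltW k0).
  by apply: sum_geometric_le; rewrite (ltW r0).
rewrite [leRHS]mulrC ler_pdivlMr// mulrBl divfK ?gt_eqF//.
apply: le_trans h1; apply: le_trans h2.
have h5 : (1 - k) * (T%:R * ((1 - k) * pm ^+ 2 / N%:R) - k^-1 * B * (1 - r)^-1 / N%:R) <=
  (1 - k) * ex P (fun w => YD w ^+ 2) by apply: ler_wpM2l.
have h6 : (k^-1 - 1) * ex P (fun w => (- 1 * W T h w) ^+ 2) <= k^-1 * (G * (CV * MVA)).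
  apply: (@le_trans _ _ (k^-1 * ex P (fun w => (- 1 * W T h w) ^+ 2))).
    by rewrite mulrBl mul1r gerBl.
  by apply: ler_wpM2l => //; rewrite invr_ge0 ltW.
apply: le_trans (lerB h5 h6); rewrite le_eqVlt; apply/orP; left; apply/eqP; ring.
Qed.

End lower_bound.

(** Let A_n be the event that all initial particles lie in {V <= n}. On it the initial weighted sum
    of V is bounded, and P(A_n) is the N-th power of a quantity tending to 1. The bound obtained
    with A_n and k = 1/(n+2) concerns the same lower limit for every n, so n may tend to
    infinity. *)
Lemma WE_lower_bound (R : realType) (d : measure_display) (X : measurableType d)
  (K : R.-pker X ~> X) (mu : probability X R) (V : X -> \bar R) (CV D r c : R) (f : X -> R)
  (N : nat) (d' : measure_display) (Om : measurableType d') (P : probability Om R)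
  (mu0 : probability X R) (m : WEdata R N X Om) :
  sqrtV_ergodic K mu V CV D r -> 0 < c -> V_class V c f -> is_WE_method K P mu0 m ->
  mu0 [set x | (V x < +oo)%E] = 1%E ->
  ((mu_vf K mu f ^+ 2 / N%:R)%:E <=
        limn_einf (fun T : nat => (T%:R)%:E * evar P (WE_estimator m f T)))%E.
Proof.
move=> Hs c0 cf HW muV.
have mV := sv_meas Hs.
have V0 x : (0 <= V x)%E by apply: le_trans (sv_ge1 Hs x).
pose E n := [set x | (V x <= n%:R%:E)%E].
have mE n : measurable (E n).
  by rewrite -[E n]setTI; apply: measurable_lee => //; exact: measurable_cst.
pose p n := fine (mu0 (E n)).
have p_cvg : p n @[n --> \oo] --> (1 : R).
  have UE : \bigcup_n E n = [set x | (V x < +oo)%E].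
    apply/seteqP; split => [x [n _] /=|x /= Vx].
      by move=> h; apply: le_lt_trans h (ltry _).
    have Vf : V x = (fine (V x))%:E by rewrite fineK// ge0_fin_numE.
    exists (Num.truncn (fine (V x))).+1 => //=.
    by rewrite /E/= Vf lee_fin; apply: ltW; exact: truncnS_gt.
  have : mu0 (E n) @[n --> \oo] --> mu0 (\bigcup_n E n).
    apply: nondecreasing_cvg_mu => //; first exact: bigcupT_measurable.
    move=> a b ab; apply/subsetPset => x /= h; apply: le_trans h _.
    by rewrite lee_fin ler_nat.
  by rewrite UE muV => /fine_cvg.
pose A n := [set w | forall i, E n (Wxi m 0 w i)].
have FA n : WF m 0 (A n).
  have sF := WE_F HW 0.
  rewrite -(sub_sigmaE sF).
  rewrite (_ : A n = \bigcap_(i in [set: 'I_N]) ((fun w => Wxi m 0 w i) @^-1` E n)).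
    have mEi i : @measurable _ (g_sigma_algebraType (WF m 0))
        ((fun w => Wxi m 0 w i) @^-1` E n).
      rewrite /measurable/= (sub_sigmaE sF); exact: (WE_xi HW 0 i (mE n)).
    exact: (@fin_bigcap_measurable _ (g_sigma_algebraType (WF m 0)) 'I_N [set: 'I_N] _
      finite_finset (fun i _ => mEi i)).
  by apply/seteqP; split => [w /= h j _|w /= h j]; [exact: h|exact: (h j I)].
have PA n : ex P (\1_(A n)) = p n ^+ N.
  have mA : measurable (A n) by exact: (WE_F HW 0).2.
  rewrite /ex /Rintegral (integral_indic_setT P mA).
  have [_ [_ [_ [init _]]]] := HW.
  rewrite [X in fine X](_ : _ = (\prod_(i < N) fine (mu0 (E n)))%:E); last first.
    exact: (init (fun=> E n) (fun=> mE n)).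
  by rewrite /= prodr_const card_ord.
have hV n : (\int[P]_w (\sum_i (cweight m (A n) 0 w i)%:E * V (Wxi m 0 w i)) < +oo)%E.
  apply: (@le_lt_trans _ _ (\int[P]_w (cst ((\sum_(i < N) n%:R)%:E) w))%E); last first.
    by rewrite integral_cst// [X in (_ * X)%E]probability_setT mule1 ltry.
  have c_ge0 w i : 0 <= cweight m (A n) 0 w i by rewrite /cweight mulr_ge0// clamp_ge0.
  apply: ge0_le_integral_nonmeas.
    by move=> w; apply: sume_ge0 => i _; rewrite mule_ge0// lee_fin.
  move=> w; rewrite /cst -sumEFin; apply: lee_sum => i _.
  have [wA|wA] := boolP (w \in A n); last first.
    by rewrite /cweight indicE (negbTE wA) mul0r mul0e lee_fin.
  apply: (@le_trans _ _ (1%:E * V (Wxi m 0 w i))%E).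
    apply: lee_wpmul2r => //; rewrite lee_fin /cweight indicE wA mul1r; exact: clamp_le1.
  by rewrite mul1e; move: wA; rewrite inE; apply.
pose k n : R := n.+2%:R^-1.
have k0 n : 0 < k n by rewrite invr_gt0.
have k1 n : k n < 1 by rewrite invf_lt1// ltr1n.
have k_cvg : k n @[n --> \oo] --> (0 : R).
  by have := @cvg_harmonic R; rewrite -cvg_shiftS.
pose u n := (1 - k n) ^+ 2 * (p n ^+ N * mu_vf K mu f) ^+ 2 / N%:R.
have uE n : ((u n)%:E <= limn_einf (fun T : nat => (T%:R)%:E * evar P (WE_estimator m f T)))%E.
  have [C h] := evar_lower HW Hs c0 cf (FA n) (hV n) (k0 n) (k1 n).
  by apply: (@limn_einf_ge _ _ _ C) => T T0; have := h T T0; rewrite PA.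
have u_cvg : u n @[n --> \oo] --> mu_vf K mu f ^+ 2 / N%:R.
  rewrite [X in _ --> X](_ : _ = (1 - 0) ^+ 2 * (1 ^+ N * mu_vf K mu f) ^+ 2 / N%:R); last first.
    by rewrite subr0 !expr1n !mul1r.
  have sq (x : nat -> R) (l : R) : x n @[n --> \oo] --> l -> x n ^+ 2 @[n --> \oo] --> l ^+ 2.
    by move=> xl; rewrite expr2; under eq_fun do rewrite expr2; exact: cvgM.
  apply: cvgM; last exact: cvg_cst.
  apply: cvgM; first by apply: sq; apply: cvgB => //; exact: cvg_cst.
  apply: sq; apply: cvgM; last exact: cvg_cst.
  exact: (cvg_comp _ _ p_cvg (@exprn_continuous R N 1)).
have ue_cvg : (u n)%:E @[n --> \oo] --> (mu_vf K mu f ^+ 2 / N%:R)%:E.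
  by apply: cvg_EFin => //; exact: nearW.
rewrite -(cvg_lim _ ue_cvg)//; apply: lime_le; first by apply/cvg_ex; eexists; exact: ue_cvg.
exact: nearW.
Qed.

(** * The Ionescu-Tulcea theorem *)

Section path_space.
Context {d : measure_display} (S : measurableType d).

Definition coordinate_sets : set (set (nat -> S)) :=
  [set A | exists k B, measurable B /\ A = [set w | B (w k)]].

Definition traj := g_sigma_algebraType coordinate_sets.

Lemma measurable_coord k : measurable_fun [set: traj] (fun w : traj => w k).
Proof.
move=> _ B mB; rewrite setTI; apply: sub_sigma_algebra.
by exists k, B.
Qed.

Lemma measurable_into_path d' (T : measurableType d') (f : T -> traj) :
  (forall k, measurable_fun setT (fun x => f x k)) -> measurable_fun setT f.
Proof.
move=> mf; apply: (@measurability _ _ T traj setT f coordinate_sets) => //.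
move=> _ [_ [k [B [mB ->]]] <-]; rewrite setTI.
by have := mf k measurableT B mB; rewrite setTI.
Qed.

Definition upd (w : traj) (k : nat) (y : S) : traj := fun i => if i == k then y else w i.

Lemma measurable_upd k : measurable_fun setT (fun p : traj * S => upd p.1 k p.2).
Proof.
apply: measurable_into_path => i; rewrite /upd; case: eqP => _.
  exact: measurable_snd.
exact: (measurableT_comp (measurable_coord i) measurable_fst).
Qed.

Definition depends (k : nat) T (F : traj -> T) :=
  forall w w', (forall i, (i < k)%N -> w i = w' i) -> F w = F w'.

Lemma depends_mono k l T (F : traj -> T) : (k <= l)%N -> depends k F -> depends l F.
Proof. by move=> kl h w w' e; apply: h => i ik; apply: e; exact: leq_trans kl. Qed.

(** The sigma-algebra of the coordinates 0, ..., k-1, given directly by the measurable sets that do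
    not see the others, which avoids a generated sigma-algebra. *)
Definition Gk (k : nat) : set (set traj) := [set A | measurable A /\ depends k A].

Lemma Gk_sub_sigma k : sub_sigma (Gk k).
Proof.
split; last by move=> A [].
split.
- by split; first exact: measurable0.
- move=> A [mA dA]; split; first exact: measurableD.
  by move=> w w' e; rewrite /setD/= (dA w w' e).
- move=> U GU; split; first by apply: bigcupT_measurable => n; have [] := GU n.
  move=> w w' e; rewrite /bigcup/=; apply/propext; split => -[n _ h]; exists n => //.
    by have [_ dU] := GU n; rewrite -(dU w w' e).
  by have [_ dU] := GU n; rewrite (dU w w' e).
Qed.

Lemma Gk_mono k l : (k <= l)%N -> Gk k `<=` Gk l.
Proof. by move=> kl A [mA dA]; split => //; exact: depends_mono dA. Qed.

Lemma Gk_meas k d' (T : measurableType d') (F : traj -> T) :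
  measurable_fun setT F -> depends k F -> Gmeas (Gk k) F.
Proof.
move=> mF dF B mB; split; first by rewrite -[_ @^-1` _]setTI; exact: mF.
by move=> w w' e; rewrite /preimage/= (dF w w' e).
Qed.

End path_space.

Section ionescu_tulcea.
Context {d : measure_display} {S : measurableType d} {R : realType}.
Local Notation traj := (traj S).
Variable kap : nat -> R.-pker traj ~> S.
Hypothesis kap_dep : forall k, forall B, depends k (fun w => kap k w B).
Local Open Scope ereal_scope.
Implicit Types (F : traj -> \bar R) (w : traj) (k n : nat) (A B : set traj).

Definition nice F := measurable_fun setT F /\ forall w, 0 <= F w.

Definition Ek k F w : \bar R := \int[kap k w]_y F (upd w k y).

Lemma measurable_upd1 w k : measurable_fun setT (fun y => upd w k y).
Proof.
apply: measurable_into_path => i; rewrite /upd; case: eqP => _ //.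
Qed.

Lemma nice_upd w k F : nice F -> measurable_fun setT (fun y => F (upd w k y)).
Proof. by move=> [mF _]; exact: (measurableT_comp mF (measurable_upd1 w k)). Qed.

Lemma Ek_nice k F : nice F -> nice (Ek k F).
Proof.
move=> [mF F0]; split; last by move=> w; apply: integral_ge0.
apply: (@measurable_fun_integral_finite_kernel _ _ _ _ R (fun p => F (upd p.1 k p.2))
  (kap k)) => //.
exact: (measurableT_comp mF (measurable_upd k)).
Qed.

Lemma eq_kap k w w' : (forall i, (i < k)%N -> w i = w' i) ->
  forall (B : set S), kap k w B = kap k w' B.
Proof. by move=> e B; exact: kap_dep e. Qed.

Lemma Ek_dep k F : depends k.+1 F -> depends k (Ek k F).
Proof.
move=> dF w w' e; rewrite /Ek.
rewrite (@eq_measure_integral _ _ _ _ (kap k w')); last by move=> B _ _; exact: eq_kap.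
apply: eq_integral => y _; apply: dF => i; rewrite ltnS leq_eqVlt /upd.
by case: eqP => //= _ ik; exact: e.
Qed.

Lemma Ek_cst k F : depends k F -> Ek k F = F.
Proof.
move=> dF; apply/funext => w; rewrite /Ek.
rewrite (eq_integral (cst (F w))); last first.
  move=> y _; apply: dF => i ik; rewrite /upd; case: eqP => // e.
  by rewrite e ltnn in ik.
by rewrite integral_cst// prob_kernel mule1.
Qed.

Lemma Ek_mono k F F' : nice F -> nice F' -> (forall w, F w <= F' w) ->
  forall w, Ek k F w <= Ek k F' w.
Proof.
move=> nF nF' FF' w; have [_ F0] := nF; have [_ F'0] := nF'.
by apply: ge0_le_integral => //; exact: nice_upd.
Qed.

Lemma EkD k F F' : nice F -> nice F' -> Ek k (F \+ F') = Ek k F \+ Ek k F'.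
Proof.
move=> nF nF'; have [_ F0] := nF; have [_ F'0] := nF'; apply/funext => w.
by rewrite /Ek ge0_integralD//; exact: nice_upd.
Qed.

Lemma EkZ k (a : R) F : (0 <= a)%R -> nice F ->
  Ek k (fun w => a%:E * F w) = (fun w => a%:E * Ek k F w).
Proof.
move=> a0 nF; have [_ F0] := nF; apply/funext => w.
by rewrite /Ek ge0_integralZl_EFin//; exact: nice_upd.
Qed.

Lemma Ek_lim k (u : nat -> traj -> \bar R) : (forall n, nice (u n)) ->
  (forall w, nondecreasing_seq (u ^~ w)) ->
  Ek k (fun w => limn (u ^~ w)) = (fun w => limn (fun n => Ek k (u n) w)).
Proof.
move=> nu ndu; apply/funext => w; rewrite /Ek monotone_convergence//.
- by move=> n; exact: nice_upd.
- by move=> n y _; have [_] := nu n.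
Qed.

Lemma nice_lim (u : nat -> traj -> \bar R) : (forall n, nice (u n)) ->
  (forall w, nondecreasing_seq (u ^~ w)) -> nice (fun w => limn (u ^~ w)).
Proof.
move=> nu ndu; split.
  rewrite (_ : (fun w => _) = (fun w => limn_esup (u ^~ w))).
    by apply: measurable_fun_limn_esup => n; have [] := nu n.
  apply/funext => w; apply/esym/is_cvg_limn_esupE.
  exact: ereal_nondecreasing_is_cvgn.
move=> w; apply: lime_ge; first exact: ereal_nondecreasing_is_cvgn.
by apply: nearW => n; have [_] := nu n.
Qed.

(** Coordinates k, ..., k+n-1 are integrated out, the last one innermost: the conditional
    expectation, given the first k coordinates, of a function of the first k+n. *)
Fixpoint It n k F : traj -> \bar R := if n is n'.+1 then Ek k (It n' k.+1 F) else F.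

Lemma It_nice n k F : nice F -> nice (It n k F).
Proof. by move=> nF; elim: n k => [//|n ih] k; apply: Ek_nice; exact: ih. Qed.

Lemma It_dep n k F : depends (k + n) F -> depends k (It n k F).
Proof.
elim: n k => [|n ih] k; first by rewrite addn0.
by rewrite addnS -addSn => dF; apply: Ek_dep; exact: ih.
Qed.

Lemma It_cst n k F : depends k F -> It n k F = F.
Proof.
elim: n k => [//|n ih] k dF /=; rewrite ih; first exact: Ek_cst.
exact: depends_mono dF.
Qed.

Lemma It_add n m k F : It (n + m) k F = It n k (It m (k + n) F).
Proof.
elim: n k => [|n ih] k; first by rewrite addn0.
by rewrite addSn /= ih addSnnS.
Qed.

Lemma It_mono n k F F' : nice F -> nice F' -> (forall w, F w <= F' w) ->
  forall w, It n k F w <= It n k F' w.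
Proof.
move=> nF nF' h; elim: n k => [//|n ih] k w /=.
by apply: Ek_mono => //; exact: It_nice.
Qed.

Lemma ItD n k F F' : nice F -> nice F' -> It n k (F \+ F') = It n k F \+ It n k F'.
Proof.
move=> nF nF'; elim: n k => [//|n ih] k /=.
by rewrite ih EkD//; exact: It_nice.
Qed.

Lemma ItZ n k (a : R) F : (0 <= a)%R -> nice F ->
  It n k (fun w => a%:E * F w) = (fun w => a%:E * It n k F w).
Proof.
move=> a0 nF; elim: n k => [//|n ih] k /=.
by rewrite ih EkZ//; exact: It_nice.
Qed.

Lemma It_lim n k (u : nat -> traj -> \bar R) : (forall n, nice (u n)) ->
  (forall w, nondecreasing_seq (u ^~ w)) ->
  It n k (fun w => limn (u ^~ w)) = (fun w => limn (fun m => It n k (u m) w)).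
Proof.
move=> nu ndu; elim: n k => [//|n ih] k /=.
rewrite ih Ek_lim//.
- by move=> m; exact: It_nice.
- by move=> w a b ab; apply: It_mono => // w'; exact: ndu.
Qed.

Definition ind (A : set traj) w : \bar R := (\1_A w)%:E.

Lemma nice_ind A : measurable A -> nice (ind A).
Proof.
move=> mA; split; last by move=> w; rewrite lee_fin.
exact/measurable_EFinP/measurable_indic.
Qed.

Lemma ind_dep k A : depends k A -> depends k (ind A).
Proof.
move=> dA w w' e; rewrite /ind !indicE.
have -> // : (w \in A) = (w' \in A).
by apply/idP/idP; rewrite !inE (dA w w' e).
Qed.

Let pt : traj := point.

(** Every horizon beyond the coordinates on which [A] depends gives the same value, so the arbitrary
    choice of a witness is harmless; a set without such a horizon gets 0. *)
Definition cyl_prob (A : set traj) : \bar R :=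
  if pselect (exists k, depends k A) is left e
  then It (projT1 (cid e)) 0 (ind A) pt else 0.

Lemma cyl_probE k A : depends k A -> cyl_prob A = It k 0 (ind A) pt.
Proof.
move=> dA; rewrite /cyl_prob; case: pselect => [e|[]]; last by exists k.
case: (cid e) => l dl /=.
have h a b : (a <= b)%N -> depends a A -> It b 0 (ind A) pt = It a 0 (ind A) pt.
  move=> ab da; rewrite -(subnKC ab) It_add add0n [It (b - a) _ _]It_cst//; exact: ind_dep.
by case: (leqP l k) => [lk|/ltnW kl]; [rewrite (h l k)|rewrite (h k l)].
Qed.

Lemma cyl_prob_ge0 A : measurable A -> 0 <= cyl_prob A.
Proof.
move=> mA; rewrite /cyl_prob; case: pselect => // e.
by have [_] := It_nice (projT1 (cid e)) 0 (nice_ind mA).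
Qed.

Lemma cyl_probT : cyl_prob setT = 1.
Proof.
by rewrite (@cyl_probE 0)//= /ind indicT.
Qed.

Lemma cyl_prob0 : cyl_prob set0 = 0.
Proof. by rewrite (@cyl_probE 0)//= /ind indic0. Qed.

Lemma cyl_probU k A B : measurable A -> measurable B -> depends k A -> depends k B ->
  A `&` B = set0 -> cyl_prob (A `|` B) = cyl_prob A + cyl_prob B.
Proof.
move=> mA mB dA dB AB.
have dU : depends k (A `|` B) by move=> w w' e; rewrite /setU/= (dA w w' e) (dB w w' e).
rewrite (cyl_probE dA) (cyl_probE dB) (cyl_probE dU).
have -> : ind (A `|` B) = ind A \+ ind B.
  apply/funext => w; rewrite /ind/= -EFinD; congr EFin.
  rewrite !indicE; have : ~ (A w /\ B w) by move=> h; have : (A `&` B) w by []; rewrite AB.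
  rewrite in_setU; case: (boolP (w \in A)); case: (boolP (w \in B)); rewrite ?inE//=.
  - by move=> Bw Aw /(_ (conj Aw Bw)).
  - by rewrite addr0.
  - by rewrite add0r.
  - by rewrite addr0.
by rewrite ItD//; exact: nice_ind.
Qed.

Lemma cyl_prob_le1 k A : measurable A -> depends k A -> cyl_prob A <= 1.
Proof.
move=> mA dA; rewrite -cyl_probT (cyl_probE dA) (@cyl_probE k)//.
apply: It_mono; [exact: nice_ind|exact: nice_ind|move=> w].
by rewrite /ind lee_fin !indicE in_setT; case: (_ \in _).
Qed.

(* The point is built one coordinate at a time, keeping the conditional probability of
   the union given the coordinates already chosen below 1. *)
Lemma cyl_prob_cover (U : nat -> set traj) (D : nat -> nat) :
  (forall n, measurable (U n)) -> (forall n, depends (D n) (U n)) ->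
  (forall n, U n `<=` U n.+1) -> limn (fun n => cyl_prob (U n)) < 1 ->
  exists w, forall n, ~ U n w.
Proof.
move=> mU dU ndU lt1.
have ndU' a b : (a <= b)%N -> U a `<=` U b.
  elim: b => [|b ih]; first by rewrite leqn0 => /eqP ->.
  by rewrite leq_eqVlt => /predU1P[->//|/ih h] w /h /ndU.
(* The conditional probability of [U n] given the first k coordinates; once k reaches [D n], the
   truncated subtraction makes it the indicator of [U n]. *)
pose p k n := It (D n - k) k (ind (U n)).
have np k n : nice (p k n) by apply: It_nice; exact: nice_ind.
have pE m k n : (D n - k <= m)%N -> p k n = It m k (ind (U n)).
  move=> h; rewrite -(subnKC h) It_add [It (m - (D n - k)) _ _]It_cst//.
  by apply: ind_dep; apply: depends_mono (dU n); rewrite -leq_subLR.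
have ndp k w : nondecreasing_seq (fun n => p k n w).
  move=> a b ab; rewrite (@pE (maxn (D a - k) (D b - k)) k a) ?leq_maxl//.
  rewrite (@pE (maxn (D a - k) (D b - k)) k b) ?leq_maxr//.
  apply: It_mono; [exact: nice_ind|exact: nice_ind|move=> w'].
  rewrite /ind lee_fin !indicE ler_nat; case: (boolP (w' \in U a)) => //.
  rewrite inE => /(ndU' _ _ ab) h; suff -> : w' \in U b by [].
  by rewrite inE.
have pS k n : p k n = Ek k (p k.+1 n).
  case: (ltnP k (D n)) => kD; first by rewrite /p -(subnSK kD).
  rewrite /p; have -> : (D n - k = 0)%N by apply/eqP; rewrite subn_eq0.
  have -> : (D n - k.+1 = 0)%N by apply/eqP; rewrite subn_eq0 ltnW.
  by rewrite /= Ek_cst//; apply: ind_dep; exact: depends_mono (dU n).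
pose s k w := limn (fun n => p k n w).
have sS k : s k = Ek k (s k.+1).
  rewrite /s Ek_lim//; apply/funext => w; congr (limn _); apply/funext => n.
  by rewrite pS.
have dp k n : depends k (p k n).
  apply: It_dep; apply: ind_dep; apply: depends_mono (dU n).
  by rewrite -leq_subLR.
have ds k : depends k (s k).
  move=> w w' e; rewrite /s; congr (limn _); apply/funext => n; exact: dp.
have p_s k n w : p k n w <= s k w.
  rewrite /s (cvg_lim _ (ereal_nondecreasing_cvgn (ndp k w)))//.
  by apply: ereal_sup_ubound; exists n.
have step k w : s k w < 1 -> exists y, s k.+1 (upd w k y) < 1.
  move=> sk1; apply: contrapT => no.
  have ge1 y : 1 <= s k.+1 (upd w k y).
    by rewrite leNgt; apply/negP => lt; apply: no; exists y.
  have ns : nice (s k.+1) by exact: nice_lim.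
  have : 1 <= s k w.
    rewrite sS /Ek -[leLHS](_ : \int[kap k w]_y (cst 1 y) = 1); last first.
      by rewrite integral_cst// prob_kernel mule1.
    by apply: ge0_le_integral => //; exact: nice_upd.
  by rewrite leNgt sk1.
pose nxt k w := if pselect (exists y, s k.+1 (upd w k y) < 1) is left e
  then upd w k (projT1 (cid e)) else w.
pose f := fix f k := if k is k'.+1 then nxt k' (f k') else pt.
have fk k : s k (f k) < 1.
  elim: k => [|k ih] /=; last first.
    rewrite /nxt; case: pselect => [e|[]]; last exact: step.
    exact: (projT2 (cid e)).
  apply: le_lt_trans lt1; rewrite /s le_eqVlt; apply/orP; left; apply/eqP.
  congr (limn _); apply/funext => n.
  by rewrite (cyl_probE (dU n)) /p subn0.
have agree i k : (i < k)%N -> f k i = f i.+1 i.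
  elim: k => [//|k ih]; rewrite ltnS leq_eqVlt => /predU1P[->//|ik].
  rewrite -ih//= /nxt; case: pselect => // e.
  by rewrite /upd; case: eqP => // ek; rewrite ek ltnn in ik.
exists (fun i => f i.+1 i) => n Un.
set ws : traj := fun i => _ in Un.
have : s (D n) ws < 1.
  by rewrite (ds (D n) ws (f (D n)))// => i ik; rewrite agree.
rewrite ltNge => /negP; apply; apply: le_trans (p_s (D n) n ws).
by rewrite /p subnn /= /ind indicE mem_set.
Qed.

End ionescu_tulcea.

(** * Countable additivity on cylinders and extension *)

Fact cylinder_display : measure_display. Proof. exact: default_measure_display. Qed.

Section cylinders.
Context {d : measure_display} (S : measurableType d).

(** A copy of the trajectory space, so that the algebra of cylinders can be its measurable structure
    beside the sigma-algebra carried by [traj]. *)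
Definition cylinder_type : Type := nat -> S.
HB.instance Definition _ := Pointed.on cylinder_type.

Definition cylinder : set (set cylinder_type) :=
  [set A | exists k, Gk k (A : set (traj S))].

Lemma cylinder0 : cylinder set0.
Proof. by exists 0%N; split; first exact: measurable0. Qed.

Lemma cylinderC : setC_closed cylinder.
Proof.
move=> A [k [mA dA]]; exists k; split; first exact: measurableC.
by move=> w w' e; rewrite /setC/= (dA w w' e).
Qed.

Lemma cylinderU : setU_closed cylinder.
Proof.
move=> A B [k [mA dA]] [l [mB dB]]; exists (maxn k l); split; first exact: measurableU.
move=> w w' e; rewrite /setU/= (dA w w') ?(dB w w')// => i ik; apply: e.
  by rewrite leq_max ik orbT.
by rewrite leq_max ik.
Qed.

HB.instance Definition _ := isAlgebraOfSets.Build cylinder_display cylinder_type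
  cylinder0 cylinderU cylinderC.

End cylinders.

Section path_measure.
Context {d : measure_display} {S : measurableType d} {R : realType}.
Variable kap : nat -> R.-pker (traj S) ~> S.
Hypothesis kap_dep : forall k, forall B, depends k (fun w => kap k w B).
Local Open Scope ereal_scope.

Definition cyl_fun (A : set (cylinder_type S)) : \bar R :=
  if pselect (cylinder A) then cyl_prob kap (A : set (traj S)) else 0.

Lemma cyl_funE A : cylinder A -> cyl_fun A = cyl_prob kap (A : set (traj S)).
Proof. by rewrite /cyl_fun; case: pselect. Qed.

Lemma cyl_fun0 : cyl_fun set0 = 0.
Proof. rewrite cyl_funE; [exact: cyl_prob0|exact: cylinder0]. Qed.

Lemma cyl_fun_ge0 A : 0 <= cyl_fun A.
Proof.
have [cA|nA] := pselect (cylinder A); last by rewrite /cyl_fun; case: pselect.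
by rewrite cyl_funE//; case: cA => k [mA _]; exact: cyl_prob_ge0.
Qed.

Lemma cyl_funU A B : cylinder A -> cylinder B -> A `&` B = set0 ->
  cyl_fun (A `|` B) = cyl_fun A + cyl_fun B.
Proof.
move=> cA cB AB; rewrite !cyl_funE//; last exact: cylinderU.
case: cA => k [mA dA]; case: cB => l [mB dB].
apply: (@cyl_probU _ _ _ kap (maxn k l)) => //.
- exact: depends_mono (leq_maxl _ _) dA.
- exact: depends_mono (leq_maxr _ _) dB.
Qed.

Lemma cyl_fun_le1 A : cylinder A -> cyl_fun A <= 1.
Proof.
by move=> cA; rewrite cyl_funE//; case: cA => k [mA dA]; exact: (cyl_prob_le1 kap mA dA).
Qed.

Lemma cylinder_bigcup (F : nat -> set (cylinder_type S)) n : (forall i, cylinder (F i)) ->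
  cylinder (\big[setU/set0]_(0 <= i < n) F i).
Proof.
move=> cF; elim: n => [|n ih]; first by rewrite big_nil; exact: cylinder0.
by rewrite big_nat_recr//=; exact: cylinderU.
Qed.

Lemma bigcup_disjoint (T : Type) (F : nat -> set T) n : trivIset setT F ->
  \big[setU/set0]_(0 <= i < n) F i `&` F n = set0.
Proof.
move=> tF; rewrite big_mkord -bigcup_mkord; apply/seteqP; split => // w [[i /= ilt Fi] Fn].
have e : i = n by apply: tF => //; exists w.
by rewrite e ltnn in ilt.
Qed.

Lemma cyl_fun_bigcup (F : nat -> set (cylinder_type S)) n : (forall i, cylinder (F i)) ->
  trivIset setT F ->
  cyl_fun (\big[setU/set0]_(0 <= i < n) F i) = \sum_(0 <= i < n) cyl_fun (F i).
Proof.
move=> cF tF; elim: n => [|n ih]; first by rewrite !big_nil cyl_fun0.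
rewrite !big_nat_recr//= -ih cyl_funU//; first exact: cylinder_bigcup.
exact: bigcup_disjoint.
Qed.

(** The sets formed by the complement of A and the partial unions [B n] increase to the whole space.
    If the masses of the [B n] stayed away from that of A, the masses of these sets would stay away
    from 1, and [cyl_prob_cover] would provide a trajectory outside all of them. *)
Lemma cyl_fun_sigma_additive : semi_sigma_additive cyl_fun.
Proof.
move=> F mF tF mA; set A := \bigcup_n F n in mA *.
have cF i : cylinder (F i) by exact: mF.
have cA : cylinder A by exact: mA.
pose B n := \big[setU/set0]_(0 <= i < n) F i.
have cB n : cylinder (B n) by exact: cylinder_bigcup.
have BA n : B n `<=` A by rewrite /B big_mkord; exact: bigsetU_bigcup.
have cCA : cylinder (~` A) by exact: cylinderC.
have CAB n : ~` A `&` B n = set0.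
  by apply/seteqP; split => // w [nA Bw]; apply: nA; exact: BA Bw.
pose U n := ~` A `|` B n.
have cU n : cylinder (U n) by exact: cylinderU.
have UE n : cyl_fun (U n) = cyl_fun (~` A) + cyl_fun (B n) by exact: cyl_funU.
have TE : 1 = cyl_fun (~` A) + cyl_fun A.
  rewrite -cyl_funU//; last by rewrite setICl.
  by rewrite setUCl cyl_funE ?cyl_probT//; exists 0%N; split; first exact: measurableT.
have finA C : cylinder C -> cyl_fun C \is a fin_num.
  move=> cC; rewrite ge0_fin_numE ?cyl_fun_ge0//.
  by apply: le_lt_trans (cyl_fun_le1 cC) _; exact: ltry.
under eq_fun => n do rewrite -cyl_fun_bigcup//.
have ndB : nondecreasing_seq (fun n => cyl_fun (B n)).
  apply/nondecreasing_seqP => n; rewrite /B big_nat_recr//= cyl_funU//.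
  - by rewrite leeDl// cyl_fun_ge0.
  - exact: cylinder_bigcup.
  - by exact: bigcup_disjoint.
have BleA n : cyl_fun (B n) <= cyl_fun A.
  by rewrite -(leeD2lE _ _ (finA _ cCA)) -TE -UE; exact: cyl_fun_le1.
have cvB := ereal_nondecreasing_cvgn ndB.
suff -> : cyl_fun A = ereal_sup (range (fun n => cyl_fun (B n))) by [].
apply/eqP; rewrite eq_le; apply/andP; split; last first.
  by apply: ge_ereal_sup => _ [n _ <-].
rewrite leNgt; apply/negP => lt.
have [D hD] := choice cU.
have := @cyl_prob_cover _ _ _ _ kap_dep U D (fun n => (hD n).1) (fun n => (hD n).2).
case.
- move=> n w [Aw|Bw]; [by left|right].
  by rewrite /B big_nat_recr//=; left.
- rewrite (_ : (fun n => _) = (fun n => cyl_fun (~` A) + cyl_fun (B n))); last first.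
    by apply/funext => n; rewrite -UE cyl_funE.
  rewrite (cvg_lim _ (cvgeD _ (cvg_cst _) cvB))//.
    by rewrite TE lteD2lE// finA.
  by rewrite fin_num_adde_defr// finA.
move=> w nU; have [Aw|nAw] := pselect (A w); last by apply: (nU 0%N); left.
case: Aw => n _ Fw; apply: (nU n.+1); right.
by rewrite /B big_nat_recr//=; right.
Qed.

HB.instance Definition _ := isMeasure.Build _ _ _ cyl_fun
  cyl_fun0 cyl_fun_ge0 cyl_fun_sigma_additive.

Lemma path_measurable_sub (A : set (traj S)) : measurable A ->
  measurable (A : set (g_sigma_algebraType (@measurable _ (cylinder_type S)))).
Proof.
apply: smallest_sub; first exact: smallest_sigma_algebra.
move=> _ [k [B [mB ->]]]; apply: sub_sigma_algebra; exists k.+1; split.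
  by have := measurable_coord k measurableT mB; rewrite setTI.
by move=> w w' e; rewrite /= e.
Qed.

Definition path_prob (A : set (traj S)) : \bar R := measure_extension cyl_fun A.

Lemma path_probE k A : Gk k A -> path_prob A = It kap k 0 (ind A) point.
Proof.
move=> [mA dA]; have cA : cylinder A by exists k.
rewrite /path_prob /measure_extension measurable_mu_extE//=.
by rewrite cyl_funE//; exact: (cyl_probE kap dA).
Qed.

Let path_prob0 : path_prob set0 = 0.
Proof. exact: measure0. Qed.

Let path_prob_ge0 A : 0 <= path_prob A.
Proof. exact: measure_ge0. Qed.

Let path_prob_sigma_additive : semi_sigma_additive path_prob.
Proof.
move=> F mF tF mA; apply: (@measure_semi_sigma_additive _ _ _ (measure_extension cyl_fun)) => //.
- by move=> i; exact: path_measurable_sub.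
- exact: path_measurable_sub.
Qed.

HB.instance Definition _ := isMeasure.Build _ _ _ path_prob
  path_prob0 path_prob_ge0 path_prob_sigma_additive.

Let path_prob_setT : path_prob setT = 1.
Proof.
have GT : Gk 0 [set: traj S] by split; first exact: measurableT.
by rewrite (path_probE GT)/= /ind indicT.
Qed.

HB.instance Definition _ := Measure_isProbability.Build _ _ _ path_prob path_prob_setT.

Lemma integral_path_prob n (F : traj S -> \bar R) :
  Gmeas (Gk n) F -> (forall w, 0 <= F w) ->
  \int[path_prob]_w F w = It kap n 0 F point.
Proof.
have sG := @Gk_sub_sigma _ S n.
have mG (G : traj S -> \bar R) : measurable_fun [set: g_sigma_algebraType (Gk n)] G ->
    measurable_fun [set: traj S] G.
  by move=> /(GmeasP _ sG)/(Gmeas_measurable sG).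
move=> /(GmeasP _ sG) mF F0.
apply: (@nonneg_measurable_ind _ (g_sigma_algebraType (Gk n)) R (fun F : traj S -> \bar R =>
  \int[path_prob]_w F w = It kap n 0 F point)) => //.
- move=> A; rewrite /measurable/= sub_sigmaE// => GA.
  rewrite integral_indic//=; last by case: GA.
  by rewrite setIT; exact: path_probE.
- move=> f g mf mg f0 g0 hf hg.
  have [nf ng] : nice f /\ nice g by split; split => //; exact: mG.
  rewrite ge0_integralD//; [|exact: mG|exact: mG].
  by rewrite hf hg ItD.
- move=> r f r0 mf f0 hf; have nf : nice f by split => //; exact: mG.
  rewrite ge0_integralZl_EFin//; last exact: mG.
  by rewrite hf ItZ.
- move=> u mu u0 ndu hu; have nu k : nice (u k) by split => //; exact: mG.
  rewrite monotone_convergence//; last by move=> k; exact: mG.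
  by rewrite It_lim//; congr (limn _); apply/funext => k.
Qed.

Lemma path_prob_kernel k A (B : set S) : Gk k A -> measurable B ->
  path_prob (A `&` [set w | B (w k)]) = \int[path_prob]_(w in A) kap k w B.
Proof.
move=> GA mB; have [mA dA] := GA.
have mC : measurable [set w : traj S | B (w k)].
  by have := measurable_coord k measurableT mB; rewrite setTI.
have GAB : Gk k.+1 (A `&` [set w | B (w k)]).
  split; first exact: measurableI.
  by move=> w w' e; rewrite /setI/= (depends_mono (leqnSn k) dA e) e.
rewrite (path_probE GAB) -[k.+1]addn1 It_add /= add0n.
have EE : Ek kap k (ind (A `&` [set w | B (w k)])) = (fun w => (\1_A w)%:E * kap k w B).
  apply/funext => w; rewrite /Ek.
  under eq_integral => y _.
    rewrite /ind indicI/= EFinM.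
    have -> : \1_A (upd w k y) = \1_A w :> R.
      rewrite !indicE; have e i : (i < k)%N -> upd w k y i = w i.
        by move=> ik; rewrite /upd; case: eqP => // ei; rewrite ei ltnn in ik.
      have -> // : (upd w k y \in A) = (w \in A).
      by apply/idP/idP; rewrite !inE (dA _ _ e).
    have -> : \1_[set w | B (w k)] (upd w k y) = \1_B y :> R.
      rewrite !indicE; have -> // : (upd w k y \in [set w | B (w k)]) = (y \in B).
      by apply/idP/idP; rewrite !inE/= /upd eqxx.
    over.
  rewrite ge0_integralZl_EFin//; last first.
    exact/measurable_EFinP/measurable_indic.
  by rewrite integral_indic// setIT.
rewrite EE [RHS]integral_mkcond -integral_path_prob.
- by apply: eq_integral => w _; rewrite epatch_indic muleC.
- apply: Gk_meas.
    apply: emeasurable_funM; last exact: measurable_kernel.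
    exact/measurable_EFinP/measurable_indic.
  move=> w w' e; rewrite /= (kap_dep B e) !indicE; have -> : (w \in A) = (w' \in A) by apply/idP/idP; rewrite !inE (dA _ _ e).
  by [].
- by move=> w; rewrite mule_ge0// lee_fin.
Qed.

Definition ionescu_tulcea : probability (traj S) R := path_prob.

End path_measure.

Theorem ionescu_tulcea_exists {d} {S : measurableType d} {R : realType}
  (kap : nat -> R.-pker (traj S) ~> S) :
  (forall k, forall B, depends k (fun w => kap k w B)) ->
  exists P : probability (traj S) R, forall k A (B : set S), Gk k A -> measurable B ->
  P (A `&` [set w | B (w k)]) = (\int[P]_(w in A) kap k w B)%E.
Proof.
move=> h; exists (ionescu_tulcea h) => k A B; exact: path_prob_kernel.
Qed.

(** * Allocations and multinomial resampling *)

Section counting.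
Variables (n : nat).
Local Notation N := n.+1.
Implicit Types (c : 'I_N -> nat) (b : 'I_N -> 'I_N).

Definition child_bins c : seq 'I_N := flatten [seq nseq (c u) u | u <- enum 'I_N].

(** Children are numbered bin by bin, so the bin of child j is known from the allocation before any
    parent is drawn. *)
Definition cbin c (j : 'I_N) : 'I_N := nth ord0 (child_bins c) j.

Lemma count_child_bins c u : count_mem u (child_bins c) = c u.
Proof.
rewrite /child_bins count_flatten -map_comp sumnE big_map -[RHS](big_ord1 addn (fun=> c u)).
rewrite (eq_bigr (fun v => if v == u then c u else 0)%N); last first.
  by move=> v _ /=; rewrite count_nseq /= ; case: eqP => [->|_]; rewrite ?mul1n ?mul0n.
by rewrite big_ord1 -big_mkcond big_enum_cond /= big_pred1_eq.
Qed.

Lemma size_child_bins c : (\sum_u c u)%N = N -> size (child_bins c) = N.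
Proof.
move=> s; rewrite /child_bins size_flatten /shape -map_comp sumnE big_map.
rewrite (eq_bigr c); last by move=> u _; rewrite /= size_nseq.
by rewrite big_enum.
Qed.

Lemma map_cbin c : (\sum_u c u)%N = N -> [seq cbin c j | j <- enum 'I_N] = child_bins c.
Proof.
move=> s; apply: (@eq_from_nth _ ord0).
  by rewrite size_map size_enum_ord size_child_bins.
move=> i; rewrite size_map size_enum_ord => iN.
by rewrite (nth_map ord0) ?size_enum_ord// /cbin nth_enum_ord.
Qed.

Lemma card_cbin c u : (\sum_u c u)%N = N -> (\sum_(j | cbin c j == u) 1)%N = c u.
Proof.
move=> s; rewrite -[RHS]count_child_bins -map_cbin// count_map -sum1_count.
by rewrite big_enum_cond.
Qed.

Lemma cbin_gt0 c j : (\sum_u c u)%N = N -> (0 < c (cbin c j))%N.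
Proof.
move=> s; rewrite -[X in (0 < X)%N](card_cbin _ s).
by rewrite (bigD1 j)//= ltnS.
Qed.

Lemma sum_cbin (R : realType) c (F : 'I_N -> R) : (\sum_u c u)%N = N ->
  \sum_j F (cbin c j) = \sum_u (c u)%:R * F u.
Proof.
move=> s; rewrite (partition_big (cbin c) xpredT)//=; apply: eq_bigr => u _.
rewrite (eq_bigr (fun=> F u)); last by move=> j /eqP ->.
by rewrite -(card_cbin u s) natr_sum mulr_suml; apply: eq_bigr => j _; rewrite mul1r.
Qed.

End counting.

Section multinomial_count.
Variables (I : finType) (b : I -> I).
Implicit Types (js : seq I) (k : I -> nat).
Local Open Scope nat_scope.

Lemma big_tuple_cons (M : nmodType) m (F : m.+1.-tuple I -> M) :
  (\sum_(p : m.+1.-tuple I) F p = \sum_i \sum_(p : m.-tuple I) F [tuple of i :: p])%R.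
Proof.
rewrite pair_big /=.
rewrite (reindex (fun q : I * m.-tuple I => [tuple of q.1 :: q.2]))//=.
exists (fun p : m.+1.-tuple I => (thead p, [tuple of behead p])).
  by move=> [i p] _ /=; rewrite theadE; congr (_, _); apply: val_inj.
by move=> p _; apply: val_inj; rewrite /= {3}(tuple_eta p).
Qed.

(** The number of ways to choose the parents of children with prescribed bins [js] so that the
    offspring numbers are [k]. *)
Definition nfib js k : nat := \sum_(p : (size js).-tuple I)
  (((map b p == js) && [forall i, count_mem i p == k i]) : nat).

Lemma nfibE js k : nfib js k * \prod_i (k i)`! =
  if [forall u, \sum_(i | b i == u) k i == count_mem u js]
  then \prod_u (count_mem u js)`! else 0.
Proof.
elim: js k => [|u js ih] k.
  rewrite /nfib (big_pred1 [tuple]) /=; last by move=> p; apply/esym/eqP; exact: tuple0.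
  have -> : [forall u, \sum_(i | b i == u) k i == 0] = [forall i, 0 == k i].
    apply/forallP/forallP => h i.
      have := h (b i); rewrite sum_nat_eq0 => /forallP/(_ i).
      by rewrite eqxx /= eq_sym.
    by rewrite sum_nat_eq0; apply/forallP => j; rewrite (eq_sym (k j)) h implybT.
  case: forallP => [h|_]; last by rewrite mul0n.
  by rewrite mul1n !big1// => i _; rewrite -(eqP (h i)).
pose k' i j := k j - (j == i).
have step : nfib (u :: js) k = \sum_(i | (b i == u) && (0 < k i)) nfib js (k' i).
  rewrite /nfib (big_tuple_cons (M := nat)) [RHS]big_mkcond /=; apply: eq_bigr => i _.
  case: (altP (b i =P u)) => bi /=; last first.
    by rewrite big1// => p _; rewrite eqseq_cons (negbTE bi).
  case: (posnP (k i)) => ki.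
    rewrite big1// => p _; apply/eqP; rewrite eqb0 negb_and; apply/orP; right.
    by apply/forallPn; exists i; rewrite ki /= eqxx.
  apply: eq_bigr => p _; rewrite eqseq_cons bi eqxx; congr (nat_of_bool (_ && _)).
  apply: eq_forallb => j; rewrite /k' eq_sym.
  by case: (altP (j =P i)) => [->|ji] /=; [rewrite eqxx; case: (k i) ki => // x _; rewrite subSS subn0 add1n eqSS eq_sym|rewrite (eq_sym i) (negbTE ji) subn0 add0n eq_sym].
rewrite step big_distrl /=.
set cond := [forall _, _].
have E i : (b i == u) && (0 < k i) -> nfib js (k' i) * \prod_j (k j)`! =
    k i * (if cond then \prod_v (count_mem v js)`! else 0).
  move=> /andP[/eqP bi ki].
  have -> : \prod_j (k j)`! = k i * \prod_j (k' i j)`!.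
    rewrite (bigD1 i)//= [in RHS](bigD1 i)//= mulnA; congr (_ * _).
      by rewrite /k' eqxx subn1; case: (k i) ki.
    by apply: eq_bigr => j /negbTE ji; rewrite /k' ji subn0.
  rewrite mulnCA ih; congr (_ * _); congr (if _ then _ else _).
  apply: eq_forallb => v /=.
  have -> : \sum_(j | b j == v) k j = (u == v) + \sum_(j | b j == v) k' i j.
    case: (altP (u =P v)) => [uv|uv].
      rewrite (bigD1 i) ?bi ?uv//= [in RHS](bigD1 i) ?bi ?uv//= addnA; congr (_ + _).
        by rewrite /k' eqxx; case: (k i) ki => // x _; rewrite subn1 add1n.
      by apply: eq_bigr => j /andP[_ /negbTE ji]; rewrite /k' ji subn0.
    rewrite add0n; apply: eq_bigr => j /eqP bj; rewrite /k'.
    by case: (altP (j =P i)) => [ji|]; rewrite ?subn0//; case/negP: uv; rewrite -bi -bj ji.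
  by rewrite eqn_add2l.
rewrite (eq_bigr _ E) -big_distrl /=.
case: (boolP cond) => [/forallP h|_]; last by rewrite muln0.
have -> : \sum_(i | (b i == u) && (0 < k i)) k i = (count_mem u js).+1.
  have /eqP := h u; rewrite /= eqxx add1n => <-.
  rewrite [RHS](bigID (fun i => 0 < k i)) /= [X in _ = _ + X]big1 ?addn0//.
  by move=> i /andP[_]; rewrite lt0n negbK => /eqP.
rewrite (bigD1 u)//= [in RHS](bigD1 u)//= eqxx factS mulnA; congr (_ * _).
by apply: eq_bigr => v /negbTE vu; rewrite eq_sym vu.
Qed.

End multinomial_count.

Section multinomial_law.
Variables (R : realType) (n : nat).
Local Notation N := n.+1.
Implicit Types (w : 'I_N -> R) (b : 'I_N -> 'I_N) (c k : 'I_N -> nat).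

Definition bwt w b (u : 'I_N) : R := \sum_(i | b i == u) w i.

(** Multinomial resampling realised child by child: independent draws, each inside the bin of its
    child. *)
Definition prb w b c (j i : 'I_N) : R :=
  if b i == cbin c j then w i / bwt w b (cbin c j) else 0.

Definition mnom w b c k (u : 'I_N) : R :=
  if (\sum_(i | b i == u) k i)%N == c u then
    (c u)`!%:R / (\prod_(i | b i == u) (k i)`!%:R) *
    \prod_(i | b i == u) (w i / bwt w b u) ^+ k i
  else 0.

(** All parent tuples compatible with the bins and with offspring numbers [k] have the same
    probability, the product of the powers of w_i / w(u); incompatible ones contribute 0. It remains
    to count, by [nfibE]. *)
Lemma sum_fibers_multinomial w b c k : (\sum_u c u)%N = N ->
  (forall u, ~~ [exists i, b i == u] -> c u = 0%N) ->
  \sum_(p : N.-tuple 'I_N | [forall i, count_mem i p == k i]) \prod_j prb w b c j (tnth p j)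
  = \prod_(u | [exists i, b i == u]) mnom w b c k u.
Proof.
move=> sc c0; pose q i := w i / bwt w b (b i).
have E (p : N.-tuple 'I_N) : [forall i, count_mem i p == k i] ->
    \prod_j prb w b c j (tnth p j) = (map b p == child_bins c)%:R * \prod_i q i ^+ k i.
  move=> /forallP kp.
  have -> : (map b p == child_bins c) = [forall j, b (tnth p j) == cbin c j].
    have sz : size (map b p) = N by rewrite size_map size_tuple.
    apply/eqP/forallP => [e j|e].
      rewrite /cbin -e (nth_map ord0) ?size_tuple// (tnth_nth ord0); exact/eqP.
    apply: (@eq_from_nth _ ord0) => [|i]; rewrite sz ?size_child_bins// => iN.
    by have /eqP := e (Ordinal iN); rewrite (tnth_nth ord0) /cbin (nth_map ord0) ?size_tuple.
  case: forallP => [h|h]; last first.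
    rewrite mul0r; have /existsP[j bj] : [exists j, b (tnth p j) != cbin c j].
      by rewrite -negb_forall; apply/negP => /forallP.
    by rewrite (bigD1 j)//= /prb (negbTE bj) mul0r.
  rewrite mul1r (eq_bigr (fun j => q (tnth p j))); last first.
    by move=> j _; rewrite /prb h /q (eqP (h j)).
  rewrite -(big_tuple _ _ p xpredT q) (big_nth ord0).
  rewrite -(big_nth ord0 xpredT q) (partition_big id xpredT)//=.
  apply: eq_bigr => i _; rewrite -(eqP (kp i)).
  rewrite (eq_bigr (fun=> q i)); last by move=> x /eqP ->.
  by rewrite big_const_seq iter_mulr_1.
rewrite (eq_bigr _ E) -mulr_suml.
have -> : \sum_(p : N.-tuple 'I_N | [forall i, count_mem i p == k i])
    (map b p == child_bins c)%:R = (nfib b (child_bins c) k)%:R :> R.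
  have H m : size (child_bins c) = m ->
      \sum_(p : m.-tuple 'I_N | [forall i, count_mem i p == k i])
      (map b p == child_bins c)%:R = (nfib b (child_bins c) k)%:R :> R.
    move=> <-; rewrite /nfib natr_sum big_mkcond; apply: eq_bigr => p _.
    by case: [forall _, _]; rewrite ?andbT ?andbF.
  exact: H (size_child_bins sc).
have f0 i : (k i)`!%:R != 0 :> R by rewrite pnatr_eq0 -lt0n fact_gt0.
have F0 : (\prod_i (k i)`!)%N%:R != 0 :> R.
  by rewrite natr_prod; apply/prodf_neq0 => i _; exact: f0.
have emp u : ~~ [exists i, b i == u] -> (\sum_(i | b i == u) k i = 0)%N.
  by rewrite negb_exists => /forallP h; rewrite big1// => i; rewrite (negbTE (h i)).
have := congr1 (fun x => x%:R : R) (nfibE b (child_bins c) k).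
rewrite natrM => /(canRL (mulfK F0)) ->.
case: forallP => [h|h]; last first.
  rewrite mul0r mul0r; have /existsP[u hu] :
      [exists u, (\sum_(i | b i == u) k i)%N != count_mem u (child_bins c)].
    by rewrite -negb_forall; apply/negP => /forallP.
  have eu : [exists i, b i == u].
    apply: contraNT hu => nu; rewrite count_child_bins emp// c0//.
  by rewrite (bigD1 u)//= /mnom -count_child_bins (negbTE hu) mul0r.
rewrite [RHS](eq_bigr (fun u => ((c u)`!%:R / (\prod_(i | b i == u) (k i)`!%:R)) *
    \prod_(i | b i == u) q i ^+ k i)); last first.
  move=> u _; have := h u; rewrite count_child_bins /mnom => ->; congr (_ * _).
  by apply: eq_bigr => i /eqP bi; rewrite /q bi.
have full (F : 'I_N -> R) : (forall u, ~~ [exists i, b i == u] -> F u = 1) ->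
    \prod_(u | [exists i, b i == u]) F u = \prod_u F u.
  move=> F1; rewrite [RHS](bigID (fun u => [exists i, b i == u])) /= [X in _ = _ * X]big1 ?mulr1//.
have em1 (G : 'I_N -> R) u : ~~ [exists i, b i == u] -> \prod_(i | b i == u) G i = 1.
  by rewrite negb_exists => /forallP h'; rewrite big1// => i; rewrite (negbTE (h' i)).
rewrite full; last by move=> u nu; rewrite !em1// c0// fact0 invr1 !mulr1.
have part (G : 'I_N -> R) : \prod_u \prod_(i | b i == u) G i = \prod_i G i.
  by rewrite [RHS](partition_big b xpredT).
rewrite big_split /= part; congr (_ * _).
rewrite big_split /= prodfV part natr_prod natr_prod; congr (_ / _).
by apply: eq_bigr => u _; rewrite count_child_bins.
Qed.

Lemma bwt_gt0 w b i : (forall i, 0 < w i) -> 0 < bwt w b (b i).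
Proof.
move=> w0; rewrite /bwt (bigD1 i)//=.
by apply: ltr_pwDl => //; apply: sumr_ge0 => j _; exact: ltW.
Qed.

Lemma bwt_ge0 w b u : (forall i, 0 < w i) -> 0 <= bwt w b u.
Proof. by move=> w0; apply: sumr_ge0 => j _; exact: ltW. Qed.

Lemma prb_ge0 w b c j i : (forall i, 0 < w i) -> 0 <= prb w b c j i.
Proof.
move=> w0; rewrite /prb; case: eqP => // e.
by rewrite mulr_ge0 ?invr_ge0 ?bwt_ge0// ltW.
Qed.

Lemma sum_prb w b c j : (forall i, 0 < w i) -> (\sum_u c u)%N = N ->
  (forall u, ~~ [exists i, b i == u] -> c u = 0%N) ->
  \sum_i prb w b c j i = 1.
Proof.
move=> w0 sc c0; have := cbin_gt0 j sc.
have [/existsP[i0 /eqP e] _|/c0 ->//] := boolP [exists i, b i == cbin c j].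
rewrite /prb -big_mkcond /= -mulr_suml mulfV//.
by rewrite gt_eqF// -e bwt_gt0.
Qed.

End multinomial_law.

(** * Construction of weighted ensembles *)

Section measurable_discr.
Context {d : measure_display} {T : measurableType d}.

Lemma measurable_discr_fun d' (U : measurableType d') (I : countType) (D : T -> I)
    (Phi : I -> T -> U) :
  (forall y, measurable (D @^-1` [set y])) -> (forall y, measurable_fun setT (Phi y)) ->
  measurable_fun setT (fun x => Phi (D x) x).
Proof.
move=> mD mP _ B mB; rewrite setTI.
rewrite (_ : _ @^-1` B = \bigcup_k (if unpickle k is Some y
    then (D @^-1` [set y]) `&` (Phi y @^-1` B) else set0)).
  apply: bigcupT_measurable => k; case: unpickle => // y; apply: measurableI => //.
  by have := mP y measurableT B mB; rewrite setTI.
apply/seteqP; split => [x Bx|x [k _]].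
  by exists (pickle (D x)) => //; rewrite pickleK.
by case: unpickle => // y [/= ->].
Qed.

Lemma measurable_discr_set (I : countType) (D : T -> I) (A : I -> set T) :
  (forall y, measurable (D @^-1` [set y])) -> (forall y, measurable (A y)) ->
  measurable [set x | A (D x) x].
Proof.
move=> mD mA.
rewrite (_ : [set x | _] = \bigcup_k (if unpickle k is Some y
    then (D @^-1` [set y]) `&` A y else set0)).
  by apply: bigcupT_measurable => k; case: unpickle => // y; apply: measurableI.
apply/seteqP; split => [x Bx|x [k _]].
  by exists (pickle (D x)) => //; rewrite pickleK.
by case: unpickle => // y [/= ->].
Qed.

Lemma measurable_discr_ffun (I : finType) (J : countType) (g : T -> I -> J) :
  (forall i y, measurable [set x | g x i = y]) ->
  forall b, measurable ((fun x => [ffun i => g x i]) @^-1` [set b]).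
Proof.
move=> mg b; rewrite (_ : _ @^-1` _ = \bigcap_(i in [set: I]) [set x | g x i = b i]).
  by apply: fin_bigcap_measurable => //; exact: finite_finset.
apply/seteqP; split => [x /= e i _|x h] /=.
  by rewrite -e ffunE.
by apply/ffunP => i; rewrite ffunE; exact: h.
Qed.

Lemma measurable_inv_gt0 {R : realType} (g : T -> R) : (forall x, 0 < g x) ->
  measurable_fun setT g -> measurable_fun setT (fun x => (g x)^-1).
Proof.
move=> g0 mg; rewrite (_ : (fun x => _) = (fun x => expR (- ln (g x)))).
  apply: measurableT_comp => //; apply: measurableT_comp => //.
  exact: measurableT_comp (@measurable_ln R) mg.
by apply/funext => x; rewrite expRN lnK ?posrE.
Qed.

End measurable_discr.

Section kernel_of_measures.
Context d d' (T : measurableType d) (U : measurableType d') (R : realType).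
Variable m : T -> {measure set U -> \bar R}.
Hypothesis mm : forall A, measurable A -> measurable_fun setT (m ^~ A).
Hypothesis m1 : forall x, m x setT = 1%E.

Definition kernel_of := m.
HB.instance Definition _ := isKernel.Build _ _ T U R kernel_of mm.
HB.instance Definition _ := Kernel_isProbability.Build _ _ _ _ _ kernel_of m1.

Lemma pker_exists : exists k : R.-pker T ~> U, forall x A, k x A = m x A.
Proof. by exists kernel_of. Qed.

End kernel_of_measures.

Section step_measures.
Context {R : realType} {d : measure_display} {X : measurableType d}.
Local Notation S := (X * nat)%type.

Section pair0.
Variable nu : {measure set X -> \bar R}.
(** A trajectory coordinate lies in X * nat, the first component serving mutations and the second
    one resampling; the idle component is set to a fixed value, here 0. *)
Definition pair0 (A : set S) : \bar R := nu [set x | A (x, 0%N)].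

Lemma measurable_pair0 (A : set S) : measurable A -> measurable [set x | A (x, 0%N)].
Proof.
move=> mA; have /(_ measurableT A mA) := measurable_pair2 (0%N : nat) : measurable_fun _ (fun x : X => (x, 0%N)).
by rewrite setTI.
Qed.

Let pair00 : pair0 set0 = 0%E. Proof. exact: measure0. Qed.
Let pair0_ge0 A : (0 <= pair0 A)%E. Proof. exact: measure_ge0. Qed.
Let pair0_sigma : semi_sigma_additive pair0.
Proof.
move=> F mF tF mA; rewrite /pair0.
rewrite (_ : [set x | _] = \bigcup_n [set x | F n (x, 0%N)]); last by [].
apply: measure_semi_sigma_additive.
- by move=> i; exact: measurable_pair0.
- apply/trivIsetP => i j _ _ ij; apply/seteqP; split => // x [/= Fi Fj].
  have /trivIsetP/(_ i j Logic.I Logic.I ij) e := tF.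
  by have : (F i `&` F j) (x, 0%N) by []; rewrite e.
- exact: (measurable_pair0 mA).
Qed.
HB.instance Definition _ := isMeasure.Build _ _ _ pair0 pair00 pair0_ge0 pair0_sigma.

End pair0.

Section disc.
Variables (n : nat) (p : 'I_n.+1 -> R).
(** The law of a parent index, stored in the second component. The maximum with 0 makes it a measure
    for every vector [p] and is invisible on probability vectors. *)
Definition disc (A : set S) : \bar R :=
  (\sum_(i < n.+1) (Num.max (p i) 0)%:E * \d_(point, i : nat) A)%E.

Let disc0 : disc set0 = 0%E.
Proof. by rewrite /disc big1// => i _; rewrite measure0 mule0. Qed.
Let disc_ge0 A : (0 <= disc A)%E.
Proof. by apply: sume_ge0 => i _; rewrite mule_ge0// lee_fin le_max lexx orbT. Qed.
Let disc_sigma : semi_sigma_additive disc.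
Proof.
move=> F mF tF mA; rewrite /disc.
rewrite (_ : (fun m => _) = (fun m => \sum_(i < n.+1) (Num.max (p i) 0)%:E *
    \sum_(0 <= j < m) \d_(point, i : nat) (F j))%E).
  apply: (@cvg_nnesum _ _ eventually_filter R _ _ (fun i m => (Num.max (p i) 0)%:E *
    \sum_(0 <= j < m) \d_(point, i : nat) (F j))%E) => i _.
    by apply: nearW => m; rewrite mule_ge0// ?lee_fin ?le_max ?lexx ?orbT// sume_ge0.
  apply: cvgeZl => //.
  exact: (@measure_semi_sigma_additive _ _ _ (\d_(point, i : nat))).
apply/funext => m; rewrite exchange_big /=; apply: eq_bigr => i _.
by rewrite ge0_sume_distrr.
Qed.
HB.instance Definition _ := isMeasure.Build _ _ _ disc disc0 disc_ge0 disc_sigma.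

Lemma disc_setT : (forall i, 0 <= p i) -> \sum_i p i = 1 -> disc setT = 1%E.
Proof.
move=> p0 p1; rewrite /disc (eq_bigr (fun i => (p i)%:E)) ?sumEFin ?p1// => i _.
by rewrite diracT mule1 max_l.
Qed.

Lemma disc_label i : (forall i, 0 <= p i) ->
  disc [set s | inord s.2 = i] = (p i)%:E.
Proof.
move=> p0; rewrite /disc (bigD1 i)//= big1 ?adde0.
  by rewrite diracE mem_set /= ?inord_val// mule1 max_l.
move=> j ji; rewrite diracE memNset /= ?mule0//= inord_val => e.
by rewrite e eqxx in ji.
Qed.
End disc.

End step_measures.

Section construction.
Context {R : realType} {d : measure_display} {X : measurableType d}.
Variables (K : R.-pker X ~> X) (mu0 : probability X R) (n : nat).
Local Notation N := n.+1.
Local Notation S := (X * nat)%type.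
Variables (bn : 'I_N -> X -> 'I_N).
Variable (al : ('I_N -> R) -> ('I_N -> 'I_N) -> 'I_N -> nat).

(** Bins may depend on the index of a particle as well as on its position, so one bin per particle
    is allowed. Measurability in the weights is asked for each fixed bin assignment, the assignments
    being finitely many. *)
Record allocation : Prop := Allocation {
  bn_meas : forall i u, measurable [set x | bn i x = u];
  al_meas : forall d' (T : measurableType d') (w : T -> 'I_N -> R),
    (forall x i, 0 < w x i) -> (forall i, measurable_fun setT (w ^~ i)) ->
    forall b u, measurable_fun setT (fun x => al (w x) b u);
  al_sum : forall w b, (forall i, 0 < w i) -> (\sum_u al w b u)%N = N;
  al_gt0 : forall w b i, (forall i, 0 < w i) -> (0 < al w b (b i))%N;
  al_eq0 : forall w b u, ~~ [exists i, b i == u] -> al w b u = 0%N }.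

Hypothesis H : allocation.

Implicit Types (om : traj S) (t : nat).

(* Coordinate 2Nt + j of a trajectory carries in its first component the particle j at
   time t, and coordinate 2Nt + N + j carries in its second one the parent of child j. *)
Definition particle t om (j : 'I_N) : X := (om (2 * N * t + j)%N).1.
Definition parent t om (j : 'I_N) : 'I_N := inord (om (2 * N * t + N + j)%N).2.
Definition bin_of t om (i : 'I_N) : 'I_N := bn i (particle t om i).

(* Child [j] is assigned to its bin beforehand, so its weight does not depend on its
   parent; the two agree almost surely, and this one is positive everywhere. *)
Definition next_weight (w : 'I_N -> R) (b : 'I_N -> 'I_N) (j : 'I_N) : R :=
  let c := al w b in bwt w b (cbin c j) / (c (cbin c j))%:R.

Fixpoint weight t om : 'I_N -> R :=
  if t is t'.+1 then next_weight (weight t' om) (bin_of t' om) else fun=> N%:R^-1.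

Definition children_alloc t om : 'I_N -> nat := al (weight t om) (bin_of t om).
Definition child_position t om (j : 'I_N) : X := particle t om (parent t om j).
Definition parent_prob t om : 'I_N -> 'I_N -> R := prb (weight t om) (bin_of t om) (children_alloc t om).

Lemma cbin_nonempty w b j : (forall i, 0 < w i) -> exists i, b i = cbin (al w b) j.
Proof.
move=> w0; have := cbin_gt0 j (al_sum H b w0).
case: (boolP [exists i, b i == cbin (al w b) j]) => [/existsP[i /eqP e] _|/(al_eq0 H w) ->//].
by exists i.
Qed.

Lemma nw_gt0 w b j : (forall i, 0 < w i) -> 0 < next_weight w b j.
Proof.
move=> w0; rewrite /next_weight; have [i e] := cbin_nonempty b j w0.
apply: divr_gt0; first by rewrite -e bwt_gt0.
by rewrite ltr0n cbin_gt0 ?(al_sum H).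
Qed.

Lemma sum_nw w b : (forall i, 0 < w i) -> \sum_j next_weight w b j = \sum_i w i.
Proof.
move=> w0; rewrite /next_weight (sum_cbin (fun u => bwt w b u / (al w b u)%:R)) ?(al_sum H)//.
rewrite [RHS](partition_big b xpredT)//=; apply: eq_bigr => u _.
have [a0|a0] := posnP (al w b u); last first.
  by rewrite mulrCA mulfV ?mulr1// pnatr_eq0 -lt0n.
rewrite a0 mul0r big1// => i /eqP bin_of'.
by have := al_gt0 H b i w0; rewrite bin_of' a0.
Qed.

Lemma wt_gt0 t om i : 0 < weight t om i.
Proof.
elim: t i => [|t ih] i /=; first by rewrite invr_gt0 ltr0n.
exact: nw_gt0.
Qed.

Lemma sum_wt t om : \sum_i weight t om i = 1.
Proof.
elim: t => [|t ih] /=; first by rewrite sumr_const card_ord -[LHS]mulr_natr mulVf// pnatr_eq0.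
by rewrite sum_nw ?ih// => i; exact: wt_gt0.
Qed.

Lemma sum_cc t om : (\sum_u children_alloc t om u)%N = N.
Proof. by apply: (al_sum H) => i; exact: wt_gt0. Qed.

Lemma cc_gt0 t om i : (0 < children_alloc t om (bin_of t om i))%N.
Proof. by apply: (al_gt0 H) => j; exact: wt_gt0. Qed.

Lemma cc_eq0 t om u : ~~ [exists i, bin_of t om i == u] -> children_alloc t om u = 0%N.
Proof. exact: (al_eq0 H). Qed.

Lemma pr_ge0 t om j i : 0 <= parent_prob t om j i.
Proof. by apply: prb_ge0 => k; exact: wt_gt0. Qed.

Lemma sum_pr t om j : \sum_i parent_prob t om j i = 1.
Proof.
apply: sum_prb; [by move=> k; exact: wt_gt0|exact: sum_cc|].
by move=> u; exact: cc_eq0.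
Qed.

Let Mt t := (2 * N * t)%N.

Lemma xi_dep t k j : (Mt t + N <= k)%N -> depends k (fun om => particle t om j).
Proof.
move=> h om om' e; rewrite /particle e//; apply: leq_trans h.
by rewrite ltn_add2l.
Qed.

Lemma bi_dep t k : (Mt t + N <= k)%N -> depends k (fun om => bin_of t om).
Proof. by move=> h om om' e; apply/funext => i; rewrite /bin_of (xi_dep i h e). Qed.

Lemma MtS t : (Mt t.+1 = Mt t + N + N)%N.
Proof. by rewrite /Mt mulnS; lia. Qed.

Lemma wt_dep t k : (Mt t <= k)%N -> depends k (fun om => weight t om).
Proof.
elim: t k => [//|t ih] k; rewrite MtS => h om om' e /=.
by rewrite (ih k _ _ _ e) ?(bi_dep _ e)//; lia.
Qed.

Lemma cc_dep t k : (Mt t + N <= k)%N -> depends k (fun om => children_alloc t om).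
Proof.
move=> h om om' e; rewrite /children_alloc (wt_dep _ e) ?(bi_dep h e)//.
by apply: leq_trans h; rewrite leq_addr.
Qed.

Lemma pr_dep t k : (Mt t + N <= k)%N -> depends k (fun om => parent_prob t om).
Proof.
move=> h om om' e; rewrite /parent_prob (wt_dep _ e) ?(bi_dep h e) ?(cc_dep h e)//.
by apply: leq_trans h; rewrite leq_addr.
Qed.

Lemma par_dep t k (j : 'I_N) : (Mt t + N + j < k)%N -> depends k (fun om => parent t om j).
Proof. by move=> h om om' e; rewrite /parent e. Qed.

Lemma xih_dep t k j : (Mt t.+1 <= k)%N -> depends k (fun om => child_position t om j).
Proof.
rewrite MtS => h om om' e; have /= ep : parent t om j = parent t om' j.
  by apply: par_dep e; have := ltn_ord j; lia.
by rewrite /child_position ep; apply: xi_dep e; lia.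
Qed.

Lemma measurable_xi t j : measurable_fun setT (fun om => particle t om j).
Proof. exact: (measurableT_comp measurable_fst (measurable_coord _)). Qed.

Lemma measurable_bi t i u : measurable [set om | bin_of t om i = u].
Proof.
have := measurable_xi t i measurableT (bn_meas H i u).
by rewrite setTI.
Qed.

Lemma measurable_par t j p : measurable [set om | parent t om j = p].
Proof.
have := measurableT_comp measurable_snd (measurable_coord (2 * N * t + N + j) : measurable_fun _ (fun om : traj S => _)).
move=> /(_ measurableT [set k | inord k = p])/=.
by rewrite setTI; apply.
Qed.

Lemma measurable_bi_ffun t (b : {ffun 'I_N -> 'I_N}) :
  measurable ((fun om => [ffun i => bin_of t om i]) @^-1` [set b]).
Proof. by apply: measurable_discr_ffun => i y; exact: measurable_bi. Qed.

Lemma bi_ffun t om : ([ffun i => bin_of t om i] : {ffun 'I_N -> 'I_N}) = bin_of t om :> (_ -> _).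
Proof. by apply/funext => i; rewrite ffunE. Qed.

Lemma measurable_cc_wt t : (forall i, measurable_fun setT (fun om => weight t om i)) ->
  forall u k, measurable [set om | children_alloc t om u = k].
Proof.
move=> mw u k; rewrite (_ : [set om | _] = [set om |
    al (weight t om) ([ffun i => bin_of t om i] : {ffun 'I_N -> 'I_N}) u = k]); last first.
  by apply/funext => om; rewrite /= bi_ffun.
apply: (measurable_discr_set (D := fun om => [ffun i => bin_of t om i] : {ffun 'I_N -> 'I_N})
  (A := fun b => [set om | al (weight t om) b u = k])).
  by move=> b; exact: measurable_bi_ffun.
move=> b; have := al_meas H (wt_gt0 t) mw b u measurableT (_ : measurable [set k]).
by rewrite setTI; apply.
Qed.

(* A function of the weights, the bins and the allocation is measurable as soon as it is
   so for fixed values of the last two, which are discrete. *)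
Lemma measurable_wbc d' (U : measurableType d') t
    (Phi : ('I_N -> R) -> ('I_N -> 'I_N) -> ('I_N -> nat) -> U) :
  (forall i, measurable_fun setT (fun om => weight t om i)) ->
  (forall b c, measurable_fun setT (fun om => Phi (weight t om) b c)) ->
  measurable_fun setT (fun om => Phi (weight t om) (bin_of t om) (children_alloc t om)).
Proof.
move=> mw mP.
rewrite (_ : (fun om => _) = (fun om => Phi (weight t om)
    ([ffun i => bin_of t om i] : {ffun 'I_N -> 'I_N})
    ([ffun u => children_alloc t om u] : {ffun 'I_N -> nat}))); last first.
  apply/funext => om; rewrite bi_ffun; congr (Phi _ _ _).
  by apply/funext => i; rewrite ffunE.
apply: (measurable_discr_fun (D := fun om => [ffun i => bin_of t om i] : {ffun 'I_N -> 'I_N})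
  (Phi := fun b om => Phi (weight t om) b ([ffun u => children_alloc t om u] : {ffun 'I_N -> nat}))).
  by move=> b; exact: measurable_bi_ffun.
move=> b; apply: (measurable_discr_fun (D := fun om => [ffun u => children_alloc t om u] : {ffun 'I_N -> nat})
  (Phi := fun c om => Phi (weight t om) b c)) => //.
by move=> c; apply: measurable_discr_ffun => u k; exact: measurable_cc_wt.
Qed.

Lemma measurable_bwt d' (T : measurableType d') (w : T -> 'I_N -> R) b u :
  (forall i, measurable_fun setT (w ^~ i)) -> measurable_fun setT (fun x => bwt (w x) b u).
Proof.
move=> mw; rewrite (_ : (fun x => _) = (fun x => \sum_i if b i == u then w x i else 0)).
  by apply: measurable_sum => j; case: eqP => // _; exact: measurable_cst.
by apply/funext => x; rewrite /bwt big_mkcond.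
Qed.

Lemma measurable_wt t i : measurable_fun setT (fun om => weight t om i).
Proof.
elim: t i => [|t ih] i; first exact: measurable_cst.
rewrite (_ : (fun om => _) = (fun om => (fun w b (c : 'I_N -> nat) => bwt w b (cbin c i) / (c (cbin c i))%:R)
  (weight t om) (bin_of t om) (children_alloc t om)))//.
apply: (measurable_wbc (Phi := fun w b (c : 'I_N -> nat) => bwt w b (cbin c i) / (c (cbin c i))%:R)) => // b c.
by apply: measurable_funM; [exact: measurable_bwt|exact: measurable_cst].
Qed.

Lemma measurable_bw t b u : measurable_fun setT (fun om => bwt (weight t om) b u).
Proof. by apply: measurable_bwt; exact: measurable_wt. Qed.

Lemma measurable_cc t u k : measurable [set om | children_alloc t om u = k].
Proof. by apply: measurable_cc_wt; exact: measurable_wt. Qed.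

Lemma measurable_pr t j i : measurable_fun setT (fun om => parent_prob t om j i).
Proof.
apply: (measurable_wbc (Phi := fun w b c => prb w b c j i)); first exact: measurable_wt.
move=> b c; rewrite /prb; case: eqP => [e|_]; last exact: measurable_cst.
apply: measurable_funM; first exact: measurable_wt.
apply: measurable_inv_gt0; last exact: measurable_bw.
by move=> om; rewrite -e; apply: bwt_gt0 => k; exact: wt_gt0.
Qed.

Lemma measurable_xih t j : measurable_fun setT (fun om => child_position t om j).
Proof.
apply: (measurable_discr_fun (D := fun om => parent t om j) (Phi := fun i om => particle t om i)).
  by move=> p; exact: measurable_par.
by move=> i; exact: measurable_xi.
Qed.

Definition step_measure (k : nat) om : {measure set S -> \bar R} :=
  let t := (k %/ (2 * N))%N in let r := (k %% (2 * N))%N in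
  if (r < N)%N then
    if t is t'.+1 then (pair0 (K (child_position t' om (inord r))) : {measure set S -> \bar R})
    else (pair0 mu0 : {measure set S -> \bar R})
  else (disc (parent_prob t om (inord (r - N))) : {measure set S -> \bar R}).

Lemma Mt_div t r : (r < 2 * N)%N -> ((2 * N * t + r) %/ (2 * N) = t)%N.
Proof. by move=> h; rewrite [(2 * N * t)%N]mulnC divnMDl// divn_small// addn0. Qed.

Lemma Mt_mod t r : (r < 2 * N)%N -> ((2 * N * t + r) %% (2 * N) = r)%N.
Proof. by move=> h; rewrite [(2 * N * t)%N]mulnC modnMDl modn_small. Qed.

Lemma step_measure_xi0 (j : 'I_N) om : step_measure j om = pair0 mu0.
Proof.
have h : (j < 2 * N)%N by have := ltn_ord j; lia.
by rewrite /step_measure divn_small// modn_small// ltn_ord.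
Qed.

Lemma step_measure_xi t (j : 'I_N) om :
  step_measure (2 * N * t.+1 + j) om = pair0 (K (child_position t om j)).
Proof.
have h : (j < 2 * N)%N by have := ltn_ord j; lia.
by rewrite /step_measure Mt_div// Mt_mod// ltn_ord inord_val.
Qed.

Lemma step_measure_par t (j : 'I_N) om :
  step_measure (2 * N * t + N + j) om = disc (parent_prob t om j).
Proof.
have h : (N + j < 2 * N)%N by have := ltn_ord j; lia.
rewrite /step_measure -addnA Mt_div// Mt_mod//.
by rewrite ltnNge leq_addr /= addKn inord_val.
Qed.

Lemma step_kernel : exists kap : nat -> R.-pker (traj S) ~> S,
  forall k om A, kap k om A = step_measure k om A.
Proof.
have h k : exists kk : R.-pker (traj S) ~> S, forall om A, kk om A = step_measure k om A.
  apply: pker_exists.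
  - move=> A mA; rewrite /step_measure; case: (k %% (2 * N) < N)%N.
      case: (k %/ (2 * N))%N => [|t]; first exact: measurable_cst.
      have mA0 : measurable [set x : X | A (x, 0%N)] by exact: measurable_pair0.
      exact: (measurableT_comp (measurable_kernel K _ mA0) (measurable_xih t (inord (k %% (2 * N))))).
    apply: emeasurable_sum => i; apply: emeasurable_funM; last exact: measurable_cst.
    apply/measurable_EFinP; apply: measurable_maxr; last exact: measurable_cst.
    exact: measurable_pr.
  - move=> om; rewrite /step_measure; case: ifP => _.
      case: (k %/ (2 * N))%N => [|t]; first exact: (probability_setT mu0).
      exact: (prob_kernel (s := K) (child_position t om (inord (k %% (2 * N))))).
    apply: disc_setT; first by move=> i; exact: pr_ge0.
    exact: sum_pr.
by have [kap hk] := choice h; exists kap.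
Qed.

Lemma step_dep k (A : set S) : depends k (fun om => step_measure k om A).
Proof.
move=> om om' e; have kE := divn_eq k (2 * N); rewrite /step_measure.
have kE' : (Mt (k %/ (2 * N)) + k %% (2 * N) = k)%N by rewrite /Mt mulnC -kE.
case: ltnP => r.
  move: kE'; case: (k %/ (2 * N))%N => [//|t] kE'.
  by rewrite (@xih_dep t k _ _ _ _ e)//; lia.
by rewrite (@pr_dep _ k _ _ _ e)//; lia.
Qed.

End construction.

(** * Conditional independence within a block of coordinates *)

Section product_kernel.
Context {d : measure_display} {S : measurableType d} {R : realType}.
Variables (kap : nat -> R.-pker (traj S) ~> S) (P : probability (traj S) R).
Hypothesis HP : forall k A (B : set S), Gk k A -> measurable B ->
  P (A `&` [set w | B (w k)]) = (\int[P]_(w in A) kap k w B)%E.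

Lemma Gk_coord k i (B : set S) : (i < k)%N -> measurable B ->
  Gk k [set w : traj S | B (w i)].
Proof.
move=> ik mB; split; last by move=> w w' e; rewrite /= e.
by have := measurable_coord i measurableT mB; rewrite setTI.
Qed.

Lemma GkI k (A B : set (traj S)) : Gk k A -> Gk k B -> Gk k (A `&` B).
Proof.
move=> [mA dA] [mB dB]; split; first exact: measurableI.
by move=> w w' e; rewrite /setI/= (dA w w' e) (dB w w' e).
Qed.

Lemma GkT k : Gk k [set: traj S].
Proof. by split; first exact: measurableT. Qed.

(** The kernels of the block see only the coordinates before [k0]. The last of them is therefore
    measurable for [Gk k0] and can be carried as a test function while the induction treats the
    other coordinates. Both the mutations and the draws of parents are blocks of this kind. *)
Lemma prob_coords k0 m (B : nat -> set S) (A : set (traj S)) : Gk k0 A ->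
  (forall j, measurable (B j)) ->
  (forall j, (j < m)%N -> depends k0 (fun w => kap (k0 + j) w (B j))) ->
  P (A `&` [set w | forall j, (j < m)%N -> B j (w (k0 + j)%N)]) =
  (\int[P]_(w in A) (\prod_(j < m) fine (kap (k0 + j) w (B j)))%:E)%E.
Proof.
move=> GA mB; pose Q m := [set w : traj S | forall j, (j < m)%N -> B j (w (k0 + j)%N)].
pose U m := fun w : traj S => ((\prod_(j < m) fine (kap (k0 + j) w (B j)))%:E)%E.
have GQ m' : Gk (k0 + m') (Q m').
  elim: m' => [|m' ih].
    rewrite (_ : Q 0%N = setT); first exact: GkT.
    by apply/seteqP; split.
  rewrite (_ : Q m'.+1 = Q m' `&` [set w | B m' (w (k0 + m')%N)]).
    apply: GkI; first by apply: Gk_mono ih; lia.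
    by apply: Gk_coord => //; lia.
  apply/seteqP; split => [w h|w [h1 h2] j].
    by split; [move=> j jm; apply: h; lia|apply: h].
  by rewrite ltnS leq_eqVlt => /predU1P[->//|]; exact: h1.
have fin j (w : traj S) : kap (k0 + j)%N w (B j) \is a fin_num.
  rewrite ge0_fin_numE//; apply: (le_lt_trans _ (ltry 1)).
  rewrite -(prob_kernel (s := kap (k0 + j)%N) w); apply: le_measure; rewrite ?inE//.
have U0 m' w : (0 <= U m' w)%E.
  by rewrite lee_fin; apply: prodr_ge0 => j _; rewrite fine_ge0.
have mU m' : measurable_fun setT (U m').
  apply/measurable_EFinP; apply: measurable_prod => j _.
  apply: measurableT_comp => //; exact: measurable_kernel.
rewrite -/(Q m) -/(U m).
elim: m A GA => [|m ih] A GA hd.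
  rewrite (_ : Q 0%N = setT); last by apply/seteqP; split.
  rewrite setIT /U (eq_integral (cst 1%E)); last by move=> w _; rewrite big_ord0.
  by rewrite integral_cst ?mul1e//; case: GA.
have -> : A `&` Q m.+1 = (A `&` Q m) `&` [set w | B m (w (k0 + m)%N)].
  apply/seteqP; split => [w [Aw h]|w [[Aw h1] h2]].
    by split; [split => // j jm; apply: h; lia|apply: h].
  split => // j; rewrite ltnS leq_eqVlt => /predU1P[->//|]; exact: h1.
rewrite HP//; last first.
  apply: GkI; last exact: GQ.
  by apply: Gk_mono GA; lia.
have sG := @Gk_sub_sigma _ S k0.
pose Hm := fun w : traj S => ((\1_A w)%:E * kap (k0 + m)%N w (B m))%E.
have mQ : measurable (Q m) by case: (GQ m).
have mA : measurable A by case: GA.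
have Hm0 w : (0 <= Hm w)%E by rewrite mule_ge0// lee_fin.
rewrite integral_mkcond [RHS]integral_mkcond.
transitivity (\int[P]_w (Hm w * (\1_(Q m) w)%:E))%E.
  apply: eq_integral => w _; rewrite epatch_indic /Hm indicI /= EFinM.
  by rewrite muleC -muleA [((\1_(Q m) w)%:E * _)%E]muleC muleA.
rewrite (@eq_integral_sub_sigma _ _ _ P (Gk k0) (fun w => (\1_(Q m) w)%:E) (U m) Hm sG) //.
- apply: eq_integral => w _; rewrite epatch_indic /Hm /= /U big_ord_recr /= EFinM fineK//.
  by rewrite [RHS]muleC -!muleA; congr (_ * _)%E; rewrite muleC.
- exact/measurable_EFinP/measurable_indic.
- move=> A' GA'; have mA' : measurable A' by case: GA'.
  rewrite integral_indic// (setIC (Q m)); apply: ih => // j jm.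
  by apply: hd; lia.
- apply: GmeasMe => //; last by apply: Gk_meas; [exact: measurable_kernel|apply: hd].
  exact: (Gmeas_EFin sG (Gmeas_indic sG GA)).
Qed.

End product_kernel.

Section WE_of_allocation.
Context {R : realType} {d : measure_display} {X : measurableType d}.
Variables (K : R.-pker X ~> X) (mu0 : probability X R) (n : nat).
Local Notation N := n.+1.
Local Notation S := (X * nat)%type.
Variables (bn : 'I_N -> X -> 'I_N).
Variable (al : ('I_N -> R) -> ('I_N -> 'I_N) -> 'I_N -> nat).
Hypothesis H : allocation bn al.
Local Notation xi := (@particle _ X n).
Local Notation par := (@parent _ X n).
Local Notation bi := (bin_of bn).
Local Notation wt := (weight bn al).
Local Notation cc := (children_alloc bn al).
Local Notation pr := (parent_prob bn al).
Local Notation Mt t := (2 * N * t)%N.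

Definition nchildren t (om : traj S) (i : 'I_N) : nat := #|[set j | par t om j == i]%SET|.

(** F_t stops after the particles of time t, that is after 2Nt + N coordinates, and Fh_t after the
    parents drawn among them. The child weights are those of time t+1, which are functions of the
    weights and bins at time t. *)
Definition we_data : WEdata R N X (traj S) :=
  @WEData R N _ X _ (traj S) (fun t => Gk (Mt t + N)) (fun t => Gk (Mt t.+1)) xi wt bi cc nchildren
    (fun t om j => child_position t om j) (fun t => wt t.+1) par.

Variables (kap : nat -> R.-pker (traj S) ~> S) (P : probability (traj S) R).
Hypothesis hkap : forall k om A, kap k om A = step_measure K mu0 bn al k om A.
Hypothesis HP : forall k A (B : set S), Gk k A -> measurable B ->
  P (A `&` [set w | B (w k)]) = (\int[P]_(w in A) kap k w B)%E.

Lemma kap_depends k (B : set S) : depends k (fun w => kap k w B).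
Proof. by move=> w w' e; rewrite !hkap; exact: step_dep e. Qed.

Lemma kap_xi t (j : 'I_N) om (B : set X) :
  kap (Mt t.+1 + j) om [set s | B s.1] = K (child_position t om j) B.
Proof. by rewrite hkap step_measure_xi. Qed.

Lemma kap_par t (j : 'I_N) om p :
  kap (Mt t + N + j) om [set s | inord s.2 = p] = (pr t om j p)%:E.
Proof.
rewrite hkap step_measure_par /= disc_label// => i; exact: pr_ge0.
Qed.

Lemma measurable_fst_set (B : set X) : measurable B -> measurable [set s : S | B s.1].
Proof.
move=> mB; have mS : measurable_fun setT (fun s : S => s.1) := measurable_fst.
by have := mS measurableT B mB; rewrite setTI.
Qed.

Lemma measurable_snd_set (p : 'I_N) : measurable [set s : S | inord s.2 = p].
Proof.
have mS : measurable_fun setT (fun s : S => s.2) := measurable_snd.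
have := mS measurableT [set k | inord k = p].
by rewrite setTI; apply.
Qed.

Lemma law_xi0 (B : 'I_N -> set X) : (forall i, measurable (B i)) ->
  P [set om | forall i, B i (xi 0 om i)] = (\prod_i fine (mu0 (B i)))%:E.
Proof.
move=> mB; have := @prob_coords _ S R kap P HP 0 N (fun j => [set s | B (inord j) s.1]) setT (@GkT _ _ _).
move=> /(_ (fun j => measurable_fst_set (mB (inord j)))).
rewrite setTI (_ : [set w | _] = [set om | forall i, B i (xi 0 om i)]); last first.
  apply/seteqP; split => w /= h.
    move=> i; have := h i (ltn_ord i); rewrite inord_val add0n /particle muln0 add0n//.
  by move=> j jN; have := h (Ordinal jN); rewrite /particle muln0 /= (_ : inord j = Ordinal jN)//; apply: val_inj; rewrite /= inordK.
move=> ->.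
  rewrite (eq_integral (cst (\prod_i fine (mu0 (B i)))%:E)).
    by rewrite integral_cst// [X in (_ * X)%E]probability_setT mule1.
  move=> w _; congr EFin; apply: eq_bigr => j _.
  by rewrite add0n hkap step_measure_xi0 inord_val.
by move=> j jN w w' _; rewrite add0n !hkap -[j]/(Ordinal jN : nat) !step_measure_xi0.
Qed.

Lemma law_xi t A (B : 'I_N -> set X) : Gk (Mt t.+1) A -> (forall j, measurable (B j)) ->
  P (A `&` [set om | forall j, B j (xi t.+1 om j)]) =
  (\int[P]_(om in A) (\prod_j fine (K (child_position t om j) (B j)))%:E)%E.
Proof.
move=> GA mB; have := @prob_coords _ S R kap P HP (Mt t.+1) N (fun j => [set s | B (inord j) s.1]) A GA.
move=> /(_ (fun j => measurable_fst_set (mB (inord j)))).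
rewrite (_ : [set w | _] = [set om | forall i, B i (xi t.+1 om i)]); last first.
  apply/seteqP; split => w /= h.
    by move=> i; have := h i (ltn_ord i); rewrite inord_val.
  by move=> j jN; have := h (Ordinal jN); rewrite /particle /= (_ : inord j = Ordinal jN)//; apply: val_inj; rewrite /= inordK.
move=> ->.
  apply: eq_integral => w _; congr EFin; apply: eq_bigr => j _.
  by rewrite kap_xi inord_val.
move=> j jN w w' e; rewrite -[j]/(Ordinal jN : nat) !kap_xi.
by rewrite (xih_dep _ _ e).
Qed.

Lemma law_par t A (p : 'I_N -> 'I_N) : Gk (Mt t + N) A ->
  P (A `&` [set om | forall j, par t om j = p j]) =
  (\int[P]_(om in A) (\prod_j pr t om j (p j))%:E)%E.
Proof.
move=> GA; have := @prob_coords _ S R kap P HP (Mt t + N) N (fun j => [set s | inord s.2 = p (inord j)]) A GA.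
move=> /(_ (fun j => measurable_snd_set (p (inord j)))).
rewrite (_ : [set w | _] = [set om | forall j, par t om j = p j]); last first.
  apply/seteqP; split => w /= h.
    by move=> i; have := h i (ltn_ord i); rewrite inord_val.
  by move=> j jN; have := h (Ordinal jN); rewrite /parent /= (_ : inord j = Ordinal jN)//; apply: val_inj; rewrite /= inordK.
move=> ->.
  apply: eq_integral => w _; congr EFin; apply: eq_bigr => j _.
  by rewrite kap_par inord_val.
move=> j jN w w' e; rewrite -[j]/(Ordinal jN : nat) !kap_par.
by rewrite (@pr_dep _ _ _ _ bn al t _ (leqnn _) _ _ e).
Qed.

Lemma law_par1 t A (j i : 'I_N) : Gk (Mt t + N + j) A ->
  P (A `&` [set om | par t om j = i]) = (\int[P]_(om in A) (pr t om j i)%:E)%E.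
Proof.
move=> GA; rewrite -[[set om | _]]/[set w : traj S | [set s : S | inord s.2 = i] (w (Mt t + N + j)%N)].
rewrite HP//; last exact: measurable_snd_set.
by apply: eq_integral => w _; exact: kap_par.
Qed.

Lemma Gk_bi_cbin t k i j : (Mt t + N <= k)%N ->
  Gk k [set om | bi t om i = cbin (cc t om) j].
Proof.
move=> tk; split; last first.
  by move=> w w' e; rewrite /= (bi_dep _ tk e) (cc_dep _ _ tk e).
rewrite (_ : [set om | _] = [set om | bi t om i = cbin ([ffun u => cc t om u] : {ffun 'I_N -> nat}) j]); last first.
  apply/funext => om /=; congr (_ = cbin _ _).
  by apply/funext => u; rewrite ffunE.
apply: (measurable_discr_set (D := fun om => [ffun u => cc t om u] : {ffun 'I_N -> nat})
    (A := fun c => [set om | bi t om i = cbin c j])).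
  by move=> c; apply: measurable_discr_ffun => u l; exact: (measurable_cc H).
by move=> c; exact: (measurable_bi H).
Qed.

(** Outside the bin of child j the drawing probability is 0; there are finitely many candidate
    parents, so the exceptional events together form a null set. *)
Lemma ae_par t : {ae P, forall om, forall j, bi t om (par t om j) = cbin (cc t om) j}.
Proof.
apply: filter_forall => j.
pose bad i := [set om | bi t om i <> cbin (cc t om) j].
have Gbad i : Gk (Mt t + N + j) (bad i).
  have sG := @Gk_sub_sigma _ S (Mt t + N + j).
  have [[_ sC _] _] := sG; rewrite (_ : bad i = setT `\` [set om | bi t om i = cbin (cc t om) j]).
    by apply: sC; apply: Gk_bi_cbin; exact: leq_addr.
  by apply/seteqP; split => [w|w []].
have h i : {ae P, forall om, bad i om -> par t om j <> i}.
  exists (bad i `&` [set om | par t om j = i]); split.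
  - apply: measurableI; last exact: measurable_par.
    by case: (Gbad i).
  - rewrite law_par1//; apply: integral0_eq => om; rewrite /bad /= => bi'.
    by rewrite /parent_prob /prb; case: eqP.
  - by move=> om /= /not_implyP[b1 /contrapT b2].
have h' := filter_forall (ae_filter_ringOfSetsType P) h; apply: filterS h' => om /= hom.
by apply: contrapT => b; exact: (hom (par t om j) b erefl).
Qed.

End WE_of_allocation.

Section WE_of_allocation.
Context {R : realType} {d : measure_display} {X : measurableType d}.
Variables (K : R.-pker X ~> X) (mu0 : probability X R) (n : nat).
Local Notation N := n.+1.
Local Notation S := (X * nat)%type.
Variables (bn : 'I_N -> X -> 'I_N).
Variable (al : ('I_N -> R) -> ('I_N -> 'I_N) -> 'I_N -> nat).
Hypothesis H : allocation bn al.
Local Notation xi := (@particle _ X n).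
Local Notation par := (@parent _ X n).
Local Notation bi := (bin_of bn).
Local Notation wt := (weight bn al).
Local Notation cc := (children_alloc bn al).
Local Notation pr := (parent_prob bn al).
Local Notation nch := (@nchildren _ X n).
Local Notation Mt t := (2 * N * t)%N.
Local Notation wed := (we_data bn al).
Variables (kap : nat -> R.-pker (traj S) ~> S) (P : probability (traj S) R).
Hypothesis hkap : forall k om A, kap k om A = step_measure K mu0 bn al k om A.
Hypothesis HP : forall k A (B : set S), Gk k A -> measurable B ->
  P (A `&` [set w | B (w k)]) = (\int[P]_(w in A) kap k w B)%E.

Lemma nchildrenE t om i : nch t om i = (\sum_j (par t om j == i))%N.
Proof.
by rewrite /nchildren -sum1_card [LHS]big_mkcond; apply: eq_bigr => j _; rewrite inE; case: eqP.
Qed.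

Definition cfac t om i : R :=
  (cc t om (bi t om i))%:R * wt t om i / bwt (wt t om) (bi t om) (bi t om i).

Lemma sum_pr_children t om i : \sum_j pr t om j i = cfac t om i.
Proof.
rewrite /parent_prob /prb (sum_cbin (fun u => if bi t om i == u then
    wt t om i / bwt (wt t om) (bi t om) u else 0)) ?(sum_cc H)//.
rewrite (bigD1 (bi t om i))//= eqxx big1 ?addr0 ?mulrA// => u.
by rewrite eq_sym => /negbTE ->; rewrite mulr0.
Qed.

Lemma integral_nchildren t i A : Gk (Mt t + N) A ->
  (\int[P]_(om in A) ((nch t om i)%:R)%:E = \int[P]_(om in A) (cfac t om i)%:E)%E.
Proof.
move=> GA; have mA : measurable A by case: GA.
have mp j : measurable_fun A (fun om => (pr t om j i)%:E).
  by have mp := measurable_pr H t j i; apply: measurable_funTS; exact/measurable_EFinP.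
have mi j : measurable_fun A (fun om : traj S => (\1_[set om | par t om j = i] om)%:E : \bar R).
  by apply/measurable_EFinP; apply: measurable_indic; exact: measurable_par.
transitivity (\sum_j \int[P]_(om in A) (\1_[set om | par t om j = i] om)%:E)%E.
  rewrite -ge0_integral_sum//.
  apply: eq_integral => om _; rewrite nchildrenE sumEFin natr_sum; congr EFin.
  apply: eq_bigr => j _.
  by rewrite indicE; case: eqP => e; [rewrite mem_set|rewrite memNset].
transitivity (\sum_j \int[P]_(om in A) (pr t om j i)%:E)%E; last first.
  rewrite -ge0_integral_sum//; last by move=> j om _; rewrite lee_fin (pr_ge0 H).
  by apply: eq_integral => om _; rewrite sumEFin sum_pr_children.
apply: eq_bigr => j _; rewrite integral_indic//; last exact: measurable_par.
by rewrite setIC; apply: (law_par1 H hkap HP); exact: (Gk_mono (leq_addr _ _) GA).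
Qed.

Lemma measurable_cfac t i : measurable_fun setT (fun om => cfac t om i).
Proof.
apply: (measurable_wbc H (Phi := fun w b (c : 'I_N -> nat) => (c (b i))%:R * w i / bwt w b (b i))).
  exact: (measurable_wt H).
move=> b c; apply: measurable_funM.
  by apply: measurable_funM; [exact: measurable_cst|exact: (measurable_wt H)].
apply: measurable_inv_gt0; last exact: (measurable_bw H).
by move=> om; apply: bwt_gt0 => j; exact: (wt_gt0 H).
Qed.

Lemma Gk_cfac t i : Gmeas (Gk (Mt t + N)) (fun om => cfac t om i).
Proof.
apply: Gk_meas; first exact: measurable_cfac.
by move=> w w' e; rewrite /cfac (bi_dep _ (leqnn _) e) (cc_dep _ _ (leqnn _) e)
  (wt_dep _ _ (leq_addr _ _) e).
Qed.

Lemma we_of_allocation : is_WE_method K P mu0 wed.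
Proof.
split => //; split; first by move=> t; split; exact: Gk_sub_sigma.
split.
  move=> t; split; apply: Gk_mono; lia.
split; first exact: (law_xi0 hkap HP).
split; first by [].
split; last first.
  split; last by [].
  by move=> t A B GA mB; exact: (law_xi hkap HP).
move=> t; split.
  move=> i; split; first by apply: Gk_meas; [exact: measurable_xi|exact: xi_dep].
  split.
    apply: Gk_meas; first exact: (measurable_wt H).
    by move=> w w' e /=; rewrite (wt_dep _ _ (leq_addr _ _) e).
  split; first exact: Gk_cfac.
  move=> u; split; first exact: (measurable_bi H).
  by move=> w w' e; rewrite /preimage/= (bi_dep _ (leqnn _) e).
split.
  move=> u k; split; first exact: (measurable_cc H).
  by move=> w w' e; rewrite /preimage/= (cc_dep _ _ (leqnn _) e).
split; first by move=> om u /existsP[i /eqP <-]; exact: (cc_gt0 H).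
split.
  move=> om; rewrite -[RHS](sum_cc H t om) [RHS](bigID (bin_nonempty wed t om)) /=.
  by rewrite [X in (_ = _ + X)%N]big1 ?addn0// => u; exact: (cc_eq0 H).
split.
  move=> om i; apply: divr_gt0; last by apply: bwt_gt0 => k; exact: (wt_gt0 H).
  by apply: mulr_gt0; [rewrite ltr0n; exact: (cc_gt0 H)|exact: (wt_gt0 H)].
split; first by move=> i A GA; exact: integral_nchildren.
split.
  apply: filterS (ae_par H hkap HP t) => om e u /=.
  rewrite -(card_cbin u (sum_cc H t om)).
  under eq_bigr do rewrite nchildrenE.
  rewrite exchange_big [RHS]big_mkcond; apply: eq_bigr => j _ /=.
  rewrite -e; case: eqP => [bu|bu].
    by rewrite (bigD1 (par t om j)) ?bu//= eqxx big1// => i /andP[_ /negbTE]; rewrite eq_sym => ->.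
  by rewrite big1// => i /eqP bi'; apply/eqP; rewrite eqb0; apply/eqP => pj; apply: bu; rewrite pj.
split.
  apply: filterS (ae_par H hkap HP t) => om e; split => [i|j].
    by apply: eq_card => j /=; rewrite [RHS]inE; apply/idP/idP; rewrite inE.
  split => //.
  by rewrite /= /next_weight -/(cc t om) e.
move=> j; split; first by apply: Gk_meas; [exact: measurable_xih|exact: xih_dep].
apply: Gk_meas; first exact: (measurable_wt H t.+1).
by move=> w w' e; have := wt_dep bn al (leqnn (2 * N * t.+1)) e => /= ->.
Qed.

(** The event of given offspring numbers is split along the tuple of parents, whose conditional law
    is a product; the sum over tuples is [sum_fibers_multinomial]. *)
Lemma binned_multinomial_of_allocation : binned_multinomial P wed.
Proof.
move=> t A k GA; have mA : measurable A by case: GA.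
pose E (p : N.-tuple 'I_N) := [set om | forall j, par t om j = tnth p j].
have mE p : measurable (E p).
  rewrite (_ : E p = \bigcap_(j in [set: 'I_N]) [set om | par t om j = tnth p j]).
    by apply: fin_bigcap_measurable => [|j _]; [exact: finite_finset|exact: measurable_par].
  by apply/seteqP; split => om h; [move=> j _; exact: h|move=> j; exact: h].
rewrite [RHS](eq_integral (fun om => \sum_(p : N.-tuple 'I_N)
    if [forall i, count_mem i p == k i] then (\prod_j pr t om j (tnth p j))%:E else 0)%E); last first.
  move=> om _; rewrite -big_mkcond sumEFin sum_fibers_multinomial ?(sum_cc H)//.
  exact: (cc_eq0 H).
have E0 p om : (0 <= (\prod_j pr t om j (tnth p j))%:E)%E.
  by rewrite lee_fin; apply: prodr_ge0 => j _; exact: (pr_ge0 H).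
rewrite [RHS]ge0_integral_sum//; last 2 first.
- move=> p; case: [forall i, count_mem i p == k i] => //; apply: measurable_funTS; apply/measurable_EFinP.
  by apply: measurable_prod => j _; exact: (measurable_pr H t j (tnth p j)).
- by move=> p om _; case: ifP.
transitivity (\sum_(p : N.-tuple 'I_N) \int[P]_(om in A)
    (if [forall i, count_mem i p == k i] then (\1_(E p) om)%:E else 0))%E; last first.
  apply: eq_bigr => p _; case: [forall i, count_mem i p == k i] => //.
  by rewrite integral_indic// setIC; exact: (law_par H hkap HP).
rewrite -ge0_integral_sum//; last 2 first.
- move=> p; case: [forall i, count_mem i p == k i] => //; apply: measurable_funTS; apply/measurable_EFinP.
  exact: measurable_indic.
- by move=> p om _; case: ifP => // _; rewrite lee_fin.
have -> : [set om | forall i, nch t om i = k i] =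
    [set om | [forall i, count_mem i [tuple par t om j | j < N] == k i]].
  have cE om i : count_mem i [tuple par t om j | j < N] = nch t om i.
    rewrite /= count_map -sum1_count big_enum_cond nchildrenE [LHS]big_mkcond.
    by apply: eq_bigr => j _ /=; case: eqP.
  apply/seteqP; split => om /= h.
    by apply/forallP => i; rewrite cE h.
  by move=> i; rewrite -cE; apply/eqP; exact: (forallP h).
set C := [set om | _].
have mC : measurable C.
  rewrite (_ : C = [set om | [forall i, count_mem i [tuple ([ffun j => par t om j] : {ffun 'I_N -> 'I_N}) j | j < N] == k i]]).
    apply: (measurable_discr_set (D := fun om => [ffun j => par t om j] : {ffun 'I_N -> 'I_N})
      (A := fun p => [set om : traj S | [forall i, count_mem i [tuple p j | j < N] == k i]])) => p.
      by apply: measurable_discr_ffun => j y; exact: measurable_par.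
    case: (boolP [forall i, count_mem i [tuple p j | j < N] == k i]) => h.
      by rewrite (_ : [set _ | _] = setT)//; apply/seteqP; split.
    by rewrite (_ : [set _ | _] = set0)//; apply/seteqP; split.
  apply/funext => om; rewrite /C /=; congr (is_true _).
  apply: eq_forallb => i; congr (count_mem i _ == _).
  by apply: eq_map => j; rewrite ffunE.
rewrite setIC -integral_indic//; apply: eq_integral => om _.
rewrite (bigD1 [tuple par t om j | j < N])//= big1 ?adde0; last first.
  move=> p pn; case: ifP => // _; rewrite indicE memNset// => h.
  case/eqP: pn; apply: eq_from_tnth => j; by rewrite tnth_mktuple h.
rewrite [in RHS]indicE mem_set; last by move=> j; rewrite tnth_mktuple.
by rewrite indicE /C; case: ifP => h; [rewrite mem_set|rewrite memNset//= h].
Qed.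

End WE_of_allocation.

(** * Variance of the selection step *)

Lemma itg_norm d (Om : measurableType d) (R : realType) (P : probability Om R) (Y : Om -> R) :
  itg P Y -> itg P (fun w => `|Y w|).
Proof. exact: integrable_abse. Qed.

Section selection_variance.
Context {R : realType} {d : measure_display} {X : measurableType d}.
Variables (K : R.-pker X ~> X) (mu0 : probability X R) (n : nat).
Local Notation N := n.+1.
Local Notation S := (X * nat)%type.
Variables (bn : 'I_N -> X -> 'I_N).
Variable (al : ('I_N -> R) -> ('I_N -> 'I_N) -> 'I_N -> nat).
Hypothesis H : allocation bn al.
Local Notation xi := (@particle _ X n).
Local Notation xih := (@child_position _ X n).
Local Notation par := (@parent _ X n).
Local Notation bi := (bin_of bn).
Local Notation wt := (weight bn al).
Local Notation cc := (children_alloc bn al).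
Local Notation pr := (parent_prob bn al).
Local Notation Mt t := (2 * N * t)%N.
Variables (kap : nat -> R.-pker (traj S) ~> S) (P : probability (traj S) R).
Hypothesis hkap : forall k om A, kap k om A = step_measure K mu0 bn al k om A.
Hypothesis HP : forall k A (B : set S), Gk k A -> measurable B ->
  P (A `&` [set w | B (w k)]) = (\int[P]_(w in A) kap k w B)%E.
Variables (V : X -> \bar R) (mu : probability X R) (CV D r : R).
Hypothesis Hs : sqrtV_ergodic K mu V CV D r.
Hypothesis PS : particle_system K V P (fun t => Gk (Mt t + N)) (fun t => Gk (Mt t.+1))
  xi xih wt.
Local Notation cls := (V_class V).
Implicit Types (om : traj S) (j k i u : 'I_N) (psi : X -> R).

Let mxi t i : measurable_fun setT (fun om => xi t om i). Proof. exact: measurable_xi. Qed.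

Lemma measurable_par_eq t j i :
  measurable_fun setT (fun om => (par t om j == i)%:R : R).
Proof.
have mi := @measurable_par _ X n t j i.
rewrite (_ : (fun om => _) = (\1_[set om | par t om j = i] : _ -> R)).
  exact: measurable_indic.
by apply/funext => om; rewrite indicE; case: eqP => h; [rewrite mem_set|rewrite memNset].
Qed.

Lemma ex_par t j i (Y : traj S -> R) : Gmeas (Gk (Mt t + N + j)) Y ->
  itg P (fun om => Y om * (par t om j == i)%:R) -> itg P (fun om => Y om * pr t om j i) ->
  ex P (fun om => Y om * (par t om j == i)%:R) = ex P (fun om => Y om * pr t om j i).
Proof.
have sG := @Gk_sub_sigma _ S (Mt t + N + j).
have p0 := pr_ge0 H t.
have nonneg (Z : traj S -> R) : Gmeas (Gk (Mt t + N + j)) Z -> (forall om, 0 <= Z om) ->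
    ex P (fun om => Z om * (par t om j == i)%:R) = ex P (fun om => Z om * pr t om j i).
  move=> GZ Z0; rewrite /ex /Rintegral; congr fine.
  under eq_integral do rewrite EFinM; under [in RHS]eq_integral do rewrite EFinM.
  apply: (eq_integral_sub_sigma sG) => //.
  - by apply/measurable_EFinP; exact: measurable_par_eq.
  - by apply/measurable_EFinP; exact: (measurable_pr H t j i).
  - by move=> om; rewrite lee_fin p0.
  - move=> A GA; have mA : measurable A by case: GA.
    rewrite (eq_integral (fun om => (\1_[set om | par t om j = i] om)%:E)); last first.
      by move=> om _; rewrite indicE; case: eqP => h; [rewrite mem_set|rewrite memNset].
    rewrite integral_indic//; last exact: measurable_par.
    by rewrite setIC; exact: (law_par1 H hkap HP).
  - exact: (Gmeas_EFin sG GZ).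
move=> GY i1 i2.
have mY := Gmeas_measurable sG GY.
have E (U : traj S -> R) : (forall om, 0 <= U om) -> measurable_fun setT U ->
    itg P (fun om => Y om * U om) ->
    ex P (fun om => Y om * U om) = ex P (fun om => Num.max (Y om) 0 * U om) -
      ex P (fun om => Num.max (- Y om) 0 * U om).
  move=> U0 mU iU.
  have b1 om : `|Num.max (Y om) 0 * U om| <= `|Y om * U om|.
    rewrite !normrM; apply: ler_wpM2r => //.
    by rewrite maxEle; case: ifP => //; rewrite normr0.
  have b2 om : `|Num.max (- Y om) 0 * U om| <= `|Y om * U om|.
    rewrite !normrM; apply: ler_wpM2r => //.
    by rewrite maxEle; case: ifP => //; rewrite ?normr0 ?normrN.
  have iaU := itg_norm iU.
  rewrite -exB.
  - by apply: eq_ex => om; rewrite -mulrBl -posnegB.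
  - apply: le_itg b1 iaU; apply: measurable_funM => //; exact: measurable_maxr.
  - apply: le_itg b2 iaU; apply: measurable_funM => //; apply: measurable_maxr => //.
    exact: measurableT_comp.
rewrite (E (fun om => (par t om j == i)%:R))//; last exact: measurable_par_eq.
rewrite (E (fun om => pr t om j i))//; last exact: (measurable_pr H t j i).
rewrite !nonneg//.
- exact: (Gmeas_maxN0 sG GY).
- by move=> om; rewrite le_max lexx orbT.
- exact: (Gmeas_max0 sG GY).
- by move=> om; rewrite le_max lexx orbT.
Qed.

Lemma ex_at_par t k (Y : 'I_N -> traj S -> R) :
  (forall i, Gmeas (Gk (Mt t + N + k)) (Y i)) ->
  (forall i, itg P (fun om => Y i om * (par t om k == i)%:R)) ->
  (forall i, itg P (fun om => Y i om * pr t om k i)) ->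
  ex P (fun om => Y (par t om k) om) = ex P (fun om => \sum_i Y i om * pr t om k i).
Proof.
move=> GY i1 i2.
rewrite (@eq_ex _ _ _ P _ (fun om => \sum_i Y i om * (par t om k == i)%:R)); last first.
  move=> om; rewrite (bigD1 (par t om k))//= eqxx mulr1 big1 ?addr0// => i.
  by rewrite eq_sym => /negbTE ->; rewrite mulr0.
rewrite ex_sum// ex_sum//; apply: eq_bigr => i _; exact: ex_par.
Qed.

Definition pmean t psi om j : R := \sum_i pr t om j i * psi (xi t om i).

(** The centred contribution of child j. Its weight is fixed before its parent is drawn, and by
    [sum_wt_pr] the weighted means add up to W_t(psi), so these terms sum to the selection
    increment. *)
Definition sel_term t psi om j : R := wt t.+1 om j * (psi (xih t om j) - pmean t psi om j).

Lemma wt_pr t om j i : wt t.+1 om j * pr t om j i =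
  if bi t om i == cbin (cc t om) j then wt t om i / (cc t om (bi t om i))%:R else 0.
Proof.
rewrite /parent_prob /prb; case: eqP => [e|_]; last by rewrite mulr0.
have -> : wt t.+1 om j = bwt (wt t om) (bi t om) (cbin (cc t om) j) / (cc t om (cbin (cc t om) j))%:R by [].
rewrite e; field; apply/andP; split.
  by rewrite pnatr_eq0 -lt0n cbin_gt0 ?(sum_cc H).
by rewrite gt_eqF// -e; apply: bwt_gt0 => k; exact: (wt_gt0 H).
Qed.

Lemma sum_wt_pr t om i : \sum_j wt t.+1 om j * pr t om j i = wt t om i.
Proof.
under eq_bigr do rewrite wt_pr.
rewrite (sum_cbin (fun u => if bi t om i == u then wt t om i / (cc t om (bi t om i))%:R else 0)) ?(sum_cc H)//.
rewrite (bigD1 (bi t om i))//= eqxx big1 ?addr0; last first.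
  by move=> u; rewrite eq_sym => /negbTE ->; rewrite mulr0.
by rewrite mulrC divfK// pnatr_eq0 -lt0n (cc_gt0 H).
Qed.

Lemma wt_pr_le t om j i : 0 <= wt t.+1 om j * pr t om j i <= wt t om i.
Proof.
have p0 k : 0 <= wt t.+1 om k * pr t om k i.
  by apply: mulr_ge0; [apply: ltW; exact: (wt_gt0 H)|exact: (pr_ge0 H)].
rewrite p0 /= -(sum_wt_pr t om i) (bigD1 j)//= lerDl.
by apply: sumr_ge0 => k _; exact: p0.
Qed.

Lemma wt_le1 t om j : wt t om j <= 1.
Proof.
rewrite -(sum_wt H t om) (bigD1 j)//= lerDl; apply: sumr_ge0 => k _.
by apply: ltW; exact: (wt_gt0 H).
Qed.

Lemma Wh_sub_W t psi om : wsumh xih wt t psi om - wsum xi wt t psi om = \sum_j sel_term t psi om j.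
Proof.
rewrite /sel_term; under [RHS]eq_bigr do rewrite mulrBr.
rewrite sumrB; congr (_ - _); rewrite /wsum /pmean.
under [RHS]eq_bigr do rewrite mulr_sumr.
rewrite exchange_big /=; apply: eq_bigr => i _.
by under eq_bigr do rewrite mulrA; rewrite -mulr_suml sum_wt_pr.
Qed.

Section one_function.
Variables (a : R) (psi : X -> R) (t : nat).
Hypotheses (a0 : 0 < a) (cpsi : cls a psi).

Let mpsi : measurable_fun setT psi. Proof. by case: cpsi. Qed.

Lemma measurable_psi_xi i : measurable_fun setT (fun om => psi (xi t om i)).
Proof. exact: (measurableT_comp mpsi (mxi t i)). Qed.

Lemma measurable_pmean j : measurable_fun setT (fun om => pmean t psi om j).
Proof.
apply: measurable_sum => i; apply: measurable_funM; first exact: (measurable_pr H t j i).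
exact: measurable_psi_xi.
Qed.

Lemma L2_wt_pr j i : L2 P (fun om => wt t.+1 om j * pr t om j i * psi (xi t om i)).
Proof.
apply: le_L2 (L2_term PS Hs t i (ltW a0) cpsi) => [|om].
  apply: measurable_funM; last exact: measurable_psi_xi.
  by apply: measurable_funM; [exact: (measurable_wt H t.+1 j)|exact: (measurable_pr H t j i)].
have /andP[h1 h2] := wt_pr_le t om j i.
rewrite normrM [leRHS]normrM; apply: ler_wpM2r => //.
by rewrite [leLHS]ger0_norm// [leRHS]ger0_norm// (ltW (wt_gt0 H t om i)).
Qed.

Lemma L2_wt_pmean j : L2 P (fun om => wt t.+1 om j * pmean t psi om j).
Proof.
rewrite (_ : (fun om => _) = (fun om => \sum_i wt t.+1 om j * pr t om j i * psi (xi t om i))).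
  by apply: L2_sum => i; exact: L2_wt_pr.
by apply/funext => om; rewrite /pmean mulr_sumr; apply: eq_bigr => i _; rewrite mulrA.
Qed.

Lemma L2_sel_term j : L2 P (fun om => sel_term t psi om j).
Proof.
rewrite (_ : (fun om => _) = (fun om => wt t.+1 om j * psi (xih t om j) -
    wt t.+1 om j * pmean t psi om j)); last by apply/funext => om; exact: mulrBr.
by apply: L2B (L2_wt_pmean j); exact: (L2_termh PS Hs t j (ltW a0) cpsi).
Qed.

Lemma Gk_sel_term j k : (j < k)%N -> Gmeas (Gk (Mt t + N + k)) (fun om => sel_term t psi om j).
Proof.
move=> jk; apply: Gk_meas; first exact: L2_meas (L2_sel_term j).
move=> w w' e; rewrite /sel_term /pmean.
have tk : (Mt t + N <= Mt t + N + k)%N by lia.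
have -> : wt t.+1 w j = wt t.+1 w' j.
  have bE := bi_dep bn tk e; have wE : wt t w = wt t w' by apply: wt_dep e; lia.
  by rewrite /= wE bE.
have -> : xih t w j = xih t w' j.
  rewrite /child_position; have -> : par t w j = par t w' j by apply: par_dep e; lia.
  exact: xi_dep e.
congr (_ * (_ - _)); apply: eq_bigr => i _.
by rewrite (pr_dep bn al tk e) (xi_dep i tk e).
Qed.

(* The parents are drawn one after the other: given the first ones, [sel_term k] is centred. *)
Lemma orth_sel_term j k : (j < k)%N ->
  ex P (fun om => sel_term t psi om j * sel_term t psi om k) = 0.
Proof.
move=> jk.
pose Y i om := sel_term t psi om j * (wt t.+1 om k * (psi (xi t om i) - pmean t psi om k)).
have sG := @Gk_sub_sigma _ S (Mt t + N + k).
have tk : (Mt t + N <= Mt t + N + k)%N by lia.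
have mdiff i : measurable_fun setT (fun om => wt t.+1 om k * (psi (xi t om i) - pmean t psi om k)).
  apply: measurable_funM; first exact: (measurable_wt H t.+1 k).
  by apply: measurable_funB; [exact: measurable_psi_xi|exact: measurable_pmean].
have GY i : Gmeas (Gk (Mt t + N + k)) (Y i).
  apply: (GmeasM sG); first exact: Gk_sel_term.
  apply: Gk_meas; first exact: mdiff.
  move=> w w' e; rewrite /pmean.
  have -> : wt t.+1 w k = wt t.+1 w' k.
    have bE := bi_dep bn tk e; have wE : wt t w = wt t w' by apply: wt_dep e; lia.
    by rewrite /= wE bE.
  congr (_ * (psi _ - _)); first exact: xi_dep e.
  by apply: eq_bigr => l _; rewrite (pr_dep bn al tk e) (xi_dep l tk e).
have mY i : measurable_fun setT (Y i) := Gmeas_measurable sG (GY i).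
have iYY := L2_itgM (L2_sel_term j) (L2_sel_term k).
have i1 i : itg P (fun om => Y i om * (par t om k == i)%:R).
  apply: (le_itg _ _ (itg_norm iYY)).
  - by apply: measurable_funM => //; exact: measurable_par_eq.
  - move=> om; rewrite /Y /sel_term /child_position; case: eqP => [->|_]; first by rewrite mulr1.
    by rewrite mulr0 normr0.
have L2p i : L2 P (fun om => wt t.+1 om k * (psi (xi t om i) - pmean t psi om k) * pr t om k i).
  rewrite (_ : (fun om => _) = (fun om => wt t.+1 om k * pr t om k i * psi (xi t om i) -
      pr t om k i * (wt t.+1 om k * pmean t psi om k))); last by apply/funext => om; ring.
  apply: L2B; first exact: L2_wt_pr.
  apply: le_L2 (L2_wt_pmean k) => [|om].
    by apply: measurable_funM; [exact: (measurable_pr H t k i)|exact: L2_meas (L2_wt_pmean k)].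
  rewrite normrM; apply: ler_piMl => //; rewrite ger0_norm ?(pr_ge0 H)//.
  rewrite -(sum_pr H t om k) (bigD1 i)//= lerDl.
  by apply: sumr_ge0 => l _; exact: (pr_ge0 H).
have i2 i : itg P (fun om => Y i om * pr t om k i).
  rewrite (_ : (fun om => _) = (fun om => sel_term t psi om j *
    (wt t.+1 om k * (psi (xi t om i) - pmean t psi om k) * pr t om k i))).
    exact: L2_itgM (L2_sel_term j) (L2p i).
  by apply/funext => om; rewrite /Y; ring.
rewrite -[LHS]/(ex P (fun om => Y (par t om k) om)) (ex_at_par GY i1 i2).
rewrite -[RHS](ex_cst P 0); apply: eq_ex => om.
rewrite (eq_bigr (fun i => sel_term t psi om j * wt t.+1 om k *
    (pr t om k i * psi (xi t om i) - pr t om k i * pmean t psi om k))); last first.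
  by move=> i _; rewrite /Y; ring.
rewrite -mulr_sumr sumrB -mulr_suml (sum_pr H) mul1r.
by rewrite -/(pmean t psi om k) subrr mulr0.
Qed.

Lemma Gk_wtS k l : (Mt t + N <= l)%N -> Gmeas (Gk l) (fun om => wt t.+1 om k).
Proof.
move=> tl; apply: Gk_meas; first exact: (measurable_wt H t.+1 k).
move=> w w' e; have bE := bi_dep bn tl e.
have wE : wt t w = wt t w' by apply: wt_dep e; lia.
by rewrite /= wE bE.
Qed.

Lemma Gk_psi_xi i l : (Mt t + N <= l)%N -> Gmeas (Gk l) (fun om => psi (xi t om i)).
Proof.
move=> tl; apply: Gk_meas; first exact: measurable_psi_xi.
by move=> w w' e; rewrite (xi_dep i tl e).
Qed.

Lemma Gk_pmean k l : (Mt t + N <= l)%N -> Gmeas (Gk l) (fun om => pmean t psi om k).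
Proof.
move=> tl; apply: Gk_meas; first exact: measurable_pmean.
move=> w w' e; apply: eq_bigr => i _.
by rewrite (pr_dep bn al tl e) (xi_dep i tl e).
Qed.

Lemma ex_sel_term_sqr k :
  itg P (fun om => \sum_i (wt t.+1 om k * (psi (xi t om i) - pmean t psi om k)) ^+ 2 * pr t om k i) /\
  ex P (fun om => sel_term t psi om k ^+ 2) =
  ex P (fun om => \sum_i (wt t.+1 om k * (psi (xi t om i) - pmean t psi om k)) ^+ 2 * pr t om k i).
Proof.
pose Y i om := (wt t.+1 om k * (psi (xi t om i) - pmean t psi om k)) ^+ 2.
have tk : (Mt t + N <= Mt t + N + k)%N by lia.
have sG := @Gk_sub_sigma _ S (Mt t + N + k).
have GY i : Gmeas (Gk (Mt t + N + k)) (Y i).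
  have G1 : Gmeas (Gk (Mt t + N + k)) (fun om => wt t.+1 om k * (psi (xi t om i) - pmean t psi om k)).
    apply: (GmeasM sG); first exact: Gk_wtS.
    by apply: (GmeasB sG); [exact: Gk_psi_xi|exact: Gk_pmean].
  exact: (GmeasM sG G1 G1).
have mY i : measurable_fun setT (Y i) := Gmeas_measurable sG (GY i).
have i1 i : itg P (fun om => Y i om * (par t om k == i)%:R).
  apply: (le_itg _ _ (L2_sqr (L2_sel_term k))).
    by apply: measurable_funM => //; exact: measurable_par_eq.
  move=> om; rewrite /Y /sel_term /child_position; case: eqP => [->|_].
    by rewrite mulr1 ger0_norm ?sqr_ge0.
  by rewrite mulr0 normr0 sqr_ge0.
have ib i : itg P (fun om => 2 * (wt t om i * psi (xi t om i) ^+ 2) +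
    2 * (wt t.+1 om k * pmean t psi om k) ^+ 2).
  apply: itgD; apply: itgZ; first exact: (itg_csq PS Hs t i (ltW a0) cpsi).
  exact: L2_sqr (L2_wt_pmean k).
have i2 i : itg P (fun om => Y i om * pr t om k i).
  apply: (le_itg _ _ (ib i)).
    by apply: measurable_funM => //; exact: (measurable_pr H t k i).
  move=> om; rewrite /Y ger0_norm; last by apply: mulr_ge0; [exact: sqr_ge0|exact: (pr_ge0 H)].
  have /andP[] := wt_pr_le t om k i; have := wt_le1 t.+1 om k; have := wt_gt0 H t.+1 om k.
  have p1 : pr t om k i <= 1.
    rewrite -(sum_pr H t om k) (bigD1 i)//= lerDl.
    by apply: sumr_ge0 => l _; exact: (pr_ge0 H).
  have := pr_ge0 H t om k i; move: p1.
  move: (pr t om k i) (wt t.+1 om k) (wt t om i) (psi _) (pmean _ _ _ _) => p w w' x m p1 p0 w0 w1 q0 q1.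
  have h1 : (w * (x - m)) ^+ 2 <= 2 * w ^+ 2 * x ^+ 2 + 2 * (w * m) ^+ 2.
    by have := sqr_ge0 (w * (x + m)); nra.
  apply: (@le_trans _ _ ((2 * w ^+ 2 * x ^+ 2 + 2 * (w * m) ^+ 2) * p)); first exact: ler_wpM2r.
  rewrite mulrDl; apply: lerD.
    rewrite (_ : _ * p = 2 * ((w * (w * p)) * x ^+ 2)); last by ring.
    rewrite ler_pM2l//; apply: ler_wpM2r; first exact: sqr_ge0.
    by apply: le_trans q1; apply: ler_piMl.
  by apply: ler_piMr => //; apply: mulr_ge0 => //; exact: sqr_ge0.
split; first exact: itg_sum.
exact: (ex_at_par GY i1 i2).
Qed.

Lemma ex_sel_sqr :
  itg P (fun om => \sum_k \sum_i
    (wt t.+1 om k * (psi (xi t om i) - pmean t psi om k)) ^+ 2 * pr t om k i) /\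
  ex P (fun om => (wsumh xih wt t psi om - wsum xi wt t psi om) ^+ 2) =
  ex P (fun om => \sum_k \sum_i
    (wt t.+1 om k * (psi (xi t om i) - pmean t psi om k)) ^+ 2 * pr t om k i).
Proof.
split; first by apply: itg_sum => k; exact: (ex_sel_term_sqr k).1.
rewrite ex_sum; last by move=> k; exact: (ex_sel_term_sqr k).1.
rewrite (@eq_ex _ _ _ P _ (fun om => (\sum_k sel_term t psi om k) ^+ 2)); last first.
  by move=> om; rewrite Wh_sub_W.
rewrite (@ex_sqr_sum_orth _ _ _ P N (fun k om => sel_term t psi om k)).
- by apply: eq_bigr => k _; exact: (ex_sel_term_sqr k).2.
- by move=> k; exact: L2_sel_term.
- move=> j k; rewrite neq_ltn => /orP[jk|kj]; first exact: orth_sel_term.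
  by rewrite -(orth_sel_term kj); apply: eq_ex => om; rewrite mulrC.
Qed.

(** The common weight of the children of the bin of particle i. *)
Definition bin_ratio om i : R := bwt (wt t om) (bi t om) (bi t om i) / (cc t om (bi t om i))%:R.

Lemma bin_ratio_gt0 om i : 0 < bin_ratio om i.
Proof.
apply: divr_gt0; first by apply: bwt_gt0 => k; exact: (wt_gt0 H).
by rewrite ltr0n (cc_gt0 H).
Qed.

Lemma sum_wt2_pr om i : \sum_j wt t.+1 om j ^+ 2 * pr t om j i = wt t om i * bin_ratio om i.
Proof.
rewrite (eq_bigr (fun j => bin_ratio om i * (wt t.+1 om j * pr t om j i))).
  by rewrite -mulr_sumr sum_wt_pr mulrC.
move=> j _; rewrite expr2 -mulrA wt_pr; case: eqP => [e|_]; last by rewrite !mulr0.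
by rewrite /= /next_weight /bin_ratio e.
Qed.

(** Inside a bin the weighted mean minimises the mean square deviation, so [pmean] may be replaced
    by any value [b] attached to the bin. *)
Lemma sum_sel_le om (b : 'I_N -> R) :
  \sum_k \sum_i (wt t.+1 om k * (psi (xi t om i) - pmean t psi om k)) ^+ 2 * pr t om k i <=
  \sum_i wt t om i * bin_ratio om i * (psi (xi t om i) - b (bi t om i)) ^+ 2.
Proof.
rewrite [leRHS](eq_bigr (fun i => \sum_k wt t.+1 om k ^+ 2 * pr t om k i *
    (psi (xi t om i) - b (bi t om i)) ^+ 2)); last first.
  by move=> i _; rewrite -mulr_suml sum_wt2_pr.
rewrite [leRHS]exchange_big /=; apply: ler_sum => k _.
rewrite [leRHS](eq_bigr (fun i => wt t.+1 om k ^+ 2 *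
    (pr t om k i * (psi (xi t om i) - b (cbin (cc t om) k)) ^+ 2))); last first.
  move=> i _; rewrite [RHS]mulrA; have [->//|ne] := eqVneq (bi t om i) (cbin (cc t om) k).
  have -> : pr t om k i = 0 by rewrite /parent_prob /prb (negbTE ne).
  by rewrite !(mulr0, mul0r).
rewrite -[leRHS]mulr_sumr [leLHS](eq_bigr (fun i => wt t.+1 om k ^+ 2 *
    (pr t om k i * (psi (xi t om i) - pmean t psi om k) ^+ 2))); last by move=> i _; rewrite exprMn -mulrA [pr t om k i * _]mulrC.
rewrite -[leLHS]mulr_sumr; apply: ler_wpM2l; first exact: sqr_ge0.
set m := pmean _ _ _ _; set c := b _.
have -> : \sum_i pr t om k i * (psi (xi t om i) - c) ^+ 2 =
   \sum_i pr t om k i * (psi (xi t om i) - m) ^+ 2 + (m - c) ^+ 2.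
  have e (i : 'I_N) : pr t om k i * (psi (xi t om i) - c) ^+ 2 =
      pr t om k i * (psi (xi t om i) - m) ^+ 2 + ((m - c) * 2 * (pr t om k i * psi (xi t om i))
      + pr t om k i * (c ^+ 2 - m ^+ 2)) by ring.
  rewrite (eq_bigr _ (fun i _ => e i)) big_split /=; congr (_ + _).
  rewrite big_split /= -mulr_sumr -mulr_suml (sum_pr H) mul1r -/(pmean t psi om k) -/m.
  by ring.
by rewrite lerDl sqr_ge0.
Qed.

Lemma ex_child_sqr : 
  itg P (fun om => \sum_i wt t om i * bin_ratio om i * psi (xi t om i) ^+ 2) /\
  \sum_j ex P (fun om => wt t.+1 om j ^+ 2 * psi (xih t om j) ^+ 2) =
  ex P (fun om => \sum_i wt t om i * bin_ratio om i * psi (xi t om i) ^+ 2).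
Proof.
pose Y k i om := wt t.+1 om k ^+ 2 * psi (xi t om i) ^+ 2.
have tk k : (Mt t + N <= Mt t + N + k)%N by lia.
have GY k i : Gmeas (Gk (Mt t + N + k)) (Y k i).
  have sG := @Gk_sub_sigma _ S (Mt t + N + k).
  apply: (GmeasM sG); [apply: (GmeasM sG)|apply: (GmeasM sG)];
    by [exact: Gk_wtS|exact: Gk_psi_xi].
have mY k i : measurable_fun setT (Y k i).
  exact: Gmeas_measurable (@Gk_sub_sigma _ S (Mt t + N + k)) (GY k i).
have wt2 om k : wt t.+1 om k ^+ 2 <= wt t.+1 om k.
  by rewrite expr2; apply: ler_piMl; [apply: ltW; exact: (wt_gt0 H)|exact: wt_le1].
have i1 k i : itg P (fun om => Y k i om * (par t om k == i)%:R).
  apply: (le_itg _ _ (itg_csqh PS Hs t k (ltW a0) cpsi)).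
    by apply: measurable_funM => //; exact: measurable_par_eq.
  move=> om; rewrite /Y /child_position; case: eqP => [->|_].
    rewrite mulr1 ger0_norm; last by apply: mulr_ge0; exact: sqr_ge0.
    by apply: ler_wpM2r => //; exact: sqr_ge0.
  rewrite mulr0 normr0; apply: mulr_ge0; last exact: sqr_ge0.
  by apply: ltW; exact: (wt_gt0 H t.+1).
have i2 k i : itg P (fun om => Y k i om * pr t om k i).
  apply: (le_itg _ _ (itg_csq PS Hs t i (ltW a0) cpsi)).
    by apply: measurable_funM => //; exact: (measurable_pr H t k i).
  move=> om; rewrite /Y ger0_norm; last first.
    by apply: mulr_ge0; [apply: mulr_ge0; exact: sqr_ge0|exact: (pr_ge0 H)].
  rewrite mulrAC; apply: ler_wpM2r; first exact: sqr_ge0.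
  have /andP[_] := wt_pr_le t om k i; apply: le_trans.
  by apply: ler_wpM2r => //; exact: (pr_ge0 H).
have E om : \sum_i wt t om i * bin_ratio om i * psi (xi t om i) ^+ 2 =
    \sum_k \sum_i Y k i om * pr t om k i.
  rewrite exchange_big /=; apply: eq_bigr => i _.
  rewrite -sum_wt2_pr mulr_suml; apply: eq_bigr => k _; rewrite /Y; ring.
have EF : (fun om => \sum_i wt t om i * bin_ratio om i * psi (xi t om i) ^+ 2) =
    (fun om => \sum_k \sum_i Y k i om * pr t om k i) by apply/funext.
rewrite EF; split; first by apply: itg_sum => k; exact: itg_sum.
rewrite ex_sum; last by move=> k; exact: itg_sum.
by apply: eq_bigr => k _; exact: (ex_at_par (GY k) (i1 k) (i2 k)).
Qed.

End one_function.
End selection_variance.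

(** * Methods started from the invariant law *)

Section stationary_start.
Context {R : realType} {d : measure_display} {X : measurableType d}.
Variables (K : R.-pker X ~> X) (mu : probability X R) (n : nat).
Local Notation N := n.+1.
Local Notation S := (X * nat)%type.
Variables (bn : 'I_N -> X -> 'I_N).
Variable (al : ('I_N -> R) -> ('I_N -> 'I_N) -> 'I_N -> nat).
Hypothesis H : allocation bn al.
Local Notation xi := (@particle _ X n).
Local Notation xih := (@child_position _ X n).
Local Notation bi := (bin_of bn).
Local Notation wt := (weight bn al).
Local Notation cc := (children_alloc bn al).
Local Notation ratio := (bin_ratio bn al).
Local Notation Mt t := (2 * N * t)%N.
Local Notation wed := (we_data bn al).
Variables (kap : nat -> R.-pker (traj S) ~> S) (P : probability (traj S) R).
Hypothesis hkap : forall k om A, kap k om A = step_measure K mu bn al k om A.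
Hypothesis HP : forall k A (B : set S), Gk k A -> measurable B ->
  P (A `&` [set w | B (w k)]) = (\int[P]_(w in A) kap k w B)%E.
Variables (V : X -> \bar R) (CV D r : R).
Hypothesis Hs : sqrtV_ergodic K mu V CV D r.
Local Notation cls := (V_class V).
Implicit Types (om : traj S) (j k i u : 'I_N) (psi phi v : X -> R).

Let r0 : 0 < r := sv_r0 Hs.
Let r1 : r < 1 := sv_r1 Hs.
Let CV1 : 1 <= CV := sv_C Hs.
Let CV0 : 0 < CV. Proof. exact: lt_le_trans CV1. Qed.
Let D0 : 0 < D := sv_D Hs.

Lemma law_xi0_one i (B : set X) : measurable B -> P [set om | B (xi 0 om i)] = mu B.
Proof.
move=> mB; have := law_xi0 hkap HP (B := fun j => if j == i then B else setT).
rewrite (_ : [set om | _] = [set om | B (xi 0 om i)]); last first.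
  apply/seteqP; split => om /= h; first by have := h i; rewrite eqxx.
  by move=> j; case: eqP => // ->.
move=> -> ; last by move=> j; case: eqP.
rewrite (bigD1 i)//= eqxx big1; last first.
  by move=> j /negbTE ->; rewrite [X in fine X]probability_setT.
rewrite mulr1 fineK// ge0_fin_numE//; apply: (@le_lt_trans _ _ 1%E); last exact: ltry.
exact: probability_le1.
Qed.

Lemma integral_xi0 i (g : X -> \bar R) : measurable_fun setT g -> (forall x, 0 <= g x)%E ->
  (\int[P]_om g (xi 0 om i) = \int[mu]_x g x)%E.
Proof.
move=> mg g0; have mxi := @measurable_xi _ X n 0 i.
have := @ge0_integral_pushforward _ _ _ _ R _ mxi P setT g measurableT mg (fun x _ => g0 x).
rewrite preimage_setT => <-; apply: eq_measure_integral => B mB _.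
exact: law_xi0_one.
Qed.

Lemma integral_We0 (g : X -> \bar R) : measurable_fun setT g -> (forall x, 0 <= g x)%E ->
  (\int[P]_om (\sum_i (wt 0 om i)%:E * g (xi 0 om i)) = \int[mu]_x g x)%E.
Proof.
move=> mg g0.
have mgx i : measurable_fun setT (fun om : traj S => g (xi 0 om i)).
  exact: (measurableT_comp mg (@measurable_xi _ X n 0 i)).
rewrite ge0_integral_sum//; last 2 first.
- by move=> i; apply: emeasurable_funM => //; apply/measurable_EFinP; exact: (measurable_wt H 0 i).
- by move=> i om _; rewrite mule_ge0// lee_fin invr_ge0.
rewrite (eq_bigr (fun=> (N%:R^-1)%:E * \int[mu]_x g x)%E); last first.
  move=> i _; rewrite -(integral_xi0 i mg g0) -ge0_integralZl_EFin//.
rewrite -ge0_sume_distrl; last by move=> i _; rewrite lee_fin invr_ge0.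
by rewrite sumEFin sumr_const card_ord -[X in X%:E]mulr_natr mulVf ?mul1e// pnatr_eq0.
Qed.

Lemma wt_system : particle_system K V P (fun t => Gk (Mt t + N)) (fun t => Gk (Mt t.+1))
  xi xih wt.
Proof.
have HW := we_of_allocation H hkap HP.
have cE : cweight wed setT = wt.
  apply/funext => t; apply/funext => om; apply/funext => i.
  rewrite /cweight indicT mul1r clamp_id//.
  by rewrite (ltW (wt_gt0 H t om i)) (wt_le1 H).
have := @WE_system _ _ _ K V _ _ _ P mu wed HW setT (@GkT _ _ _).
rewrite cE; apply.
rewrite integral_We0; first exact: sv_int Hs.
- exact: sv_meas Hs.
- by move=> x; apply: le_trans (sv_ge1 Hs x).
Qed.

Local Notation PS := wt_system.

Definition muV : R := fine (\int[mu]_x V x)%E.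

Lemma MV_muV : MV V P xi wt = muV.
Proof.
rewrite /MV /muV; congr fine; apply: integral_We0; first exact: sv_meas Hs.
by move=> x; apply: le_trans (sv_ge1 Hs x).
Qed.

Lemma muV_ge0 : 0 <= muV. Proof. by rewrite -MV_muV; exact: (MV_ge0 PS Hs). Qed.

Lemma ex_Wsq t psi a : 0 < a -> cls a psi ->
  itg P (fun om => \sum_i wt t om i * psi (xi t om i) ^+ 2) /\
  ex P (fun om => \sum_i wt t om i * psi (xi t om i) ^+ 2) = ex mu (fun x => psi x ^+ 2).
Proof.
move=> a0 cpsi; have [mpsi _] := cpsi.
split; first by apply: itg_sum => i; exact: (itg_csq PS Hs t i (ltW a0) cpsi).
rewrite /ex /Rintegral; congr fine.
pose g x : \bar R := (psi x ^+ 2)%:E.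
have mg : measurable_fun setT g by apply/measurable_EFinP; exact: measurable_funX.
have g0 x : (0 <= g x)%E by rewrite lee_fin sqr_ge0.
rewrite -(@integral_invariant _ _ _ K mu g (sv_inv Hs) mg g0 t).
have [mKg Kg0] := Kpos_nice K t mg g0.
rewrite -(integral_We0 mKg Kg0) -(int_We_0 PS t mg g0).
by apply: eq_integral => om _; rewrite /We -sumEFin; apply: eq_bigr => i _; rewrite EFinM.
Qed.

(** Carried back to the parents, mutation and selection get the same factor, parent weight times
    child weight: mutation contributes v^2, and selection at most the squared distance of K phi to a
    value attached to the bin. *)
Lemma ex_Dinc_le t phi a v a' (b : traj S -> 'I_N -> R) (Y : traj S -> R) :
  0 < a -> cls a phi -> 0 < a' -> cls a' v ->
  (forall x, (V x < +oo)%E -> var1 K phi x = v x ^+ 2) ->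
  itg P Y ->
  (forall om, \sum_i wt t om i * ratio t om i *
     (v (xi t om i) ^+ 2 + (Kt K 1 phi (xi t om i) - b om (bi t om i)) ^+ 2) <= Y om) ->
  ex P (fun om => Dinc K xi wt t phi om ^+ 2) <= ex P Y.
Proof.
move=> a0 cphi a'0 cv hv iY leY.
rewrite (ex_Dinc_sqr PS Hs t a0 cphi) (ex_Dmut_sqr PS Hs t a0 cphi).
have [i1 E1] := ex_child_sqr H hkap HP Hs PS t a'0 cv.
have aCV : 0 < a * CV by rewrite mulr_gt0.
have cK := cls_Kt1 Hs a0 cphi.
have [i2 E2] := ex_sel_sqr H hkap HP Hs PS t aCV cK.
have -> : \sum_j ex P (fun om => wt t.+1 om j ^+ 2 * var1 K phi (xih t om j)) =
    \sum_j ex P (fun om => wt t.+1 om j ^+ 2 * v (xih t om j) ^+ 2).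
  apply: eq_bigr => j _; apply: ex_ae.
  - exact: itg_meas (mut_var PS Hs t j a0 cphi).1.
  - apply: measurable_funM; first exact: measurable_funX (measurable_wt H t.+1 j).
    apply: measurable_funX; have [mv _] := cv.
    exact: (measurableT_comp mv (@measurable_xih _ X n t j)).
  - apply: filterS (ae_Vh PS Hs t) => om Vom; rewrite hv//; apply: Vom.
    by rewrite gt_eqF// (wt_gt0 H).
rewrite E1 /Dsel E2 -exD//; apply: le_ex => //; first exact: itgD.
move=> om; apply: le_trans (leY om).
apply: (@le_trans _ _ (\sum_i wt t om i * ratio t om i * v (xi t om i) ^+ 2 +
  \sum_i wt t om i * ratio t om i * (Kt K 1 phi (xi t om i) - b om (bi t om i)) ^+ 2)).
  by rewrite lerD2l; exact: (sum_sel_le H).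
by rewrite -big_split /=; apply: ler_sum => i _; rewrite -mulrDr.
Qed.

Lemma wtS_le_ratio t om j rho : (forall i, ratio t om i <= rho) -> wt t.+1 om j <= rho.
Proof.
move=> h; have [i e] := cbin_nonempty H (bi t om) j (wt_gt0 H t om).
have := h i; rewrite /bin_ratio e; exact.
Qed.

(** A cruder bound, linear in a bound [rho] on the child weights: of the two weight factors in a
    squared term one is at most [rho], and what is left is a second moment controlled by mu(V).
    Child weights O(1/N) thus give increments with second moment O(1/N). *)
Lemma ex_Dinc_ratio_le t phi a rho : 0 < a -> cls a phi -> 0 <= rho ->
  (forall om i, ratio t om i <= rho) ->
  ex P (fun om => Dinc K xi wt t phi om ^+ 2) <= rho * (a * (CV * muV) * (1 + CV)).
Proof.
move=> a0 cphi rho0 hr.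
rewrite (ex_Dinc_sqr PS Hs t a0 cphi) (ex_Dmut_sqr PS Hs t a0 cphi).
have aCV : 0 < a * CV by rewrite mulr_gt0.
have cK := cls_Kt1 Hs a0 cphi.
have wr om j : wt t.+1 om j <= rho by exact: wtS_le_ratio.
have -> : rho * (a * (CV * muV) * (1 + CV)) =
    rho * (a * (CV * muV)) + rho * (a * CV * (CV * muV)) by ring.
apply: lerD.
  have L1 j := L2_term PS Hs t.+1 j (ltW a0) cphi.
  have L2h j := L2_termh PS Hs t j (ltW aCV) cK.
  apply: (@le_trans _ _ (\sum_j ex P (fun om => (wt t.+1 om j * phi (xi t.+1 om j)) ^+ 2))).
    apply: ler_sum => j _; rewrite -(mut_var PS Hs t j a0 cphi).2.
    pose U om := wt t.+1 om j * phi (xi t.+1 om j) - wt t.+1 om j * Kt K 1 phi (xih t om j); pose Uh om := wt t.+1 om j * Kt K 1 phi (xih t om j).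
    have LU : L2 P U by exact: L2B (L1 j) (L2h j).
    rewrite -[leLHS]/(ex P (fun om => U om ^+ 2)).
    have -> : ex P (fun om => (wt t.+1 om j * phi (xi t.+1 om j)) ^+ 2) =
        ex P (fun om => (U om + Uh om) ^+ 2).
      by apply: eq_ex => om; rewrite /U /Uh subrK.
    rewrite (ex_sqrD LU (L2h j)).
    have -> : ex P (fun om => U om * Uh om) = 0.
      under eq_ex do rewrite mulrC.
      apply: (orth_mut_Fh PS Hs j a0 cphi (L2h j)).
      have sG := ps_Fh PS t; apply: (GmeasM sG); first exact: (ps_ch PS).
      by apply: Gmeas_comp (ps_xih PS t j); case: cK.
    by rewrite mulr0 addr0 lerDl; apply: ex_ge0 => om; exact: sqr_ge0.
  have i1 j := itg_csq PS Hs t.+1 j (ltW a0) cphi.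
  apply: (@le_trans _ _ (\sum_j rho * ex P (fun om => wt t.+1 om j * phi (xi t.+1 om j) ^+ 2))).
    apply: ler_sum => j _; rewrite -exZ//; apply: le_ex; [exact: L2_sqr (L1 j)|exact: itgZ|move=> om].
    rewrite exprMn mulrA; apply: ler_wpM2r; first exact: sqr_ge0.
    by rewrite expr2; apply: ler_wpM2r; [apply: ltW; exact: (wt_gt0 H t.+1)|exact: wr].
  rewrite -mulr_sumr; apply: ler_wpM2l => //; rewrite -ex_sum// -MV_muV.
  exact: (ex_csq PS Hs t.+1 (ltW a0) cphi).
have [i2 E2] := ex_sel_sqr H hkap HP Hs PS t aCV cK.
have i3 i := itg_csq PS Hs t i (ltW aCV) cK.
rewrite /Dsel E2.
apply: (@le_trans _ _ (rho * ex P (fun om => \sum_i wt t om i * Kt K 1 phi (xi t om i) ^+ 2))).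
  rewrite -exZ; last exact: itg_sum.
  apply: le_ex => //; first by apply: itgZ; exact: itg_sum.
  move=> om; apply: le_trans (sum_sel_le H (Kt K 1 phi) t om (fun=> 0)) _.
  rewrite mulr_sumr; apply: ler_sum => i _; rewrite subr0 mulrA.
  apply: ler_wpM2r; first exact: sqr_ge0.
  by rewrite mulrC; apply: ler_wpM2r => //; apply: ltW; exact: (wt_gt0 H).
apply: ler_wpM2l => //; rewrite -MV_muV.
exact: (ex_csq PS Hs t (ltW aCV) cK).
Qed.

(** In the backward expansion the increment at time s involves K^(T-s-1) phi, whose class constant
    is of order r^(T-s-1) because mu(phi) = 0. The geometric sum keeps the bound uniform in T. *)
Lemma ex_WT_dev phi a rho T : 0 < a -> cls a phi -> ex mu phi = 0 -> 0 <= rho ->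
  (forall t om i, ratio t om i <= rho) ->
  ex P (fun om => wsum xi wt T phi om ^+ 2) <=
    a * D * (CV * muV) * (r ^+ T + rho * (1 + CV) * (1 - r)^-1).
Proof.
move=> a0 cphi mphi rho0 hr.
have M0 := muV_ge0.
have ck t : cls (a * D * r ^+ t) (Kt K t phi).
  have := V_class_dev Hs t a0 cphi; rewrite mphi.
  by rewrite (_ : (fun x => Kt K t phi x - 0) = Kt K t phi)//; apply/funext => x; rewrite subr0.
have ak t : 0 < a * D * r ^+ t by rewrite mulr_gt0 ?exprn_gt0// mulr_gt0.
have LY : L2 P (wsum xi wt 0 (Kt K T phi)) := L2_W PS Hs 0 (ltW (ak T)) (ck T).
have GY : Gmeas (Gk (Mt 0 + N)) (wsum xi wt 0 (Kt K T phi)).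
  by apply: (Gmeas_W PS 0); case: (ck T).
have [LD _ ED] := ex_sum_Dinc PS Hs T LY GY (fun s => ak (T - s.+1)%N) (fun s => ck (T - s.+1)%N).
have -> : ex P (fun om => wsum xi wt T phi om ^+ 2) = ex P (fun om => (wsum xi wt 0 (Kt K T phi) om +
    \sum_(0 <= s < T) Dinc K xi wt s (Kt K (T - s.+1) phi) om) ^+ 2).
  apply: ex_ae.
  - by apply: measurable_funX; exact: L2_meas (L2_W PS Hs T (ltW a0) cphi).
  - by apply: measurable_funX; exact: L2_meas LD.
  - by apply: filterS (telescope_power PS Hs T a0 cphi) => om ->.
rewrite ED mulrDr; apply: lerD.
  apply: le_trans (ex_W_sqr PS Hs 0 (ltW (ak T)) (ck T)) _.
  by rewrite MV_muV le_eqVlt; apply/orP; left; apply/eqP; ring.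
apply: (@le_trans _ _ (\sum_(0 <= s < T) a * D * (CV * muV) * (rho * (1 + CV)) * r ^+ (T - s.+1))).
  apply: ler_sum => s _; apply: le_trans (ex_Dinc_ratio_le (ak _) (ck _) rho0 (hr s)) _.
  by rewrite le_eqVlt; apply/orP; left; apply/eqP; ring.
rewrite -mulr_sumr [leRHS]mulrA; apply: ler_wpM2l.
  apply: mulr_ge0; last by rewrite mulr_ge0// addr_ge0// ltW.
  by rewrite mulr_ge0 ?mulr_ge0// ltW.
rewrite big_nat_rev /= add0n (eq_big_nat _ _ (F2 := fun s => r ^+ s)).
  by apply: sum_geometric_le; rewrite (ltW r0).
by move=> s /andP[_ sT]; congr (r ^+ _); lia.
Qed.

Section upper_bound.
Variables (c : R) (f : X -> R).
Hypotheses (c0 : 0 < c) (cf : cls c f).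
Local Notation h := (h_fun K mu f).
Local Notation G := (h_const D r c).

(** Centring at T mu(f) instead of at the mean can only increase the second moment. The summable
    transient C r^t and the boundary terms disappear after division by T; the factor 1 + k separates
    W_T(h) from the martingale. *)
Lemma WE_upper_bound (Q C k : R) : 0 < k -> 0 <= Q ->
  (forall t, ex P (fun om => Dinc K xi wt t h om ^+ 2) <= Q + C * r ^+ t) ->
  (limn_esup (fun T : nat => (T%:R)%:E * evar P (WE_estimator wed f T)) <= ((1 + k) * Q)%:E)%E.
Proof.
move=> k0 Q0 hD.
have G0 : 0 < G := h_const_gt0 Hs c0.
have ch : cls G h := V_class_h_fun Hs c0 cf.
have C0 : 0 <= C \/ C <= 0 by apply/orP; exact: le_total.
pose C' := Num.max C 0; have C'0 : 0 <= C' by rewrite le_max lexx orbT.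
have M0 := muV_ge0.
pose A := G * (CV * muV).
have A0 : 0 <= A by rewrite /A mulr_ge0 ?(ltW G0)// mulr_ge0// ltW.
apply: (@limn_esup_le _ _ _ ((1 + k) * (A + C' * (1 - r)^-1) + (1 + k^-1) * A)) => T T0.
have TR0 : 0 < T%:R :> R by rewrite ltr0n.
pose S0 om := \sum_(0 <= t < T) \sum_i wt t om i * f (xi t om i).
have estE : WE_estimator wed f T = (fun om => T%:R^-1 * S0 om) by [].
have LY : L2 P (wsum xi wt 0 h) := L2_W PS Hs 0 (ltW G0) ch.
have GY : Gmeas (Gk (Mt 0 + N)) (wsum xi wt 0 h) by apply: (Gmeas_W PS 0); case: ch.
have [LD _ ED] := ex_sum_Dinc PS Hs T LY GY (fun=> G0) (fun=> ch).
have LWT : L2 P (fun om => - 1 * wsum xi wt T h om) by apply: L2Z; exact: (L2_W PS Hs T (ltW G0) ch).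
set YD := fun om => wsum xi wt 0 h om + _ in LD ED.
have LZ := L2D LD LWT.
have mS : measurable_fun setT S0.
  apply: measurable_sum => t; apply: measurable_sum => i.
  apply: measurable_funM; first exact: (measurable_wt H t i).
  by have [mf _] := cf; exact: (measurableT_comp mf (@measurable_xi _ X n t i)).
have SE : {ae P, forall om, YD om + - 1 * wsum xi wt T h om = S0 om - T%:R * ex mu f}.
  have := telescope_poisson PS Hs (f0 := fun x => f x - ex mu f) T G0 ch
    (fun x Vx => poisson_eq Hs c0 cf Vx).
  apply: filterS => om e; rewrite mulN1r -[LHS]e.
  rewrite mulr_natl -[T in _ *+ T]subn0 -sumr_const_nat -sumrB; apply: eq_bigr => t _.
  rewrite /wsum; under eq_bigr do rewrite mulrBr; rewrite sumrB; congr (_ - _).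
  by rewrite -mulr_suml (sum_wt H) mul1r.
have LS0 : L2 P (fun om => S0 om - T%:R * ex mu f).
  split; first by apply: measurable_funB => //; exact: measurable_cst.
  apply: itg_ae (L2_sqr LZ).
    by apply: measurable_funX; apply: measurable_funB => //; exact: measurable_cst.
  by apply: filterS SE => om ->.
have LS : L2 P S0.
  have -> : S0 = (fun om => (S0 om - T%:R * ex mu f) + T%:R * ex mu f).
    by apply/funext => om; rewrite subrK.
  by apply: L2D => //; exact: L2_cst.
have LE : L2 P (WE_estimator wed f T) by rewrite estE; exact: L2Z.
rewrite (evar_ex LE) -EFinM lee_fin.
have estb : ex P (WE_estimator wed f T) = T%:R^-1 * ex P S0.
  by rewrite estE exZ//; exact: L2_itg.
have -> : T%:R * ex P (fun om => (WE_estimator wed f T om - ex P (WE_estimator wed f T)) ^+ 2) =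
   T%:R^-1 * ex P (fun om => (S0 om - ex P S0) ^+ 2).
  rewrite estb (@eq_ex _ _ _ P _ (fun om => (T%:R^-1) ^+ 2 * (S0 om - ex P S0) ^+ 2)); last first.
    by move=> om; rewrite estE -mulrBr exprMn.
  rewrite exZ; last exact: L2_sqr (L2B LS (L2_cst P (ex P S0))).
  by rewrite expr2 -mulrA mulVKf// gt_eqF.
have varle : ex P (fun om => (S0 om - ex P S0) ^+ 2) <=
    ex P (fun om => (S0 om - T%:R * ex mu f) ^+ 2).
  set b := ex P S0; set b' := T%:R * _.
  have -> : ex P (fun om => (S0 om - b') ^+ 2) = ex P (fun om => ((S0 om - b) + (b - b')) ^+ 2).
    by apply: eq_ex => om; rewrite addrA subrK.
  rewrite (ex_sqrD (L2B LS (L2_cst P b)) (L2_cst P (b - b'))) ex_cst.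
  under [X in _ + 2 * X]eq_ex do rewrite mulrC.
  rewrite exZ; last exact: L2_itg (L2B LS (L2_cst P b)).
  rewrite exB; [|exact: L2_itg|exact: itg_cst].
  by rewrite ex_cst subrr !mulr0 addr0 lerDl sqr_ge0.
have EE : ex P (fun om => (S0 om - T%:R * ex mu f) ^+ 2) =
    ex P (fun om => (YD om + - 1 * wsum xi wt T h om) ^+ 2).
  apply: ex_ae.
  - by apply: measurable_funX; exact: L2_meas LS0.
  - by apply: measurable_funX; exact: L2_meas LZ.
  - by apply: filterS SE => om ->.
rewrite EE in varle.
have h2 := ex_sqrD_le k0 LD LWT.
have h3 : ex P (fun om => (- 1 * wsum xi wt T h om) ^+ 2) <= A.
  under eq_ex do rewrite mulN1r sqrrN.
  by rewrite /A -MV_muV; exact: (ex_W_sqr PS Hs T (ltW G0) ch).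
have h4 : ex P (fun om => YD om ^+ 2) <= A + (T%:R * Q + C' * (1 - r)^-1).
  rewrite ED; apply: lerD.
    by rewrite /A -MV_muV; exact: (ex_W_sqr PS Hs 0 (ltW G0) ch).
  apply: (@le_trans _ _ (\sum_(0 <= t < T) (Q + C' * r ^+ t))).
    apply: ler_sum => t _; apply: le_trans (hD t) _; rewrite lerD2l.
    by apply: ler_wpM2r; [exact: exprn_ge0 (ltW r0)|rewrite le_max lexx].
  rewrite big_split /= sumr_const_nat subn0 mulr_natl lerD2l -mulr_sumr.
  by apply: ler_wpM2l => //; apply: sum_geometric_le; rewrite (ltW r0).
have k10 : 0 <= 1 + k by rewrite addr_ge0// ltW.
have k20 : 0 <= 1 + k^-1 by rewrite addr_ge0// invr_ge0 ltW.
rewrite mulrC ler_pdivrMr// mulrDl divfK ?gt_eqF//.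
apply: le_trans varle (le_trans h2 _).
apply: (@le_trans _ _ ((1 + k) * (A + (T%:R * Q + C' * (1 - r)^-1)) + (1 + k^-1) * A)).
  by apply: lerD; exact: ler_wpM2l.
by rewrite le_eqVlt; apply/orP; left; apply/eqP; ring.
Qed.

End upper_bound.
End stationary_start.

(** * Near-optimal allocations *)

Section proportional_allocation.
Context {R : realType}.
Variable (n : nat).
Local Notation N := n.+1.
Variable q : 'I_N -> R.
Hypothesis q0 : forall u, 0 < q u.
Implicit Types (w : 'I_N -> R) (b : 'I_N -> 'I_N) (u i : 'I_N).

Definition occupied b u : bool := [exists i, b i == u].
Definition nbins b : nat := #|[pred u | occupied b u]|.
Definition qmass w b : R := \sum_i w i * q (b i).
Definition share w b u : nat := Num.truncn ((N - nbins b)%:R * (bwt w b u * q u) / qmass w b).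

(* One child per occupied bin, the other children in proportion to [bwt w b u * q u];
   those lost by rounding down go to the bin of particle 0. *)
Definition prop_alloc w b u : nat :=
  if occupied b u then
    (1 + share w b u + (if u == b ord0 then
      N - nbins b - \sum_(u' | occupied b u') share w b u' else 0))%N
  else 0%N.

Lemma nbins_le b : (nbins b <= N)%N.
Proof. by rewrite /nbins -[leqRHS]card_ord; exact: max_card. Qed.

Lemma occupied_bin b i : occupied b (b i).
Proof. by apply/existsP; exists i. Qed.

Lemma qmass_gt0 w b : (forall i, 0 < w i) -> 0 < qmass w b.
Proof.
move=> w0; rewrite /qmass (bigD1 ord0)//=; apply: ltr_pwDl; first exact: mulr_gt0.
by apply: sumr_ge0 => i _; rewrite mulr_ge0// ltW.
Qed.

Lemma sum_bwt_q w b : \sum_(u | occupied b u) bwt w b u * q u = qmass w b.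
Proof.
rewrite /qmass [RHS](partition_big b (occupied b)) /=; last by move=> i _; exact: occupied_bin.
by apply: eq_bigr => u _; rewrite /bwt mulr_suml; apply: eq_bigr => i /eqP ->.
Qed.

Lemma share_arg_ge0 w b u : (forall i, 0 < w i) ->
  0 <= (N - nbins b)%:R * (bwt w b u * q u) / qmass w b.
Proof.
move=> w0; apply: mulr_ge0; last by rewrite invr_ge0 ltW// qmass_gt0.
by apply: mulr_ge0 => //; apply: mulr_ge0; [exact: bwt_ge0|exact: ltW].
Qed.

Lemma sum_share_le w b : (forall i, 0 < w i) ->
  (\sum_(u | occupied b u) share w b u <= N - nbins b)%N.
Proof.
move=> w0; rewrite -(ler_nat R) natr_sum.
apply: (@le_trans _ _ (\sum_(u | occupied b u) (N - nbins b)%:R * (bwt w b u * q u) / qmass w b)).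
  by apply: ler_sum => u _; rewrite truncn_le share_arg_ge0.
by rewrite -mulr_suml -mulr_sumr sum_bwt_q mulfK// gt_eqF// qmass_gt0.
Qed.

Lemma sum_prop_alloc w b : (forall i, 0 < w i) -> (\sum_u prop_alloc w b u)%N = N.
Proof.
move=> w0; rewrite /prop_alloc -big_mkcond /= !big_split /=.
rewrite sum1_card -/(nbins b) -big_mkcondr /=.
rewrite [X in (_ + X)%N = _](big_pred1 (b ord0)); last first.
  by move=> u; apply/andP/eqP => [[_ /eqP]//|->]; rewrite occupied_bin eqxx.
by rewrite -addnA subnKC ?sum_share_le// subnKC// nbins_le.
Qed.

Lemma prop_alloc_gt0 w b i : (0 < prop_alloc w b (b i))%N.
Proof. by rewrite /prop_alloc occupied_bin. Qed.

Lemma prop_alloc_eq0 w b u : ~~ [exists i, b i == u] -> prop_alloc w b u = 0%N.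
Proof. by rewrite /prop_alloc /occupied => /negbTE ->. Qed.

Lemma truncn_measurable d (T : measurableType d) (g : T -> R) k : measurable_fun setT g ->
  measurable [set x | Num.truncn (g x) = k].
Proof.
move=> mg; have mle l : measurable [set x | (Num.truncn (g x) <= l)%N].
  have := mg measurableT [set` `]-oo, (l.+1%:R : R)[%R] (measurable_itv _).
  rewrite setTI (_ : _ @^-1` _ = [set x | (Num.truncn (g x) <= l)%N])//.
  by apply/seteqP; split => x /=; rewrite truncn_le_nat in_itv.
case: k => [|k].
  rewrite (_ : [set x | _] = [set x | (Num.truncn (g x) <= 0)%N])//.
  by apply/seteqP; split => x /=; rewrite leqn0 => /eqP.
rewrite (_ : [set x | _] = [set x | (Num.truncn (g x) <= k.+1)%N] `\`
    [set x | (Num.truncn (g x) <= k)%N]); first exact: measurableD.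
by apply/seteqP; split => x /= => [->|[h1 /negP h2]]; [split => //; apply/negP; rewrite ltnn|apply/eqP; rewrite eqn_leq h1 ltnNge].
Qed.

Lemma prop_alloc_allocation d (X : measurableType d) (bn : 'I_N -> X -> 'I_N) :
  (forall i u, measurable [set x | bn i x = u]) -> allocation bn prop_alloc.
Proof.
move=> mbn; split => //.
- move=> d' T w w0 mw b u.
  pose s x : {ffun 'I_N -> nat} := [ffun u => share (w x) b u].
  pose Phi (s : {ffun 'I_N -> nat}) (x : T) : nat := if occupied b u then (1 + s u + (if u == b ord0 then
      N - nbins b - \sum_(u' | occupied b u') s u' else 0))%N else 0%N.
  rewrite (_ : (fun x => _) = (fun x => Phi (s x) x)); last first.
    apply/funext => x; rewrite /prop_alloc /Phi /s ffunE; case: ifP => // _; congr (_ + _)%N.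
    by case: ifP => // _; congr (_ - _)%N; apply: eq_bigr => u' _; rewrite ffunE.
  have ms u' k : measurable [set x | share (w x) b u' = k]; last first.
    have mD y : measurable (s @^-1` [set y]).
      by apply: (measurable_discr_ffun (g := fun x u => share (w x) b u)); exact: ms.
    have mP y : measurable_fun setT (Phi y) by exact: measurable_cst.
    exact: (measurable_discr_fun mD mP).
  apply: truncn_measurable.
  have mb v : measurable_fun setT (fun x => bwt (w x) b v) by exact: measurable_bwt.
  apply: measurable_funM.
    apply: measurable_funM; first exact: measurable_cst.
    by apply: measurable_funM => //; exact: measurable_cst.
  apply: measurable_inv_gt0; first by move=> x; apply: qmass_gt0.
  by apply: measurable_sum => i; apply: measurable_funM => //; exact: measurable_cst.
- by move=> w b; exact: sum_prop_alloc.
- by move=> w b i _; exact: prop_alloc_gt0.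
- exact: prop_alloc_eq0.
Qed.

(** The child given to each occupied bin more than compensates rounding down, so the only loss is
    that of the at most [B] children withheld from the proportional sharing. *)
Lemma prop_alloc_ratio w b i B : (forall i, 0 < w i) -> (nbins b <= B)%N -> (B < N)%N ->
  bwt w b (b i) / (prop_alloc w b (b i))%:R <= qmass w b / ((N - B)%:R * q (b i)).
Proof.
move=> w0 bB BN; have Z0 := qmass_gt0 b w0; have W0 := bwt_gt0 b i w0.
have NB : 0 < (N - B)%:R :> R by rewrite ltr0n subn_gt0.
have NBq : 0 < (N - B)%:R * q (b i) by rewrite mulr_gt0.
have a0 : 0 < (prop_alloc w b (b i))%:R :> R by rewrite ltr0n prop_alloc_gt0.
rewrite ler_pdivrMr// mulrAC ler_pdivlMr//.
have : (N - nbins b)%:R * (bwt w b (b i) * q (b i)) / qmass w b <= (prop_alloc w b (b i))%:R.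
  apply: ltW; apply: lt_le_trans (truncnS_gt _) _.
  by rewrite ler_nat /prop_alloc occupied_bin -addn1 [(_ + 1)%N]addnC -addnA leq_add2l leq_addr.
rewrite ler_pdivrMr// [leRHS]mulrC; apply: le_trans.
rewrite mulrCA; apply: ler_wpM2r; last by rewrite ler_nat leq_sub2l.
by apply: mulr_ge0; exact: ltW.
Qed.

Lemma prop_alloc_le1 w b i : (forall i, 0 < w i) -> \sum_i w i = 1 ->
  bwt w b (b i) / (prop_alloc w b (b i))%:R <= 1.
Proof.
move=> w0 w1; rewrite ler_pdivrMr ?ltr0n ?prop_alloc_gt0// mul1r.
apply: (@le_trans _ _ 1); last by rewrite ler1n prop_alloc_gt0.
rewrite -w1 [leRHS](bigID (fun j => b j == b i)) /= lerDl.
by apply: sumr_ge0 => j _; exact: ltW.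
Qed.

End proportional_allocation.

(** * Truncation and the grid of bins *)

Section truncation.
Context {R : realType} {d : measure_display} {X : measurableType d}.
Variables (mu : probability X R) (v psi : X -> R).
Hypotheses (Lv : L2 mu v) (Lp : L2 mu psi) (v0 : forall x, 0 <= v x).

Definition tail (M : R) x : bool := (M <= v x) || (M <= `|psi x|).
Definition tail_sqr (M : R) x : R := if tail M x then v x ^+ 2 + psi x ^+ 2 else 0.

Let mv : measurable_fun setT v := L2_meas Lv.
Let mp : measurable_fun setT psi := L2_meas Lp.

Lemma measurable_tail M (b : bool) : measurable [set x | tail M x = b].
Proof.
have mt : measurable [set x | tail M x].
  rewrite (_ : [set x | _] = [set x | M <= v x] `|` [set x | M <= `|psi x|]).
    have mle (g : X -> R) : measurable_fun setT g -> measurable [set x | M <= g x].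
      move=> mg; have := mg measurableT [set` `[M, +oo[%R] (measurable_itv _).
      rewrite setTI (_ : _ @^-1` _ = [set x | M <= g x])//.
      by apply/seteqP; split => x /=; rewrite in_itv /= andbT.
    apply: measurableU; apply: mle => //; exact: measurableT_comp.
  by apply/seteqP; split => x /=; rewrite /tail => /orP.
case: b => //.
rewrite (_ : [set x | _] = ~` [set x | tail M x]); first exact: measurableC.
by apply/seteqP; split => x /=; case: tail.
Qed.

Lemma itg_tail_sqr M : itg mu (tail_sqr M).
Proof.
apply: (le_itg _ _ (itgD (L2_sqr Lv) (L2_sqr Lp))).
  apply: (measurable_discr_fun (D := tail M) (Phi := fun b x => if b then v x ^+ 2 + psi x ^+ 2 else 0)).
    by move=> b; exact: measurable_tail.
  case; last exact: measurable_cst.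
  by apply: measurable_funD; exact: measurable_funX.
move=> x; rewrite /tail_sqr; case: tail.
  by rewrite ger0_norm// addr_ge0// sqr_ge0.
by rewrite normr0 addr_ge0// sqr_ge0.
Qed.

(** Each point leaves the tail region once M exceeds v + |psi|, and v^2 + psi^2 dominates. The
    condition 1 <= M is kept for the comparison of M with M^2 in the tail. *)
Lemma tail_small (e : R) : 0 < e -> exists M : R, 1 <= M /\ ex mu (tail_sqr M) <= e.
Proof.
move=> e0.
pose g (k : nat) x := (tail_sqr k.+1%:R x)%:E.
have mg k : measurable_fun setT (g k) := measurable_int _ (itg_tail_sqr _).
have g0 x : g k x @[k --> \oo] --> (0 : \bar R)%E.
  have [K hK] : exists k0, forall k, (k0 <= k)%N -> g k x = 0%E.
    exists (Num.truncn (v x + `|psi x|)).+1 => k hk.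
    have lt : v x + `|psi x| < k.+1%:R.
      by apply: lt_le_trans (truncnS_gt _) _; rewrite ler_nat; exact: leqW.
    rewrite /g /tail_sqr /tail !leNgt.
    have -> : v x < k.+1%:R by apply: le_lt_trans lt; rewrite lerDl.
    by have -> : `|psi x| < k.+1%:R by apply: le_lt_trans lt; rewrite lerDr.
  apply: cvg_near_cst; exists K => // k /= h; exact: hK.
have gG k x : (`|g k x| <= (v x ^+ 2 + psi x ^+ 2)%:E)%E.
  rewrite /g /tail_sqr lee_fin; case: tail.
    by rewrite ger0_norm// addr_ge0// sqr_ge0.
  by rewrite normr0 addr_ge0// sqr_ge0.
have [_ _] := @dominated_convergence _ _ _ mu setT measurableT g (cst 0%E)
  (fun x => (v x ^+ 2 + psi x ^+ 2)%:E) mg (measurable_cst _) (aeW _ (fun x _ => g0 x))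
  (itgD (L2_sqr Lv) (L2_sqr Lp)) (aeW _ (fun x k _ => gG k x)).
rewrite integral0 => /fine_cvg cv.
have cv0 : (ex mu (tail_sqr k.+1%:R)) @[k --> \oo] --> (0 : R) by exact: cv.
have [k _ hk] := cvgr0_norm_lt _ cv0 _ e0.
exists k.+1%:R; split; first by rewrite ler1n.
by apply: le_trans (ler_norm _) _; apply: ltW; exact: (hk k (leqnn k)).
Qed.

End truncation.

Section grid.
Context {R : realType} {d : measure_display} {X : measurableType d}.
Variables (mu : probability X R) (v psi : X -> R).
Hypotheses (Lv : L2 mu v) (Lp : L2 mu psi) (v0 : forall x, 0 <= v x).
Let mv : measurable_fun setT v := L2_meas Lv.
Let mp : measurable_fun setT psi := L2_meas Lp.
Variables (M : R) (A : nat).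
Hypotheses (M1 : 1 <= M) (A2 : (1 < A)%N).

Let M0 : 0 < M. Proof. exact: lt_le_trans M1. Qed.
Let A0 : 0 < A%:R :> R. Proof. by rewrite ltr0n; apply: leq_trans A2. Qed.

Definition mesh : R := M / A%:R.
Local Notation eta := mesh.
Let eta0 : 0 < eta. Proof. exact: divr_gt0. Qed.

(* Label 0 is the tail; the regular cells (a, a') with a < A and a' < 2A are
   numbered from 1. *)
Definition grid_size : nat := (A * (2 * A)).+1.
Definition label x : nat := if tail v psi M x then 0%N else
  (Num.truncn (v x / eta) * (2 * A) + Num.truncn ((psi x + M) / eta)).+1.
(** On a regular cell v < (a + 1) eta; the additional mesh makes the square of [label_q] at least
    v^2 + eta^2, which covers the spread of psi inside the cell. *)
Definition label_q (l : nat) : R :=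
  if l is l'.+1 then ((l' %/ (2 * A))%:R + 2) * eta else M.
Definition label_b (l : nat) : R :=
  if l is l'.+1 then (l' %% (2 * A))%:R * eta - M else 0.

Lemma tailF x : tail v psi M x = false -> v x < M /\ `|psi x| < M.
Proof. by rewrite /tail => /negbT; rewrite negb_or -!ltNge => /andP. Qed.

Lemma MA : M = A%:R * eta.
Proof. by rewrite /mesh mulrC divfK// gt_eqF. Qed.

Lemma trunc_v_lt x : v x < M -> (Num.truncn (v x / eta) < A)%N.
Proof.
move=> vM; have h0 : 0 <= v x / eta := divr_ge0 (v0 x) (ltW eta0).
by rewrite truncn_lt_nat// ltr_pdivrMr// -MA.
Qed.

Lemma psiM_ge0 x : `|psi x| < M -> 0 <= psi x + M.
Proof. by rewrite ltr_norml => /andP[h _]; lra. Qed.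

Lemma trunc_psi_lt x : `|psi x| < M -> (Num.truncn ((psi x + M) / eta) < 2 * A)%N.
Proof.
move=> pM; have h0 : 0 <= (psi x + M) / eta := divr_ge0 (psiM_ge0 pM) (ltW eta0).
rewrite truncn_lt_nat// ltr_pdivrMr// natrM -mulrA -MA.
by move: pM; rewrite ltr_norml => /andP[_ h]; lra.
Qed.

Lemma label_lt x : (label x < grid_size)%N.
Proof.
rewrite /label; case E : tail => //; have [/trunc_v_lt h1 /trunc_psi_lt h2] := tailF E.
rewrite /grid_size ltnS.
by apply: (@leq_trans ((Num.truncn (v x / eta)).+1 * (2 * A)));
  [rewrite mulSn addnC ltn_add2r|rewrite leq_mul2r h1 orbT].
Qed.

Lemma label_regular x : tail v psi M x = false ->
  exists a a' : R, [/\ label_q (label x) = (a + 2) * eta, label_b (label x) = a' * eta - M,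
    a * eta <= v x < (a + 1) * eta & a' * eta <= psi x + M < (a' + 1) * eta].
Proof.
move=> E; have [h1 h2] := tailF E; have h3 := trunc_psi_lt h2.
have A2' : (0 < 2 * A)%N by rewrite muln_gt0 /=; apply: leq_trans A2.
exists (Num.truncn (v x / eta))%:R, (Num.truncn ((psi x + M) / eta))%:R.
have g1 : 0 <= v x / eta := divr_ge0 (v0 x) (ltW eta0).
have g2 : 0 <= (psi x + M) / eta := divr_ge0 (psiM_ge0 h2) (ltW eta0).
rewrite /label E /label_q /label_b divnMDl// modnMDl divn_small// addn0 modn_small//; split => //.
  rewrite -ler_pdivlMr// truncn_le g1 /= -ltr_pdivrMr// natr1.
  exact: truncnS_gt.
rewrite -ler_pdivlMr// truncn_le g2 /= -ltr_pdivrMr// natr1.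
exact: truncnS_gt.
Qed.

Lemma label_q_ge l : eta <= label_q l.
Proof.
case: l => [|l] /=; last first.
  by rewrite -[leLHS]mul1r; apply: ler_wpM2r; [exact: ltW|have := ler0n R (l %/ (2 * A)); lra].
by rewrite [leRHS]MA -[leLHS]mul1r; apply: ler_wpM2r; [exact: ltW|rewrite ler1n; apply: leq_trans A2].
Qed.

Lemma label_q_gt0 l : 0 < label_q l.
Proof. exact: lt_le_trans (label_q_ge l). Qed.

Lemma label_q_regular x : tail v psi M x = false ->
  v x ^+ 2 + (psi x - label_b (label x)) ^+ 2 <= label_q (label x) ^+ 2 /\
  label_q (label x) <= v x + 2 * eta.
Proof.
move=> E; have [a [a' [-> -> /andP[h1 h2] /andP[h3 h4]]]] := label_regular E.
have vx0 := v0 x; have e0 := eta0.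
set u := psi x - _; have u0 : 0 <= u by rewrite /u; lra.
have u1 : u <= eta by rewrite /u; lra.
set s := v x in vx0 h1 h2 *; set e := eta in e0 h1 h2 u1 *.
split; last by lra.
have h5 : s + e <= (a + 2) * e by lra.
apply: (@le_trans _ _ ((s + e) ^+ 2)).
  have : u ^+ 2 <= e ^+ 2 by rewrite ler_sqr// nnegrE ltW.
  have : 0 <= s * e by rewrite mulr_ge0// ltW.
  by nra.
by rewrite ler_sqr// nnegrE; lra.
Qed.

Lemma label_q_tail x : tail v psi M x = true -> label_q (label x) = M /\ label_b (label x) = 0.
Proof. by rewrite /label => ->. Qed.

Lemma label_q_le x : label_q (label x) <= 2 * M.
Proof.
case E : (tail v psi M x); first by have [-> _] := label_q_tail E; have := M0; lra.
have [_ h] := label_q_regular E; have [h1 _] := tailF E; apply: le_trans h _.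
have : 2 * eta <= M.
  by rewrite [leRHS]MA; apply: ler_wpM2r; [exact: ltW|rewrite (ler_nat R 2)].
by lra.
Qed.

(** In the tail v or |psi| is at least M, and 1 <= M gives M <= M^2 <= v^2 + psi^2. *)
Lemma label_q_le_v x : label_q (label x) <= v x + 2 * eta + tail_sqr v psi M x.
Proof.
rewrite /tail_sqr; case E : (tail v psi M x); last first.
  by rewrite addr0; have [] := label_q_regular E.
have [-> _] := label_q_tail E; have vx0 := v0 x.
have h : M ^+ 2 <= v x ^+ 2 + psi x ^+ 2.
  have := E; rewrite /tail => /orP[h|h].
    have : M ^+ 2 <= v x ^+ 2 by rewrite ler_sqr// nnegrE// ltW.
    by have := sqr_ge0 (psi x); lra.
  have : M ^+ 2 <= `|psi x| ^+ 2 by rewrite ler_sqr// nnegrE// ltW.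
  by rewrite real_normK ?num_real//; have := sqr_ge0 (v x); lra.
have : M <= M ^+ 2 by rewrite expr2; apply: ler_peMl => //; exact: ltW.
by have := eta0; lra.
Qed.

Lemma measurable_label l : measurable [set x | label x = l].
Proof.
have m1 k : measurable [set x | Num.truncn (v x / eta) = k].
  by apply: truncn_measurable; apply: measurable_funM => //; exact: measurable_cst.
have m2 k : measurable [set x | Num.truncn ((psi x + M) / eta) = k].
  apply: truncn_measurable; apply: measurable_funM; last exact: measurable_cst.
  by apply: measurable_funD => //; exact: measurable_cst.
rewrite (_ : [set x | _] = [set x | (fun b x => (if b then 0%N else
   (Num.truncn (v x / eta) * (2 * A) + Num.truncn ((psi x + M) / eta)).+1) = l) (tail v psi M x) x])//.
apply: (measurable_discr_set (D := tail v psi M) (A := fun b => [set x | (if b then 0%N else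
   (Num.truncn (v x / eta) * (2 * A) + Num.truncn ((psi x + M) / eta)).+1) = l])).
  by move=> b; exact: (measurable_tail Lv Lp).
have mc (B : Prop) : measurable [set x : X | B].
  have [b|b] := pselect B; first by rewrite (_ : [set _ | _] = setT)//; apply/seteqP; split.
  by rewrite (_ : [set _ | _] = set0)//; apply/seteqP; split.
case; first exact: mc.
have m3 k : measurable [set x | (k * (2 * A) + Num.truncn ((psi x + M) / eta)).+1 = l].
  exact: (measurable_discr_set (D := fun x => Num.truncn ((psi x + M) / eta))
    (A := fun k' => [set x : X | (k * (2 * A) + k').+1 = l]) m2 (fun k' => mc _)).
exact: (measurable_discr_set (D := fun x => Num.truncn (v x / eta))
  (A := fun k => [set x | (k * (2 * A) + Num.truncn ((psi x + M) / eta)).+1 = l]) m1 m3).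
Qed.

Lemma measurable_label_q : measurable_fun setT (fun x => label_q (label x)).
Proof.
apply: (measurable_discr_fun (D := label) (Phi := fun l _ => label_q l)).
  exact: measurable_label.
by move=> l; exact: measurable_cst.
Qed.

End grid.

(** * Weighted ensembles on the grid *)

Section near_optimal.
Context {R : realType} {d : measure_display} {X : measurableType d}.
Variables (K : R.-pker X ~> X) (mu : probability X R).
Variables (V : X -> \bar R) (CV D r : R).
Hypothesis Hs : sqrtV_ergodic K mu V CV D r.
Variables (c : R) (f : X -> R).
Hypotheses (c0 : 0 < c) (cf : V_class V c f).
Local Notation cls := (V_class V).
Local Notation h := (h_fun K mu f).
Local Notation v := (v_fun K mu f).
Local Notation psi := (Kt K 1 h).
Local Notation G := (h_const D r c).

Let r0 : 0 < r := sv_r0 Hs.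
Let r1 : r < 1 := sv_r1 Hs.
Let CV0 : 0 < CV. Proof. exact: lt_le_trans (sv_C Hs). Qed.
Let G0 : 0 < G := h_const_gt0 Hs c0.
Let GCV0 : 0 < G * CV. Proof. exact: mulr_gt0. Qed.
Let ch : cls G h := V_class_h_fun Hs c0 cf.
Let cv : cls (G * CV) v := V_class_v_fun Hs c0 cf.
Let cp : cls (G * CV) psi := cls_Kt1 Hs G0 ch.
Let Lv : L2 mu v := V_class_L2mu Hs cv.
Let Lp : L2 mu psi := V_class_L2mu Hs cp.
Let v0 x : 0 <= v x. Proof. exact: v_fun_ge0. Qed.
Let hv x : (V x < +oo)%E -> var1 K h x = v x ^+ 2. Proof. exact: (var1_h Hs c0 cf). Qed.

Definition WE_achieves (N : nat) (Q : R) : Prop :=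
  exists (d' : measure_display) (Om : measurableType d') (P : probability Om R)
    (m : WEdata R N X Om), [/\ is_WE_method K P mu m, binned_multinomial P m &
    (limn_esup (fun T : nat => (T%:R)%:E * evar P (WE_estimator m f T)) <= Q%:E)%E].

Lemma WE_achieves_of (n : nat) bn al (k Q C : R) : allocation bn al -> 0 < k -> 0 <= Q ->
  (forall (P : probability (traj (X * nat)%type) R) (kap : nat -> R.-pker (traj (X * nat)%type) ~> (X * nat)%type),
     (forall k om A, kap k om A = step_measure K mu (n := n) bn al k om A) ->
     (forall k A (B : set (X * nat)%type), Gk k A -> measurable B ->
        P (A `&` [set w | B (w k)]) = (\int[P]_(w in A) kap k w B)%E) ->
     forall t, ex P (fun om => Dinc K (@particle _ X n) (weight bn al) t h om ^+ 2) <= Q + C * r ^+ t) ->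
  WE_achieves n.+1 ((1 + k) * Q).
Proof.
move=> H k0 Q0 hD.
have [kap hkap] := step_kernel K mu H.
have kd l (B : set (X * nat)) : depends l (fun w => kap l w B) by exact: kap_depends hkap _ _.
have [P HP] := ionescu_tulcea_exists kd.
exists _, (traj (X * nat)%type), P, (we_data bn al); split.
- exact: (we_of_allocation H hkap HP).
- exact: (binned_multinomial_of_allocation H hkap HP).
- exact: (WE_upper_bound H hkap HP Hs c0 cf k0 Q0 (hD P kap hkap HP)).
Qed.

(** With a bin of its own, each particle can take its own value of psi as bin constant, so selection
    contributes nothing; child weights being at most 1, what remains is bounded by the mean of
    W_t(v^2), which is mu(v^2) = 0. *)
Lemma WE_achieves_zero n : ex mu v = 0 -> WE_achieves n.+1 0.
Proof.
move=> mv0.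
have v20 : ex mu (fun x => v x ^+ 2) = 0.
  have iv := L2_itg Lv.
  have [+ _] := ae_eq_integral_abs mu measurableT (measurable_int _ iv).
  have -> : (\int[mu]_x `|(EFin \o v) x| = 0)%E.
    rewrite (eq_integral (fun x => (v x)%:E)); last by move=> x _ /=; rewrite ger0_norm.
    by rewrite -(exE iv) mv0.
  move=> /(_ erefl) ae0; rewrite -[RHS](ex_cst mu 0); apply: ex_ae.
  - exact: measurable_funX (L2_meas Lv).
  - exact: measurable_cst.
  - by apply: filterS ae0 => x /(_ I) [->]; rewrite expr0n.
pose q (u : 'I_n.+1) : R := 1.
have q0 u : 0 < q u by exact: ltr01.
pose bn (i : 'I_n.+1) (x : X) := i.
have mbn i u : measurable [set x | bn i x = u].
  have [e|e] := pselect (i = u); first by rewrite (_ : [set _ | _] = setT)//; apply/seteqP; split.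
  by rewrite (_ : [set _ | _] = set0)//; apply/seteqP; split.
have H := prop_alloc_allocation q0 mbn.
rewrite -(mulr0 (1 + 1)); apply: (WE_achieves_of (C := 0) H ltr01 (lexx 0)) => P kap hkap HP t.
have [iY EY] := ex_Wsq H hkap HP Hs t GCV0 cv.
rewrite mul0r addr0 -v20 -EY.
apply: (ex_Dinc_le H hkap HP Hs (b := fun om u => psi (particle t om u)) G0 ch GCV0 cv hv iY).
move=> om; apply: ler_sum => i _; rewrite /bin_of /bn subrr expr0n addr0.
apply: ler_wpM2r; first exact: sqr_ge0.
apply: ler_piMr; first by apply: ltW; exact: (wt_gt0 H).
exact: (prop_alloc_le1 _ _ _ (wt_gt0 H t om) (sum_wt H t om)).
Qed.

Section grid_method.
Variables (M : R) (A : nat).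
Hypotheses (M1 : 1 <= M) (A2 : (1 < A)%N).
Let M0 : 0 < M. Proof. exact: lt_le_trans M1. Qed.

Local Notation B0 := (grid_size A).
Local Notation lab := (label v psi M A).
Local Notation eta := (mesh M A).
Definition qfun x : R := label_q M A (lab x).
Let tau := ex mu (tail_sqr v psi M).
Let eta0 : 0 < eta.
Proof. by apply: divr_gt0 => //; rewrite ltr0n; apply: leq_trans A2. Qed.
Let q_gt0 l : 0 < label_q M A l. Proof. exact: label_q_gt0. Qed.

Lemma measurable_qfun : measurable_fun setT qfun.
Proof. exact: (measurable_label_q Lv Lp). Qed.

Lemma itg_qfun : itg mu qfun.
Proof.
apply: (le_itg measurable_qfun _ (itg_cst mu (2 * M))) => x.
by rewrite (ger0_norm (ltW (q_gt0 _))); exact: label_q_le.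
Qed.

Lemma ex_qfun_le : ex mu qfun <= ex mu v + 2 * eta + tau.
Proof.
rewrite -(ex_cst mu (2 * eta)) /tau -!exD//.
- apply: le_ex; [exact: itg_qfun| |move=> x; exact: label_q_le_v].
  apply: itgD; last exact: itg_tail_sqr.
  by apply: itgD; [exact: L2_itg|exact: itg_cst].
- by apply: itgD; [exact: L2_itg|exact: itg_cst].
- exact: itg_tail_sqr.
- exact: L2_itg.
- exact: itg_cst.
Qed.

(** The prefactor in [ex_WT_dev] for q - mu(q), a function bounded by 2M and hence of class
    (2M)^2. *)
Definition fluct : R := (2 * M) ^+ 2 * D * (CV * muV mu V).

Lemma fluct_ge0 : 0 <= fluct.
Proof.
have D0 := sv_D Hs; have m0 : 0 <= muV mu V.
  apply: fine_ge0; apply: integral_ge0 => x _; exact: le_trans (sv_ge1 Hs x).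
by rewrite /fluct mulr_ge0// mulr_ge0 ?sqr_ge0// ?ltW.
Qed.

(** Here [y] stands for 1/(N - B0), where B0 bounds the number of occupied bins. The bracket is the
    time-independent part of the bound on the mean of W_t(q)^2, with 2M y / eta as bound on child
    weights, plus twice the tail moment. *)
Definition grid_bound (k y : R) : R :=
  y * ((1 + k) * ex mu qfun ^+ 2 + (1 + k^-1) * fluct * (2 * M / eta * y * (1 + CV) * (1 - r)^-1)
    + 2 * tau).

(** A child of a parent at x weighs at most y Z / q(x), where Z = W_t(q). On regular cells v^2 +
    (psi - b)^2 <= q^2, which after summation gives y Z^2. In the tail q = M and Z <= 2M, so the
    child weight is at most 2y and the contribution is 2y times a quantity of mean [tau]. *)
Lemma WE_achieves_grid (n : nat) (k : R) : 0 < k -> (B0 < n.+1)%N ->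
  WE_achieves n.+1 ((1 + k) * grid_bound k ((n.+1 - B0)%:R^-1)).
Proof.
move=> k0 BN; set y := _^-1.
have NB0 : 0 < (n.+1 - B0)%:R :> R by rewrite ltr0n subn_gt0.
have y0 : 0 < y by rewrite invr_gt0.
pose q (u : 'I_n.+1) := label_q M A u.
have q0 u : 0 < q u by exact: q_gt0.
pose bn (i : 'I_n.+1) (x : X) : 'I_n.+1 := inord (lab x).
have lab_lt x : (lab x < n.+1)%N by apply: ltn_trans BN; exact: label_lt.
have bnE i x : bn i x = lab x :> nat by rewrite /bn inordK.
have mbn i u : measurable [set x | bn i x = u].
  rewrite (_ : [set x | _] = [set x | lab x = u]).
    exact: (measurable_label Lv Lp).
  by apply/seteqP; split => x /= => [<-|e]; [rewrite bnE|apply: ord_inj; rewrite bnE].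
have H := prop_alloc_allocation q0 mbn.
have tau0 : 0 <= tau.
  apply: ex_ge0 => x; rewrite /tail_sqr; case: tail => //.
  by apply: addr_ge0; exact: sqr_ge0.
have k1 : 0 <= k^-1 by rewrite invr_ge0 ltW.
have fl0 := fluct_ge0.
pose E1 := 2 * M / eta * y * (1 + CV) * (1 - r)^-1.
have E10 : 0 <= E1.
  rewrite /E1; apply: mulr_ge0; last by rewrite invr_ge0 subr_ge0 ltW.
  apply: mulr_ge0; last by rewrite addr_ge0// ltW.
  by apply: mulr_ge0 (ltW y0); apply: divr_ge0 (ltW eta0); rewrite mulr_ge0// ltW.
have Q0 : 0 <= grid_bound k y.
  rewrite /grid_bound; apply: mulr_ge0 (ltW y0) _; apply: addr_ge0; last by rewrite mulr_ge0.
  apply: addr_ge0; first by apply: mulr_ge0; [rewrite addr_ge0// ltW|exact: sqr_ge0].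
  by apply: mulr_ge0 E10; apply: mulr_ge0 fl0; rewrite addr_ge0.
apply: (WE_achieves_of (C := y * ((1 + k^-1) * fluct)) H k0 Q0) => P kap hkap HP t.
pose weight' := weight bn (prop_alloc q).
have PS := wt_system H hkap HP Hs.
pose Z s om := wsum (@particle _ X n) weight' s qfun om.
have qE s om i : q (bin_of bn s om i) = qfun (particle s om i) by rewrite /q /bin_of bnE.
have ZE s om : qmass q (weight' s om) (bin_of bn s om) = Z s om.
  by apply: eq_bigr => i _; rewrite qE.
have nb s om : (nbins (bin_of bn s om) <= B0)%N.
  apply: leq_trans (_ : #|codom (fun l : 'I_B0 => inord l : 'I_n.+1)| <= _)%N; last first.
    by apply: leq_trans (leq_image_card _ _) _; rewrite card_ord.
  rewrite /nbins; apply: subset_leq_card; apply/fintype.subsetP => u; rewrite inE => /existsP[i /eqP <-].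
  have ll : (lab (particle s om i) < B0)%N by exact: label_lt.
  by apply/codomP; exists (Ordinal ll).
have ratio s om i : bin_ratio bn (prop_alloc q) s om i <= y * Z s om / qfun (particle s om i).
  have := prop_alloc_ratio q0 i (wt_gt0 H s om) (nb s om) BN.
  rewrite ZE qE invfM mulrA => hh; apply: (le_trans hh).
  by rewrite -/y [Z s om * y]mulrC.
have qf0 x : 0 < qfun x by exact: q_gt0.
have qf2 x : qfun x <= 2 * M by exact: label_q_le.
have Z0 s om : 0 <= Z s om.
  apply: sumr_ge0 => i _; apply: mulr_ge0 (ltW (qf0 _)); apply: ltW; exact: (wt_gt0 H).
have Z2 s om : Z s om <= 2 * M.
  apply: (@le_trans _ _ (\sum_i weight' s om i * (2 * M))).
    apply: ler_sum => i _; apply: ler_wpM2l (qf2 _); apply: ltW; exact: (wt_gt0 H).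
  by rewrite -mulr_suml (sum_wt H) mul1r.
(* This uses only Z <= 2M and q >= eta, so no control of the fluctuations of Z enters the proof that
   they are small. *)
have rho_bound s om i : bin_ratio bn (prop_alloc q) s om i <= y * (2 * M) / eta.
  apply: le_trans (ratio s om i) _; apply: ler_pM.
  - by apply: mulr_ge0 (Z0 s om); exact: ltW.
  - by rewrite invr_ge0 ltW.
  - by apply: ler_wpM2l (Z2 s om); exact: ltW.
  - by rewrite lef_pV2 ?posrE//; exact: label_q_ge.
pose mq := ex mu qfun.
have mq0 : 0 <= mq by apply: ex_ge0 => x; exact: ltW.
have mq2 : mq <= 2 * M.
  by rewrite -(ex_cst mu (2 * M)); apply: le_ex => //; [exact: itg_qfun|exact: itg_cst].
pose phi x := qfun x - mq.
have M20 : 0 < 2 * M by rewrite mulr_gt0.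
have M220 : 0 < (2 * M) ^+ 2 by rewrite exprn_gt0.
have cphi : cls ((2 * M) ^+ 2) phi.
  apply: (V_class_bounded Hs M20).
    by apply: measurable_funB; [exact: measurable_qfun|exact: measurable_cst].
  have hb (a a' b : R) : 0 < a -> a <= b -> 0 <= a' -> a' <= b -> `|a - a'| <= b.
    by move=> h1 h2 h3 h4; rewrite ler_norml; lra.
  by move=> x; apply: hb.
have mphi : ex mu phi = 0.
  by rewrite (exB itg_qfun (itg_cst mu mq)) ex_cst subrr.
have LWphi : L2 P (wsum (@particle _ X n) weight' t phi) := L2_W PS Hs t (ltW M220) cphi.
have ZphiE om : Z t om = mq + wsum (@particle _ X n) weight' t phi om.
  rewrite /wsum /phi; under eq_bigr do rewrite mulrBr.
  by rewrite sumrB -mulr_suml (sum_wt H) mul1r addrC subrK.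
have EZ : ex P (fun om => Z t om ^+ 2) <= (1 + k) * mq ^+ 2 +
    (1 + k^-1) * (fluct * (r ^+ t + y * (2 * M) / eta * (1 + CV) * (1 - r)^-1)).
  rewrite (@eq_ex _ _ _ P _ (fun om => (mq + wsum (@particle _ X n) weight' t phi om) ^+ 2)); last first.
    by move=> om; rewrite ZphiE.
  apply: le_trans (ex_sqrD_le k0 (L2_cst P mq) LWphi) _; rewrite ex_cst lerD2l.
  apply: ler_wpM2l; first exact: addr_ge0.
  apply: (ex_WT_dev H hkap HP Hs t M220 cphi mphi _ rho_bound).
  by apply: divr_ge0 (ltW eta0); apply: mulr_ge0; exact: ltW.
have LZ : L2 P (Z t).
  rewrite (_ : Z t = (fun om => mq + wsum (@particle _ X n) weight' t phi om)); last exact/funext.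
  by apply: L2D => //; exact: L2_cst.
pose cut (g : X -> R) x := if tail v psi M x then g x else 0.
have ccut g : cls (G * CV) g -> cls (G * CV) (cut g).
  move=> cg; have [mg _] := cg; apply: (V_classP Hs GCV0).
    apply: (measurable_discr_fun (D := tail v psi M) (Phi := fun (b : bool) x => if b then g x else 0)).
      by move=> b; exact: (measurable_tail Lv Lp).
    by case => //; exact: measurable_cst.
  move=> x Vx; have := V_class_le Hs cg Vx; rewrite /cut; case: tail => // hh.
  by rewrite expr0n; apply: le_trans hh; exact: sqr_ge0.
have [i1 E2] := ex_Wsq H hkap HP Hs t GCV0 (ccut _ cv).
have [i2 E3] := ex_Wsq H hkap HP Hs t GCV0 (ccut _ cp).
have tauE : tau = ex mu (fun x => cut v x ^+ 2) + ex mu (fun x => cut psi x ^+ 2).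
  rewrite -exD; last 2 first.
  - exact: L2_sqr (V_class_L2mu Hs (ccut _ cv)).
  - exact: L2_sqr (V_class_L2mu Hs (ccut _ cp)).
  by apply: eq_ex => x; rewrite /tail_sqr /cut; case: tail; rewrite ?expr0n ?addr0.
pose Y om := y * (Z t om ^+ 2 + 2 * ((\sum_i weight' t om i * cut v (particle t om i) ^+ 2) +
   \sum_i weight' t om i * cut psi (particle t om i) ^+ 2)).
have i12 := itgD i1 i2.
have iZ := L2_sqr LZ.
have iY : itg P Y by apply: itgZ; apply: itgD => //; exact: itgZ.
have EY : ex P Y = y * (ex P (fun om => Z t om ^+ 2) + 2 * tau).
  rewrite exZ; last by apply: itgD => //; exact: itgZ.
  rewrite exD//; last exact: itgZ.
  by rewrite exZ// exD// E2 E3 tauE.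
apply: (@le_trans _ _ (ex P Y)); last first.
  rewrite EY (_ : grid_bound k y + _ = y * (((1 + k) * mq ^+ 2 + (1 + k^-1) *
    (fluct * (r ^+ t + y * (2 * M) / eta * (1 + CV) * (1 - r)^-1))) + 2 * tau)).
    by apply: ler_wpM2l; [exact: ltW|rewrite lerD2r].
  by rewrite /grid_bound -/mq; ring.
apply: (ex_Dinc_le H hkap HP Hs (b := fun om u => label_b M A u) G0 ch GCV0 cv hv iY) => om.
have YE : Y om = \sum_i weight' t om i * (y * (Z t om * qfun (particle t om i) +
    2 * (cut v (particle t om i) ^+ 2 + cut psi (particle t om i) ^+ 2))).
  have Zd : Z t om = \sum_i weight' t om i * qfun (particle t om i) by [].
  rewrite /Y expr2 [X in Z t om * X]Zd -big_split /= !mulr_sumr -big_split /= mulr_sumr.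
  by apply: eq_bigr => i _; ring.
rewrite YE; apply: ler_sum => i _.
have -> : label_b M A (bin_of bn t om i) = label_b M A (lab (particle t om i)) by rewrite /bin_of bnE.
set x := particle t om i.
have w0 : 0 <= weight' t om i by apply: ltW; exact: (wt_gt0 H).
have r_le := ratio t om i; rewrite -/x in r_le.
have rr0 : 0 <= bin_ratio bn (prop_alloc q) t om i by apply: ltW; exact: (bin_ratio_gt0 H).
have Zt0 := Z0 t om; have Zt2 := Z2 t om; have qx0 := qf0 x.
rewrite -mulrA; apply: ler_wpM2l => //.
have s0 : 0 <= v x ^+ 2 + (psi x - label_b M A (lab x)) ^+ 2 by apply: addr_ge0; exact: sqr_ge0.
apply: (@le_trans _ _ (y * Z t om / qfun x * (v x ^+ 2 + (psi x - label_b M A (lab x)) ^+ 2))).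
  exact: ler_wpM2r.
rewrite -!mulrA; apply: ler_wpM2l; first exact: ltW.
rewrite /cut; case E : (tail v psi M x).
  have [qM ->] := label_q_tail A E; rewrite subr0 -/(qfun x) in qM *.
  rewrite qM; apply: ler_wpDl; first by rewrite mulr_ge0// ltW.
  rewrite mulrA; apply: ler_wpM2r; first by apply: addr_ge0; exact: sqr_ge0.
  by rewrite ler_pdivrMr.
have [hq _] := label_q_regular v0 M1 A2 E.
rewrite expr0n addr0 mulr0 addr0; apply: ler_wpM2l => //.
by rewrite mulrC ler_pdivrMr// -expr2.
Qed.

End grid_method.
End near_optimal.

Section near_optimal_methods.
Context {R : realType} {d : measure_display} {X : measurableType d}.
Variables (K : R.-pker X ~> X) (mu : probability X R).
Variables (V : X -> \bar R) (CV D r : R).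
Hypothesis Hs : sqrtV_ergodic K mu V CV D r.
Variables (c : R) (f : X -> R).
Hypotheses (c0 : 0 < c) (cf : V_class V c f).
Local Notation h := (h_fun K mu f).
Local Notation v := (v_fun K mu f).
Local Notation psi := (Kt K 1 h).
Local Notation G := (h_const D r c).

Lemma WE_achieves_mono N (Q Q' : R) : Q <= Q' ->
  WE_achieves K mu f N Q -> WE_achieves K mu f N Q'.
Proof.
move=> QQ' [d' [Om [P [m [h1 h2 h3]]]]]; exists d', Om, P, m; split => //.
by apply: le_trans h3 _; rewrite lee_fin.
Qed.

(** Since x <= 1/16, the powers x^2 to x^5 are at most x/16, and the accumulated polynomial 1 + 7x +
    13x^2 + 11x^3 + 5x^4 + x^5 stays below 1 + 16x. *)
Lemma near_optimal_arith (e x m a b B y Nr : R) : 0 < m -> 0 < x -> e = 16 * x -> x <= 16^-1 ->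
  0 <= b -> 0 <= B -> 0 < y -> Nr * y = 1 + B * y -> 0 < Nr -> B * y <= x -> b * y <= x * m ^+ 2 ->
  a <= m ^+ 2 * ((1 + x) ^+ 3 + x) ->
  (1 + x) * (y * (a + b * y / (1 + x))) <= (1 + e) * (m ^+ 2 / Nr).
Proof.
move=> m0 x0 -> x16 b0 B0 y0 Ny N0 By bey ale.
rewrite [leRHS]mulrA ler_pdivlMr//.
have x1 : 0 < 1 + x by lra.
have -> : (1 + x) * (y * (a + b * y / (1 + x))) * Nr = (Nr * y) * ((1 + x) * a + b * y).
  by field; rewrite gt_eqF.
rewrite Ny; have m2 : 0 < m ^+ 2 by rewrite exprn_gt0.
apply: (@le_trans _ _ ((1 + x) * (m ^+ 2 * ((1 + x) ^+ 4 + x * (1 + x) + x)))).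
  have h1 : (1 + x) * a + b * y <= m ^+ 2 * ((1 + x) ^+ 4 + x * (1 + x) + x).
    have h2 : (1 + x) * a <= (1 + x) * (m ^+ 2 * ((1 + x) ^+ 3 + x)) by apply: ler_wpM2l => //; exact: ltW.
    have -> : m ^+ 2 * ((1 + x) ^+ 4 + x * (1 + x) + x) =
      (1 + x) * (m ^+ 2 * ((1 + x) ^+ 3 + x)) + x * m ^+ 2 by ring.
    exact: lerD.
  apply: (@le_trans _ _ ((1 + B * y) * (m ^+ 2 * ((1 + x) ^+ 4 + x * (1 + x) + x)))).
    by apply: ler_wpM2l => //; rewrite addr_ge0// mulr_ge0// ltW.
  apply: ler_wpM2r; last by rewrite lerD2l.
  apply: mulr_ge0; first exact: ltW.
  have : 0 <= (1 + x) ^+ 4 by rewrite exprn_ge0// ltW.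
  have h0 : 0 <= x * (1 + x) by rewrite mulr_ge0// ltW.
  by move=> h4; rewrite addr_ge0 ?(ltW x0)// addr_ge0.
have -> : (1 + x) * (m ^+ 2 * ((1 + x) ^+ 4 + x * (1 + x) + x)) =
  (1 + x) * ((1 + x) ^+ 4 + x * (1 + x) + x) * m ^+ 2 by ring.
apply: ler_wpM2r; first exact: ltW.
have X2 : x ^+ 2 <= x / 16 by rewrite expr2; apply: ler_wpM2l => //; exact: ltW.
have X3 : x ^+ 3 <= x / 16.
  by apply: le_trans X2; rewrite exprS; apply: ler_piMl; [exact: sqr_ge0|lra].
have X4 : x ^+ 4 <= x / 16.
  by apply: le_trans X3; rewrite exprS; apply: ler_piMl; [rewrite exprn_ge0// ltW|lra].
have X5 : x ^+ 5 <= x / 16.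
  by apply: le_trans X4; rewrite exprS; apply: ler_piMl; [rewrite exprn_ge0// ltW|lra].
have -> : (1 + x) * ((1 + x) ^+ 4 + x * (1 + x) + x) =
  1 + 7 * x + 13 * x ^+ 2 + 11 * x ^+ 3 + 5 * x ^+ 4 + x ^+ 5 by ring.
by lra.
Qed.

(** The order of choice matters: M depends on the tails of v and psi, the mesh on M, the grid size
    and the fluctuation constants on both, and N comes last, large compared with all of them. The
    tolerance [x] is a sixteenth of min(e, 1). *)
Lemma WE_near_optimal (e : R) : 0 < e -> exists Ne : nat, forall N : nat, (Ne <= N)%N ->
  WE_achieves K mu f N ((1 + e) * (ex mu v ^+ 2 / N%:R)).
Proof.
move=> e0; have v0 x : 0 <= v x by exact: v_fun_ge0.
set m := ex mu v; have m_ge0 : 0 <= m by exact: ex_ge0.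
have [m0|m0] := eqVneq m 0.
  exists 1%N => -[//|n] _; rewrite m0 expr0n mul0r mulr0.
  exact: (WE_achieves_zero Hs c0 cf).
have {m_ge0} mp : 0 < m by rewrite lt_def m0.
have r0 := sv_r0 Hs; have r1 := sv_r1 Hs.
have CV0 : 0 < CV := lt_le_trans ltr01 (sv_C Hs).
have G0 : 0 < G := h_const_gt0 Hs c0.
have ch := V_class_h_fun Hs c0 cf.
have Lv : L2 mu v := V_class_L2mu Hs (V_class_v_fun Hs c0 cf).
have Lp : L2 mu psi := V_class_L2mu Hs (cls_Kt1 Hs G0 ch).
pose x := Num.min e 1 / 16.
have x0 : 0 < x by rewrite /x divr_gt0// lt_min e0 ltr01.
have x16 : x <= 16^-1 by rewrite /x ler_pdivrMr// mulVf// ge_min lexx orbT.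
have xe : 16 * x <= e by rewrite /x mulrC divfK// ge_min lexx.
clearbody x.
have m2 : 0 < m ^+ 2 by rewrite exprn_gt0.
have xm : 0 < x * m by exact: mulr_gt0.
(* The bound x m / 2 serves, with the mesh, to keep mu(q) below (1 + x) m; the bound x m^2 / 2 keeps
   2 tau below x m^2. *)
have [M [M1 tauM]] : exists M : R, 1 <= M /\
    ex mu (tail_sqr v psi M) <= Num.min (x * m / 2) (x * m ^+ 2 / 2).
  apply: tail_small => //.
  by rewrite lt_min !divr_gt0// mulr_gt0.
set tau := ex mu _ in tauM; move: tauM; rewrite le_min => /andP[tau1 tau2].
have tau0 : 0 <= tau.
  apply: ex_ge0 => z; rewrite /tail_sqr; case: tail => //.
  by apply: addr_ge0; exact: sqr_ge0.
have M0 : 0 < M := lt_le_trans ltr01 M1.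
(* This makes 2 eta at most x m / 2; adding 2 to the truncation also ensures 1 < A. *)
pose A := (Num.truncn (4 * M / (x * m))).+2.
have AM : 4 * M / (x * m) <= A%:R.
  apply: ltW; apply: lt_le_trans (truncnS_gt _) _; by rewrite ler_nat.
have A1 : (1 < A)%N by [].
have A0 : 0 < A%:R :> R by rewrite ltr0n.
have eta0 : 0 < mesh M A by rewrite /mesh divr_gt0.
have etam : 2 * mesh M A <= x * m / 2.
  rewrite /mesh mulrA ler_pdivrMr//.
  have := AM; rewrite ler_pdivrMr// => hA.
  rewrite -(ler_pM2l (_ : 0 < 2 :> R))//; apply: (@le_trans _ _ (4 * M)); first lra.
  by apply: le_trans hA _; rewrite le_eqVlt; apply/orP; left; apply/eqP; field.
set B0 := grid_size A.
set mq := ex mu (qfun K mu f M A).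
have mq0 : 0 <= mq.
  by apply: ex_ge0 => z; apply: ltW; exact: label_q_gt0.
have mqle : mq <= m * (1 + x).
  have := ex_qfun_le Hs c0 cf M1 A1.
  rewrite -/mq -/m -/tau => hq; apply: le_trans hq _.
  rewrite [leRHS](_ : _ = m + x * m / 2 + x * m / 2); last by field.
  by apply: lerD => //; rewrite lerD2l.
pose E := (1 + x^-1) * fluct mu V CV D M * (2 * M / mesh M A * (1 + CV) * (1 - r)^-1).
have E0 : 0 <= E.
  have fl0 := fluct_ge0 Hs M.
  apply: mulr_ge0; first by apply: mulr_ge0 fl0; rewrite addr_ge0// invr_ge0 ltW.
  apply: mulr_ge0; last by rewrite invr_ge0 subr_ge0 ltW.
  apply: mulr_ge0; last by rewrite addr_ge0// ltW.
  by apply: divr_ge0; [rewrite mulr_ge0// ltW|exact: ltW].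
pose b := (1 + x) * E.
have x1 : 0 < 1 + x by lra.
have b0 : 0 <= b by rewrite mulr_ge0// ltW.
(* With y at most 1/s, the two terms of [s] secure B0 y <= x and b y <= x m^2. *)
pose s := B0%:R / x + b / (x * m ^+ 2).
exists (B0 + (Num.truncn s).+1)%N => -[|n] Nn.
  by move: Nn; rewrite addnS.
have BN : (B0 < n.+1)%N by apply: leq_trans Nn; rewrite addnS ltnS leq_addr.
apply: (WE_achieves_mono _ (WE_achieves_grid Hs c0 cf M1 A1 x0 BN)).
set y := _^-1; rewrite -/B0 in y *.
have NB : 0 < (n.+1 - B0)%:R :> R by rewrite ltr0n subn_gt0.
have y0 : 0 < y by rewrite invr_gt0.
have sN : s <= (n.+1 - B0)%:R.
  apply: ltW; apply: lt_le_trans (truncnS_gt _) _; rewrite ler_nat.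
  by rewrite leq_subRL// ltnW.
have xm0 : 0 < x * m ^+ 2 by rewrite mulr_gt0.
have s1 : B0%:R / x <= (n.+1 - B0)%:R.
  by apply: le_trans sN; rewrite /s lerDl divr_ge0// ltW.
have s2 : b / (x * m ^+ 2) <= (n.+1 - B0)%:R.
  by apply: le_trans sN; rewrite /s lerDr divr_ge0// ltW.
have -> : grid_bound K mu V CV D r f M A x y =
    y * (((1 + x) * mq ^+ 2 + 2 * tau) + b * y / (1 + x)).
  rewrite /grid_bound -/mq -/tau /b /E; field.
  by rewrite !gt_eqF// subr_gt0.
apply: (@le_trans _ _ ((1 + 16 * x) * (m ^+ 2 / n.+1%:R))); last first.
  by apply: ler_wpM2r; [rewrite divr_ge0// ltW|rewrite lerD2l].
apply: (@near_optimal_arith _ x m _ b B0%:R y) => //.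
- have -> : n.+1%:R = (n.+1 - B0)%:R + B0%:R :> R by rewrite -natrD subnK// ltnW.
  by rewrite mulrDl /y mulfV ?gt_eqF.
- by rewrite /y ler_pdivrMr// mulrC -ler_pdivrMr.
- by rewrite /y ler_pdivrMr// mulrC -ler_pdivrMr.
have h1 : mq ^+ 2 <= (m * (1 + x)) ^+ 2.
  by rewrite ler_sqr// nnegrE// mulr_ge0// ltW.
have -> : m ^+ 2 * ((1 + x) ^+ 3 + x) = (1 + x) * (m * (1 + x)) ^+ 2 + x * m ^+ 2 by ring.
apply: lerD; first by apply: ler_wpM2l => //; exact: ltW.
by lra.
Qed.

End near_optimal_methods.

Theorem mainTheorem9 (R : realType) (d : measure_display) (X : measurableType d)
  (K : R.-pker X ~> X) (mu : probability X R) (V : X -> \bar R) (f : X -> R) :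
  geometrically_ergodic K mu ->
  V_uniformly_ergodic K mu V ->
  measurable_fun setT f ->
  (exists C : R, forall x, ((f x ^+ 2)%:E <= C%:E * V x)%E) ->
  (* (1) lower bound for every WE method *)
  (forall (N : nat) (d' : measure_display) (Omega : measurableType d')
          (P : probability Omega R) (mu0 : probability X R)
          (m : WEdata R N X Omega),
     is_WE_method K P mu0 m ->
     mu0 [set x | (V x < +oo)%E] = 1%E ->
     ((mu_vf K mu f ^+ 2 / N%:R)%:E <=
        limn_einf (fun T : nat => (T%:R)%:E * evar P (WE_estimator m f T)))%E)
  /\
  (* (2) near-optimal WE methods with binned multinomial resampling *)
  (forall eps : R, 0 < eps ->
     exists Neps : nat, forall N : nat, (Neps <= N)%N ->
       exists (d' : measure_display) (Omega : measurableType d')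
              (P : probability Omega R) (mu0 : probability X R)
              (m : WEdata R N X Omega),
         [/\ is_WE_method K P mu0 m,
             binned_multinomial P m,
             (\int[mu0]_x V x < +oo)%E &
             (limn_esup (fun T : nat => (T%:R)%:E * evar P (WE_estimator m f T))
                <= ((1 + eps) * (mu_vf K mu f ^+ 2 / N%:R))%:E)%E]).
Proof.
move=> _ VE mf [C fC].
have [CV [D [r Hs]]] := V_uniform_sqrtV VE.
(* The estimates for V-classes ask for a positive constant. *)
pose c := Num.max C 1.
have c0 : 0 < c by rewrite lt_max ltr01 orbT.
have cf : V_class V c f.
  split => // x; apply: le_trans (fC x) _; apply: lee_wpmul2r.
    by apply: le_trans (sv_ge1 Hs x).
  by rewrite lee_fin le_max lexx.
split => [N d' Omega P mu0 m HW muV|eps eps0]; first exact: (WE_lower_bound Hs c0 cf HW muV).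
have [Ne hNe] := WE_near_optimal Hs c0 cf eps0.
exists Ne => N hN; have [d' [Om [P [m [h1 h2 h3]]]]] := hNe N hN.
by exists d', Om, P, mu, m; split => //; exact: sv_int Hs.
Qed.
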